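(* Work in $\mathrm{ZF}+\mathrm{DC}_\lambda$. A cardinal $\lambda$ is ultraexacting if and only if for every ordinal definable set $A\subseteq V_{\lambda+1}$ there exists a non-identity elementary embedding $j:(V_{\lambda+1},A)\to(V_{\lambda+1},A)$.
   Context: $\mathrm{DC}_\lambda$ is the assertion that every ${<}\lambda$-closed tree with no terminal nodes has a branch of length $\lambda$. For a natural number $n$, $C^{(n)}$ denotes the class of ordinals $\alpha$ such that $V_\alpha$ is a $\Sigma_n$-elementary substructure of $V$. Let $\lambda$ be a limit cardinal. $\lambda$ is called exacting if there exist a natural number $n>0$, a cardinal $\eta\in C^{(n)}$ with $\eta>\lambda$, an elementary substructure $X\prec V_\eta$ with $V_\lambda\cup\{\lambda\}\subseteq X$, a cardinal $\zeta\in C^{(n+1)}$ with $\zeta>\lambda$, and an elementary embedding $j:X\to V_\zeta$ with $j(\lambda)=\lambda$ and $j\restriction\lambda\neq\mathrm{id}_\lambda$. $\lambda$ is called ultraexacting if such $n,\eta,X,\zeta,j$ exist with the additional property $j\restriction V_\lambda\in X$. (Equivalently: for the least $\zeta\in C^{(2)}$ above $\lambda$ there are $X\prec V_\zeta$ with $V_\lambda\cup\{\lambda\}\subseteq X$ and an elementary $j:X\to V_\zeta$ with $j(\lambda)=\lambda$, $j\restriction\lambda\ne\mathrm{id}$, and, for ultraexacting, $j\restriction V_\lambda\in X$.) A set is ordinal definable if it is definable in $V$ by a first-order formula with ordinal parameters. *)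

(* Defs.v *)
(* Sets are the elements of an arbitrary model [V] of ZF, possibly ill-founded
   and possibly with non-standard natural numbers.  Set-theoretic notions are
   stated as relations on [V], so that they mean what the corresponding
   first-order formula means in [V].

   Two kinds of formulas occur.  Those of the metatheory (type [fm]) serve for
   the axiom schemes, for the classes C^(n) and for ordinal definability, where
   "V satisfies phi" is meant.  Truth in a structure that is a set of [V] is
   [V]'s own satisfaction relation, on formulas coded by elements of [V]. *)

Record structure := Structure { dom :> Type; mem : dom -> dom -> Prop }.

Notation "x ∈ y" := (mem _ x y) (at level 70, no associativity).
Notation "x ∉ y" := (~ mem _ x y) (at level 70, no associativity).

Definition subset {V : structure} (x y : V) := forall z : V, z ∈ x -> z ∈ y.
Notation "x ⊆ y" := (subset x y) (at level 70, no associativity).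

(** * First-order formulas of the language of set theory *)

(* De Bruijn indices. *)
Inductive fm : Type :=
| Mem (i k : nat)
| Eq (i k : nat)
| Neg (p : fm)
| And (p q : fm)
| Ex (p : fm).

Definition All (p : fm) := Neg (Ex (Neg p)).

Definition scons {T : Type} (x : T) (e : nat -> T) (k : nat) : T :=
  match k with 0 => x | S k' => e k' end.

(* Truth in the substructure of [V] with domain [D]. *)
Fixpoint sat {V : structure} (D : V -> Prop) (p : fm) (e : nat -> V) : Prop :=
  match p with
  | Mem i k => e i ∈ e k
  | Eq i k => e i = e k
  | Neg q => ~ sat D q e
  | And q r => sat D q e /\ sat D r e
  | Ex q => exists x : V, D x /\ sat D q (scons x e)
  end.

Definition holds {V : structure} (p : fm) (e : nat -> V) : Prop :=
  sat (fun _ : V => True) p e.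

(* The Levy hierarchy. *)
Inductive Delta0 : fm -> Prop :=
| Delta0_Mem i k : Delta0 (Mem i k)
| Delta0_Eq i k : Delta0 (Eq i k)
| Delta0_Neg p : Delta0 p -> Delta0 (Neg p)
| Delta0_And p q : Delta0 p -> Delta0 q -> Delta0 (And p q)
| Delta0_Ex i p : Delta0 p -> Delta0 (Ex (And (Mem 0 (S i)) p)).

Inductive Sigma : nat -> fm -> Prop :=
| Sigma_Delta0 p : Delta0 p -> Sigma 0 p
| Sigma_of_Pi n p : Pi n p -> Sigma (S n) p
| Sigma_Ex n p : Sigma (S n) p -> Sigma (S n) (Ex p)
with Pi : nat -> fm -> Prop :=
| Pi_Delta0 p : Delta0 p -> Pi 0 p
| Pi_of_Sigma n p : Sigma n p -> Pi (S n) p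
| Pi_All n p : Pi (S n) p -> Pi (S n) (All p).

(** * Basic notions *)

Definition is_empty {V : structure} (x : V) := forall y : V, y ∉ x.

Definition is_pair {V : structure} (p x y : V) :=
  forall z : V, z ∈ p <-> z = x \/ z = y.

Definition is_opair {V : structure} (p x y : V) :=
  exists a b : V, is_pair a x x /\ is_pair b x y /\ is_pair p a b.

(* <x, y> is an element of [r]. *)
Definition rel {V : structure} (r x y : V) :=
  exists p : V, is_opair p x y /\ p ∈ r.

(* [y] is the union of [x] and {[x]}. *)
Definition is_succ {V : structure} (x y : V) :=
  forall z : V, z ∈ y <-> z ∈ x \/ z = x.

Definition inductive_set {V : structure} (I : V) :=
  (forall z : V, is_empty z -> z ∈ I) /\
  (forall x y : V, x ∈ I -> is_succ x y -> y ∈ I).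

Definition is_nat {V : structure} (x : V) :=
  forall I : V, inductive_set I -> x ∈ I.

Definition is_omega {V : structure} (w : V) := forall x : V, x ∈ w <-> is_nat x.

(* [f] is a function from [a] to [b]. *)
Definition is_fun {V : structure} (f a b : V) :=
  (forall p : V, p ∈ f -> exists x y : V, x ∈ a /\ y ∈ b /\ is_opair p x y) /\
  (forall x : V, x ∈ a -> exists! y : V, rel f x y).

(* [g] is the restriction of the function [f] to [a]. *)
Definition is_restriction {V : structure} (g f a : V) :=
  forall p : V, p ∈ g <-> p ∈ f /\ exists x y : V, x ∈ a /\ is_opair p x y.

(** * The axioms of ZF *)

Record ZF (V : structure) : Prop := {
  ZF_extensionality : forall x y : V, (forall z : V, z ∈ x <-> z ∈ y) -> x = y;
  ZF_foundation : forall x : V, (exists y : V, y ∈ x) ->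
    exists y : V, y ∈ x /\ forall z : V, z ∈ x -> z ∉ y;
  ZF_pairing : forall x y : V, exists p : V, is_pair p x y;
  ZF_union : forall x : V, exists u : V,
    forall z : V, z ∈ u <-> exists y : V, y ∈ x /\ z ∈ y;
  ZF_power : forall x : V, exists p : V, forall z : V, z ∈ p <-> z ⊆ x;
  ZF_infinity : exists I : V,
    inductive_set I /\ exists z : V, is_empty z /\ z ∈ I;
  ZF_separation : forall (p : fm) (e : nat -> V) (a : V), exists b : V,
    forall x : V, x ∈ b <-> x ∈ a /\ holds p (scons x e);
  ZF_replacement : forall (p : fm) (e : nat -> V) (a : V),
    (forall x y y' : V, x ∈ a ->
       holds p (scons x (scons y e)) -> holds p (scons x (scons y' e)) ->
       y = y') ->
    exists b : V, forall y : V,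
      y ∈ b <-> exists x : V, x ∈ a /\ holds p (scons x (scons y e))
}.

(** * Ordinals, cardinals and the cumulative hierarchy *)

Definition transitive_set {V : structure} (x : V) :=
  forall y : V, y ∈ x -> y ⊆ x.

(* By foundation, such a set is well-ordered by membership. *)
Definition is_ordinal {V : structure} (a : V) :=
  transitive_set a /\ forall b : V, b ∈ a -> transitive_set b.

Definition is_bijection {V : structure} (f a b : V) :=
  is_fun f a b /\
  forall y : V, y ∈ b -> exists! x : V, x ∈ a /\ rel f x y.

Definition is_cardinal {V : structure} (k : V) :=
  is_ordinal k /\ forall a : V, a ∈ k -> ~ exists f : V, is_bijection f a k.

Definition is_limit_cardinal {V : structure} (k : V) :=
  is_cardinal k /\ ~ is_empty k /\
  forall m : V, m ∈ k -> is_cardinal m ->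
    exists m' : V, is_cardinal m' /\ m ∈ m' /\ m' ∈ k.

(* On the successor of [a], [f] obeys the recursion saying that its value at
   [b] is the union of the power sets of its values at the elements of [b]. *)
Definition is_hierarchy {V : structure} (f a : V) :=
  forall b : V, b ∈ a \/ b = a -> forall w : V,
    rel f b w <->
    forall x : V, x ∈ w <-> exists c u : V, c ∈ b /\ rel f c u /\ x ⊆ u.

(* [v] is V_a. *)
Definition is_V {V : structure} (a v : V) :=
  is_ordinal a /\ exists f : V, is_hierarchy f a /\ rel f a v.

Definition C (n : nat) {V : structure} (a : V) :=
  exists v : V, is_V a v /\
    forall p : fm, Sigma n p -> forall e : nat -> V, (forall k, e k ∈ v) ->
      (sat (fun x : V => x ∈ v) p e <-> holds p e).

Definition OD {V : structure} (A : V) :=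
  exists (p : fm) (e : nat -> V),
    (forall k, is_ordinal (e k)) /\
    forall x : V, holds p (scons x e) <-> x = A.

(** * Dependent choice *)

(* [T] is a tree under the strict order [r]. *)
Definition is_tree {V : structure} (T r : V) :=
  (forall x : V, x ∈ T -> ~ rel r x x) /\
  (forall x y z : V, x ∈ T -> y ∈ T -> z ∈ T ->
     rel r x y -> rel r y z -> rel r x z) /\
  (forall t a : V, t ∈ T -> (exists x : V, x ∈ a) ->
     (forall x : V, x ∈ a -> x ∈ T /\ rel r x t) ->
     exists m : V, m ∈ a /\ forall x : V, x ∈ a -> x = m \/ rel r m x).

Definition no_terminal_nodes {V : structure} (T r : V) :=
  forall t : V, t ∈ T -> exists u : V, u ∈ T /\ rel r t u.

(* [f] is a strictly increasing sequence of length [d] of nodes of [T]. *)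
Definition is_chain {V : structure} (T r d f : V) :=
  is_fun f d T /\
  forall a b x y : V, a ∈ b -> b ∈ d -> rel f a x -> rel f b y -> rel r x y.

Definition closed_below {V : structure} (T r l : V) :=
  forall d f : V, d ∈ l -> is_chain T r d f ->
    exists t : V, t ∈ T /\
      forall a x : V, a ∈ d -> rel f a x -> x = t \/ rel r x t.

(* The increasing enumeration [f] of a downward closed chain of order type [l].
   The chain need not be maximal, as [T] may have height larger than [l]. *)
Definition is_branch {V : structure} (T r l f : V) :=
  is_chain T r l f /\
  forall a x y : V, a ∈ l -> rel f a x -> y ∈ T -> rel r y x ->
    exists b : V, b ∈ a /\ rel f b y.

Definition DC {V : structure} (l : V) :=
  forall T r : V,
    is_tree T r -> no_terminal_nodes T r -> closed_below T r l ->
    exists f : V, is_branch T r l f.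

(** * Satisfaction inside [V] *)

(* A structure whose domain is a set [X], with membership and, for
   [P = Some A], the set [A] as interpretation of a unary predicate symbol.
   With n in omega as the variable v_n, formulas are coded as
     <0, <i, k>>  v_i belongs to v_k       <3, <a, a>>  negation of a
     <1, <i, k>>  v_i equals v_k           <4, <a, b>>  conjunction of a and b
     <2, <i, i>>  v_i is in the predicate  <5, <i, a>>  exists v_i, a        *)

Fixpoint is_num {V : structure} (n : nat) (x : V) : Prop :=
  match n with
  | 0 => is_empty x
  | S m => exists y : V, is_num m y /\ is_succ y x
  end.

Definition is_code {V : structure} (tag : nat) (a b c : V) :=
  exists t q : V, is_num tag t /\ is_opair q a b /\ is_opair c t q.

Definition formula_closed {V : structure} (with_pred : bool) (F : V) :=
  (forall i k c : V, is_nat i -> is_nat k -> is_code 0 i k c -> c ∈ F) /\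
  (forall i k c : V, is_nat i -> is_nat k -> is_code 1 i k c -> c ∈ F) /\
  (with_pred = true -> forall i c : V, is_nat i -> is_code 2 i i c -> c ∈ F) /\
  (forall a c : V, a ∈ F -> is_code 3 a a c -> c ∈ F) /\
  (forall a b c : V, a ∈ F -> b ∈ F -> is_code 4 a b c -> c ∈ F) /\
  (forall i a c : V, is_nat i -> a ∈ F -> is_code 5 i a c -> c ∈ F).

Definition is_formula {V : structure} (with_pred : bool) (c : V) :=
  forall F : V, formula_closed with_pred F -> c ∈ F.

Definition has_pred {V : structure} (P : option V) : bool :=
  match P with Some _ => true | None => false end.

Definition is_assignment {V : structure} (X s : V) :=
  exists w : V, is_omega w /\ is_fun s w X.

(* [s'] is [s] with its value at [i] changed to [x]. *)
Definition is_update {V : structure} (s i x s' : V) :=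
  rel s' i x /\
  forall k y : V, is_nat k -> k <> i -> (rel s' k y <-> rel s k y).

(* Tarski's clauses for the set [S] of pairs of a formula and an assignment. *)
Definition is_satisfaction {V : structure} (X : V) (P : option V) (S : V) :=
  forall s : V, is_assignment X s ->
  (forall i k c : V, is_nat i -> is_nat k -> is_code 0 i k c ->
     (rel S c s <-> exists x y : V, rel s i x /\ rel s k y /\ x ∈ y)) /\
  (forall i k c : V, is_nat i -> is_nat k -> is_code 1 i k c ->
     (rel S c s <-> exists x : V, rel s i x /\ rel s k x)) /\
  (forall A i c : V, P = Some A -> is_nat i -> is_code 2 i i c ->
     (rel S c s <-> exists x : V, rel s i x /\ x ∈ A)) /\
  (forall a c : V, is_formula (has_pred P) a -> is_code 3 a a c ->
     (rel S c s <-> ~ rel S a s)) /\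
  (forall a b c : V, is_formula (has_pred P) a -> is_formula (has_pred P) b ->
     is_code 4 a b c -> (rel S c s <-> rel S a s /\ rel S b s)) /\
  (forall i a c : V, is_nat i -> is_formula (has_pred P) a ->
     is_code 5 i a c ->
     (rel S c s <-> exists x s' : V,
        x ∈ X /\ is_assignment X s' /\ is_update s i x s' /\ rel S a s')).

(* (X, P) satisfies the formula [c] at the assignment [s]. *)
Definition satisfies {V : structure} (X : V) (P : option V) (c s : V) :=
  exists S : V, is_satisfaction X P S /\ rel S c s.

Definition elementary_substructure {V : structure} (X Y : V) :=
  X ⊆ Y /\
  forall c s : V, is_formula false c -> is_assignment X s ->
    (satisfies X None c s <-> satisfies Y None c s).

(* [j] is an elementary embedding of (X, P) into (Y, Q). *)
Definition elementary_embedding {V : structure}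
    (X : V) (P : option V) (Y : V) (Q : option V) (j : V) :=
  has_pred P = has_pred Q /\
  is_fun j X Y /\
  forall c s s' : V, is_formula (has_pred P) c ->
    is_assignment X s -> is_assignment Y s' ->
    (forall k x y : V, rel s k x -> rel j x y -> rel s' k y) ->
    (satisfies X P c s <-> satisfies Y Q c s').

(** * Exacting and ultraexacting cardinals *)

(* [Vl] is V_l. *)
Definition exacting_witness {V : structure} (l Vl : V) (n : nat)
    (eta X zeta j : V) :=
  n > 0 /\
  (is_cardinal eta /\ C n eta /\ l ∈ eta) /\
  (exists Veta : V, is_V eta Veta /\ elementary_substructure X Veta) /\
  (Vl ⊆ X /\ l ∈ X) /\
  (is_cardinal zeta /\ C (S n) zeta /\ l ∈ zeta) /\
  (exists Vzeta : V,
     is_V zeta Vzeta /\ elementary_embedding X None Vzeta None j) /\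
  rel j l l /\
  (exists a : V, a ∈ l /\ ~ rel j a a).

Definition ultraexacting {V : structure} (l : V) :=
  is_limit_cardinal l /\
  exists Vl : V, is_V l Vl /\
  exists (n : nat) (eta X zeta j : V),
    exacting_witness l Vl n eta X zeta j /\
    exists r : V, is_restriction r j Vl /\ r ∈ X.

(* Main.v *)
From Stdlib Require Import Classical ClassicalEpsilon Lia Arith List.
Require Import Defs.

(* Forward.  Let [j : X -> V_zeta] witness that lambda is ultraexacting and let [A] be
   an ordinal definable subset of V_{lambda+1}.  The satisfaction relation [B] of
   (V_{lambda+1}, A) is ordinal definable.  If no nontrivial map of V_{lambda+1} to
   itself preserved some ordinal definable set in the way an elementary embedding
   preserves [B], this would be reflected to a level of the hierarchy, hence, being
   Sigma_2, be seen by [X]; the least such level, ordinal parameters and set would be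
   in [X] and fixed by [j].  But the restriction [i] of [j] to V_lambda is in [X], and
   the canonical extension of [i] to V_{lambda+1}, also in [X], agrees with [j] on
   [X], so it cannot fail to preserve a set that [j] fixes.

   Backward.  Take zeta > lambda in a definable closed unbounded subclass of C^(2), and
   let [A] be the set of theories of V_zeta with names from V_lambda for certain
   elements, including lambda and the elements of V_lambda.  Let [j] be an embedding of
   (V_{lambda+1}, A).  Kunen's argument, with DC_lambda in place of choice, shows that
   lambda is the supremum of the critical sequence of [j], hence a limit cardinal such
   that V_lambda injects into lambda.  DC_lambda then gives an elementary substructure
   [X] of V_zeta, all of whose elements are named, that includes V_lambda and contains
   lambda and the restriction of [j] to V_lambda.  The theory [T] of these names is in [A], so
   [j(T)] is in [A] too, and sending the element named [a] in the sense of [T] to the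
   one named [j(a)] in the sense of [j(T)] is an elementary embedding of [X] into V_zeta. *)

(* Truth in the model is not definable in the model, so each use of separation, replacement or
   induction must exhibit a formula; [definable] records one. When the same formula works in two
   domains at once, elementary maps transport what it defines. As numbers may be non-standard, a
   single membership question about the internal satisfaction relation has to cover all formulas of
   the model. Forward, the correctness of zeta that can be relied on is for Sigma_2 statements. This
   dictates the shape of the reflected statement and calls for a description of the levels of the
   hierarchy with a bounded matrix. Backward, no well-ordering of V_{lambda+1} is at hand. If the
   supremum d of the critical sequence were below lambda, the Hartogs number of d would be at most
   lambda, so Kunen's combinatorics can take place on it, inside V_{lambda+1}; its regularity rests
   on a chosen family of injections and on an injection of V_d into d. Finally, a sequence unbounded
   in lambda is not an element of V_lambda, so assignments are cut down to finitely many relevant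
   values before they enter a theory or a task. *)
Existing Class ZF.

(** * Renaming and definability *)

Fixpoint rename (r : nat -> nat) (p : fm) : fm :=
  match p with
  | Mem i k => Mem (r i) (r k)
  | Eq i k => Eq (r i) (r k)
  | Neg q => Neg (rename r q)
  | And q q' => And (rename r q) (rename r q')
  | Ex q => Ex (rename (scons 0 (fun k => S (r k))) q)
  end.

Lemma sat_ext {V : structure} (D : V -> Prop) p : forall e e',
  (forall k, e k = e' k) -> (sat D p e <-> sat D p e').
Proof.
  induction p; simpl; intros e e' H.
  - now rewrite !H.
  - now rewrite !H.
  - now rewrite (IHp e e' H).
  - now rewrite (IHp1 e e' H), (IHp2 e e' H).
  - split; intros [x [Hx Hs]]; exists x; split; auto;
    revert Hs; apply IHp; intros [|k]; simpl; auto.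
Qed.

Lemma sat_rename {V : structure} (D : V -> Prop) p : forall r e,
  sat D (rename r p) e <-> sat D p (fun k => e (r k)).
Proof.
  induction p; simpl; intros r e; try tauto.
  - now rewrite IHp.
  - now rewrite IHp1, IHp2.
  - split; intros [x [Hx Hs]]; exists x; split; auto.
    + apply IHp in Hs. revert Hs; apply sat_ext; intros [|k]; reflexivity.
    + apply IHp. revert Hs; apply sat_ext; intros [|k]; reflexivity.
Qed.

Lemma Delta0_rename p : Delta0 p -> forall r, Delta0 (rename r p).
Proof.
  induction 1; intros r; simpl; try (constructor; auto).
Qed.

Definition valuation {T : Type} (s : nat -> nat + T) (e : nat -> T) (i : nat) : T :=
  match s i with inl k => e k | inr c => c end.

(* [P] is defined by one formula ([Delta0] if [b]) in all domains of the family
   [DD], from constants that satisfy [Q]; [s] says which variables of the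
   formula stand for entries of the environment and which for constants. *)
Definition definable {V : structure} (b : bool) (DD : (V -> Prop) -> Prop)
    (Q : V -> Prop) (P : (nat -> V) -> Prop) : Prop :=
  exists (p : fm) (s : nat -> nat + V),
    (b = true -> Delta0 p) /\
    (forall i c, s i = inr c -> Q c /\ forall D, DD D -> D c) /\
    forall D, DD D -> forall e, (forall k, D (e k)) ->
      (sat D p (valuation s e) <-> P e).

Definition is_term {V : structure} (DD : (V -> Prop) -> Prop) (Q : V -> Prop)
    (t : (nat -> V) -> V) : Prop :=
  exists o : nat + V,
    (forall c, o = inr c -> Q c /\ forall D, DD D -> D c) /\
    forall e, t e = match o with inl k => e k | inr c => c end.

Class trans_domains {V : structure} (DD : (V -> Prop) -> Prop) : Prop :=
  trans_dom : forall D, DD D -> forall x y, D y -> x ∈ y -> D x.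

Section Definability.
Context {V : structure} {b : bool} {DD : (V -> Prop) -> Prop} {Q : V -> Prop}.
Implicit Types P R : (nat -> V) -> Prop.
Notation Def := (definable b DD Q).
Notation Tm := (is_term DD Q).

Lemma is_term_var k : Tm (fun e => e k).
Proof. exists (inl k). split; [discriminate|reflexivity]. Qed.

Lemma is_term_const c : Q c -> (forall D, DD D -> D c) -> Tm (fun _ => c).
Proof. intros H1 H2. exists (inr c). split; [|reflexivity]. now intros c' [= <-]. Qed.

Lemma is_term_shift t : Tm t -> Tm (fun e => t (fun k => e (S k))).
Proof.
  intros [o [H1 H2]]. exists (match o with inl k => inl (S k) | inr c => inr c end).
  split.
  - destruct o; [discriminate|]. exact H1.
  - intros e. rewrite H2. now destruct o.
Qed.

Lemma def_equiv P R :
  (forall D, DD D -> forall e, (forall k, D (e k)) -> (P e <-> R e)) -> Def P -> Def R.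
Proof.
  intros H (p & s & H1 & H2 & H3). exists p, s. split; [|split]; auto.
  intros D HD e He. rewrite (H3 D HD e He). eapply H; eauto.
Qed.

Lemma def_equiv' P R : (forall e, P e <-> R e) -> Def P -> Def R.
Proof. intros H; apply def_equiv; auto. Qed.

Lemma def_mem t u : Tm t -> Tm u -> Def (fun e => t e ∈ u e).
Proof.
  intros [o [H1 H2]] [o' [H3 H4]].
  exists (Mem 0 1), (fun i => match i with 0 => o | _ => o' end).
  split; [|split].
  - constructor.
  - intros [|i] c; auto.
  - intros D HD e He. simpl. unfold valuation. now rewrite H2, H4.
Qed.

Lemma def_eq t u : Tm t -> Tm u -> Def (fun e => t e = u e).
Proof.
  intros [o [H1 H2]] [o' [H3 H4]].
  exists (Eq 0 1), (fun i => match i with 0 => o | _ => o' end).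
  split; [|split].
  - constructor.
  - intros [|i] c; auto.
  - intros D HD e He. simpl. unfold valuation. now rewrite H2, H4.
Qed.

Lemma def_not P : Def P -> Def (fun e => ~ P e).
Proof.
  intros (p & s & H1 & H2 & H3). exists (Neg p), s. split; [|split]; auto.
  - intros Hb. constructor; auto.
  - intros D HD e He. simpl. now rewrite (H3 D HD e He).
Qed.

Lemma def_and P R : Def P -> Def R -> Def (fun e => P e /\ R e).
Proof.
  intros (p & s & H1 & H2 & H3) (q & s' & H1' & H2' & H3').
  (* Each formula has its own reading of the variables, so those of [p] are moved to the even
     indices and those of [q] to the odd ones. *)
  exists (And (rename (fun i => 2 * i) p) (rename (fun i => 2 * i + 1) q)),
    (fun i => if Nat.even i then s (Nat.div2 i) else s' (Nat.div2 i)).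
  split; [|split].
  - intros Hb. constructor; apply Delta0_rename; auto.
  - intros i c. destruct (Nat.even i); eauto.
  - intros D HD e He. cbn [sat].
    rewrite <- (H3 D HD e He), <- (H3' D HD e He), !sat_rename.
    rewrite (sat_ext D p _ (valuation s e)), (sat_ext D q _ (valuation s' e)); [tauto| |];
    intros k; unfold valuation.
    + rewrite Nat.even_add, Nat.even_mul; cbn [Nat.even negb orb Bool.eqb].
      replace (2 * k + 1) with (S (2 * k)) by lia. now rewrite Nat.div2_succ_double.
    + rewrite Nat.even_mul; cbn [Nat.even orb]. now rewrite Nat.div2_double.
Qed.

(** An unbounded quantifier changes its meaning with the domain; the second hypothesis asks that a
    witness, if there is any, be found in the domain itself. *)
Lemma def_ex (R : V -> (nat -> V) -> Prop) :
  b = false ->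
  (forall D, DD D -> forall e, (forall k, D (e k)) ->
     (exists x, R x e) -> exists x, D x /\ R x e) ->
  Def (fun e => R (e 0) (fun k => e (S k))) -> Def (fun e => exists x, R x e).
Proof.
  intros Hb HC (p & s & H1 & H2 & H3).
  (* All variables read as entry 0 become the bound variable; the others move past it. *)
  exists (Ex (rename (fun i => match s i with inl 0 => 0 | _ => S i end) p)),
    (fun i => match s i with inl 0 => inl 0 | inl (S k) => inl k | inr c => inr c end).
  split; [|split].
  - congruence.
  - intros i c Hc. apply (H2 i). destruct (s i) as [[|k]|]; congruence.
  - intros D HD e He. simpl.
    assert (K : forall x, D x ->
      (sat D (rename (fun i => match s i with inl 0 => 0 | _ => S i end) p)
        (scons x (valuation (fun i => match s i with inl 0 => inl 0
           | inl (S k) => inl k | inr c => inr c end) e)) <-> R x e)).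
    { intros x Hx. rewrite sat_rename.
      assert (Hse : forall k, D (scons x e k)) by (intros [|k]; simpl; auto).
      specialize (H3 D HD _ Hse). cbv beta in H3. simpl in H3.
      change (fun k => e k) with e in H3.
      rewrite <- H3. apply sat_ext. intros k. unfold valuation.
      destruct (s k) as [[|i]|c] eqn:E; simpl; rewrite ?E; auto. }
    split.
    + intros [x [Hx Hs]]. exists x. now apply K.
    + intros H. destruct (HC D HD e He H) as [x [Hx Hs]]. exists x. split; auto. now apply K.
Qed.

(** Transitivity of the domains supplies the witness. Variable 0 of the new formula is set aside for
    the bounding term, so the variables of [p] move by two under the quantifier. *)
Lemma def_bex {HT : trans_domains DD} t (R : V -> (nat -> V) -> Prop) :
  Tm t -> Def (fun e => R (e 0) (fun k => e (S k))) ->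
  Def (fun e => exists x, x ∈ t e /\ R x e).
Proof.
  intros [o [Ht1 Ht2]] (p & s & H1 & H2 & H3).
  exists (Ex (And (Mem 0 (S 0)) (rename (fun i => match s i with inl 0 => 0 | _ => S (S i) end) p))),
    (fun i => match i with 0 => o | S i => match s i with inl 0 => o | inl (S k) => inl k | inr c => inr c end end).
  split; [|split].
  - intros Hb. constructor. apply Delta0_rename; auto.
  - intros [|i] c Hc; auto. destruct (s i) as [[|k]|] eqn:E; try congruence; auto.
    apply (H2 i). congruence.
  - intros D HD e He. cbn [sat].
    assert (Dt : D (t e)).
    { rewrite Ht2. destruct o; auto. now apply (Ht1 d). }
    assert (K : forall x, D x ->
      (sat D (rename (fun i => match s i with inl 0 => 0 | _ => S (S i) end) p)
        (scons x (valuation (fun i => match i with 0 => o | S i => match s i with inl 0 => o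
           | inl (S k) => inl k | inr c => inr c end end) e)) <-> R x e)).
    { intros x Hx. rewrite sat_rename.
      assert (Hse : forall k, D (scons x e k)) by (intros [|k]; simpl; auto).
      specialize (H3 D HD _ Hse). cbv beta in H3. simpl in H3.
      change (fun k => e k) with e in H3.
      rewrite <- H3. apply sat_ext. intros k. unfold valuation.
      destruct (s k) as [[|i]|c] eqn:E; simpl; rewrite ?E; auto. }
    assert (Et : valuation (fun i => match i with 0 => o | S i => match s i with inl 0 => o
           | inl (S k) => inl k | inr c => inr c end end) e 0 = t e).
    { unfold valuation. now rewrite Ht2. }
    simpl scons. rewrite Et.
    split.
    + intros [x [Hx [Hm Hs]]]. exists x. split; auto. now apply K.
    + intros [x [Hm Hs]].
      assert (Hx : D x) by (eapply (trans_dom D HD); eauto).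
      exists x. split; auto. split; auto. now apply K.
Qed.

Lemma def_or P R : Def P -> Def R -> Def (fun e => P e \/ R e).
Proof.
  intros H1 H2. apply (def_equiv' (fun e => ~ (~ P e /\ ~ R e))).
  - intros e. tauto.
  - auto using def_not, def_and.
Qed.

Lemma def_imp P R : Def P -> Def R -> Def (fun e => P e -> R e).
Proof.
  intros H1 H2. apply (def_equiv' (fun e => ~ (P e /\ ~ R e))).
  - intros e. tauto.
  - auto using def_not, def_and.
Qed.

Lemma def_iff P R : Def P -> Def R -> Def (fun e => P e <-> R e).
Proof. intros H1 H2. apply def_and; apply def_imp; auto. Qed.

Lemma def_all (R : V -> (nat -> V) -> Prop) :
  b = false ->
  (forall D, DD D -> forall e, (forall k, D (e k)) ->
     (exists x, ~ R x e) -> exists x, D x /\ ~ R x e) ->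
  Def (fun e => R (e 0) (fun k => e (S k))) -> Def (fun e => forall x, R x e).
Proof.
  intros Hb HC H. apply (def_equiv' (fun e => ~ exists x, ~ R x e)).
  - intros e. split; [|firstorder]. intros H' x. apply NNPP. firstorder.
  - apply def_not, (def_ex (fun x e => ~ R x e)); auto. now apply def_not.
Qed.

Lemma def_ball {HT : trans_domains DD} t (R : V -> (nat -> V) -> Prop) :
  Tm t -> Def (fun e => R (e 0) (fun k => e (S k))) ->
  Def (fun e => forall x, x ∈ t e -> R x e).
Proof.
  intros Ht H. apply (def_equiv' (fun e => ~ exists x, x ∈ t e /\ ~ R x e)).
  - intros e. split; [|firstorder]. intros H' x Hx. apply NNPP. firstorder.
  - apply def_not, (def_bex t (fun x e => ~ R x e)); auto. now apply def_not.
Qed.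

Lemma def_True : Def (fun _ => True).
Proof.
  exists (Eq 0 0), (fun _ => inl 0). split; [constructor|split]; [discriminate|].
  intros; simpl; tauto.
Qed.

Lemma def_False : Def (fun _ => False).
Proof. apply (def_equiv' (fun _ => ~ True)); [tauto|]. apply def_not, def_True. Qed.

(** The truth value of [A], not its form, selects the formula, so any statement of the metatheory
    may stand here. *)
Lemma def_const (A : Prop) : Def (fun _ => A).
Proof.
  destruct (classic A).
  - apply (def_equiv' (fun _ => True)); [tauto|apply def_True].
  - apply (def_equiv' (fun _ => False)); [tauto|apply def_False].
Qed.

(** In a set, every quantifier of a formula of the metatheory is bounded by that set, so
    satisfaction of a fixed formula is bounded itself. *)
Lemma def_sat {HT : trans_domains DD} p : forall (t : (nat -> V) -> V) (u : nat -> (nat -> V) -> V),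
  Tm t -> (forall k, Tm (u k)) ->
  Def (fun e => sat (fun x => x ∈ t e) p (fun k => u k e)).
Proof.
  induction p; simpl; intros t u Ht Hu.
  - apply def_mem; auto.
  - apply def_eq; auto.
  - apply def_not; auto.
  - apply def_and; auto.
  - apply (def_bex t (fun x e => sat (fun x => x ∈ t e) p (scons x (fun k => u k e)))); auto.
    apply (def_equiv' (fun e => sat (fun x => x ∈ t (fun k => e (S k))) p
      (fun k => match k with 0 => e 0 | S k => u k (fun k => e (S k)) end))).
    + intros e. apply sat_ext. intros [|k]; reflexivity.
    + apply (IHp (fun e => t (fun k => e (S k)))
        (fun k e => match k with 0 => e 0 | S k => u k (fun k => e (S k)) end)).
      * now apply is_term_shift.
      * intros [|k]; [apply is_term_var|]. now apply is_term_shift.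
Qed.

(** The formula stays the same; only the reading of its variables is composed with the terms. *)
Lemma def_subst P (u : nat -> (nat -> V) -> V) :
  Def P -> (forall k, Tm (u k)) -> Def (fun e => P (fun k => u k e)).
Proof.
  intros (p & s & H1 & H2 & H3) Hu.
  pose (o := fun k => proj1_sig (constructive_indefinite_description _ (Hu k))).
  assert (Ho : forall k, (forall c, o k = inr c -> Q c /\ forall D, DD D -> D c) /\
    forall e, u k e = match o k with inl i => e i | inr c => c end).
  { intros k. unfold o. apply (proj2_sig (constructive_indefinite_description _ (Hu k))). }
  exists p, (fun i => match s i with inl k => o k | inr c => inr c end).
  split; [auto|split].
  - intros i c Hc. destruct (s i) eqn:E; [now apply (Ho n)|]. apply (H2 i). congruence.
  - intros D HD e He.
    assert (Hue : forall k, D (u k e)).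
    { intros k. destruct (Ho k) as [A B]. rewrite B. destruct (o k); auto. now apply (A d). }
    rewrite <- (H3 D HD _ Hue). apply sat_ext. intros i. unfold valuation.
    destruct (s i); [|reflexivity]. symmetry. apply Ho.
Qed.

Fixpoint pick (l : list ((nat -> V) -> V)) (k : nat) : (nat -> V) -> V :=
  match l, k with
  | cons t _, 0 => t
  | cons _ l, S k => pick l k
  | nil, _ => fun e => e 0
  end.

Lemma def_substs P l : Def P -> Forall Tm l -> Def (fun e => P (fun k => pick l k e)).
Proof.
  intros H Hl. apply (def_subst P); auto.
  induction Hl; intros [|k]; simpl; auto using is_term_var.
Qed.

Lemma def_subst1 (R : V -> Prop) t1 :
  Def (fun e => R (e 0)) -> Tm t1 -> Def (fun e => R (t1 e)).
Proof. intros H ?. apply (def_substs _ (t1 :: nil) H). repeat constructor; auto. Qed.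

Lemma def_subst2 (R : V -> V -> Prop) t1 t2 :
  Def (fun e => R (e 0) (e 1)) -> Tm t1 -> Tm t2 -> Def (fun e => R (t1 e) (t2 e)).
Proof. intros H ? ?. apply (def_substs _ (t1 :: t2 :: nil) H). repeat constructor; auto. Qed.

Lemma def_subst3 (R : V -> V -> V -> Prop) t1 t2 t3 :
  Def (fun e => R (e 0) (e 1) (e 2)) -> Tm t1 -> Tm t2 -> Tm t3 ->
  Def (fun e => R (t1 e) (t2 e) (t3 e)).
Proof.
  intros H ? ? ?. apply (def_substs _ (t1 :: t2 :: t3 :: nil) H). repeat constructor; auto.
Qed.

Lemma def_subst4 (R : V -> V -> V -> V -> Prop) t1 t2 t3 t4 :
  Def (fun e => R (e 0) (e 1) (e 2) (e 3)) -> Tm t1 -> Tm t2 -> Tm t3 -> Tm t4 ->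
  Def (fun e => R (t1 e) (t2 e) (t3 e) (t4 e)).
Proof.
  intros H ? ? ? ?. apply (def_substs _ (t1 :: t2 :: t3 :: t4 :: nil) H).
  repeat constructor; auto.
Qed.

Lemma def_subst5 (R : V -> V -> V -> V -> V -> Prop) t1 t2 t3 t4 t5 :
  Def (fun e => R (e 0) (e 1) (e 2) (e 3) (e 4)) ->
  Tm t1 -> Tm t2 -> Tm t3 -> Tm t4 -> Tm t5 ->
  Def (fun e => R (t1 e) (t2 e) (t3 e) (t4 e) (t5 e)).
Proof.
  intros H ? ? ? ? ?. apply (def_substs _ (t1 :: t2 :: t3 :: t4 :: t5 :: nil) H).
  repeat constructor; auto.
Qed.

End Definability.

(** * The whole universe as domain, and automation for definability *)

Definition univ {V : structure} : (V -> Prop) -> Prop := fun D => D = (fun _ => True).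

#[export] Instance trans_univ {V : structure} : trans_domains (@univ V).
Proof. intros D -> x y _ _. exact I. Qed.

Lemma univ_I {V : structure} (c : V) : forall D, univ D -> D c.
Proof. now intros D ->. Qed.

Definition anyc {V : structure} (c : V) := True.

Notation dfn := (definable false univ anyc).

Ltac dfn_side :=
  let D := fresh in let HD := fresh in
  intros D HD;
  first [ rewrite HD; intros ? _ [? ?]; eexists; split; [exact I|eassumption]
        | intros ? ? [? ?]; eexists; split; [|eassumption]; tauto
        | idtac ].

Ltac dfn_const := solve [ exact I | assumption | apply univ_I | auto ].

Create HintDb dfn.
#[export] Hint Extern 1 (trans_domains _) => typeclasses eauto : dfn.

(** A hint states the definability of a notion at the variables [e 0], [e 1] and so on; here
    arbitrary terms are substituted for them. *)
Ltac dfn_hook :=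
  match goal with
  | |- definable _ _ _ (fun e => ?R _) => apply (def_subst1 R); [solve [auto 2 with dfn] | ..]
  | |- definable _ _ _ (fun e => ?R _ _) => apply (def_subst2 R); [solve [auto 2 with dfn] | ..]
  | |- definable _ _ _ (fun e => ?R _ _ _) => apply (def_subst3 R); [solve [auto 2 with dfn] | ..]
  | |- definable _ _ _ (fun e => ?R _ _ _ _) => apply (def_subst4 R); [solve [auto 2 with dfn] | ..]
  | |- definable _ _ _ (fun e => ?R _ _ _ _ _) => apply (def_subst5 R); [solve [auto 2 with dfn] | ..]
  end.

Ltac dfn_term :=
  lazymatch goal with
  | |- is_term _ _ (fun e => e _) => apply is_term_var
  | |- is_term _ _ _ => apply is_term_const; dfn_const
  end.

Ltac dfn1 :=
  cbv beta;
  lazymatch goal with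
  | |- is_term _ _ _ => dfn_term
  | |- definable _ _ _ (fun _ => ?A) => apply def_const
  | |- definable _ _ _ (fun e => _ ∈ _) => apply def_mem
  | |- definable _ _ _ (fun e => @?t e = @?u e) =>
      first [ apply def_eq; dfn_term
            | lazymatch u with fun e => ?F (@?v e) =>
                apply (def_subst2 (fun x y => y = F x) v t); [solve [auto 2 with dfn] | ..] end ]
  | |- definable _ _ _ (fun e => ~ _) => apply def_not
  | |- definable _ _ _ (fun e => _ /\ _) => apply def_and
  | |- definable _ _ _ (fun e => _ \/ _) => apply def_or
  | |- definable _ _ _ (fun e => _ <-> _) => apply def_iff
  | |- definable _ _ _ (fun e => exists x, x ∈ @?t e /\ @?R e x) =>
      apply (def_bex t (fun x e => R e x))
  | |- definable _ _ _ (fun e => exists x, @?R e x) =>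
      apply (def_ex (fun x e => R e x)); [reflexivity | dfn_side | ]
  | |- definable _ _ _ (fun e => forall x, x ∈ @?t e -> @?R e x) =>
      apply (def_ball t (fun x e => R e x))
  | |- definable _ _ _ (fun e => @?A e -> @?B e) => apply (def_imp A B)
  | |- definable _ _ _ (fun e => forall x, @?R e x) =>
      apply (def_all (fun x e => R e x)); [reflexivity | dfn_side | ]
  | |- definable _ _ _ (fun e => unique _ _) => unfold unique
  | |- definable _ _ _ _ => first [ assumption | dfn_hook ]
  end.

Ltac dfn_tac := repeat dfn1.

(** The bounded definition of [is_fun] needs this in an arbitrary structure, without extensionality,
    so the components are recovered through membership only. *)
Lemma is_opair_inj {V : structure} {p x y x' y' : V} :
  is_opair p x y -> is_opair p x' y' -> x = x' /\ y = y'.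
Proof.
  intros (a & c & A1 & A2 & A3) (a' & c' & B1 & B2 & B3). unfold is_pair in *.
  assert (E1 : x = x').
  { destruct (proj1 (A3 a') (proj2 (B3 a') (or_introl eq_refl))) as [->| ->].
    - assert (H : x' ∈ a) by (apply B1; auto). symmetry. apply A1 in H. tauto.
    - assert (H : x ∈ c) by (apply A2; auto). apply B1 in H. tauto. }
  split; [exact E1|]. subst x'.
  destruct (proj1 (A3 c') (proj2 (B3 c') (or_intror eq_refl))) as [->| ->].
  - assert (y' = x) by (assert (H : y' ∈ a) by (apply B2; auto); apply A1 in H; tauto).
    subst y'. destruct (proj1 (B3 c) (proj2 (A3 c) (or_intror eq_refl))) as [->| ->].
    + assert (H : y ∈ a') by (apply A2; auto). apply B1 in H. tauto.
    + assert (H : y ∈ a) by (apply A2; auto). apply A1 in H. tauto.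
  - assert (E : y ∈ c) by (apply A2; auto). apply B2 in E.
    assert (E' : y' ∈ c) by (apply B2; auto). apply A2 in E'.
    destruct E, E'; congruence.
Qed.

(** * Notions given by bounded formulas *)

Section Delta0_notions.
Context {V : structure} {b : bool} {DD : (V -> Prop) -> Prop} {Q : V -> Prop}
  {HT : trans_domains DD}.
Notation Def := (definable b DD Q).
Implicit Type e : nat -> V.

Lemma def_subset : Def (fun e => e 0 ⊆ e 1).
Proof. unfold subset. dfn_tac. Qed.

Lemma def_is_empty : Def (fun e => is_empty (e 0)).
Proof.
  apply (def_equiv' (fun e => forall y, y ∈ e 0 -> False)); [|dfn_tac].
  intros e. unfold is_empty. tauto.
Qed.

Lemma def_is_pair : Def (fun e => is_pair (e 0) (e 1) (e 2)).
Proof.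
  apply (def_equiv' (fun e => (e 1 ∈ e 0 /\ e 2 ∈ e 0) /\
    forall z, z ∈ e 0 -> z = e 1 \/ z = e 2)); [|dfn_tac].
  intros e. unfold is_pair. split.
  - intros [[H1 H2] H] z. split; auto. now intros [->| ->].
  - intros H. split; [split; apply H; auto|]. intros z; apply H.
Qed.
#[local] Hint Resolve def_subset def_is_empty def_is_pair : dfn.

Lemma def_is_opair : Def (fun e => is_opair (e 0) (e 1) (e 2)).
Proof.
  apply (def_equiv' (fun e => exists a, a ∈ e 0 /\ exists c, c ∈ e 0 /\
    (is_pair a (e 1) (e 1) /\ is_pair c (e 1) (e 2) /\ is_pair (e 0) a c))); [|dfn_tac].
  intros e. split.
  - intros (a & _ & c & _ & H). exists a, c. exact H.
  - intros (a & c & H1 & H2 & H3). exists a. split; [apply H3; auto|].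
    exists c. split; [apply H3; auto|]. auto.
Qed.
#[local] Hint Resolve def_is_opair : dfn.

Lemma def_rel : Def (fun e => rel (e 0) (e 1) (e 2)).
Proof.
  apply (def_equiv' (fun e => exists p, p ∈ e 0 /\ is_opair p (e 1) (e 2))); [|dfn_tac].
  intros e. unfold rel. firstorder.
Qed.

Lemma def_is_succ : Def (fun e => is_succ (e 0) (e 1)).
Proof.
  apply (def_equiv' (fun e => e 0 ⊆ e 1 /\ e 0 ∈ e 1 /\
    forall z, z ∈ e 1 -> z ∈ e 0 \/ z = e 0)); [|dfn_tac].
  intros e. unfold is_succ. split.
  - intros (H1 & H2 & H3) z. split; auto. intros [H| ->]; auto.
  - intros H. split; [|split]; try apply H; auto. intros z Hz; apply H; auto.
Qed.

Lemma def_transitive : Def (fun e => transitive_set (e 0)).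
Proof. unfold transitive_set. dfn_tac. Qed.
#[local] Hint Resolve def_rel def_is_succ def_transitive : dfn.

Lemma def_ordinal : Def (fun e => is_ordinal (e 0)).
Proof. unfold is_ordinal. dfn_tac. Qed.

Lemma def_is_fun : Def (fun e => is_fun (e 0) (e 1) (e 2)).
Proof.
  apply (def_equiv' (fun e =>
    (forall p, p ∈ e 0 -> exists x, x ∈ e 1 /\ exists y, y ∈ e 2 /\ is_opair p x y) /\
    (forall x, x ∈ e 1 -> exists y, y ∈ e 2 /\ (rel (e 0) x y /\
        forall y', y' ∈ e 2 -> rel (e 0) x y' -> y = y')))); [|dfn_tac].
  intros e. unfold is_fun. split.
  - intros (H1 & H2). split.
    + intros p Hp. destruct (H1 p Hp) as (x & Hx & y & Hy & H). eauto.
    + intros x Hx. destruct (H2 x Hx) as (y & Hy & H & U). exists y. split; auto.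
      intros y' Hy'. apply U; auto. destruct Hy' as (p & Ho & Hp).
      destruct (H1 p Hp) as (x1 & _ & y1 & Hy1 & Ho1).
      destruct (is_opair_inj Ho Ho1). congruence.
  - intros (H1 & H2). split.
    + intros p Hp. destruct (H1 p Hp) as (x & y & Hx & Hy & H). eauto.
    + intros x Hx. destruct (H2 x Hx) as (y & Hy & U). exists y. split; [|split; auto].
      destruct Hy as (p & Ho & Hp). destruct (H1 p Hp) as (x1 & y1 & _ & Hy1 & Ho1).
      destruct (is_opair_inj Ho Ho1). congruence.
Qed.

End Delta0_notions.

#[export] Hint Resolve def_subset def_is_empty def_is_pair def_is_opair def_rel def_is_succ
  def_transitive def_ordinal def_is_fun : dfn.

(** * Elementary set theory *)

Definition is_limit {V : structure} (a : V) : Prop :=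
  is_ordinal a /\ (exists b, b ∈ a) /\ forall b, b ∈ a -> exists c, c ∈ a /\ is_succ b c.

Lemma def_is_limit {V : structure} {b DD} {Q : V -> Prop} {HT : trans_domains DD} :
  definable b DD Q (fun e => is_limit (e 0)).
Proof.
  apply (def_equiv' (fun e : nat -> V => is_ordinal (e 0) /\ (exists b, b ∈ e 0 /\ True) /\
    forall b, b ∈ e 0 -> exists c, c ∈ e 0 /\ is_succ b c)); [|dfn_tac].
  intros e. unfold is_limit. firstorder.
Qed.
#[export] Hint Resolve def_is_limit : dfn.

Section Sets.
Context {V : structure} {HZF : ZF V}.
Implicit Types x y z a f : V.

Lemma ext a b : (forall z, z ∈ a <-> z ∈ b) -> a = b.
Proof. now apply ZF_extensionality. Qed.

Lemma sub_antisym a b : a ⊆ b -> b ⊆ a -> a = b.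
Proof. intros H1 H2. apply ext. split; auto. Qed.

Lemma sub_refl a : a ⊆ a.
Proof. intros z; auto. Qed.

Lemma sub_trans a b c : a ⊆ b -> b ⊆ c -> a ⊆ c.
Proof. unfold subset. auto. Qed.

Lemma sep_ex (P : V -> Prop) a :
  dfn (fun e => P (e 0)) -> exists b, forall x, x ∈ b <-> x ∈ a /\ P x.
Proof.
  intros (p & s & _ & _ & H).
  (* [P] looks at [e 0] only, so every variable read as an entry of the environment may be read as
     [x]; the constants take the places after it. *)
  destruct (ZF_separation V HZF
    (rename (fun i => match s i with inl _ => 0 | inr _ => S i end) p)
    (fun i => match s i with inl _ => a | inr c => c end) a) as [b Hb].
  exists b. intros x. rewrite Hb. unfold holds. rewrite sat_rename.
  rewrite <- (H (fun _ => True) eq_refl (fun _ => x) (fun _ => I)).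
  rewrite (sat_ext _ p _ (valuation s (fun _ => x))); [tauto|].
  intros k. unfold valuation. destruct (s k) eqn:E; simpl; rewrite ?E; auto.
Qed.

Lemma repl_ex (R : V -> V -> Prop) a :
  dfn (fun e => R (e 0) (e 1)) ->
  (forall x y y', x ∈ a -> R x y -> R x y' -> y = y') ->
  exists b, forall y, y ∈ b <-> exists x, x ∈ a /\ R x y.
Proof.
  intros (p & s & _ & _ & H) HR.
  pose (q := rename (fun i => match s i with inl 0 => 0 | inl _ => 1 | inr _ => S (S i) end) p).
  pose (e := fun i => match s i with inl _ => a | inr c => c end).
  assert (K : forall x y, holds q (scons x (scons y e)) <-> R x y).
  { intros x y. unfold holds, q. rewrite sat_rename.
    pose (E := fun k => match k with 0 => x | _ => y end).
    change (R x y) with (R (E 0) (E 1)).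
    rewrite <- (H (fun _ => True) eq_refl E (fun _ => I)).
    apply sat_ext. intros k. unfold valuation, E, e.
    destruct (s k) as [[|i]|c] eqn:E'; simpl; rewrite ?E'; auto. }
  destruct (ZF_replacement V HZF q e a) as [b Hb].
  { intros x y y' Hx. rewrite !K. now apply HR. }
  exists b. intros y. rewrite Hb. split; intros [x [Hx Hy]]; exists x; split; auto; now apply K.
Qed.

Lemma empty_ex : exists z : V, is_empty z.
Proof. destruct (ZF_infinity V HZF) as (I & _ & z & Hz & _). eauto. Qed.

Definition emp : V := proj1_sig (constructive_indefinite_description _ empty_ex).

Lemma in_emp x : x ∈ emp <-> False.
Proof.
  split; [|tauto]. unfold emp.
  apply (proj2_sig (constructive_indefinite_description _ empty_ex)).
Qed.

Lemma is_empty_emp x : is_empty x <-> x = emp.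
Proof.
  split.
  - intros H. apply ext. intros z. rewrite in_emp. split; [apply H|tauto].
  - intros -> z. now rewrite in_emp.
Qed.

Lemma nonempty x : x <> emp <-> exists y, y ∈ x.
Proof.
  split.
  - intros H. apply NNPP. intros H'. apply H, is_empty_emp. intros y Hy. eauto.
  - intros [y Hy] ->. now apply in_emp in Hy.
Qed.

(** Hilbert's epsilon makes [sep] total in [P]; its specification is available for definable [P]. *)
Definition sep a (P : V -> Prop) : V :=
  epsilon (inhabits a) (fun b => forall x, x ∈ b <-> x ∈ a /\ P x).

Lemma in_sep (P : V -> Prop) a x :
  dfn (fun e => P (e 0)) -> (x ∈ sep a P <-> x ∈ a /\ P x).
Proof.
  intros H. unfold sep. apply (epsilon_spec (inhabits a) _ (sep_ex P a H)).
Qed.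

Lemma foundation (P : V -> Prop) a x :
  dfn (fun e => P (e 0)) -> x ∈ a -> P x ->
  exists y, y ∈ a /\ P y /\ forall z, z ∈ y -> z ∈ a -> ~ P z.
Proof.
  intros HP Hx HPx.
  destruct (ZF_foundation V HZF (sep a P)) as [y [Hy H]].
  { exists x. now apply in_sep. }
  apply in_sep in Hy; auto. exists y. split; [tauto|]. split; [tauto|].
  intros z Hz Hza HPz. apply (H z); auto. now apply in_sep.
Qed.

Definition upair x y : V := proj1_sig (constructive_indefinite_description _ (ZF_pairing V HZF x y)).

Lemma in_upair x y z : z ∈ upair x y <-> z = x \/ z = y.
Proof. apply (proj2_sig (constructive_indefinite_description _ (ZF_pairing V HZF x y))). Qed.

Lemma is_pair_upair p x y : is_pair p x y <-> p = upair x y.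
Proof.
  split.
  - intros H. apply ext. intros z. rewrite in_upair. apply H.
  - intros -> z. apply in_upair.
Qed.

Definition opair x y : V := upair (upair x x) (upair x y).

Lemma is_opair_opair p x y : is_opair p x y <-> p = opair x y.
Proof.
  split.
  - intros (a & b & H1 & H2 & H3). apply is_pair_upair in H1, H2, H3. subst. reflexivity.
  - intros ->. exists (upair x x), (upair x y). rewrite !is_pair_upair. auto.
Qed.

Lemma opair_inj x y x' y' : opair x y = opair x' y' -> x = x' /\ y = y'.
Proof.
  intros H. apply (@is_opair_inj V (opair x y)); now apply is_opair_opair.
Qed.

Lemma rel_opair f x y : rel f x y <-> opair x y ∈ f.
Proof.
  split.
  - intros (p & H1 & H2). apply is_opair_opair in H1. now subst.
  - intros H. exists (opair x y). split; auto. now apply is_opair_opair.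
Qed.

Definition bigcup a : V := proj1_sig (constructive_indefinite_description _ (ZF_union V HZF a)).

Lemma in_bigcup a z : z ∈ bigcup a <-> exists y, y ∈ a /\ z ∈ y.
Proof. apply (proj2_sig (constructive_indefinite_description _ (ZF_union V HZF a))). Qed.

Definition pow a : V := proj1_sig (constructive_indefinite_description _ (ZF_power V HZF a)).

Lemma in_pow a z : z ∈ pow a <-> z ⊆ a.
Proof. apply (proj2_sig (constructive_indefinite_description _ (ZF_power V HZF a))). Qed.

Definition cup a b : V := bigcup (upair a b).

Lemma in_cup a b z : z ∈ cup a b <-> z ∈ a \/ z ∈ b.
Proof.
  unfold cup. rewrite in_bigcup. split.
  - intros (y & Hy & Hz). apply in_upair in Hy as [->| ->]; auto.
  - intros [H|H]; [exists a|exists b]; split; auto; apply in_upair; auto.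
Qed.

Definition sing x : V := upair x x.

Lemma in_sing x z : z ∈ sing x <-> z = x.
Proof. unfold sing. rewrite in_upair. tauto. Qed.

Definition succ x : V := cup x (sing x).

Lemma in_succ x z : z ∈ succ x <-> z ∈ x \/ z = x.
Proof. unfold succ. now rewrite in_cup, in_sing. Qed.

Lemma is_succ_succ x y : is_succ x y <-> y = succ x.
Proof.
  split.
  - intros H. apply ext. intros z. rewrite in_succ. apply H.
  - intros -> z. apply in_succ.
Qed.

Definition prod a b : V :=
  sep (pow (pow (cup a b))) (fun p => exists x, x ∈ a /\ exists y, y ∈ b /\ is_opair p x y).

Lemma in_prod a b p : p ∈ prod a b <-> exists x y, x ∈ a /\ y ∈ b /\ p = opair x y.
Proof.
  unfold prod. rewrite in_sep by dfn_tac. split.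
  - intros [_ (x & Hx & y & Hy & H)]. apply is_opair_opair in H. eauto.
  - intros (x & y & Hx & Hy & ->). split.
    + apply in_pow. intros u Hu. apply in_pow. intros z Hz. apply in_cup.
      unfold opair in Hu. apply in_upair in Hu as [->| ->]; apply in_upair in Hz as [->| ->]; auto.
    + exists x. split; auto. exists y. split; auto. now apply is_opair_opair.
Qed.

Lemma opair_in_prod a b x y : opair x y ∈ prod a b <-> x ∈ a /\ y ∈ b.
Proof.
  rewrite in_prod. split.
  - intros (x' & y' & Hx & Hy & E). apply opair_inj in E as [-> ->]. auto.
  - intros [H1 H2]. eauto.
Qed.

Lemma not_in_self x : x ∉ x.
Proof.
  intros H. destruct (foundation (fun z => z = x) (sing x) x) as (y & Hy & E & K); auto.
  - dfn_tac.
  - now apply in_sing.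
  - subst y. apply (K x); auto.
Qed.

Lemma no_2cycle x y : x ∈ y -> y ∉ x.
Proof.
  intros H1 H2. destruct (foundation (fun z => True) (upair x y) x) as (z & Hz & _ & K); auto.
  - dfn_tac.
  - apply in_upair; auto.
  - apply in_upair in Hz as [->| ->].
    + apply (K y); auto. apply in_upair; auto.
    + apply (K x); auto. apply in_upair; auto.
Qed.

(** ** Functions *)

Definition ap f x : V := epsilon (inhabits x) (rel f x).

Lemma fun_rel f a b x y : is_fun f a b -> rel f x y -> x ∈ a /\ y ∈ b.
Proof.
  intros [H _] (p & Ho & Hp). destruct (H p Hp) as (x' & y' & Hx & Hy & Ho').
  destruct (is_opair_inj Ho Ho'). subst. auto.
Qed.

Lemma fun_dom f a b x y : is_fun f a b -> rel f x y -> x ∈ a.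
Proof. intros H Hr. apply (fun_rel f a b x y H Hr). Qed.

Lemma fun_cod f a b x y : is_fun f a b -> rel f x y -> y ∈ b.
Proof. intros H Hr. apply (fun_rel f a b x y H Hr). Qed.

Lemma ap_rel f a b x : is_fun f a b -> x ∈ a -> rel f x (ap f x).
Proof.
  intros [_ H] Hx. destruct (H x Hx) as [y [Hy _]].
  unfold ap. apply epsilon_spec. eauto.
Qed.

Lemma ap_in f a b x : is_fun f a b -> x ∈ a -> ap f x ∈ b.
Proof. intros H Hx. apply (fun_cod f a b x); auto. eapply ap_rel; eauto. Qed.

Lemma ap_eq f a b x y : is_fun f a b -> rel f x y -> ap f x = y.
Proof.
  intros H Hr. assert (Hx : x ∈ a) by (eapply fun_dom; eauto).
  destruct (proj2 H x Hx) as [z [Hz U]].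
  rewrite <- (U y Hr). symmetry. apply U. eapply ap_rel; eauto.
Qed.

Lemma fun_func f a b x y y' : is_fun f a b -> rel f x y -> rel f x y' -> y = y'.
Proof.
  intros H H1 H2. rewrite <- (ap_eq f a b x y H H1). now apply (ap_eq f a b).
Qed.

Lemma rel_ap f a b x y : is_fun f a b -> (rel f x y <-> x ∈ a /\ y = ap f x).
Proof.
  intros H. split.
  - intros Hr. split; [eapply fun_dom; eauto|]. symmetry. eapply ap_eq; eauto.
  - intros [Hx ->]. eapply ap_rel; eauto.
Qed.

Lemma fun_ex (R : V -> V -> Prop) a b :
  dfn (fun e => R (e 0) (e 1)) ->
  (forall x, x ∈ a -> exists y, y ∈ b /\ R x y) ->
  (forall x y y', x ∈ a -> y ∈ b -> y' ∈ b -> R x y -> R x y' -> y = y') ->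
  exists f, is_fun f a b /\ (forall x y, rel f x y <-> x ∈ a /\ y ∈ b /\ R x y) /\
    forall x, x ∈ a -> R x (ap f x).
Proof.
  intros HR H1 H2.
  assert (Hd : dfn (fun e : nat -> V => exists x, x ∈ a /\ exists y, y ∈ b /\
    (is_opair (e 0) x y /\ R x y))).
  { dfn_tac. }
  destruct (sep_ex (fun p => exists x, x ∈ a /\ exists y, y ∈ b /\
    (is_opair p x y /\ R x y)) (prod a b) Hd) as [f Hf].
  assert (K : forall x y, rel f x y <-> x ∈ a /\ y ∈ b /\ R x y).
  { intros x y. rewrite rel_opair, Hf, opair_in_prod. split.
    - intros [_ (x' & Hx & y' & Hy & Ho & H)]. apply is_opair_opair, opair_inj in Ho as [-> ->]. auto.
    - intros (Hx & Hy & H). split; auto. exists x. split; auto. exists y. split; auto.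
      split; auto. now apply is_opair_opair. }
  assert (F : is_fun f a b).
  { split.
    - intros p Hp. apply Hf in Hp as [_ (x & Hx & y & Hy & Ho & _)]. eauto.
    - intros x Hx. destruct (H1 x Hx) as (y & Hy & H). exists y. split.
      + apply K; auto.
      + intros y' Hy'. apply K in Hy'. apply (H2 x); tauto. }
  exists f. split; auto. split; auto.
  intros x Hx. apply (K x (ap f x)). eapply ap_rel; eauto.
Qed.

Lemma fun_ext f g a b b' : is_fun f a b -> is_fun g a b' ->
  (forall x, x ∈ a -> ap f x = ap g x) -> f = g.
Proof.
  intros Hf Hg H. apply ext. intros p. split; intros Hp.
  - destruct (proj1 Hf p Hp) as (x & y & Hx & Hy & Ho). apply is_opair_opair in Ho. subst p.
    apply rel_opair. apply rel_opair in Hp. apply (rel_ap g a b'); auto. split; auto.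
    rewrite <- H by auto. symmetry. eapply ap_eq; eauto.
  - destruct (proj1 Hg p Hp) as (x & y & Hx & Hy & Ho). apply is_opair_opair in Ho. subst p.
    apply rel_opair. apply rel_opair in Hp. apply (rel_ap f a b); auto. split; auto.
    rewrite H by auto. symmetry. eapply ap_eq; eauto.
Qed.

(** ** Ordinals *)

Lemma ord_in a b : is_ordinal a -> b ∈ a -> is_ordinal b.
Proof.
  intros [H1 H2] Hb. split; auto. intros c Hc. apply H2. now apply (H1 b).
Qed.

Lemma ord_trans a b c : is_ordinal c -> a ∈ b -> b ∈ c -> a ∈ c.
Proof. intros [H _] H1 H2. now apply (H b). Qed.

Lemma ord_succ a : is_ordinal a -> is_ordinal (succ a).
Proof.
  intros [H1 H2]. split.
  - intros b Hb c Hc. apply in_succ. left. apply in_succ in Hb as [Hb| ->]; auto.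
    now apply (H1 b).
  - intros b Hb. apply in_succ in Hb as [Hb| ->]; auto.
Qed.

Lemma ord_emp : is_ordinal emp.
Proof. split; intros b Hb; now apply in_emp in Hb. Qed.

Lemma in_succ_self x : x ∈ succ x.
Proof. apply in_succ; auto. Qed.

Lemma ord_ind (P : V -> Prop) : dfn (fun e => P (e 0)) ->
  (forall a, is_ordinal a -> (forall b, b ∈ a -> P b) -> P a) ->
  forall a, is_ordinal a -> P a.
Proof.
  intros HP H a Ha. apply NNPP. intros N.
  destruct (foundation (fun x => ~ P x) (succ a) a) as (y & Hy & Ny & K); auto.
  - dfn_tac.
  - apply in_succ_self.
  - apply Ny. apply H.
    + apply (ord_in (succ a)); auto. now apply ord_succ.
    + intros b Hb. apply NNPP. apply K; auto.
      apply (ord_trans b y); auto. now apply ord_succ.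
Qed.

Lemma ord_tri a b : is_ordinal a -> is_ordinal b -> a ∈ b \/ a = b \/ b ∈ a.
Proof.
  intros Ha Hb. revert a Ha.
  apply (ord_ind (fun a => a ∈ b \/ a = b \/ b ∈ a)); [dfn_tac|].
  intros a Ha IH. clear IH. revert b Hb a Ha.
  apply (ord_ind (fun b => forall a, is_ordinal a -> a ∈ b \/ a = b \/ b ∈ a)); [dfn_tac|].
  intros b Hb IHb. apply (ord_ind (fun a => a ∈ b \/ a = b \/ b ∈ a)); [dfn_tac|].
  intros a Ha IHa.
  destruct (classic (a ∈ b)); auto. destruct (classic (b ∈ a)); auto. right; left.
  apply ext. intros z. split; intros Hz.
  - destruct (IHa z Hz) as [K|[->|K]]; auto; [tauto|].
    destruct H0. now apply (ord_trans b z).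
  - destruct (IHb z Hz a Ha) as [K|[->|K]]; auto; [|tauto].
    destruct H. now apply (ord_trans a z).
Qed.

Lemma ord_sub a b : is_ordinal a -> is_ordinal b -> (a ⊆ b <-> a ∈ b \/ a = b).
Proof.
  intros Ha Hb. split.
  - intros H. destruct (ord_tri a b Ha Hb) as [K|[K|K]]; auto.
    now apply H, not_in_self in K.
  - intros [H| ->]; [|apply sub_refl]. now apply (proj1 Hb a).
Qed.

Lemma ord_lt_or_le a b : is_ordinal a -> is_ordinal b -> a ∈ b \/ b ⊆ a.
Proof.
  intros Ha Hb. destruct (ord_tri a b Ha Hb) as [K|[K|K]]; auto; right; apply ord_sub; auto.
Qed.

Lemma ord_le_lt a b c : is_ordinal a -> is_ordinal b -> is_ordinal c ->
  a ⊆ b -> b ∈ c -> a ∈ c.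
Proof.
  intros Ha Hb Hc H1 H2. apply ord_sub in H1 as [H1| ->]; auto. now apply (ord_trans a b).
Qed.

Lemma ord_le_total a b : is_ordinal a -> is_ordinal b -> a ⊆ b \/ b ⊆ a.
Proof.
  intros Ha Hb. destruct (ord_lt_or_le a b Ha Hb); auto. left. apply ord_sub; auto.
Qed.

Lemma succ_le a b : is_ordinal a -> is_ordinal b -> (succ a ⊆ b <-> a ∈ b).
Proof.
  intros Ha Hb. split.
  - intros H. apply H, in_succ_self.
  - intros H z Hz. apply in_succ in Hz as [Hz| ->]; auto. now apply (ord_trans z a).
Qed.

Lemma in_succ_le a b : is_ordinal a -> is_ordinal b -> (a ∈ succ b <-> a ⊆ b).
Proof. intros Ha Hb. rewrite in_succ, ord_sub; tauto. Qed.

Lemma succ_inj a b : is_ordinal a -> is_ordinal b -> succ a = succ b -> a = b.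
Proof.
  intros Ha Hb E.
  assert (H1 : a ∈ succ b) by (rewrite <- E; apply in_succ_self).
  assert (H2 : b ∈ succ a) by (rewrite E; apply in_succ_self).
  apply in_succ in H1 as [H1|]; auto. apply in_succ in H2 as [H2|]; auto.
  now destruct (no_2cycle a b).
Qed.

Lemma least_ord (P : V -> Prop) a : dfn (fun e => P (e 0)) -> is_ordinal a -> P a ->
  exists m, is_ordinal m /\ P m /\ m ⊆ a /\ forall b, is_ordinal b -> P b -> m ⊆ b.
Proof.
  intros HP Ha H.
  destruct (foundation P (succ a) a) as (m & Hm & Pm & K); auto using in_succ_self.
  assert (Om : is_ordinal m) by (apply (ord_in (succ a)); auto using ord_succ).
  apply in_succ_le in Hm; auto. exists m. repeat (split; auto).
  intros b Hb Pb. destruct (ord_lt_or_le b m Hb Om) as [L|]; auto.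
  destruct (K b); auto. apply in_succ_le; auto. apply (sub_trans b m a); auto.
  apply ord_sub; auto.
Qed.

Lemma ord_bigcup a : (forall x, x ∈ a -> is_ordinal x) -> is_ordinal (bigcup a).
Proof.
  intros H. split.
  - intros y Hy z Hz. apply in_bigcup in Hy as (x & Hx & Hy). apply in_bigcup.
    exists x. split; auto. apply (ord_trans z y); auto.
  - intros y Hy. apply in_bigcup in Hy as (x & Hx & Hy).
    apply (proj1 (ord_in x y (H x Hx) Hy)).
Qed.

Lemma bigcup_ub a x : x ∈ a -> x ⊆ bigcup a.
Proof. intros H z Hz. apply in_bigcup. eauto. Qed.

Lemma limit_ord a : is_limit a -> is_ordinal a.
Proof. now intros [H _]. Qed.

Lemma limit_succ a b : is_limit a -> b ∈ a -> succ b ∈ a.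
Proof.
  intros (_ & _ & H) Hb. destruct (H b Hb) as (c & Hc & E). apply is_succ_succ in E. now subst.
Qed.

Lemma limit_intro a : is_ordinal a -> a <> emp -> (forall b, b ∈ a -> succ b ∈ a) -> is_limit a.
Proof.
  intros Ha Hne H. split; auto. split; [now apply nonempty|].
  intros b Hb. exists (succ b). split; auto. now apply is_succ_succ.
Qed.

Lemma ord_cases a : is_ordinal a -> a = emp \/ (exists b, is_ordinal b /\ a = succ b) \/ is_limit a.
Proof.
  intros Ha. destruct (classic (a = emp)); auto. right.
  destruct (classic (exists b, b ∈ a /\ succ b ∉ a)) as [(b & Hb & N)|N].
  - left. exists b. assert (Ob : is_ordinal b) by (eapply ord_in; eauto). split; auto.
    destruct (ord_tri (succ b) a) as [K|[K|K]]; auto using ord_succ; [tauto|].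
    exfalso. apply in_succ in K as [K| ->]; [now apply (no_2cycle a b)|now apply (not_in_self b)].
  - right. apply limit_intro; auto. intros b Hb. apply NNPP. eauto.
Qed.

(** ** Natural numbers *)

Lemma nat_emp : is_nat emp.
Proof. intros I [H _]. apply H. now apply is_empty_emp. Qed.

Lemma nat_succ n : is_nat n -> is_nat (succ n).
Proof. intros H I HI. apply (proj2 HI n); auto. now apply is_succ_succ. Qed.

End Sets.

Lemma def_is_nat {V : structure} {Q : V -> Prop} : definable false univ Q (fun e => is_nat (e 0)).
Proof. unfold is_nat, inductive_set. dfn_tac. Qed.
#[export] Hint Resolve def_is_nat : dfn.

Lemma def_is_omega {V : structure} {Q : V -> Prop} : definable false univ Q (fun e => is_omega (e 0)).
Proof. unfold is_omega. dfn_tac. Qed.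
#[export] Hint Resolve def_is_omega : dfn.

Section Naturals.
Context {V : structure} {HZF : ZF V}.
Implicit Types x y z a f n m : V.

Lemma nat_ind' (P : V -> Prop) : dfn (fun e => P (e 0)) -> P emp ->
  (forall n, is_nat n -> P n -> P (succ n)) -> forall n, is_nat n -> P n.
Proof.
  intros HP H0 HS n Hn. destruct (ZF_infinity V HZF) as (I & HI & _).
  assert (Hd : dfn (fun e => is_nat (e 0) /\ P (e 0))) by dfn_tac.
  assert (K : inductive_set (sep I (fun x => is_nat x /\ P x))).
  { split.
    - intros z Hz. apply in_sep; auto. split; [now apply HI|].
      apply is_empty_emp in Hz. subst z. split; auto using nat_emp.
    - intros x y Hx Hy. apply in_sep in Hx as (H1 & H2 & H3); auto. apply in_sep; auto.
      split; [apply (proj2 HI x); auto|]. apply is_succ_succ in Hy. subst y.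
      split; auto using nat_succ. }
  specialize (Hn _ K). apply in_sep in Hn; tauto.
Qed.

Lemma omega_ex : exists w : V, is_omega w.
Proof.
  destruct (ZF_infinity V HZF) as (I & HI & _).
  exists (sep I is_nat). intros x. rewrite in_sep by dfn_tac. split; [tauto|].
  intros H. split; auto.
Qed.

Definition omega : V := proj1_sig (constructive_indefinite_description _ omega_ex).

Lemma in_omega x : x ∈ omega <-> is_nat x.
Proof. apply (proj2_sig (constructive_indefinite_description _ omega_ex)). Qed.

Lemma is_omega_omega w : is_omega w <-> w = omega.
Proof.
  split.
  - intros H. apply ext. intros z. rewrite in_omega. apply H.
  - intros -> z. apply in_omega.
Qed.

Lemma nat_ord n : is_nat n -> is_ordinal n.
Proof.
  revert n. apply nat_ind'; [dfn_tac|apply ord_emp|]. intros; now apply ord_succ.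
Qed.

Lemma nat_in n m : is_nat n -> m ∈ n -> is_nat m.
Proof.
  intros Hn. revert n Hn m. apply (nat_ind' (fun n => forall m, m ∈ n -> is_nat m)); [dfn_tac| |].
  - intros m Hm. now apply in_emp in Hm.
  - intros n Hn IH m Hm. apply in_succ in Hm as [Hm| ->]; auto.
Qed.

Lemma ord_omega : is_ordinal omega.
Proof.
  split.
  - intros n Hn m Hm. apply in_omega in Hn. apply in_omega. eapply nat_in; eauto.
  - intros n Hn. apply in_omega in Hn. apply (proj1 (nat_ord n Hn)).
Qed.

Lemma limit_omega : is_limit omega.
Proof.
  apply limit_intro; [apply ord_omega| |].
  - apply nonempty. exists emp. apply in_omega, nat_emp.
  - intros n Hn. apply in_omega. apply in_omega in Hn. now apply nat_succ.
Qed.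

Lemma nat_cases n : is_nat n -> n = emp \/ exists m, is_nat m /\ n = succ m.
Proof.
  revert n. apply (nat_ind' (fun n => n = emp \/ exists m, is_nat m /\ n = succ m)); auto.
  - apply (def_equiv' (fun e => e 0 = emp \/ exists m, is_nat m /\ is_succ m (e 0))); [|dfn_tac].
    intros e. split; (intros [H|(m & H1 & H2)]; [now left|right; exists m; split; auto; now apply is_succ_succ]).
  - intros n Hn _. right; eauto.
Qed.

Lemma limit_emp a : is_limit a -> emp ∈ a.
Proof.
  intros (Ha & H & _). destruct (ord_tri emp a) as [K|[K|K]]; auto using ord_emp.
  - subst a. destruct H as [b H]. now apply in_emp in H.
  - now apply in_emp in K.
Qed.

Lemma omega_le_limit a : is_limit a -> omega ⊆ a.
Proof.
  intros Ha n Hn. apply in_omega in Hn. revert n Hn.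
  apply nat_ind'; [dfn_tac|now apply limit_emp|]. intros n _ H. now apply limit_succ.
Qed.

(** No codomain is known beforehand. The approximations [A n h] obey the recursion up to [n];
    induction in the model shows that they exist and agree up to [n], and replacement collects their
    values. *)
Lemma iterate (F : V -> V) x0 : dfn (fun e => e 1 = F (e 0)) ->
  exists f b, is_fun f omega b /\ ap f emp = x0 /\
    forall n, is_nat n -> ap f (succ n) = F (ap f n).
Proof.
  intros HF.
  pose (A := fun n h => (rel h emp x0 /\ (forall y, rel h emp y -> y = x0)) /\
    forall k, k ∈ n -> exists y, rel h k y /\ forall k' y' z, is_succ k k' -> y' = F y ->
       (rel h k' z <-> z = y')).
  assert (HA : dfn (fun e => A (e 0) (e 1))).
  { unfold A. dfn_tac. }
  assert (A_ind : forall n h, is_nat n -> A n h -> forall m, is_nat m -> m ⊆ n ->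
    exists y, rel h m y /\ (forall y', rel h m y' -> y' = y) /\
      forall h', A n h' -> forall y', rel h' m y' -> y' = y).
  { intros n h Hn HAh. apply (nat_ind' (fun m => m ⊆ n -> exists y, rel h m y /\
      (forall y', rel h m y' -> y' = y) /\ forall h', A n h' -> forall y', rel h' m y' -> y' = y)).
    - dfn_tac.
    - intros _. exists x0. destruct HAh as [[H1 H2] _]. split; auto. split; auto.
      intros h' [[_ H] _]. auto.
    - intros m Hm IH Hle. assert (Hmn : m ∈ n) by (apply Hle, in_succ_self).
      destruct IH as (y & Hy & U & U').
      { intros z Hz. apply Hle, in_succ. auto. }
      exists (F y).
      destruct (proj2 HAh m Hmn) as (y1 & Hy1 & K). apply U in Hy1. subst y1.
      split; [|split].
      + apply (K (succ m) (F y)); auto. now apply is_succ_succ.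
      + intros y' Hy'. apply (K (succ m) (F y) y') in Hy'; auto. now apply is_succ_succ.
      + intros h' Hh' y' Hy'. destruct (proj2 Hh' m Hmn) as (y2 & Hy2 & K').
        rewrite (U' h' Hh' y2 Hy2) in K'. apply (K' (succ m) (F y)) in Hy'; auto. now apply is_succ_succ. }
  assert (A_ex : forall n, is_nat n -> exists h, A n h).
  { apply (nat_ind' (fun n => exists h, A n h)).
    - dfn_tac.
    - exists (sing (opair emp x0)). split; [split|].
      + apply rel_opair, in_sing. reflexivity.
      + intros y Hy. apply rel_opair, in_sing, opair_inj in Hy. tauto.
      + intros k Hk. now apply in_emp in Hk.
    - intros n Hn (h & Hh).
      destruct (A_ind n h Hn Hh n Hn (sub_refl n)) as (y & Hy & U & _).
      assert (Hd : dfn (fun e => forall y, ~ is_opair (e 0) (succ n) y)) by dfn_tac.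
      (* [h] may relate [succ n] to anything, so such pairs are removed before the new one is
         added. *)
      exists (cup (sep h (fun p => forall y, ~ is_opair p (succ n) y)) (sing (opair (succ n) (F y)))).
      assert (K : forall k z, k <> succ n -> (rel (cup (sep h (fun p => forall y, ~ is_opair p (succ n) y)) (sing (opair (succ n) (F y)))) k z <-> rel h k z)).
      { intros k z Hk. rewrite !rel_opair, in_cup, in_sing, in_sep by auto. split.
        - intros [[H _]|H]; auto. apply opair_inj in H. tauto.
        - intros H. left. split; auto. intros y1 Hy1. apply is_opair_opair, opair_inj in Hy1. tauto. }
      assert (K' : forall z, (rel (cup (sep h (fun p => forall y, ~ is_opair p (succ n) y)) (sing (opair (succ n) (F y)))) (succ n) z <-> z = F y)).
      { intros z. rewrite !rel_opair, in_cup, in_sing, in_sep by auto. split.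
        - intros [[_ H]|H].
          + destruct (H z). now apply is_opair_opair.
          + apply opair_inj in H. tauto.
        - intros ->. auto. }
      assert (Hne : forall k, k ∈ succ n -> k <> succ n).
      { intros k Hk ->. now apply (not_in_self (succ n)). }
      assert (E0 : emp <> succ n).
      { intros E. assert (n ∈ emp) by (rewrite E; apply in_succ_self). now apply in_emp in H. }
      split; [split|].
      + apply K; auto. apply Hh.
      + intros z Hz. apply K in Hz; auto. now apply Hh.
      + intros k Hk. apply in_succ in Hk as Hk'. destruct Hk' as [Hk'| ->].
        * destruct (proj2 Hh k Hk') as (y1 & Hy1 & K1). exists y1. split.
          { apply K; auto. }
          intros k' y' z Hs -> . rewrite K; [now apply K1|].
          apply is_succ_succ in Hs. subst k'. intros E. apply succ_inj in E; auto using nat_ord.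
          { subst k. now apply (not_in_self n). }
          apply nat_ord. eapply nat_in; eauto.
        * exists y. split; [apply K; auto|]. intros k' y' z Hs ->. apply is_succ_succ in Hs. subst k'.
          apply K'. }
  assert (A_down : forall n m h, is_nat n -> m ⊆ n -> A n h -> A m h).
  { intros n m h Hn Hm [H1 H2]. split; auto. }
  pose (R := fun n y => exists h, A n h /\ rel h n y).
  assert (HR : dfn (fun e => R (e 0) (e 1))).
  { unfold R. dfn_tac. }
  assert (HRu : forall n y y', is_nat n -> R n y -> R n y' -> y = y').
  { intros n y y' Hn (h & Hh & Hy) (h' & Hh' & Hy').
    destruct (A_ind n h Hn Hh n Hn (sub_refl n)) as (y1 & _ & U & U').
    rewrite (U _ Hy). symmetry. eapply U'; eauto. }
  destruct (repl_ex R omega) as [b Hb]; auto.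
  { intros n y y' Hn. apply HRu. now apply in_omega. }
  destruct (fun_ex R omega b) as (f & Hf & Hrel & Hap); auto.
  { intros n Hn. assert (Hn' := Hn). apply in_omega in Hn. destruct (A_ex n Hn) as [h Hh].
    destruct (A_ind n h Hn Hh n Hn (sub_refl n)) as (y1 & Hy1 & _).
    assert (HRn : R n y1) by (exists h; auto).
    exists y1. split; auto. apply Hb. eauto. }
  { intros x y y' Hx _ _. apply HRu. now apply in_omega. }
  exists f, b. split; auto. split.
  - apply (HRu emp); [apply nat_emp|apply Hap, in_omega, nat_emp|].
    destruct (A_ex emp nat_emp) as [h Hh]. exists h. split; auto. apply Hh.
  - intros n Hn. apply (HRu (succ n)); auto using nat_succ.
    { apply Hap, in_omega; auto using nat_succ. }
    destruct (A_ex (succ n) (nat_succ n Hn)) as [h Hh]. exists h. split; auto.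
    destruct (proj2 Hh n (in_succ_self n)) as (y & Hy & K).
    apply (K (succ n) (F y)); [now apply is_succ_succ|auto|].
    f_equal. apply (HRu n); auto.
    + apply Hap. now apply in_omega.
    + exists h. split; auto. apply (A_down (succ n)); auto using nat_succ.
      intros z Hz. apply in_succ; auto.
Qed.

End Naturals.

(** * The cumulative hierarchy *)

Lemma def_is_hierarchy {V : structure} {Q : V -> Prop} :
  definable false univ Q (fun e => is_hierarchy (e 0) (e 1)).
Proof. unfold is_hierarchy. dfn_tac. Qed.
#[export] Hint Resolve def_is_hierarchy : dfn.

Lemma def_is_V {V : structure} {Q : V -> Prop} :
  definable false univ Q (fun e => is_V (e 0) (e 1)).
Proof. unfold is_V. dfn_tac. Qed.
#[export] Hint Resolve def_is_V : dfn.

Section Hierarchy.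
Context {V : structure} {HZF : ZF V}.
Implicit Types x y z a b f u v : V.

Lemma hierarchy_down f a b :
  is_ordinal a -> is_hierarchy f a -> b ∈ a -> is_hierarchy f b.
Proof.
  intros Ha H Hb c Hc. apply H. left. destruct Hc as [Hc| ->]; auto. now apply (ord_trans c b).
Qed.

Lemma hierarchy_ex f a b : is_hierarchy f a -> b ∈ a \/ b = a -> exists w, rel f b w.
Proof.
  intros H Hb.
  (* The second component of a pair in [f] lies two unions deep, and the elements of that component
     three unions deep. *)
  exists (sep (pow (bigcup (bigcup (bigcup f)))) (fun x => exists c u, c ∈ b /\ rel f c u /\ x ⊆ u)).
  apply (H b Hb). intros x. rewrite in_sep by dfn_tac. split; [tauto|].
  intros (c & u & Hc & Hr & Hx). split; eauto.
  apply in_pow. intros z Hz. apply in_bigcup. exists u. split; auto.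
  apply in_bigcup. exists (upair c u). split; [|apply in_upair; auto].
  apply in_bigcup. exists (opair c u). split; [now apply rel_opair|apply in_upair; auto].
Qed.

Lemma hierarchy_unique a : is_ordinal a -> forall f f' u u',
  is_hierarchy f a -> is_hierarchy f' a -> rel f a u -> rel f' a u' -> u = u'.
Proof.
  revert a. apply (ord_ind (fun a => forall f f' u u',
    is_hierarchy f a -> is_hierarchy f' a -> rel f a u -> rel f' a u' -> u = u')); [dfn_tac|].
  intros a Ha IH.
  assert (K : forall f f' u u', is_hierarchy f a -> is_hierarchy f' a ->
    rel f a u -> rel f' a u' -> u ⊆ u').
  { intros f f' u u' Hf Hf' Hu Hu' x Hx.
    apply (Hf a (or_intror eq_refl)) with (x := x) in Hu. apply Hu in Hx.
    destruct Hx as (c & w & Hc & Hw & Hx).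
    destruct (hierarchy_ex f' a c Hf' (or_introl Hc)) as [w' Hw'].
    apply (Hf' a (or_intror eq_refl)) with (x := x) in Hu'. apply Hu'.
    exists c, w'. split; auto. split; auto.
    replace w' with w; auto. apply (IH c Hc f f'); auto; eapply hierarchy_down; eauto. }
  intros f f' u u' Hf Hf' Hu Hu'. apply sub_antisym; eauto.
Qed.

Lemma is_V_mem a v : is_V a v ->
  forall x, x ∈ v <-> exists c u, c ∈ a /\ is_V c u /\ x ⊆ u.
Proof.
  intros (Ha & f & Hf & Hv) x.
  rewrite (proj1 (Hf a (or_intror eq_refl) v) Hv x). split; intros (c & u & Hc & Hu & Hx).
  - exists c, u. split; auto. split; auto. split; [eapply ord_in; eauto|].
    exists f. split; auto. eapply hierarchy_down; eauto.
  - exists c, u. split; auto. split; auto. destruct Hu as (Oc & f' & Hf' & Hr).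
    destruct (hierarchy_ex f a c Hf (or_introl Hc)) as [w' Hw'].
    replace u with w'; auto. apply (hierarchy_unique c Oc f f'); auto. now apply (hierarchy_down f a c).
Qed.

Lemma is_V_unique a v v' : is_V a v -> is_V a v' -> v = v'.
Proof. intros (Ha & f & Hf & Hv) (_ & f' & Hf' & Hv'). now apply (hierarchy_unique a Ha f f'). Qed.

Lemma is_V_ex a : is_ordinal a -> exists v, is_V a v.
Proof.
  revert a. apply (ord_ind (fun a => exists v, is_V a v)); [dfn_tac|]. intros a Ha IH.
  destruct (repl_ex is_V a) as [r Hr]; [dfn_tac| |].
  { intros x y y' _. apply is_V_unique. }
  pose (v := sep (pow (bigcup r)) (fun x => exists u, u ∈ r /\ x ⊆ u)).
  assert (Hv : forall x, x ∈ v <-> exists c u, c ∈ a /\ is_V c u /\ x ⊆ u).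
  { intros x. unfold v. rewrite in_sep by dfn_tac. split.
    - intros (_ & u & Hu & Hx). apply Hr in Hu as (c & Hc & Hu). eauto.
    - intros (c & u & Hc & Hu & Hx). assert (Hur : u ∈ r) by (apply Hr; eauto). split; eauto.
      apply in_pow. intros z Hz. apply in_bigcup. eauto. }
  destruct (fun_ex is_V a r) as (f & Hf & Hrel & Hap); [dfn_tac| | |].
  { intros x Hx. destruct (IH x Hx) as [u Hu]. exists u. split; auto. apply Hr; eauto. }
  { intros x y y' _ _ _. apply is_V_unique. }
  exists v. split; auto. exists (cup f (sing (opair a v))).
  assert (K : forall b w, rel (cup f (sing (opair a v))) b w <-> rel f b w \/ (b = a /\ w = v)).
  { intros b w. rewrite !rel_opair, in_cup, in_sing. split; intros [H|H]; auto.
    - right. now apply opair_inj.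
    - destruct H as [-> ->]. auto. }
  assert (K' : forall b w, b ∈ a -> (rel (cup f (sing (opair a v))) b w <-> is_V b w)).
  { intros b w Hb. rewrite K, Hrel. split.
    - intros [H|[-> _]]; [tauto|]. now apply not_in_self in Hb.
    - intros H. left. split; auto. split; auto. apply Hr; eauto. }
  split; [|apply K; auto].
  intros b Hb w.
  assert (K2 : (forall x, x ∈ w <-> exists c u, c ∈ b /\ rel (cup f (sing (opair a v))) c u /\ x ⊆ u) <->
    (forall x, x ∈ w <-> exists c u, c ∈ b /\ is_V c u /\ x ⊆ u)).
  { assert (Hba : forall c, c ∈ b -> c ∈ a).
    { intros c Hc. destruct Hb as [Hb| ->]; auto. now apply (ord_trans c b). }
    split; intros H x; rewrite H; split; intros (c & u & Hc & Hu & Hx); exists c, u;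
    (split; [auto|split; [apply K'; auto|auto]]). }
  rewrite K2. destruct Hb as [Hb| ->].
  - rewrite K' by auto. split; [apply is_V_mem|]. intros H.
    destruct (IH b Hb) as [u Hu]. replace w with u; auto. apply ext. intros x.
    now rewrite H, (is_V_mem b u Hu).
  - rewrite K. split.
    + intros [H|[_ ->]]; auto. apply Hrel in H as [H _]. now apply not_in_self in H.
    + intros H. right. split; auto. apply ext. intros x. now rewrite Hv, H.
Qed.

(* [VV a] is [V_a]; the value is [emp] when [a] is not an ordinal. *)
Definition VV a : V :=
  epsilon (inhabits a) (fun v => is_V a v \/ (~ is_ordinal a /\ is_empty v)).

Lemma VV_spec a v : v = VV a <-> is_V a v \/ (~ is_ordinal a /\ is_empty v).
Proof.
  assert (E : exists v, is_V a v \/ (~ is_ordinal a /\ is_empty v)).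
  { destruct (classic (is_ordinal a)) as [H|H].
    - destruct (is_V_ex a H) as [v0 Hv0]. eauto.
    - exists emp. right. split; auto. now apply is_empty_emp. }
  assert (S := epsilon_spec (inhabits a) _ E). fold (VV a) in S. split; [now intros ->|].
  intros H. destruct H as [H|[N H]], S as [S|[N' S]].
  - eapply is_V_unique; eauto.
  - destruct H; tauto.
  - destruct S; tauto.
  - apply is_empty_emp in H, S. congruence.
Qed.

Lemma is_V_VV a v : is_V a v <-> is_ordinal a /\ v = VV a.
Proof.
  rewrite VV_spec. split.
  - intros H. split; auto. apply H.
  - intros [H [K|K]]; tauto.
Qed.

Lemma in_VV a x : is_ordinal a -> (x ∈ VV a <-> exists b, b ∈ a /\ x ⊆ VV b).
Proof.
  intros Ha. rewrite (is_V_mem a (VV a)) by (apply is_V_VV; auto). split.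
  - intros (c & u & Hc & Hu & Hx). exists c. apply is_V_VV in Hu as [_ ->]. auto.
  - intros (c & Hc & Hx). exists c, (VV c). split; auto. split; auto.
    apply is_V_VV. split; auto. eapply ord_in; eauto.
Qed.

End Hierarchy.

Lemma def_VV {V : structure} {HZF : ZF V} {Q : V -> Prop} :
  definable false univ Q (fun e => e 1 = VV (e 0)).
Proof.
  apply (def_equiv' (fun e => is_V (e 0) (e 1) \/ (~ is_ordinal (e 0) /\ is_empty (e 1)))); [|dfn_tac].
  intros e. symmetry. apply VV_spec.
Qed.
#[export] Hint Resolve def_VV : dfn.

Section Hierarchy2.
Context {V : structure} {HZF : ZF V}.
Implicit Types x y z a b f u v : V.

Lemma VV_trans a : is_ordinal a -> transitive_set (VV a).
Proof.
  (* The induction predicate has to be definable and [VV a] is not a term, hence the detour through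
     a variable [v]. *)
  intros Ha. assert (H : forall v, v = VV a -> transitive_set v); [|now apply H].
  revert a Ha. apply (ord_ind (fun a => forall v, v = VV a -> transitive_set v)); [dfn_tac|].
  intros a Ha IH v -> x Hx y Hy. apply in_VV in Hx as (b & Hb & Hx); auto.
  apply in_VV; auto. exists b. split; auto. apply (IH b Hb (VV b) eq_refl). auto.
Qed.

Lemma VV_sub a x y : is_ordinal a -> y ∈ VV a -> x ⊆ y -> x ∈ VV a.
Proof.
  intros Ha Hy Hx. apply in_VV in Hy as (b & Hb & Hy); auto. apply in_VV; auto.
  exists b. split; auto. eapply sub_trans; eauto.
Qed.

Lemma VV_mono a b : is_ordinal a -> is_ordinal b -> a ⊆ b -> VV a ⊆ VV b.
Proof.
  intros Ha Hb H x Hx. apply in_VV in Hx as (c & Hc & Hx); auto. apply in_VV; eauto.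
Qed.

Lemma VV_in a b : is_ordinal b -> a ∈ b -> VV a ∈ VV b.
Proof. intros Hb H. apply in_VV; auto. exists a. split; auto. apply sub_refl. Qed.

Lemma VV_succ a x : is_ordinal a -> (x ∈ VV (succ a) <-> x ⊆ VV a).
Proof.
  intros Ha. rewrite in_VV by now apply ord_succ. split.
  - intros (b & Hb & Hx). apply (sub_trans x (VV b)); auto.
    assert (Ob : is_ordinal b) by (apply (ord_in (succ a)); auto using ord_succ).
    apply VV_mono; auto. apply in_succ_le; auto.
  - intros H. exists a. split; auto. apply in_succ_self.
Qed.

Lemma ord_sub_VV a : is_ordinal a -> a ⊆ VV a.
Proof.
  intros Ha. assert (H : forall v, v = VV a -> a ⊆ v); [|now apply H].
  revert a Ha. apply (ord_ind (fun a => forall v, v = VV a -> a ⊆ v)); [dfn_tac|].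
  intros a Ha IH v -> b Hb. apply in_VV; auto. exists b. split; auto.
Qed.

Lemma not_in_VV a : is_ordinal a -> a ∉ VV a.
Proof.
  intros Ha. assert (H : forall v, v = VV a -> a ∉ v); [|now apply H].
  revert a Ha. apply (ord_ind (fun a => forall v, v = VV a -> a ∉ v)); [dfn_tac|].
  intros a Ha IH v -> K. apply in_VV in K as (b & Hb & K); auto.
  apply (IH b Hb (VV b) eq_refl). auto.
Qed.

Lemma ord_in_VV a b : is_ordinal a -> is_ordinal b -> (b ∈ VV a <-> b ∈ a).
Proof.
  intros Ha Hb. split; [|now apply ord_sub_VV].
  intros H. destruct (ord_lt_or_le b a Hb Ha) as [|L]; auto. exfalso.
  apply (not_in_VV a Ha). apply (VV_sub a a b); auto.
Qed.

Lemma VV_inj_lt a b : is_ordinal a -> is_ordinal b -> VV a ∈ VV b -> a ∈ b.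
Proof.
  intros Ha Hb H. apply ord_in_VV; auto. apply (VV_sub b a (VV a)); auto. now apply ord_sub_VV.
Qed.

Lemma VV_inj a b : is_ordinal a -> is_ordinal b -> VV a = VV b -> a = b.
Proof.
  intros Ha Hb E. destruct (ord_tri a b) as [K|[K|K]]; auto.
  - apply VV_in in K; auto. rewrite E in K. now apply not_in_self in K.
  - apply VV_in in K; auto. rewrite E in K. now apply not_in_self in K.
Qed.

Hint Resolve limit_ord : core.

Lemma VV_limit a x : is_limit a -> (x ∈ VV a <-> exists b, b ∈ a /\ x ∈ VV b).
Proof.
  intros Ha. split.
  - intros H. apply in_VV in H as (b & Hb & H); auto. exists (succ b). split; [now apply limit_succ|].
    apply VV_succ; auto. eapply ord_in; eauto.
  - intros (b & Hb & H). assert (Ob : is_ordinal b) by (eapply ord_in; eauto).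
    apply (VV_mono b a); auto. apply ord_sub; auto.
Qed.

Lemma VV_upair_limit a x y : is_limit a -> x ∈ VV a -> y ∈ VV a -> upair x y ∈ VV a.
Proof.
  intros Ha Hx Hy. apply VV_limit in Hx as (b & Hb & Hx), Hy as (c & Hc & Hy); auto.
  assert (Ob : is_ordinal b) by (apply (ord_in a); auto).
  assert (Oc : is_ordinal c) by (apply (ord_in a); auto).
  assert (K : forall d, d ∈ a -> x ∈ VV d -> y ∈ VV d -> upair x y ∈ VV a).
  { intros d Hd Hxd Hyd. apply in_VV; auto. exists d. split; auto.
    intros z Hz. apply in_upair in Hz as [->| ->]; auto. }
  destruct (ord_le_total b c); auto.
  - apply (K c); auto. apply (VV_mono b c); auto.
  - apply (K b); auto. apply (VV_mono c b); auto.
Qed.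

Lemma VV_opair_limit a x y : is_limit a -> x ∈ VV a -> y ∈ VV a -> opair x y ∈ VV a.
Proof. intros. unfold opair. auto using VV_upair_limit. Qed.

Lemma VV_pow_limit a x : is_limit a -> x ∈ VV a -> pow x ∈ VV a.
Proof.
  intros Ha Hx. apply VV_limit in Hx as (b & Hb & Hx); auto. apply in_VV; auto. exists b.
  split; auto. intros y Hy. apply in_pow in Hy. apply (VV_sub b y x); auto. eapply ord_in; eauto.
Qed.

Lemma VV_cup_limit a x y : is_limit a -> x ∈ VV a -> y ∈ VV a -> cup x y ∈ VV a.
Proof.
  intros Ha Hx Hy. assert (H := VV_upair_limit a x y Ha Hx Hy).
  apply in_VV in H as (b & Hb & H); auto. apply in_VV; auto. exists b. split; auto.
  intros z Hz. assert (Ob : is_ordinal b) by (eapply ord_in; eauto).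
  apply in_cup in Hz as [Hz|Hz].
  - apply (VV_trans b Ob x); auto. apply H, in_upair; auto.
  - apply (VV_trans b Ob y); auto. apply H, in_upair; auto.
Qed.

Lemma VV_prod_limit a x y : is_limit a -> x ∈ VV a -> y ∈ VV a -> prod x y ∈ VV a.
Proof.
  intros Ha Hx Hy. apply (VV_sub a _ (pow (pow (cup x y)))); auto.
  - auto using VV_pow_limit, VV_cup_limit.
  - intros z Hz. unfold prod in Hz. apply in_sep in Hz; [tauto|dfn_tac].
Qed.

Lemma fun_sub_prod f x y : is_fun f x y -> f ⊆ prod x y.
Proof.
  intros H p Hp. destruct (proj1 H p Hp) as (u & w & Hu & Hw & Ho).
  apply is_opair_opair in Ho. subst. now apply opair_in_prod.
Qed.

Lemma VV_fun_limit a f x y : is_limit a -> x ∈ VV a -> y ∈ VV a -> is_fun f x y -> f ∈ VV a.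
Proof.
  intros Ha Hx Hy Hf. apply (VV_sub a f (prod x y)); auto using VV_prod_limit, fun_sub_prod.
Qed.

Lemma opair_in_VV_limit a x y : is_limit a -> (opair x y ∈ VV a <-> x ∈ VV a /\ y ∈ VV a).
Proof.
  intros Ha. split; [|intros []; now apply VV_opair_limit].
  intros H. assert (K : upair x y ∈ VV a).
  { apply (VV_trans a (limit_ord a Ha) (opair x y)); auto. apply in_upair; auto. }
  split; (eapply (VV_trans a (limit_ord a Ha)); [exact K|apply in_upair; auto]).
Qed.

(** Supplies a function of the metatheory with definable graph, the form in which [iterate] wants
    its step. *)
Lemma func_of_rel (R : V -> V -> Prop) :
  dfn (fun e => R (e 0) (e 1)) -> (forall x, exists! y, R x y) ->
  exists F : V -> V, dfn (fun e => e 1 = F (e 0)) /\ forall x y, R x y <-> y = F x.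
Proof.
  intros HR H. exists (fun x => epsilon (inhabits x) (R x)).
  assert (K : forall x y, R x y <-> y = epsilon (inhabits x) (R x)).
  { intros x y. destruct (H x) as (y0 & Hy0 & U).
    assert (S : R x (epsilon (inhabits x) (R x))) by (apply epsilon_spec; eauto).
    split; [|now intros ->]. intros Hy. rewrite <- (U _ Hy). now apply U. }
  split; auto. apply (def_equiv' (fun e => R (e 0) (e 1))); auto.
Qed.

Lemma iterate_fun (S a x0 : V) : is_fun S a a -> x0 ∈ a -> exists f, is_fun f omega a /\ ap f emp = x0 /\
  forall n, is_nat n -> ap f (succ n) = ap S (ap f n).
Proof.
  intros HS Hx.
  destruct (func_of_rel (fun x y => rel S x y \/ (x ∉ a /\ is_empty y))) as (F & HF & HFR).
  { dfn_tac. }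
  { intros x. destruct (classic (x ∈ a)) as [Ha|Ha].
    - exists (ap S x). split; [left; eapply ap_rel; eauto|].
      intros y [Hy|[? _]]; [|tauto]. eapply ap_eq; eauto.
    - exists emp. split; [right; split; auto; now apply is_empty_emp|].
      intros y [Hy|[_ Hy]]; [|symmetry; now apply is_empty_emp].
      destruct Ha. eapply fun_dom; eauto. }
  assert (FS : forall x, x ∈ a -> F x = ap S x).
  { intros x Ha. symmetry. apply HFR. left. eapply ap_rel; eauto. }
  destruct (iterate F x0 HF) as (f & b & Hf & H0 & Hs).
  assert (Hv : forall n, is_nat n -> forall y, rel f n y -> y ∈ a).
  { apply (nat_ind' (fun n => forall y, rel f n y -> y ∈ a)); [dfn_tac| |].
    - intros y Hy. apply (rel_ap f omega b) in Hy as [_ ->]; auto. now rewrite H0.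
    - intros n Hn IH y Hy. apply (rel_ap f omega b) in Hy as [_ ->]; auto. rewrite Hs by auto.
      assert (K : ap f n ∈ a) by (apply IH; eapply ap_rel; eauto; now apply in_omega).
      rewrite FS by auto. eapply ap_in; eauto. }
  exists f. split; [|split; auto].
  - split; [|apply Hf]. intros p Hp. destruct (proj1 Hf p Hp) as (x & y & Hx' & Hy & Ho).
    exists x, y. split; auto. split; auto. apply (Hv x); [now apply in_omega|].
    apply is_opair_opair in Ho. subst p. now apply rel_opair.
  - intros n Hn. rewrite Hs by auto. apply FS, (Hv n Hn). eapply ap_rel; eauto. now apply in_omega.
Qed.

(** Collection without choice: only the least suitable ordinals are collected, and by monotonicity
    of [R] their supremum serves for all [x]. *)
Lemma collect_ord (R : V -> V -> Prop) u : dfn (fun e => R (e 0) (e 1)) ->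
  (forall x a b, is_ordinal a -> is_ordinal b -> a ⊆ b -> R x a -> R x b) ->
  (forall x, x ∈ u -> exists a, is_ordinal a /\ R x a) ->
  exists a, is_ordinal a /\ forall x, x ∈ u -> R x a.
Proof.
  intros HR Hup H.
  pose (L := fun x a => is_ordinal a /\ R x a /\ forall b, is_ordinal b -> R x b -> a ⊆ b).
  destruct (repl_ex L u) as [r Hr].
  - unfold L. dfn_tac.
  - intros x y y' _ (H1 & H2 & H3) (H4 & H5 & H6). apply sub_antisym; auto.
  - assert (Or : forall x, x ∈ r -> is_ordinal x).
    { intros x Hx. apply Hr in Hx as (? & _ & Hx & _). auto. }
    exists (bigcup r). split; [now apply ord_bigcup|].
    intros x Hx. destruct (H x Hx) as (a & Ha & Ra).
    destruct (least_ord (R x) a) as (m & Om & Rm & _ & K); auto; [dfn_tac|].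
    assert (Hm : m ∈ r) by (apply Hr; exists x; split; [auto|]; split; [auto|]; split; auto).
    apply (Hup x m); auto using ord_bigcup, bigcup_ub.
Qed.

Lemma transitive_closure x : exists t, transitive_set t /\ x ∈ t.
Proof.
  destruct (iterate bigcup (sing x)) as (f & b & Hf & H0 & HS).
  { apply (def_equiv' (fun e => forall z, z ∈ e 1 <-> exists y, y ∈ e 0 /\ z ∈ y)); [|dfn_tac].
    intros e. split; [|intros ->; intros z; apply in_bigcup].
    intros H. apply ext. intros z. now rewrite in_bigcup. }
  assert (Hd : dfn (fun e : nat -> V => exists n y, rel f n y /\ e 0 ∈ y)) by dfn_tac.
  exists (sep (bigcup b) (fun z => exists n y, rel f n y /\ z ∈ y)).
  assert (K : forall z n, is_nat n -> z ∈ ap f n -> z ∈ sep (bigcup b) (fun z => exists n y, rel f n y /\ z ∈ y)).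
  { intros z n Hn Hz. apply in_omega in Hn. apply in_sep; auto. split.
    - apply in_bigcup. exists (ap f n). split; auto. eapply ap_in; eauto.
    - exists n, (ap f n). split; auto. eapply ap_rel; eauto. }
  split.
  - intros y Hy z Hz. apply in_sep in Hy as (_ & n & u & Hr & Hu); auto.
    apply (rel_ap f omega b) in Hr as [Hn ->]; auto. apply in_omega in Hn.
    apply (K z (succ n)); auto using nat_succ. rewrite HS by auto. apply in_bigcup. eauto.
  - apply (K x emp); auto using nat_emp. rewrite H0. now apply in_sing.
Qed.

(** In a transitive set around [x], an element minimal among those without rank has ranked elements
    only, and a common bound of their ranks gives it a rank. *)
Lemma rank_ex x : exists a, is_ordinal a /\ x ∈ VV a.
Proof.
  apply NNPP. intros N. destruct (transitive_closure x) as (t & Ht & Hx).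
  destruct (foundation (fun x => ~ exists a v, is_V a v /\ x ∈ v) t x) as (y & Hy & Ny & K); auto.
  - dfn_tac.
  - intros (a & v & Ha & Hv). apply is_V_VV in Ha as [Ha ->]. eauto.
  - apply Ny.
    destruct (collect_ord (fun z a => exists v, is_V a v /\ z ∈ v) y) as (a & Ha & H).
    + dfn_tac.
    + intros z a b Ha Hb Hab (v & Hv & Hz). apply is_V_VV in Hv as [_ ->].
      exists (VV b). split; [now apply is_V_VV|]. apply (VV_mono a b); auto.
    + intros z Hz. specialize (K z Hz (Ht y Hy z Hz)). apply NNPP in K as (a & v & Ha & Hv).
      exists a. split; [apply Ha|]. eauto.
    + exists (succ a), (VV (succ a)). split; [apply is_V_VV; auto using ord_succ|].
      apply VV_succ; auto. intros z Hz. destruct (H z Hz) as (v & Hv & Hzv).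
      apply is_V_VV in Hv as [_ ->]. auto.
Qed.

Lemma sup_omega f b : is_fun f omega b -> (forall n, is_nat n -> is_ordinal (ap f n)) ->
  exists g, is_ordinal g /\ forall z, z ∈ g <-> exists n, is_nat n /\ z ∈ ap f n.
Proof.
  intros Hf Ho.
  pose (r := sep b (fun y => exists n, rel f n y)).
  assert (Hr : forall y, y ∈ r <-> exists n, is_nat n /\ y = ap f n).
  { intros y. unfold r. rewrite in_sep by dfn_tac. split.
    - intros (_ & n & Hn). apply (rel_ap f omega b) in Hn as [Hn ->]; auto. apply in_omega in Hn. eauto.
    - intros (n & Hn & ->). apply in_omega in Hn. split; [eapply ap_in; eauto|].
      exists n. eapply ap_rel; eauto. }
  exists (bigcup r). split.
  - apply ord_bigcup. intros y Hy. apply Hr in Hy as (n & Hn & ->). auto.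
  - intros z. rewrite in_bigcup. split.
    + intros (y & Hy & Hz). apply Hr in Hy as (n & Hn & ->). eauto.
    + intros (n & Hn & Hz). exists (ap f n). split; auto. apply Hr; eauto.
Qed.

Lemma increasing_sup_limit f b : is_fun f omega b ->
  (forall n, is_nat n -> is_ordinal (ap f n)) ->
  (forall n, is_nat n -> ap f n ∈ ap f (succ n)) ->
  exists g, is_limit g /\ (forall n, is_nat n -> ap f n ∈ g) /\
    forall z, z ∈ g -> exists n, is_nat n /\ z ∈ ap f n.
Proof.
  intros Hf Ho Hi. destruct (sup_omega f b Hf Ho) as (g & Og & Hg). exists g.
  assert (K : forall n, is_nat n -> ap f n ∈ g).
  { intros n Hn. apply Hg. exists (succ n). auto using nat_succ. }
  split; [|split; auto]; [|intros z; apply Hg].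
  apply limit_intro; auto.
  - apply nonempty. eauto using nat_emp.
  - intros z Hz. apply Hg in Hz as (n & Hn & Hz). apply Hg. exists (succ n).
    split; auto using nat_succ.
    apply (ord_le_lt (succ z) (ap f n)); auto using nat_succ.
    + apply ord_succ. apply (ord_in (ap f n)); auto.
    + apply succ_le; auto. apply (ord_in (ap f n)); auto.
Qed.

(** An omega-sequence that always passes to the least larger ordinal related by [S] has the required
    supremum; monotonicity carries the relation from its terms to all ordinals below. Both the
    reflection theorem and the unboundedness of the classes [K m] rest on this. *)
Lemma closing (S : V -> V -> Prop) : dfn (fun e => S (e 0) (e 1)) ->
  (forall a, is_ordinal a -> exists b, is_ordinal b /\ S a b) ->
  (forall a a' b, is_ordinal a -> is_ordinal a' -> is_ordinal b -> a' ⊆ a -> S a b -> S a' b) ->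
  (forall a b b', is_ordinal a -> is_ordinal b -> is_ordinal b' -> b ⊆ b' -> S a b -> S a b') ->
  forall a, is_ordinal a ->
  exists g, is_limit g /\ a ∈ g /\ forall x, x ∈ g -> exists y, y ∈ g /\ S x y.
Proof.
  intros HS Htot Hdown Hup a Ha.
  pose (L := fun x y => is_ordinal y /\ x ∈ y /\ S x y).
  assert (HL : dfn (fun e => L (e 0) (e 1))) by (unfold L; dfn_tac).
  assert (Lex : forall x, is_ordinal x -> exists y, L x y).
  { intros x Hx. destruct (Htot x Hx) as (b & Hb & Hxb).
    destruct (ord_le_total b (succ x)) as [H|H]; auto using ord_succ.
    - exists (succ x). split; auto using ord_succ. split; [apply in_succ_self|].
      apply (Hup x b); auto using ord_succ.
    - exists b. split; auto. split; auto. apply H, in_succ_self. }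
  pose (G := fun x y => (is_ordinal x /\ L x y /\ forall b, L x b -> y ⊆ b) \/
    (~ is_ordinal x /\ is_empty y)).
  destruct (func_of_rel G) as (F & HF & HFG).
  { unfold G. dfn_tac. }
  { intros x. destruct (classic (is_ordinal x)) as [Hx|Hx].
    - destruct (Lex x Hx) as (y & Hy).
      destruct (least_ord (L x) y) as (m & Om & Lm & _ & K); auto; [dfn_tac|apply Hy|].
      exists m. split.
      + left. split; auto. split; auto. intros b Hb. apply K; auto. apply Hb.
      + intros y' [(_ & Ly & K')|[? _]]; [|tauto]. apply sub_antisym; auto. apply K; auto. apply Ly.
    - exists emp. split.
      + right. split; auto. now apply is_empty_emp.
      + intros y' [[? _]|[_ E]]; [tauto|]. now apply is_empty_emp in E. }
  assert (FL : forall x, is_ordinal x -> L x (F x)).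
  { intros x Hx. assert (K : G x (F x)) by now apply HFG. destruct K as [K|K]; tauto. }
  destruct (iterate F (succ a) HF) as (f & b & Hf & H0 & HSn).
  assert (Ho : forall n, is_nat n -> is_ordinal (ap f n)).
  { intros n Hn. assert (K : forall y, rel f n y -> is_ordinal y).
    { revert n Hn. apply (nat_ind' (fun n => forall y, rel f n y -> is_ordinal y)); [dfn_tac| |].
      - intros y Hy. apply (rel_ap f omega b) in Hy as [_ ->]; auto. rewrite H0. now apply ord_succ.
      - intros n Hn IH y Hy. apply (rel_ap f omega b) in Hy as [_ ->]; auto. rewrite HSn by auto.
        apply FL, IH. eapply ap_rel; eauto. now apply in_omega. }
    apply K. eapply ap_rel; eauto. now apply in_omega. }
  destruct (increasing_sup_limit f b Hf Ho) as (g & Hg & Hin & Hz).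
  { intros n Hn. rewrite HSn by auto. apply FL; auto. }
  exists g. split; auto. split.
  - apply (ord_trans a (ap f emp)); auto using nat_emp. rewrite H0. apply in_succ_self.
  - intros x Hx. destruct (Hz x Hx) as (n & Hn & Hxn).
    exists (ap f (succ n)). split; auto using nat_succ. rewrite HSn by auto.
    assert (Ox : is_ordinal x) by (apply (ord_in (ap f n)); auto).
    apply (Hdown (ap f n)); auto; try apply FL; auto. apply ord_sub; auto.
Qed.

End Hierarchy2.
#[export] Hint Resolve limit_ord : core.

(** * The reflection theorem *)

Fixpoint fv_lt (n : nat) (p : fm) : Prop :=
  match p with
  | Mem i k | Eq i k => i < n /\ k < n
  | Neg q => fv_lt n q
  | And q r => fv_lt n q /\ fv_lt n r
  | Ex q => fv_lt (S n) q
  end.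

Lemma fv_lt_mono p : forall n m, n <= m -> fv_lt n p -> fv_lt m p.
Proof.
  induction p; simpl; intros n m H; try (intros; lia); eauto.
  - intros []. eauto.
  - apply IHp. lia.
Qed.

Lemma fv_lt_ex p : exists n, fv_lt n p.
Proof.
  induction p as [i k|i k|q [n IH]|q [n IH] r [m IH']|q [n IH]]; simpl.
  - exists (S (i + k)). lia.
  - exists (S (i + k)). lia.
  - eauto.
  - exists (n + m). split; [apply (fv_lt_mono q n)|apply (fv_lt_mono r m)]; auto; lia.
  - exists n. apply (fv_lt_mono q n); auto; lia.
Qed.

Lemma sat_agree {V : structure} (D : V -> Prop) p : forall n e e', fv_lt n p ->
  (forall k, k < n -> e k = e' k) -> (sat D p e <-> sat D p e').
Proof.
  induction p; simpl; intros n e e' Hn H.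
  - destruct Hn. now rewrite !H.
  - destruct Hn. now rewrite !H.
  - now rewrite (IHp n e e').
  - now rewrite (IHp1 n e e'), (IHp2 n e e') by tauto.
  - split; intros [x [Hx Hs]]; exists x; split; auto;
    revert Hs; apply (IHp (S n)); auto; intros [|k] Hk; simpl; auto; try (rewrite H; auto; lia);
    symmetry; apply H; lia.
Qed.

Definition imp (p q : fm) : fm := Neg (And p (Neg q)).

Lemma sat_imp {V : structure} (D : V -> Prop) p q e :
  sat D (imp p q) e <-> (sat D p e -> sat D q e).
Proof. simpl. tauto. Qed.

Lemma sat_All {V : structure} (D : V -> Prop) p e :
  sat D (All p) e <-> forall x, D x -> sat D p (scons x e).
Proof.
  simpl. split.
  - intros H x Hx. apply NNPP. intros N. apply H. eauto.
  - intros H (x & Hx & N). auto.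
Qed.

Definition prepend {T : Type} (l : list T) (e : nat -> T) : nat -> T := fold_right scons e l.

Lemma prepend_lt {T : Type} (l : list T) e e' k :
  k < length l -> prepend l e k = prepend l e' k.
Proof.
  revert k. induction l; simpl; intros k Hk; [lia|]. destruct k; simpl; auto. apply IHl. lia.
Qed.

Lemma prepend_ge {T : Type} (l : list T) e k : prepend l e (length l + k) = e k.
Proof. induction l; simpl; auto. Qed.

Lemma prepend_map {T : Type} (e e' : nat -> T) n : forall m k, k < n ->
  prepend (map e (seq m n)) e' k = e (m + k).
Proof.
  induction n; simpl; intros m k Hk; [lia|]. destruct k; simpl.
  - f_equal. lia.
  - fold (prepend (map e (seq (S m) n)) e'). rewrite IHn by lia. f_equal. lia.
Qed.

(** The bounding set is the variable of index [k], which each further quantifier shifts by one. *)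
Fixpoint nall (n k : nat) (p : fm) : fm :=
  match n with
  | 0 => p
  | S n => All (imp (Mem 0 (S k)) (nall n (S k) p))
  end.

Lemma sat_nall {V : structure} (v : V) p t n : forall l,
  holds (nall n (length l) p) (prepend l (scons v t)) <->
  forall l', length l' = n -> (forall x, In x l' -> x ∈ v) ->
    holds p (prepend (l' ++ l) (scons v t)).
Proof.
  unfold holds. induction n; cbn [nall]; intros l.
  - split.
    + intros H l' Hl'. destruct l'; [auto|discriminate].
    + intros H. apply (H nil); simpl; tauto.
  - rewrite sat_All. setoid_rewrite sat_imp.
    assert (E : forall x, sat (fun _ : V => True) (Mem 0 (S (length l))) (scons x (prepend l (scons v t))) <-> x ∈ v).
    { intros x. simpl. replace (length l) with (length l + 0) by lia. now rewrite prepend_ge. }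
    setoid_rewrite E. split.
    + intros H l' Hl' Hin. destruct (exists_last (l := l')) as (l1 & x & ->); [intros ->; discriminate|].
      rewrite <- app_assoc. simpl. specialize (H x I).
      rewrite (IHn (x :: l)) in H. apply H.
      * apply Hin. apply in_or_app; simpl; auto.
      * rewrite length_app in Hl'. simpl in Hl'. lia.
      * intros y Hy. apply Hin. apply in_or_app; auto.
    + intros H x _ Hx. apply (IHn (x :: l)). intros l' Hl' Hin.
      replace (l' ++ x :: l) with ((l' ++ x :: nil) ++ l) by (rewrite <- app_assoc; reflexivity).
      apply H.
      * rewrite length_app. simpl. lia.
      * intros y Hy. apply in_app_or in Hy as [Hy|[<-|[]]]; auto.
Qed.

Lemma def_holds {V : structure} {Q : V -> Prop} p (u : nat -> (nat -> V) -> V) :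
  (forall k, is_term univ Q (u k)) ->
  definable false univ Q (fun e => holds p (fun k => u k e)).
Proof.
  intros H. apply (def_subst (fun e => holds p e)); auto.
  exists p, inl. split; [discriminate|]. split; [discriminate|].
  intros D -> e _. apply sat_ext. reflexivity.
Qed.

Section Reflection.
Context {V : structure} {HZF : ZF V}.
Implicit Types x y z a b g : V.

Definition reflects g p : Prop := forall e : nat -> V, (forall k, e k ∈ VV g) ->
  (sat (fun x => x ∈ VV g) p e <-> holds p e).

(** A tuple is a list of the metatheory, over which the model cannot collect. The bound is found one
    entry at a time, by collection over [v]: [l] holds the entries already fixed and [k] counts the
    free ones. *)
Lemma bound_lists (P : list V -> V -> Prop) q n v t :
  (forall l b, length l = n -> is_ordinal b -> (P l b <-> holds q (prepend l (scons v (scons (VV b) t))))) ->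
  (forall l a b, is_ordinal a -> is_ordinal b -> a ⊆ b -> P l a -> P l b) ->
  forall k l, length l + k = n ->
  (forall l', length l' = n -> exists b, is_ordinal b /\ P l' b) ->
  exists b, is_ordinal b /\ forall l', length l' = k -> (forall x, In x l' -> x ∈ v) -> P (l' ++ l) b.
Proof.
  intros HP Hup. induction k; intros l Hl Hex.
  - destruct (Hex l) as (b & Hb & H); [lia|]. exists b. split; auto.
    intros [|] Hl' _; [auto|discriminate].
  - destruct (collect_ord (fun x b => exists w, is_V b w /\
      holds (nall k (length (x :: l)) q) (prepend (x :: l) (scons v (scons w t)))) v) as (b & Hb & H).
    + dfn_tac.
      apply (def_equiv' (fun e : nat -> V => holds (nall k (S (length l)) q)
         (fun i => match i with 0 => e 1 | S i => match Nat.compare i (S (length l)) with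
            | Datatypes.Eq => e 0 | _ => prepend l (scons v (scons emp t)) i end end))).
      * intros e. apply sat_ext. intros [|i]; [reflexivity|].
        simpl. destruct (Nat.compare_spec i (S (length l))) as [E|E|E].
        -- subst i. replace (S (length l)) with (length l + 1) by lia. now rewrite prepend_ge.
        -- destruct (Nat.eq_dec i (length l)) as [->|].
           ++ assert (A := prepend_ge l (scons v (scons emp t)) 0).
              assert (B := prepend_ge l (scons v (scons (e 0) t)) 0).
              rewrite Nat.add_0_r in A, B. now rewrite A, B.
           ++ apply prepend_lt. lia.
        -- replace i with (length l + S (S (i - length l - 2))) by lia. now rewrite !prepend_ge.
      * apply (def_holds _ (fun i e => match i with 0 => e 1 | S i => match Nat.compare i (S (length l)) with
            | Datatypes.Eq => e 0 | _ => prepend l (scons v (scons emp t)) i end end)).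
        intros [|i]; [dfn_tac|]. destruct (Nat.compare i (S (length l))); dfn_tac.
    + intros x a b Ha Hb Hab (w & Hw & H). apply is_V_VV in Hw as [_ ->].
      exists (VV b). split; [now apply is_V_VV|].
      rewrite (sat_nall v q) in *. intros l' Hl' Hin.
      assert (E : length (l' ++ x :: l) = n) by (rewrite length_app; simpl; lia).
      apply HP; auto. apply (Hup _ a); auto. apply HP; auto.
    + intros x Hx. destruct (IHk (x :: l)) as (b & Hb & H); [simpl; lia|auto|].
      exists b. split; auto. exists (VV b). split; [now apply is_V_VV|].
      apply (sat_nall v q). intros l' Hl' Hin. apply HP; auto.
      rewrite length_app; simpl; lia.
    + exists b. split; auto. intros l' Hl' Hin.
      destruct (exists_last (l := l')) as (l1 & x & ->); [intros ->; discriminate|].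
      rewrite <- app_assoc. simpl.
      destruct (H x) as (w & Hw & K); [apply Hin, in_or_app; simpl; auto|].
      apply is_V_VV in Hw as [_ ->].
      rewrite (sat_nall v q) in K. rewrite length_app in Hl'. simpl in Hl'.
      apply HP; auto; [rewrite length_app; simpl; lia|]. apply K; [lia|].
      intros y Hy. apply Hin, in_or_app; auto.
Qed.

Lemma bound_env g (e : nat -> V) n : is_limit g -> (forall k, e k ∈ VV g) ->
  exists a, a ∈ g /\ forall k, k < n -> e k ∈ VV a.
Proof.
  intros Hg He. induction n as [|n (a & Ha & IH)].
  - exists emp. split; [now apply limit_emp|]. lia.
  - specialize (He n) as Hn. apply VV_limit in Hn as (b & Hb & Hn); auto.
    assert (Oa : is_ordinal a) by (apply (ord_in g); auto using limit_ord).
    assert (Ob : is_ordinal b) by (apply (ord_in g); auto using limit_ord).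
    destruct (ord_le_total a b); auto.
    + exists b. split; auto. intros k Hk. destruct (Nat.eq_dec k n) as [->|]; auto.
      apply (VV_mono a b); auto. apply IH. lia.
    + exists a. split; auto. intros k Hk. destruct (Nat.eq_dec k n) as [->|]; [|apply IH; lia].
      apply (VV_mono b a); auto.
Qed.

(** [S a b] says that, for parameters in [VV a], the existential subformulas of [p] have witnesses
    in [VV b] if they have any. It is built by recursion in the metatheory, one relation for each
    formula, because no single formula expresses truth. *)
Lemma reflection_aux p : forall n, fv_lt n p -> exists S : V -> V -> Prop,
  dfn (fun e => S (e 0) (e 1)) /\
  (forall a, is_ordinal a -> exists b, is_ordinal b /\ S a b) /\
  (forall a a' b, is_ordinal a -> is_ordinal a' -> is_ordinal b -> a' ⊆ a -> S a b -> S a' b) /\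
  (forall a b b', is_ordinal a -> is_ordinal b -> is_ordinal b' -> b ⊆ b' -> S a b -> S a b') /\
  forall g, is_limit g -> (forall x, x ∈ g -> exists y, y ∈ g /\ S x y) -> reflects g p.
Proof.
  induction p; simpl; intros n Hn.
  - exists (fun _ _ => True). split; [dfn_tac|]. split; [eauto using ord_emp|split; [auto|split; [auto|]]].
    intros g _ _ e _. simpl. tauto.
  - exists (fun _ _ => True). split; [dfn_tac|]. split; [eauto using ord_emp|split; [auto|split; [auto|]]].
    intros g _ _ e _. simpl. tauto.
  - destruct (IHp n Hn) as (S & H1 & H2 & H3 & H4 & H5). exists S.
    split; [auto|split; [auto|split; [auto|split; [auto|]]]].
    intros g Hg H e He. unfold holds. simpl. specialize (H5 g Hg H e He). unfold holds in H5. tauto.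
  - destruct Hn as [Hn1 Hn2].
    destruct (IHp1 n Hn1) as (S & H1 & H2 & H3 & H4 & H5).
    destruct (IHp2 n Hn2) as (T & K1 & K2 & K3 & K4 & K5).
    exists (fun a b => S a b /\ T a b). split; [dfn_tac|]. split; [|split; [|split]].
    + intros a Ha. destruct (H2 a Ha) as (b & Hb & Sb), (K2 a Ha) as (c & Hc & Tc).
      destruct (ord_le_total b c); auto.
      * exists c. split; auto. split; auto. now apply (H4 a b c).
      * exists b. split; auto. split; auto. now apply (K4 a c b).
    + intros a a' b Ha Ha' Hb Hle [HS HT]. split; [apply (H3 a)|apply (K3 a)]; auto.
    + intros a b b' Ha Hb Hb' Hle [HS HT]. split; [apply (H4 a b)|apply (K4 a b)]; auto.
    + intros g Hg H e He. unfold holds. simpl.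
      assert (R1 : reflects g p1).
      { apply H5; auto. intros x Hx. destruct (H x Hx) as (y & Hy & ? & ?). eauto. }
      assert (R2 : reflects g p2).
      { apply K5; auto. intros x Hx. destruct (H x Hx) as (y & Hy & ? & ?). eauto. }
      specialize (R1 e He). specialize (R2 e He). unfold holds in *. tauto.
  - destruct (IHp (Datatypes.S n) Hn) as (S & H1 & H2 & H3 & H4 & H5).
    (* Behind the [n] parameters stand the sets that bound parameters and witnesses. The latter has
       index n + 1, and n + 2 under the quantifier. *)
    pose (q := imp (Ex p) (Ex (And (Mem 0 (Datatypes.S (Datatypes.S n))) p))).
    pose (t0 := fun _ : nat => emp).
    assert (Eq : forall l v w, length l = n -> (holds q (prepend l (scons v (scons w t0))) <->
      ((exists x, holds p (scons x (prepend l t0))) ->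
        exists x, x ∈ w /\ holds p (scons x (prepend l t0))))).
    { intros l v w Hl. unfold q, holds. rewrite sat_imp. simpl.
      replace (prepend l (scons v (scons w t0)) (Datatypes.S n)) with w.
      - assert (K : forall x, sat (fun _ : V => True) p (scons x (prepend l (scons v (scons w t0)))) <->
          sat (fun _ : V => True) p (scons x (prepend l t0))).
        { intros x. apply (sat_agree _ p (Datatypes.S n)); auto. intros [|k] Hk; simpl; auto.
          apply prepend_lt. lia. }
        setoid_rewrite K. split.
        + intros H [x Hx]. destruct H as (y & _ & H); eauto.
        + intros H (x & _ & Hx). destruct H as (y & H); eauto.
      - rewrite <- Hl. replace (Datatypes.S (length l)) with (length l + 1) by lia. now rewrite prepend_ge. }
    pose (T := fun a b => exists v w, is_V a v /\ is_V b w /\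
      holds (nall n (length (@nil V)) q) (prepend nil (scons v (scons w t0)))).
    pose (P := fun l b => (exists x, holds p (scons x (prepend l t0))) ->
        exists x, x ∈ VV b /\ holds p (scons x (prepend l t0))).
    assert (ET : forall a b, is_ordinal a -> is_ordinal b -> (T a b <-> forall l, length l = n ->
       (forall x, In x l -> x ∈ VV a) -> P l b)).
    { intros a b Ha Hb. unfold T. split.
      - intros (v & w & Hv & Hw & H). apply is_V_VV in Hv as [_ ->]. apply is_V_VV in Hw as [_ ->].
        intros l Hl Hin. refine (proj1 (Eq l (VV a) (VV b) Hl) _).
        rewrite sat_nall in H. specialize (H l Hl Hin). now rewrite app_nil_r in H.
      - intros H. exists (VV a), (VV b). rewrite !is_V_VV. split; auto. split; auto.
        rewrite sat_nall. intros l Hl Hin. rewrite app_nil_r. apply Eq; auto. apply H; auto. }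
    assert (Pup : forall l b b', is_ordinal b -> is_ordinal b' -> b ⊆ b' -> P l b -> P l b').
    { intros l b b' Hb Hb' Hle HP Hx. destruct (HP Hx) as (y & Hy & Hp).
      exists y. split; auto. apply (VV_mono b b'); auto. }
    assert (Tup : forall a b b', is_ordinal a -> is_ordinal b -> is_ordinal b' -> b ⊆ b' -> T a b -> T a b').
    { intros a b b' Ha Hb Hb' Hle HT. apply ET; auto. rewrite ET in HT by auto.
      intros l Hl Hin. apply (Pup l b); auto. }
    exists (fun a b => S a b /\ T a b). split; [|split; [|split; [|split]]].
    + unfold T. dfn_tac.
      apply (def_equiv' (fun e : nat -> V => holds (nall n 0 q)
        (fun i => match i with 0 => e 1 | 1 => e 0 | _ => emp end))).
      * intros e. apply sat_ext. intros [|[|i]]; reflexivity.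
      * apply (def_holds _ (fun i e => match i with 0 => e 1 | 1 => e 0 | _ => emp end)).
        intros [|[|i]]; dfn_tac.
    + intros a Ha. destruct (H2 a Ha) as (b & Hb & Sb).
      destruct (bound_lists P q n (VV a) t0) with (k := n) (l := @nil V) as (c & Hc & K); auto.
      { intros l d Hl Hd. rewrite Eq by auto. reflexivity. }
      { intros l Hl. destruct (classic (exists x, holds p (scons x (prepend l t0)))) as [[x Hx]|N].
        - destruct (rank_ex x) as (d & Hd & Hxd). exists d. split; auto. intros _. eauto.
        - exists emp. split; [apply ord_emp|]. intros Hx; tauto. }
      assert (Tc : T a c).
      { apply ET; auto. intros l Hl Hin. specialize (K l Hl Hin). now rewrite app_nil_r in K. }
      destruct (ord_le_total b c); auto.
      * exists c. split; auto. split; auto. now apply (H4 a b c).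
      * exists b. split; auto. split; auto. now apply (Tup a c b).
    + intros a a' b Ha Ha' Hb Hle [HS HT]. split; [apply (H3 a); auto|].
      apply ET; auto. rewrite ET in HT by auto. intros l Hl Hin. apply HT; auto.
      intros x Hx. apply (VV_mono a' a); auto.
    + intros a b b' Ha Hb Hb' Hle [HS HT]. split; [apply (H4 a b)|apply (Tup a b)]; auto.
    + intros g Hg H e He.
      assert (R1 : reflects g p).
      { apply H5; auto. intros x Hx. destruct (H x Hx) as (y & Hy & ? & ?). eauto. }
      assert (Hse : forall x, x ∈ VV g -> forall k, scons x e k ∈ VV g) by (intros x Hx [|k]; simpl; auto).
      split.
      * intros (x & Hx & Hs). exists x. split; auto. apply R1; auto.
      * intros (x & _ & Hs).
        destruct (bound_env g e n Hg He) as (a & Ha & Hea).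
        destruct (H a Ha) as (b & Hb & _ & HT).
        assert (Oa : is_ordinal a) by (apply (ord_in g); auto using limit_ord).
        assert (Ob : is_ordinal b) by (apply (ord_in g); auto using limit_ord).
        rewrite ET in HT by auto.
        assert (Ag : forall y, holds p (scons y (prepend (map e (seq 0 n)) t0)) <-> holds p (scons y e)).
        { intros y. apply (sat_agree _ p (Datatypes.S n)); auto. intros [|k] Hk; simpl; auto.
          rewrite prepend_map by lia. reflexivity. }
        destruct (HT (map e (seq 0 n))) as (y & Hy & Hp).
        -- now rewrite length_map, length_seq.
        -- intros z Hz. apply in_map_iff in Hz as (k & <- & Hk). apply in_seq in Hk. apply Hea. lia.
        -- exists x. now apply Ag.
        -- assert (Hyg : y ∈ VV g) by (apply (VV_mono b g); auto; apply ord_sub; auto).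
           exists y. split; auto. apply R1; auto. now apply Ag.
Qed.

Theorem reflection p a : is_ordinal a -> exists g, is_limit g /\ a ∈ g /\ reflects g p.
Proof.
  intros Ha. destruct (fv_lt_ex p) as [n Hn].
  destruct (reflection_aux p n Hn) as (S & H1 & H2 & H3 & H4 & H5).
  destruct (closing S H1 H2 H3 H4 a Ha) as (g & Hg & Hag & H). eauto.
Qed.

End Reflection.

(** * Satisfaction inside the model *)

Lemma def_is_num {V : structure} {b DD} {Q : V -> Prop} {HT : trans_domains DD} n :
  definable b DD Q (fun e => is_num n (e 0)).
Proof.
  induction n; simpl; [dfn_tac|].
  apply (def_equiv' (fun e : nat -> V => exists y, y ∈ e 0 /\ (is_num n y /\ is_succ y (e 0)))).
  - intros e. split.
    + intros (y & _ & H). eauto.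
    + intros (y & H1 & H2). exists y. split; auto. apply H2. auto.
  - dfn_tac.
Qed.
#[export] Hint Resolve def_is_num : dfn.

Lemma def_is_code {V : structure} {Q : V -> Prop} t :
  definable false univ Q (fun e => is_code t (e 0) (e 1) (e 2)).
Proof. unfold is_code. dfn_tac. Qed.
#[export] Hint Resolve def_is_code : dfn.

Lemma def_formula_closed {V : structure} {Q : V -> Prop} w :
  definable false univ Q (fun e => formula_closed w (e 0)).
Proof. unfold formula_closed. dfn_tac. Qed.
#[export] Hint Resolve def_formula_closed : dfn.

Lemma def_is_formula {V : structure} {Q : V -> Prop} w :
  definable false univ Q (fun e => is_formula w (e 0)).
Proof. unfold is_formula. dfn_tac. Qed.
#[export] Hint Resolve def_is_formula : dfn.

Lemma def_is_assignment {V : structure} {Q : V -> Prop} :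
  definable false univ Q (fun e => is_assignment (e 0) (e 1)).
Proof. unfold is_assignment. dfn_tac. Qed.
#[export] Hint Resolve def_is_assignment : dfn.

Lemma def_is_update {V : structure} {Q : V -> Prop} :
  definable false univ Q (fun e => is_update (e 0) (e 1) (e 2) (e 3)).
Proof. unfold is_update. dfn_tac. Qed.
#[export] Hint Resolve def_is_update : dfn.

Definition in_pred {V : structure} (P : option V) (x : V) : Prop :=
  match P with Some A => x ∈ A | None => False end.

(* [is_satisfaction] with the optional predicate replaced by a class. *)
Definition tarski {V : structure} (w : bool) (X : V) (A : V -> Prop) (S : V) :=
  forall s : V, is_assignment X s ->
  (forall i k c : V, is_nat i -> is_nat k -> is_code 0 i k c ->
     (rel S c s <-> exists x y : V, rel s i x /\ rel s k y /\ x ∈ y)) /\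
  (forall i k c : V, is_nat i -> is_nat k -> is_code 1 i k c ->
     (rel S c s <-> exists x : V, rel s i x /\ rel s k x)) /\
  (w = true -> forall i c : V, is_nat i -> is_code 2 i i c ->
     (rel S c s <-> exists x : V, rel s i x /\ A x)) /\
  (forall a c : V, is_formula w a -> is_code 3 a a c ->
     (rel S c s <-> ~ rel S a s)) /\
  (forall a b c : V, is_formula w a -> is_formula w b ->
     is_code 4 a b c -> (rel S c s <-> rel S a s /\ rel S b s)) /\
  (forall i a c : V, is_nat i -> is_formula w a ->
     is_code 5 i a c ->
     (rel S c s <-> exists x s' : V,
        x ∈ X /\ is_assignment X s' /\ is_update s i x s' /\ rel S a s')).

Lemma is_satisfaction_tarski {V : structure} (X : V) P S :
  is_satisfaction X P S <-> tarski (has_pred P) X (in_pred P) S.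
Proof.
  unfold is_satisfaction, tarski.
  destruct P as [A|]; split; intros H s Hs; destruct (H s Hs) as (H0 & H1 & H2 & H3 & H4 & H5);
    (split; [exact H0|split; [exact H1|split; [|split; [exact H3|split; [exact H4|exact H5]]]]]).
  - intros _ i c. apply H2. reflexivity.
  - intros A' i c [= <-]. apply H2. reflexivity.
  - discriminate.
  - discriminate.
Qed.

Lemma def_satisfies_None {V : structure} {Q : V -> Prop} :
  definable false univ Q (fun e => satisfies (e 0) None (e 1) (e 2)).
Proof.
  apply (def_equiv' (fun e : nat -> V => exists S, tarski false (e 0) (fun _ => False) S /\ rel S (e 1) (e 2))).
  - intros e. unfold satisfies. now setoid_rewrite is_satisfaction_tarski.
  - unfold tarski. dfn_tac.
Qed.

Lemma def_satisfies_Some {V : structure} {Q : V -> Prop} :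
  definable false univ Q (fun e => satisfies (e 0) (Some (e 1)) (e 2) (e 3)).
Proof.
  apply (def_equiv' (fun e : nat -> V => exists S, tarski true (e 0) (fun x => x ∈ e 1) S /\ rel S (e 2) (e 3))).
  - intros e. unfold satisfies. now setoid_rewrite is_satisfaction_tarski.
  - unfold tarski. dfn_tac.
Qed.

Lemma def_satisfies_const {V : structure} (X : V) P :
  dfn (fun e => satisfies X P (e 0) (e 1)).
Proof.
  destruct P as [A|].
  - apply (def_subst4 (fun X A c s => satisfies X (Some A) c s)); [apply def_satisfies_Some| dfn_tac..].
  - apply (def_subst3 (fun X c s => satisfies X None c s)); [apply def_satisfies_None| dfn_tac..].
Qed.
#[export] Hint Resolve def_satisfies_const : dfn.

Section Formulas.
Context {V : structure} {HZF : ZF V}.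
Implicit Types x y z a b c f g s i k X : V.
Implicit Types w : bool.

Fixpoint num (n : nat) : V := match n with 0 => emp | S m => succ (num m) end.

Lemma is_num_num n x : is_num n x <-> x = num n.
Proof.
  revert x. induction n; simpl; intros x; [apply is_empty_emp|]. split.
  - intros (y & H1 & H2). apply IHn in H1. subst. now apply is_succ_succ.
  - intros ->. exists (num n). split; [now apply IHn|now apply is_succ_succ].
Qed.

Lemma num_nat n : is_nat (num n).
Proof. induction n; simpl; auto using nat_emp, nat_succ. Qed.

Lemma num_lt n m : n < m -> num n ∈ num m.
Proof.
  induction 1; simpl; [apply in_succ_self|]. apply in_succ; auto.
Qed.

Lemma num_inj n m : num n = num m -> n = m.
Proof.
  intros E. destruct (Nat.lt_trichotomy n m) as [H|[H|H]]; auto;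
  apply num_lt in H; rewrite E in H; now apply not_in_self in H.
Qed.

Definition code (t : nat) a b : V := opair (num t) (opair a b).

Lemma is_code_code t a b c : is_code t a b c <-> c = code t a b.
Proof.
  split.
  - intros (u & q & H1 & H2 & H3). apply is_num_num in H1. apply is_opair_opair in H2, H3.
    subst. reflexivity.
  - intros ->. exists (num t), (opair a b). rewrite is_num_num, !is_opair_opair. auto.
Qed.

Lemma code_inj t a b t' a' b' : code t a b = code t' a' b' -> t = t' /\ a = a' /\ b = b'.
Proof.
  intros E. apply opair_inj in E as [E1 E2]. apply opair_inj in E2. apply num_inj in E1. tauto.
Qed.

Lemma form_mem w i k : is_nat i -> is_nat k -> is_formula w (code 0 i k).
Proof. intros Hi Hk F HF. apply (proj1 HF i k); auto. now apply is_code_code. Qed.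

Lemma form_eq w i k : is_nat i -> is_nat k -> is_formula w (code 1 i k).
Proof. intros Hi Hk F HF. apply (proj1 (proj2 HF) i k); auto. now apply is_code_code. Qed.

Lemma form_pred i : is_nat i -> is_formula true (code 2 i i).
Proof. intros Hi F HF. apply (proj1 (proj2 (proj2 HF))) with (i := i); auto. now apply is_code_code. Qed.

Lemma form_neg w a : is_formula w a -> is_formula w (code 3 a a).
Proof.
  intros H F HF. apply (proj1 (proj2 (proj2 (proj2 HF))) a); auto. now apply is_code_code.
Qed.

Lemma form_and w a b : is_formula w a -> is_formula w b -> is_formula w (code 4 a b).
Proof.
  intros H H' F HF. apply (proj1 (proj2 (proj2 (proj2 (proj2 HF)))) a b); auto. now apply is_code_code.
Qed.

Lemma form_ex w i a : is_nat i -> is_formula w a -> is_formula w (code 5 i a).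
Proof.
  intros H H' F HF. apply (proj2 (proj2 (proj2 (proj2 (proj2 HF)))) i a); auto. now apply is_code_code.
Qed.

Lemma nat_Vomega i : is_nat i -> i ∈ VV omega.
Proof. intros H. apply ord_sub_VV; [apply ord_omega|]. now apply in_omega. Qed.

Lemma code_Vomega t a b : a ∈ VV omega -> b ∈ VV omega -> code t a b ∈ VV omega.
Proof.
  intros. unfold code. auto using VV_opair_limit, limit_omega, nat_Vomega, num_nat.
Qed.

Lemma formula_Vomega w c : is_formula w c -> c ∈ VV omega.
Proof.
  intros H. apply H. split; [|split; [|split; [|split; [|split]]]].
  - intros i k d Hi Hk E. apply is_code_code in E. subst. auto using code_Vomega, nat_Vomega.
  - intros i k d Hi Hk E. apply is_code_code in E. subst. auto using code_Vomega, nat_Vomega.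
  - intros _ i d Hi E. apply is_code_code in E. subst. auto using code_Vomega, nat_Vomega.
  - intros a d Ha E. apply is_code_code in E. subst. auto using code_Vomega, nat_Vomega.
  - intros a b d Ha Hb E. apply is_code_code in E. subst. auto using code_Vomega, nat_Vomega.
  - intros i a d Hi Ha E. apply is_code_code in E. subst. auto using code_Vomega, nat_Vomega.
Qed.

Lemma formula_ind w (P : V -> Prop) : dfn (fun e => P (e 0)) ->
  (forall i k, is_nat i -> is_nat k -> P (code 0 i k)) ->
  (forall i k, is_nat i -> is_nat k -> P (code 1 i k)) ->
  (w = true -> forall i, is_nat i -> P (code 2 i i)) ->
  (forall a, is_formula w a -> P a -> P (code 3 a a)) ->
  (forall a b, is_formula w a -> P a -> is_formula w b -> P b -> P (code 4 a b)) ->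
  (forall i a, is_nat i -> is_formula w a -> P a -> P (code 5 i a)) ->
  forall c, is_formula w c -> P c.
Proof.
  intros HP H0 H1 H2 H3 H4 H5 c Hc.
  assert (Hd : dfn (fun e => is_formula w (e 0) /\ P (e 0))) by dfn_tac.
  assert (K : forall c, c ∈ sep (VV omega) (fun c => is_formula w c /\ P c) <-> is_formula w c /\ P c).
  { intros d. rewrite in_sep by auto. split; [tauto|]. intros H. split; auto.
    apply (formula_Vomega w); tauto. }
  apply (K c). apply Hc. split; [|split; [|split; [|split; [|split]]]].
  - intros i k d Hi Hk E. apply is_code_code in E. subst. apply K. auto using form_mem.
  - intros i k d Hi Hk E. apply is_code_code in E. subst. apply K. auto using form_eq.
  - intros -> i d Hi E. apply is_code_code in E. subst. apply K. auto using form_pred.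
  - intros a d Ha E. apply is_code_code in E. subst. apply K in Ha as [? ?]. apply K. auto using form_neg.
  - intros a b d Ha Hb E. apply is_code_code in E. subst. apply K in Ha as [? ?]. apply K in Hb as [? ?].
    apply K. auto using form_and.
  - intros i a d Hi Ha E. apply is_code_code in E. subst. apply K in Ha as [? ?]. apply K. auto using form_ex.
Qed.

(** ** Assignments *)

Lemma assignment_fun X s : is_assignment X s <-> is_fun s omega X.
Proof.
  split.
  - intros (u & Hu & H). apply is_omega_omega in Hu. now subst.
  - intros H. exists omega. split; auto. now apply is_omega_omega.
Qed.

Definition upd s i x : V := cup (sep s (fun p => forall y, ~ is_opair p i y)) (sing (opair i x)).

Lemma rel_upd s i x k y : rel (upd s i x) k y <-> (k = i /\ y = x) \/ (k <> i /\ rel s k y).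
Proof.
  unfold upd. rewrite !rel_opair, in_cup, in_sing, in_sep by dfn_tac. split.
  - intros [[H1 H2]|H].
    + right. split; auto. intros ->. apply (H2 y). now apply is_opair_opair.
    + left. now apply opair_inj.
  - intros [[-> ->]|[H1 H2]]; auto. left. split; auto.
    intros z Hz. apply is_opair_opair, opair_inj in Hz. tauto.
Qed.

Lemma upd_fun X s i x : is_fun s omega X -> is_nat i -> x ∈ X -> is_fun (upd s i x) omega X.
Proof.
  intros Hs Hi Hx. apply in_omega in Hi. split.
  - intros p Hp. unfold upd in Hp. apply in_cup in Hp as [Hp|Hp].
    + apply in_sep in Hp as [Hp _]; [|dfn_tac]. now apply Hs.
    + apply in_sing in Hp. exists i, x. rewrite is_opair_opair. auto.
  - intros k Hk. destruct (classic (k = i)) as [->|N].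
    + exists x. split; [apply rel_upd; auto|]. intros y Hy. apply rel_upd in Hy. destruct Hy as [[_ ->]|[? _]]; tauto.
    + exists (ap s k). split.
      * apply rel_upd. right. split; auto. eapply ap_rel; eauto.
      * intros y Hy. apply rel_upd in Hy as [[? _]|[_ Hy]]; [tauto|]. eapply ap_eq; eauto.
Qed.

Lemma ap_upd_same X s i x : is_fun s omega X -> is_nat i -> x ∈ X -> ap (upd s i x) i = x.
Proof. intros. eapply ap_eq; [apply (upd_fun X); eauto|]. apply rel_upd; auto. Qed.

Lemma ap_upd_other X s i x k : is_fun s omega X -> is_nat i -> x ∈ X -> is_nat k -> k <> i ->
  ap (upd s i x) k = ap s k.
Proof.
  intros. eapply ap_eq; [apply (upd_fun X); eauto|]. apply rel_upd. right. split; auto.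
  eapply ap_rel; eauto. now apply in_omega.
Qed.

Lemma is_update_upd X s i x s' : is_fun s omega X -> is_nat i -> x ∈ X -> is_fun s' omega X ->
  (is_update s i x s' <-> s' = upd s i x).
Proof.
  intros Hs Hi Hx Hs'. split.
  - intros [H1 H2]. apply (fun_ext _ _ omega X X); auto using upd_fun.
    intros k Hk. destruct (classic (k = i)) as [->|N].
    + rewrite (ap_upd_same X) by auto. eapply ap_eq; eauto.
    + apply in_omega in Hk as Hk'. rewrite (ap_upd_other X) by auto. eapply ap_eq; eauto. apply H2; auto.
      eapply ap_rel; eauto.
  - intros ->. split; [apply rel_upd; auto|]. intros k y _ N. rewrite rel_upd. tauto.
Qed.

Lemma const_fun X x a : x ∈ X -> exists s, is_fun s a X /\ forall k, k ∈ a -> ap s k = x.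
Proof.
  intros Hx. destruct (fun_ex (fun _ y => y = x) a X) as (s & Hs & _ & H).
  - dfn_tac.
  - intros; exists x; auto.
  - congruence.
  - eauto.
Qed.

(** ** Existence and uniqueness of satisfaction relations *)

(** One round of Tarski's clauses, with [S] consulted at the immediate subformulas. *)
Definition sat_step (P : option V) X S c s : Prop :=
  (exists i k, is_nat i /\ is_nat k /\ is_code 0 i k c /\ exists x y, rel s i x /\ rel s k y /\ x ∈ y) \/
  (exists i k, is_nat i /\ is_nat k /\ is_code 1 i k c /\ exists x, rel s i x /\ rel s k x) \/
  (exists i, is_nat i /\ is_code 2 i i c /\ exists x, rel s i x /\ in_pred P x) \/
  (exists a, is_code 3 a a c /\ ~ rel S a s) \/
  (exists a b, is_code 4 a b c /\ rel S a s /\ rel S b s) \/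
  (exists i a, is_code 5 i a c /\ exists x s', x ∈ X /\ is_assignment X s' /\ is_update s i x s' /\ rel S a s').

Ltac code_cases :=
  intros H; unfold sat_step in H; setoid_rewrite is_code_code in H;
  destruct H as [(?&?&?&?&E&H)|[(?&?&?&?&E&H)|[(?&?&E&H)|[(?&E&H)|[(?&?&E&H)|(?&?&E&H)]]]]];
  apply code_inj in E as (E & ? & ?); try discriminate E; subst; auto.

Lemma step_mem P X S i k s : is_nat i -> is_nat k ->
  (sat_step P X S (code 0 i k) s <-> exists x y, rel s i x /\ rel s k y /\ x ∈ y).
Proof.
  intros Hi Hk. split; [code_cases|]. intros H. left. exists i, k. rewrite is_code_code. auto.
Qed.

Lemma step_eq P X S i k s : is_nat i -> is_nat k ->
  (sat_step P X S (code 1 i k) s <-> exists x, rel s i x /\ rel s k x).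
Proof.
  intros Hi Hk. split; [code_cases|]. intros H. right; left. exists i, k. rewrite is_code_code. auto.
Qed.

Lemma step_pred P X S i s : is_nat i ->
  (sat_step P X S (code 2 i i) s <-> exists x, rel s i x /\ in_pred P x).
Proof.
  intros Hi. split; [code_cases|]. intros H. right; right; left. exists i. rewrite is_code_code. auto.
Qed.

Lemma step_neg P X S a s : sat_step P X S (code 3 a a) s <-> ~ rel S a s.
Proof.
  split; [code_cases|]. intros H. do 3 right; left. exists a. rewrite is_code_code. auto.
Qed.

Lemma step_and P X S a b s : sat_step P X S (code 4 a b) s <-> rel S a s /\ rel S b s.
Proof.
  split; [code_cases|]. intros H. do 4 right; left. exists a, b. rewrite is_code_code. auto.
Qed.

Lemma step_ex P X S i a s : sat_step P X S (code 5 i a) s <->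
  exists x s', x ∈ X /\ is_assignment X s' /\ is_update s i x s' /\ rel S a s'.
Proof.
  split; [code_cases|]. intros H. do 5 right. exists i, a. rewrite is_code_code. auto.
Qed.

(** Starting from the empty set, [sat_step] is iterated omega times. By induction in the model, the
    rounds stabilise at each formula, and [S] collects the pairs that are present from some round
    on. *)
Lemma satisfaction_ex X P : exists S, is_satisfaction X P S.
Proof.
  pose (w := has_pred P).
  pose (U := prod (sep (VV omega) (is_formula w)) (sep (pow (prod omega X)) (is_assignment X))).
  assert (HU : forall c s, opair c s ∈ U <-> is_formula w c /\ is_assignment X s).
  { intros c s. unfold U. rewrite opair_in_prod, !in_sep by dfn_tac. split; [tauto|].
    intros [H1 H2]. split; split; auto; [now apply (formula_Vomega w)|].
    apply in_pow, fun_sub_prod. now apply assignment_fun. }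
  assert (Hst : dfn (fun e => sat_step P X (e 0) (e 1) (e 2))).
  { unfold sat_step. destruct P; unfold in_pred; dfn_tac. }
  assert (Hst' : forall S, dfn (fun e => exists c s, is_opair (e 0) c s /\ sat_step P X S c s)).
  { intros S. dfn_tac. }
  destruct (iterate (fun S => sep U (fun p => exists c s, is_opair p c s /\ sat_step P X S c s)) emp)
    as (f & B & Hf & _ & HS).
  { apply (def_equiv' (fun e => forall p, p ∈ e 1 <-> p ∈ U /\
      exists c s, is_opair p c s /\ sat_step P X (e 0) c s)); [|dfn_tac].
    intros e. split.
    - intros H. apply ext. intros p. rewrite in_sep by auto. apply H.
    - intros -> p. now rewrite in_sep by auto. }
  assert (step : forall m c s, is_nat m -> is_formula w c -> is_assignment X s ->
    (rel (ap f (succ m)) c s <-> sat_step P X (ap f m) c s)).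
  { intros m c s Hm Hc Hs. rewrite HS by auto. rewrite rel_opair, in_sep by auto. split.
    - intros [_ (c' & s' & E & H)]. apply is_opair_opair, opair_inj in E as [-> ->]. auto.
    - intros H. split; [now apply HU|]. exists c, s. rewrite is_opair_opair. auto. }
  assert (Hd : dfn (fun e : nat -> V => exists n, is_nat n /\ forall m y, is_nat m -> n ⊆ m -> rel f m y -> e 0 ∈ y))
    by dfn_tac.
  pose (S := sep U (fun p => exists n, is_nat n /\ forall m y, is_nat m -> n ⊆ m -> rel f m y -> p ∈ y)).
  assert (HSr : forall c s, is_formula w c -> is_assignment X s ->
    (rel S c s <-> exists n, is_nat n /\ forall m, is_nat m -> n ⊆ m -> rel (ap f m) c s)).
  { intros c s Hc Hs. unfold S. rewrite rel_opair, in_sep by auto. split.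
    - intros [_ (n & Hn & H)]. exists n. split; auto. intros m Hm Hle. apply rel_opair.
      apply (H m); auto. eapply ap_rel; eauto. now apply in_omega.
    - intros (n & Hn & H). split; [now apply HU|]. exists n. split; auto.
      intros m y Hm Hle Hy. apply (rel_ap f omega B) in Hy as [_ ->]; auto. apply rel_opair. auto. }
  pose (stab := fun c => exists n, is_nat n /\ forall m y, is_nat m -> n ⊆ m -> rel f m y ->
    forall s, is_assignment X s -> (rel y c s <-> rel S c s)).
  assert (stabE : forall c, stab c -> exists n, is_nat n /\ forall m, is_nat m -> n ⊆ m ->
    forall s, is_assignment X s -> (rel (ap f m) c s <-> rel S c s)).
  { intros c (n & Hn & H). exists n. split; auto. intros m Hm Hle. apply (H m); auto.
    eapply ap_rel; eauto. now apply in_omega. }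
  assert (natmax : forall n m, is_nat n -> is_nat m -> exists k, is_nat k /\ n ⊆ k /\ m ⊆ k).
  { intros n m Hn Hm. destruct (ord_le_total n m); auto using nat_ord; eauto using sub_refl. }
  (* If a clause eventually has the truth value [Bs], then so does the limit [S], and the formula
     itself is stable one round later. *)
  assert (key : forall (Bs : V -> Prop) c, is_formula w c ->
    (exists n, is_nat n /\ forall m, is_nat m -> n ⊆ m -> forall s, is_assignment X s ->
       (sat_step P X (ap f m) c s <-> Bs s)) ->
    (forall s, is_assignment X s -> (rel S c s <-> Bs s)) /\ stab c).
  { intros Bs c Hc (n & Hn & H).
    assert (H' : forall m, is_nat m -> succ n ⊆ m -> forall s, is_assignment X s ->
      (rel (ap f m) c s <-> Bs s)).
    { intros m Hm Hle s Hs. destruct (nat_cases m Hm) as [->|(m' & Hm' & ->)].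
      - specialize (Hle n (in_succ_self n)). now apply in_emp in Hle.
      - rewrite step by auto. apply H; auto. intros z Hz.
        assert (K : n ∈ succ m') by (apply Hle, in_succ_self).
        apply in_succ_le in K; auto using nat_ord. }
    assert (HB : forall s, is_assignment X s -> (rel S c s <-> Bs s)).
    { intros s Hs. rewrite HSr by auto. split.
      - intros (n' & Hn' & K). destruct (natmax n' (succ n)) as (m & Hm & L1 & L2); auto using nat_succ.
        apply (H' m); auto.
      - intros K. exists (succ n). split; auto using nat_succ. intros m Hm Hle. apply H'; auto. }
    split; auto. exists (succ n). split; auto using nat_succ.
    intros m y Hm Hle Hy s Hs. apply (rel_ap f omega B) in Hy as [_ ->]; auto.
    rewrite HB by auto. apply H'; auto. }
  assert (Hstab : forall c, is_formula w c -> stab c).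
  { apply formula_ind.
    - unfold stab. dfn_tac.
    - intros i k Hi Hk. apply (key (fun s => exists x y, rel s i x /\ rel s k y /\ x ∈ y)); auto using form_mem.
      exists emp. split; [apply nat_emp|]. intros. now apply step_mem.
    - intros i k Hi Hk. apply (key (fun s => exists x, rel s i x /\ rel s k x)); auto using form_eq.
      exists emp. split; [apply nat_emp|]. intros. now apply step_eq.
    - intros Hw i Hi. apply (key (fun s => exists x, rel s i x /\ in_pred P x)).
      { rewrite Hw. now apply form_pred. }
      exists emp. split; [apply nat_emp|]. intros. now apply step_pred.
    - intros a Ha IH. apply stabE in IH as (n & Hn & H).
      apply (key (fun s => ~ rel S a s)); auto using form_neg.
      exists n. split; auto. intros m Hm Hle s Hs. rewrite step_neg, H; tauto.
    - intros a b Ha IHa Hb IHb. apply stabE in IHa as (n & Hn & H). apply stabE in IHb as (n' & Hn' & H').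
      apply (key (fun s => rel S a s /\ rel S b s)); auto using form_and.
      destruct (natmax n n') as (k & Hk & L1 & L2); auto.
      exists k. split; auto. intros m Hm Hle s Hs.
      rewrite step_and, H, H'; eauto using sub_trans; tauto.
    - intros i a Hi Ha IH. apply stabE in IH as (n & Hn & H).
      apply (key (fun s => exists x s', x ∈ X /\ is_assignment X s' /\ is_update s i x s' /\ rel S a s'));
        auto using form_ex.
      exists n. split; auto. intros m Hm Hle s Hs. rewrite step_ex.
      split; intros (x & s' & H1 & H2 & H3 & H4); exists x, s'; repeat (split; auto); now apply (H m). }
  exists S. intros s Hs. fold w. split; [|split; [|split; [|split; [|split]]]].
  - intros i k c Hi Hk E. apply is_code_code in E. subst.
    apply (key (fun s => exists x y, rel s i x /\ rel s k y /\ x ∈ y)); auto using form_mem.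
    exists emp. split; [apply nat_emp|]. intros. now apply step_mem.
  - intros i k c Hi Hk E. apply is_code_code in E. subst.
    apply (key (fun s => exists x, rel s i x /\ rel s k x)); auto using form_eq.
    exists emp. split; [apply nat_emp|]. intros. now apply step_eq.
  - intros A i c EP Hi E. apply is_code_code in E. subst.
    apply (key (fun s => exists x, rel s i x /\ x ∈ A)); auto using form_pred.
    exists emp. split; [apply nat_emp|]. intros. now apply step_pred.
  - intros a c Ha E. apply is_code_code in E. subst. destruct (stabE a (Hstab a Ha)) as (n & Hn & H).
    apply (key (fun s => ~ rel S a s)); auto using form_neg.
    exists n. split; auto. intros m Hm Hle s' Hs'. rewrite step_neg, H; tauto.
  - intros a b c Ha Hb E. apply is_code_code in E. subst.
    destruct (stabE a (Hstab a Ha)) as (n & Hn & H), (stabE b (Hstab b Hb)) as (n' & Hn' & H').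
    apply (key (fun s => rel S a s /\ rel S b s)); auto using form_and.
    destruct (natmax n n') as (k & Hk & L1 & L2); auto.
    exists k. split; auto. intros m Hm Hle s' Hs'.
    rewrite step_and, H, H'; eauto using sub_trans; tauto.
  - intros i a c Hi Ha E. apply is_code_code in E. subst. destruct (stabE a (Hstab a Ha)) as (n & Hn & H).
    apply (key (fun s => exists x s', x ∈ X /\ is_assignment X s' /\ is_update s i x s' /\ rel S a s'));
        auto using form_ex.
    exists n. split; auto. intros m Hm Hle s0 Hs0. rewrite step_ex.
    split; intros (x & s' & H1 & H2 & H3 & H4); exists x, s'; repeat (split; auto); now apply (H m).
Qed.

Lemma satisfaction_unique X P S S' : is_satisfaction X P S -> is_satisfaction X P S' ->
  forall c, is_formula (has_pred P) c -> forall s, is_assignment X s -> (rel S c s <-> rel S' c s).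
Proof.
  intros H H'. apply (formula_ind _ (fun c => forall s, is_assignment X s -> (rel S c s <-> rel S' c s))).
  - dfn_tac.
  - intros i k Hi Hk s Hs. rewrite (proj1 (H s Hs) i k), (proj1 (H' s Hs) i k); auto; try tauto;
    now apply is_code_code.
  - intros i k Hi Hk s Hs.
    rewrite (proj1 (proj2 (H s Hs)) i k), (proj1 (proj2 (H' s Hs)) i k); auto; try tauto;
    now apply is_code_code.
  - intros EP i Hi s Hs. destruct P as [A|]; [|discriminate].
    rewrite (proj1 (proj2 (proj2 (H s Hs))) A i), (proj1 (proj2 (proj2 (H' s Hs))) A i); auto; try tauto;
    now apply is_code_code.
  - intros a Ha IH s Hs. destruct (H s Hs) as (_ & _ & _ & K & _), (H' s Hs) as (_ & _ & _ & K' & _).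
    rewrite (K a), (K' a), IH; auto; try tauto; now apply is_code_code.
  - intros a b Ha IHa Hb IHb s Hs.
    destruct (H s Hs) as (_ & _ & _ & _ & K & _), (H' s Hs) as (_ & _ & _ & _ & K' & _).
    rewrite (K a b), (K' a b), IHa, IHb; auto; try tauto; now apply is_code_code.
  - intros i a Hi Ha IH s Hs.
    destruct (H s Hs) as (_ & _ & _ & _ & _ & K), (H' s Hs) as (_ & _ & _ & _ & _ & K').
    rewrite (K i a), (K' i a); auto; try now apply is_code_code.
    split; intros (x & s' & H1 & H2 & H3 & H4); exists x, s'; repeat (split; auto); now apply IH.
Qed.

Lemma satisfies_rel X P S c s : is_satisfaction X P S -> is_formula (has_pred P) c ->
  is_fun s omega X -> (satisfies X P c s <-> rel S c s).
Proof.
  intros H Hc Hs. apply assignment_fun in Hs. split.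
  - intros (S' & H' & K). now apply (satisfaction_unique X P S S').
  - intros K. exists S. auto.
Qed.

Lemma satisfies_mem X P i k s : is_nat i -> is_nat k -> is_fun s omega X ->
  (satisfies X P (code 0 i k) s <-> ap s i ∈ ap s k).
Proof.
  intros Hi Hk Hs. destruct (satisfaction_ex X P) as [S HS].
  rewrite (satisfies_rel X P S) by auto using form_mem.
  apply assignment_fun in Hs as Ha. rewrite (proj1 (HS s Ha) i k); auto; [|now apply is_code_code].
  apply in_omega in Hi, Hk. split.
  - intros (x & y & H1 & H2 & H). now rewrite (ap_eq s omega X i x), (ap_eq s omega X k y).
  - intros H. exists (ap s i), (ap s k). split; [|split]; auto; eapply ap_rel; eauto.
Qed.

Lemma satisfies_eq X P i k s : is_nat i -> is_nat k -> is_fun s omega X ->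
  (satisfies X P (code 1 i k) s <-> ap s i = ap s k).
Proof.
  intros Hi Hk Hs. destruct (satisfaction_ex X P) as [S HS].
  rewrite (satisfies_rel X P S) by auto using form_eq.
  apply assignment_fun in Hs as Ha. rewrite (proj1 (proj2 (HS s Ha)) i k); auto; [|now apply is_code_code].
  apply in_omega in Hi, Hk. split.
  - intros (x & H1 & H2). now rewrite (ap_eq s omega X i x), (ap_eq s omega X k x).
  - intros H. exists (ap s i). split; [|rewrite H]; eapply ap_rel; eauto.
Qed.

Lemma satisfies_pred X A i s : is_nat i -> is_fun s omega X ->
  (satisfies X (Some A) (code 2 i i) s <-> ap s i ∈ A).
Proof.
  intros Hi Hs. destruct (satisfaction_ex X (Some A)) as [S HS].
  rewrite (satisfies_rel X (Some A) S) by auto using form_pred.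
  apply assignment_fun in Hs as Ha. destruct (HS s Ha) as (_ & _ & K & _).
  rewrite (K A i); auto; [|now apply is_code_code].
  apply in_omega in Hi. split.
  - intros (x & H1 & H2). now rewrite (ap_eq s omega X i x).
  - intros H. exists (ap s i). split; auto. eapply ap_rel; eauto.
Qed.

Lemma satisfies_neg X P a s : is_formula (has_pred P) a -> is_fun s omega X ->
  (satisfies X P (code 3 a a) s <-> ~ satisfies X P a s).
Proof.
  intros Ha Hs. destruct (satisfaction_ex X P) as [S HS].
  rewrite !(satisfies_rel X P S) by auto using form_neg.
  apply assignment_fun in Hs. destruct (HS s Hs) as (_ & _ & _ & K & _).
  apply K; auto. now apply is_code_code.
Qed.

Lemma satisfies_and X P a b s : is_formula (has_pred P) a -> is_formula (has_pred P) b ->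
  is_fun s omega X ->
  (satisfies X P (code 4 a b) s <-> satisfies X P a s /\ satisfies X P b s).
Proof.
  intros Ha Hb Hs. destruct (satisfaction_ex X P) as [S HS].
  rewrite !(satisfies_rel X P S) by auto using form_and.
  apply assignment_fun in Hs. destruct (HS s Hs) as (_ & _ & _ & _ & K & _).
  apply K; auto. now apply is_code_code.
Qed.

Lemma satisfies_ex X P i a s : is_nat i -> is_formula (has_pred P) a -> is_fun s omega X ->
  (satisfies X P (code 5 i a) s <-> exists x, x ∈ X /\ satisfies X P a (upd s i x)).
Proof.
  intros Hi Ha Hs. destruct (satisfaction_ex X P) as [S HS].
  rewrite (satisfies_rel X P S) by auto using form_ex.
  apply assignment_fun in Hs as Hs'. destruct (HS s Hs') as (_ & _ & _ & _ & _ & K).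
  rewrite (K i a); auto; [|now apply is_code_code]. split.
  - intros (x & s' & Hx & H1 & H2 & H3). exists x. split; auto.
    apply assignment_fun in H1. apply (is_update_upd X) in H2; auto. subst s'.
    apply (satisfies_rel X P S); auto.
  - intros (x & Hx & H). assert (U := upd_fun X s i x Hs Hi Hx).
    exists x, (upd s i x). split; auto. split; [now apply assignment_fun|].
    split; [now apply (is_update_upd X)|]. now apply (satisfies_rel X P S) in H.
Qed.

(** The number [n] is one of the model. An assignment is an infinite sequence and need not lie in a
    given level; keeping only its entries below [n] is what later brings it into bounded levels. *)
Lemma finite_support X P c : is_formula (has_pred P) c -> exists n, is_nat n /\
  forall s s', is_fun s omega X -> is_fun s' omega X -> (forall k, k ∈ n -> ap s k = ap s' k) ->
    (satisfies X P c s <-> satisfies X P c s').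
Proof.
  (* Agreement is expressed by [rel] instead of [ap] to make [G] definable for the induction; one
     implication is enough by symmetry. *)
  pose (G := fun n c => forall s s', is_fun s omega X -> is_fun s' omega X ->
    (forall k y, k ∈ n -> (rel s k y <-> rel s' k y)) -> (satisfies X P c s -> satisfies X P c s')).
  assert (HG : forall n c, is_nat n -> (G n c <-> forall s s', is_fun s omega X -> is_fun s' omega X ->
    (forall k, k ∈ n -> ap s k = ap s' k) -> (satisfies X P c s <-> satisfies X P c s'))).
  { intros n d Hn.
    assert (E : forall s s', is_fun s omega X -> is_fun s' omega X ->
      ((forall k y, k ∈ n -> (rel s k y <-> rel s' k y)) <-> (forall k, k ∈ n -> ap s k = ap s' k))).
    { intros s s' Hs Hs'. assert (Hk : forall k, k ∈ n -> k ∈ omega).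
      { intros k Hk. apply in_omega. eapply nat_in; eauto. }
      split.
      - intros H k Hkn. symmetry. eapply ap_eq; eauto. apply H; auto. eapply ap_rel; eauto.
      - intros H k y Hkn. rewrite (rel_ap s omega X), (rel_ap s' omega X), H; tauto. }
    split.
    - intros H s s' Hs Hs' K. split; apply H; auto; apply E; auto. intros k Hk. symmetry. auto.
    - intros H s s' Hs Hs' K. apply (H s s'); auto. now apply E. }
  assert (mono : forall n m c, is_nat n -> is_nat m -> n ⊆ m -> G n c -> G m c).
  { intros n m d Hn Hm Hle H s s' Hs Hs' K. apply H; auto. }
  assert (natmax : forall n m, is_nat n -> is_nat m -> exists k, is_nat k /\ n ⊆ k /\ m ⊆ k).
  { intros n m Hn Hm. destruct (ord_le_total n m); auto using nat_ord; eauto using sub_refl. }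
  intros Hc. assert (H : exists n, is_nat n /\ G n c).
  2:{ destruct H as (n & Hn & H). exists n. split; auto. now apply HG. }
  revert c Hc.
  assert (atom : forall i k, is_nat i -> is_nat k -> exists n, is_nat n /\ i ∈ n /\ k ∈ n).
  { intros i k Hi Hk. destruct (natmax (succ i) (succ k)) as (n & Hn & L1 & L2); auto using nat_succ.
    exists n. split; auto. split; [apply L1|apply L2]; apply in_succ_self. }
  apply (formula_ind _ (fun c => exists n, is_nat n /\ G n c)).
  - unfold G. dfn_tac.
  - intros i k Hi Hk. destruct (atom i k Hi Hk) as (n & Hn & Hin & Hkn). exists n. split; auto.
    apply HG; auto. intros s s' Hs Hs' K. rewrite !satisfies_mem by auto. now rewrite !K.
  - intros i k Hi Hk. destruct (atom i k Hi Hk) as (n & Hn & Hin & Hkn). exists n. split; auto.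
    apply HG; auto. intros s s' Hs Hs' K. rewrite !satisfies_eq by auto. now rewrite !K.
  - intros EP i Hi. destruct P as [A|]; [|discriminate].
    destruct (atom i i Hi Hi) as (n & Hn & Hin & Hkn). exists n. split; auto.
    apply HG; auto. intros s s' Hs Hs' K. rewrite !satisfies_pred by auto. now rewrite !K.
  - intros a Ha (n & Hn & H). exists n. split; auto. rewrite HG in H by auto. apply HG; auto.
    intros s s' Hs Hs' K. rewrite !satisfies_neg by auto. now rewrite (H s s').
  - intros a b Ha (n & Hn & H) Hb (n' & Hn' & H').
    destruct (natmax n n') as (k & Hk & L1 & L2); auto. exists k. split; auto.
    apply (mono n k) in H; auto. apply (mono n' k) in H'; auto. rewrite HG in H, H' by auto. apply HG; auto.
    intros s s' Hs Hs' K. rewrite !satisfies_and by auto. now rewrite (H s s'), (H' s s').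
  - intros i a Hi Ha (n & Hn & H). exists n. split; auto. rewrite HG in H by auto. apply HG; auto.
    intros s s' Hs Hs' K. rewrite !satisfies_ex by auto.
    assert (E : forall x, x ∈ X -> (satisfies X P a (upd s i x) <-> satisfies X P a (upd s' i x))).
    { intros x Hx. apply H; auto using upd_fun. intros k Hk.
      assert (Nk : is_nat k) by (eapply nat_in; eauto).
      destruct (classic (k = i)) as [->|N].
      - now rewrite !(ap_upd_same X) by auto.
      - rewrite !(ap_upd_other X) by auto. auto. }
    split; intros (x & Hx & K1); exists x; split; auto; now apply E.
Qed.

End Formulas.

(** * Formulas of the metatheory as codes *)

Section Coding.
Context {V : structure} {HZF : ZF V}.
Implicit Types x y z a b c f g s j X Y : V.

(* The de Bruijn index [i] under [n] binders becomes the variable [n - 1 - i]. *)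
Fixpoint tr (n : nat) (p : fm) : V :=
  match p with
  | Mem i k => code 0 (num (n - 1 - i)) (num (n - 1 - k))
  | Eq i k => code 1 (num (n - 1 - i)) (num (n - 1 - k))
  | Neg q => code 3 (tr n q) (tr n q)
  | And q r => code 4 (tr n q) (tr n r)
  | Ex q => code 5 (num n) (tr (S n) q)
  end.

Lemma tr_formula w p : forall n, is_formula w (tr n p).
Proof.
  induction p; simpl; intros n;
    auto using form_mem, form_eq, form_neg, form_and, form_ex, num_nat.
Qed.

Lemma tr_sat X P p : forall n e s, fv_lt n p -> is_fun s omega X ->
  (forall i, i < n -> ap s (num (n - 1 - i)) = e i) ->
  (satisfies X P (tr n p) s <-> sat (fun x => x ∈ X) p e).
Proof.
  induction p; cbn [tr sat fv_lt]; intros n e s Hn Hs He.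
  - rewrite satisfies_mem by auto using num_nat. now rewrite !He by tauto.
  - rewrite satisfies_eq by auto using num_nat. now rewrite !He by tauto.
  - rewrite satisfies_neg by auto using tr_formula. now rewrite (IHp n e).
  - rewrite satisfies_and by auto using tr_formula. now rewrite (IHp1 n e), (IHp2 n e) by tauto.
  - rewrite satisfies_ex by auto using tr_formula, num_nat.
    assert (K : forall x, x ∈ X -> (satisfies X P (tr (S n) p) (upd s (num n) x) <->
      sat (fun x => x ∈ X) p (scons x e))).
    { intros x Hx. apply IHp; auto using upd_fun, num_nat.
      intros [|i] Hi; cbn [scons].
      - replace (S n - 1 - 0) with n by lia. apply (ap_upd_same X); auto using num_nat.
      - replace (S n - 1 - S i) with (n - 1 - i) by lia.
        rewrite (ap_upd_other X); auto using num_nat.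
        + apply He. lia.
        + intros E. apply num_inj in E. lia. }
    split; intros (x & Hx & H); exists x; split; auto; now apply K.
Qed.

Lemma assignment_ex X (h : nat -> V) n : (forall k, h k ∈ X) ->
  exists s, is_fun s omega X /\ forall i, i < n -> ap s (num i) = h i.
Proof.
  intros Hh. induction n as [|n (s & Hs & IH)].
  - destruct (const_fun X (h 0) omega) as (s & Hs & _); auto. exists s. split; auto. lia.
  - exists (upd s (num n) (h n)). split; auto using upd_fun, num_nat.
    intros i Hi. destruct (Nat.eq_dec i n) as [->|N].
    + apply (ap_upd_same X); auto using num_nat.
    + rewrite (ap_upd_other X); auto using num_nat; [apply IH; lia|].
      intros E. now apply num_inj in E.
Qed.

Lemma assignment_env X (e : nat -> V) n : (forall k, e k ∈ X) ->
  exists s, is_fun s omega X /\ forall i, i < n -> ap s (num (n - 1 - i)) = e i.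
Proof.
  intros He. destruct (assignment_ex X (fun k => e (n - 1 - k)) n) as (s & Hs & H); auto.
  exists s. split; auto. intros i Hi. rewrite H by lia. f_equal. lia.
Qed.

Lemma comp_fun s j a X Y : is_fun s a X -> is_fun j X Y ->
  exists s', is_fun s' a Y /\ forall k, k ∈ a -> ap s' k = ap j (ap s k).
Proof.
  intros Hs Hj.
  destruct (fun_ex (fun k y => exists x, rel s k x /\ rel j x y) a Y) as (s' & Hs' & _ & H).
  - dfn_tac.
  - intros k Hk. exists (ap j (ap s k)). split; [eapply ap_in; eauto; eapply ap_in; eauto|].
    exists (ap s k). split; eapply ap_rel; eauto. eapply ap_in; eauto.
  - intros k y y' _ _ _ (x & H1 & H2) (x' & H1' & H2').
    rewrite (fun_func s a X k x' x) in H2'; auto. eapply fun_func; eauto.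
  - exists s'. split; auto. intros k Hk. destruct (H k Hk) as (x & H1 & H2).
    rewrite (ap_eq s a X k x) by auto. symmetry. now apply (ap_eq j X Y).
Qed.

(** Elementarity for the formulas of the metatheory. The model's own notion implies it, and the
    transfer of definable notions needs no more. *)
Definition elem X Y (J : V -> V) : Prop :=
  (forall x, x ∈ X -> J x ∈ Y) /\
  forall p e, (forall k, e k ∈ X) ->
    (sat (fun x => x ∈ X) p e <-> sat (fun x => x ∈ Y) p (fun k => J (e k))).

Lemma embedding_elem X P Y Q j : elementary_embedding X P Y Q j -> elem X Y (ap j).
Proof.
  intros (_ & Hj & H). split; [intros x Hx; eapply ap_in; eauto|].
  intros p e He. destruct (fv_lt_ex p) as [n Hn].
  destruct (assignment_env X e n He) as (s & Hs & Hse).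
  destruct (comp_fun s j omega X Y Hs Hj) as (s' & Hs' & Hse').
  rewrite <- (tr_sat X P p n e s), <- (tr_sat Y Q p n _ s'); auto.
  - apply H; auto using tr_formula; try now apply assignment_fun.
    intros k x y Hk Hx. apply (rel_ap s omega X) in Hk as [Hk ->]; auto.
    apply (rel_ap j X Y) in Hx as [_ ->]; auto. apply (rel_ap s' omega Y); auto.
    split; auto. symmetry. auto.
  - intros i Hi. rewrite Hse' by (apply in_omega, num_nat). now rewrite Hse.
Qed.

(** Elementarity for the atomic formula in which the predicate is applied to variable 0. *)
Lemma embedding_pred X A Y B j x : elementary_embedding X (Some A) Y (Some B) j -> x ∈ X ->
  (x ∈ A <-> ap j x ∈ B).
Proof.
  intros (_ & Hj & H) Hx.
  destruct (const_fun X x omega Hx) as (s & Hs & Es).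
  destruct (comp_fun s j omega X Y Hs Hj) as (s' & Hs' & Es').
  specialize (H (code 2 emp emp) s s' (form_pred emp nat_emp)).
  rewrite !satisfies_pred in H by auto using nat_emp.
  rewrite Es', Es in H by apply in_omega, nat_emp. apply H; try now apply assignment_fun.
  intros k u y Hk Hu. apply (rel_ap s omega X) in Hk as [Hk ->]; auto.
  apply (rel_ap j X Y) in Hu as [_ ->]; auto. apply (rel_ap s' omega Y); auto.
  split; auto. symmetry. auto.
Qed.

Lemma substructure_elem X Y : elementary_substructure X Y -> elem X Y (fun x => x).
Proof.
  intros [Hsub H]. split; auto. intros p e He. destruct (fv_lt_ex p) as [n Hn].
  destruct (assignment_env X e n He) as (s & Hs & Hse).
  assert (Hs' : is_fun s omega Y).
  { split; [|apply Hs]. intros q Hq. destruct (proj1 Hs q Hq) as (k & y & Hk & Hy & Ho).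
    exists k, y. auto. }
  rewrite <- (tr_sat X None p n e s), <- (tr_sat Y None p n e s); auto.
  apply H; auto using tr_formula. now apply assignment_fun.
Qed.

End Coding.

(** * Levels of the hierarchy without ordinals *)

(** [h] is a history in the style of Scott and Potter: each [u] in it consists of the subsets of
    those members of [h] that belong to [u], and [v] of the subsets of all members of [h]. The
    quantifier over [x] is left out to keep the matrix bounded. In contrast to [is_hierarchy], no
    ordered pairs of an ordinal and a level occur, so the notion stays correct inside successor
    stages such as [VV (succ l)]. *)
Definition level_matrix {V : structure} (h v x : V) : Prop :=
  (forall u, u ∈ h -> (x ∈ u <-> exists w, w ∈ h /\ (w ∈ u /\ x ⊆ w))) /\
  (x ∈ v <-> exists w, w ∈ h /\ x ⊆ w).

Definition is_level {V : structure} (v : V) : Prop := exists h, forall x, level_matrix h v x.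

Lemma def_level_matrix {V : structure} {b DD} {Q : V -> Prop} {HT : trans_domains DD} :
  definable b DD Q (fun e => level_matrix (e 0) (e 1) (e 2)).
Proof. unfold level_matrix. dfn_tac. Qed.
#[export] Hint Resolve def_level_matrix : dfn.

Class rank_domains {V : structure} (DD : (V -> Prop) -> Prop) : Prop :=
  rank_dom : forall D, DD D -> exists a v, is_V a v /\ D = (fun x => x ∈ v).

#[export] Instance rank_trans {V : structure} {HZF : ZF V} (DD : (V -> Prop) -> Prop) :
  rank_domains DD -> trans_domains DD.
Proof.
  intros H D HD x y Hy Hx. destruct (H D HD) as (a & v & Hv & ->).
  apply is_V_VV in Hv as [Ha ->]. now apply (VV_trans a Ha y).
Qed.

Definition level_of {V : structure} (a v : V) : Prop :=
  is_level v /\ a ⊆ v /\ forall x, x ∈ v -> is_ordinal x -> x ∈ a.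

Section Levels.
Context {V : structure} {HZF : ZF V}.
Implicit Types x y z a b c f g s u v h : V.

Lemma level_union (k : V) : (forall w, w ∈ k -> exists a, is_ordinal a /\ w = VV a) ->
  exists b, is_ordinal b /\ forall x, x ∈ VV b <-> exists w, w ∈ k /\ x ⊆ w.
Proof.
  intros H.
  destruct (repl_ex (fun w a => is_V a w) k) as [r Hr].
  { dfn_tac. }
  { intros w a a' _ Ha Ha'. apply is_V_VV in Ha as [? E]. apply is_V_VV in Ha' as [? E'].
    apply VV_inj; auto. congruence. }
  assert (Hr' : forall a, a ∈ r <-> is_ordinal a /\ VV a ∈ k).
  { intros a. rewrite Hr. split.
    - intros (w & Hw & Ha). apply is_V_VV in Ha as [Ha ->]. auto.
    - intros [Ha Hk]. exists (VV a). split; auto. now apply is_V_VV. }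
  pose (b := cup r (bigcup r)).
  assert (Hb : forall c, c ∈ b <-> exists a, a ∈ r /\ (c ∈ a \/ c = a)).
  { intros c. unfold b. rewrite in_cup, in_bigcup. split.
    - intros [Hc|(a & Ha & Hc)]; eauto.
    - intros (a & Ha & [Hc| ->]); eauto. }
  assert (Ob : is_ordinal b).
  { split.
    - intros c Hc d Hd. apply Hb in Hc as (a & Ha & Hc). apply Hb. exists a. split; auto. left.
      destruct Hc as [Hc| ->]; auto. apply (ord_trans d c); auto. now apply Hr'.
    - intros c Hc. apply Hb in Hc as (a & Ha & Hc). apply Hr' in Ha as [Ha _].
      destruct Hc as [Hc| ->]; [apply (proj1 (ord_in a c Ha Hc))|apply (proj1 Ha)]. }
  exists b. split; auto. intros x. rewrite in_VV by auto. split.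
  - intros (c & Hc & Hx). apply Hb in Hc as (a & Ha & Hc). apply Hr' in Ha as [Ha Hk].
    exists (VV a). split; auto. apply (sub_trans x (VV c)); auto.
    destruct Hc as [Hc| ->]; [|apply sub_refl].
    apply VV_mono; auto; [apply (ord_in a); auto|]. apply ord_sub; auto. apply (ord_in a); auto.
  - intros (w & Hw & Hx). destruct (H w Hw) as (a & Ha & ->). exists a. split; auto.
    apply Hb. exists a. split; auto. now apply Hr'.
Qed.

(** Let a member of a history be minimal among those not of the form [VV a]. The members of the
    history in it do have this form, and [level_union] gives it this form too. Conversely, the
    stages below [a] are a history of [VV a]. *)
Lemma is_level_VV v : is_level v <-> exists a, is_ordinal a /\ v = VV a.
Proof.
  split.
  - intros (h & H).
    assert (Hh : forall u, u ∈ h -> exists a, is_ordinal a /\ u = VV a).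
    { intros u Hu. apply NNPP. intros N.
      destruct (foundation (fun u => ~ exists a, is_V a u) h u) as (m & Hm & Nm & K); auto.
      - dfn_tac.
      - intros (a & Ha). apply N. exists a. now apply is_V_VV.
      - apply Nm. destruct (level_union (sep h (fun w => w ∈ m))) as (b & Ob & Hb).
        + intros w Hw. apply in_sep in Hw as [Hw Hwm]; [|dfn_tac].
          specialize (K w Hwm Hw). apply NNPP in K as (a & Ha). exists a. now apply is_V_VV.
        + exists b. apply is_V_VV. split; auto. apply ext. intros x. rewrite Hb.
          destruct (H x) as [H1 _]. rewrite (H1 m Hm).
          split; intros (w & Hw & Hx); exists w.
          * rewrite in_sep by dfn_tac. tauto.
          * rewrite in_sep in Hw by dfn_tac. tauto. }
    destruct (level_union h Hh) as (b & Ob & Hb). exists b. split; auto.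
    apply ext. intros x. rewrite Hb. apply (H x).
  - intros (a & Ha & ->).
    destruct (repl_ex is_V a) as [h Hh]; [dfn_tac| |].
    { intros x y y' _. apply is_V_unique. }
    assert (Hh' : forall w, w ∈ h <-> exists b, b ∈ a /\ w = VV b).
    { intros w. rewrite Hh. split; intros (b & Hb & K); exists b; split; auto.
      - now apply is_V_VV in K.
      - apply is_V_VV. split; auto. apply (ord_in a); auto. }
    exists h. intros x. split.
    + intros u Hu. apply Hh' in Hu as (b & Hb & ->).
      assert (Ob : is_ordinal b) by (apply (ord_in a); auto).
      rewrite in_VV by auto. split.
      * intros (c & Hc & Hx). exists (VV c). split; [apply Hh'; exists c; split; auto; now apply (ord_trans c b)|].
        split; auto. now apply VV_in.
      * intros (w & Hw & Hwb & Hx). apply Hh' in Hw as (c & Hc & ->). exists c. split; auto.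
        apply VV_inj_lt; auto. apply (ord_in a); auto.
    + rewrite in_VV by auto. split.
      * intros (c & Hc & Hx). exists (VV c). split; auto. apply Hh'. eauto.
      * intros (w & Hw & Hx). apply Hh' in Hw as (c & Hc & ->). eauto.
Qed.

Lemma level_of_VV a v : is_ordinal a -> (level_of a v <-> v = VV a).
Proof.
  intros Ha. unfold level_of. rewrite is_level_VV. split.
  - intros ((b & Hb & ->) & H1 & H2). f_equal. apply sub_antisym.
    + intros x Hx. apply H2; [now apply ord_sub_VV|]. apply (ord_in b); auto.
    + intros x Hx. apply ord_in_VV; auto. apply (ord_in a); auto.
  - intros ->. split; eauto. split; [now apply ord_sub_VV|].
    intros x Hx Ox. now apply ord_in_VV.
Qed.

Lemma level_linear v v' : is_level v -> is_level v' -> v ∈ v' \/ v = v' \/ v' ∈ v.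
Proof.
  intros H H'. apply is_level_VV in H as (a & Ha & ->). apply is_level_VV in H' as (b & Hb & ->).
  destruct (ord_tri a b) as [K|[K|K]]; subst; auto using VV_in.
Qed.

(* A witness [h] for the level [v] can be taken inside any rank initial segment
   that contains [v], and it is enough to test it there. *)
Lemma is_level_abs D v : is_ordinal D -> v ∈ VV D ->
  (is_level v <-> exists h, h ∈ VV D /\ forall x, x ∈ VV D -> level_matrix h v x).
Proof.
  intros OD Hv. split.
  - intros H. apply is_level_VV in H as H'. destruct H' as (a & Ha & Ev). destruct H as (h & Hh).
    exists h. split; auto.
    apply (VV_sub D h v); auto. intros w Hw. apply Hh. exists w. split; auto. apply sub_refl.
  - intros (h & Hh & H). exists h. intros x. destruct (classic (x ∈ VV D)) as [|N]; auto.
    assert (T := VV_trans D OD).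
    split.
    + intros u Hu. split.
      * intros Hx. destruct N. apply (T u); auto. now apply (T h).
      * intros (w & Hw & Hwu & Hx). destruct N. apply (VV_sub D x w); auto. now apply (T h).
    + split.
      * intros Hx. destruct N. now apply (T v).
      * intros (w & Hw & Hx). destruct N. apply (VV_sub D x w); auto. now apply (T h).
Qed.

(** For [x] outside [VV D] both sides of each equivalence fail, as either would put [x] inside. *)
Lemma level_matrix_outside D h v x : is_ordinal D -> h ∈ VV D -> v ∈ VV D ->
  ~ level_matrix h v x -> x ∈ VV D.
Proof.
  intros OD Hh Hv N. apply NNPP. intros Nx. apply N. assert (T := VV_trans D OD).
  split.
  - intros u Hu. split.
    + intros Hx. destruct Nx. apply (T u); auto. now apply (T h).
    + intros (w & Hw & Hwu & Hx). destruct Nx. apply (VV_sub D x w); auto. now apply (T h).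
  - split.
    + intros Hx. destruct Nx. now apply (T v).
    + intros (w & Hw & Hx). destruct Nx. apply (VV_sub D x w); auto. now apply (T h).
Qed.

Lemma def_is_level {DD} {Q : V -> Prop} {HR : rank_domains DD} :
  definable false DD Q (fun e => is_level (e 0)).
Proof.
  unfold is_level. apply (def_ex (fun h e => forall x, level_matrix h (e 0) x)); [reflexivity| |].
  - intros D HD e He. destruct (rank_dom D HD) as (a & v & Hv & ->). apply is_V_VV in Hv as [Ha ->].
    intros (h & Hh). exists h. split; auto. apply (VV_sub a h (e 0)); auto.
    intros w Hw. apply (Hh w). exists w. split; auto. apply sub_refl.
  - apply (def_all (fun x e => level_matrix (e 0) (e 1) x)); [reflexivity| |dfn_tac].
    intros D HD e He. destruct (rank_dom D HD) as (a & v & Hv & ->). apply is_V_VV in Hv as [Ha ->].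
    intros (x & Hx). exists x. split; auto. eapply level_matrix_outside; eauto.
Qed.

End Levels.
#[export] Hint Resolve def_is_level : dfn.
#[export] Hint Extern 1 (rank_domains _) => typeclasses eauto : dfn.

Lemma def_level_of {V : structure} {HZF : ZF V} {DD} {Q : V -> Prop} {HR : rank_domains DD} :
  definable false DD Q (fun e => level_of (e 0) (e 1)).
Proof. unfold level_of. dfn_tac. Qed.
#[export] Hint Resolve def_level_of : dfn.

(** * Elementary maps between rank initial segments *)

(** A notion that one formula defines in both structures is respected by elementary maps between
    them; this family of domains asks for such a formula. *)
Definition two_domains {V : structure} (Y Z : V) : (V -> Prop) -> Prop :=
  fun D => D = (fun x => x ∈ Y) \/ D = (fun x => x ∈ Z).

(* [X] is an elementary substructure of [Y = V_eta] and [j] embeds it in [Z = V_zeta]. *)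
Class elementary_map {V : structure} (X Y Z j eta zeta : V) : Prop := {
  em_Y : is_V eta Y;
  em_Z : is_V zeta Z;
  em_sub : elem X Y (fun x => x);
  em_fun : is_fun j X Z;
  em_elem : elem X Z (ap j)
}.

Section Elementary.
Context {V : structure} {HZF : ZF V} {X Y Z j eta zeta : V}
  {E : elementary_map X Y Z j eta zeta}.
#[local] Notation Hsub := (@em_sub _ _ _ _ _ _ _ E).
#[local] Notation Hj := (@em_fun _ _ _ _ _ _ _ E).
#[local] Notation Hel := (@em_elem _ _ _ _ _ _ _ E).
Notation J := (ap j).
Implicit Types x y z a b c f g s u v h : V.

Definition fixed_by (X j : V) : V -> Prop := fun c => c ∈ X /\ ap j c = c.

#[export] Instance rank_two : rank_domains (two_domains Y Z).
Proof. intros D [->| ->]; [exists eta, Y|exists zeta, Z]; split; auto; apply E. Qed.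

(** The Tarski-Vaught property of [X] in [Y], for notions definable in [Y] from constants in [X]. *)
Lemma hull_witness {B : bool} {DD} {Q : V -> Prop} P e : definable B DD Q P -> DD (fun x => x ∈ Y) ->
  (forall c, Q c -> c ∈ X) -> (forall k, e k ∈ X) ->
  (exists x, x ∈ Y /\ P (scons x e)) -> exists x, x ∈ X /\ P (scons x e).
Proof.
  intros (p & s & _ & H2 & H3) HD HQ He (x & Hx & HP).
  assert (XY : forall x, x ∈ X -> x ∈ Y) by apply Hsub.
  pose (r := fun i => match s i with inl 0 => 0 | _ => S i end).
  pose (E' := fun i => match s i with inl (S k) => e k | inl 0 => e 0 | inr c => c end).
  assert (HE : forall k, E' k ∈ X).
  { intros k. unfold E'. destruct (s k) as [[|i]|c] eqn:Es; auto. apply HQ. apply (proj1 (H2 k c Es)). }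
  assert (K : forall x, x ∈ Y -> (sat (fun x => x ∈ Y) (rename r p) (scons x E') <-> P (scons x e))).
  { intros y Hy. rewrite <- (H3 _ HD (scons y e)).
    - rewrite sat_rename. apply sat_ext. intros k. unfold r, E', valuation.
      destruct (s k) as [[|i]|c] eqn:Es; simpl; rewrite ?Es; auto.
    - intros [|k]; simpl; auto. }
  assert (S1 : sat (fun x => x ∈ Y) (Ex (rename r p)) E') by (exists x; split; auto; now apply K).
  apply Hsub in S1; auto. destruct S1 as (y & Hy & S1). exists y. split; auto.
  apply K; auto. apply Hsub in S1; auto. intros [|k]; simpl; auto.
Qed.

(** The constants of the formula are fixed by [j], so its truth in [Y] passes down to [X] and along
    [j] to [Z], with only the entries of the environment moved. *)
Lemma transfer {B : bool} P e : definable B (two_domains Y Z) (fixed_by X j) P ->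
  (forall k, e k ∈ X) -> (P e <-> P (fun k => J (e k))).
Proof.
  intros (p & s & _ & H2 & H3) He.
  assert (XY : forall x, x ∈ X -> x ∈ Y) by apply Hsub.
  assert (HE : forall k, valuation s e k ∈ X).
  { intros k. unfold valuation. destruct (s k) as [i|c] eqn:Es; auto. apply (proj1 (proj1 (H2 k c Es))). }
  rewrite <- (H3 (fun x => x ∈ Y)), <- (H3 (fun x => x ∈ Z)).
  - transitivity (sat (fun x => x ∈ X) p (valuation s e)).
    + symmetry. now apply Hsub.
    + rewrite (proj2 Hel) by auto. apply sat_ext. intros k. unfold valuation.
      destruct (s k) as [i|c] eqn:Es; auto. apply (proj2 (proj1 (H2 k c Es))).
  - now right.
  - intros k. now apply Hel.
  - now left.
  - intros k. auto.
Qed.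

Lemma transfer1 {B : bool} (R : V -> Prop) x :
  definable B (two_domains Y Z) (fixed_by X j) (fun e => R (e 0)) -> x ∈ X -> (R x <-> R (J x)).
Proof. intros H Hx. apply (transfer _ (fun _ => x) H). auto. Qed.

Lemma transfer2 {B : bool} (R : V -> V -> Prop) x y :
  definable B (two_domains Y Z) (fixed_by X j) (fun e => R (e 0) (e 1)) ->
  x ∈ X -> y ∈ X -> (R x y <-> R (J x) (J y)).
Proof.
  intros H Hx Hy. apply (transfer _ (scons x (fun _ => y)) H). intros [|k]; simpl; auto.
Qed.

Lemma transfer3 {B : bool} (R : V -> V -> V -> Prop) x y z :
  definable B (two_domains Y Z) (fixed_by X j) (fun e => R (e 0) (e 1) (e 2)) ->
  x ∈ X -> y ∈ X -> z ∈ X -> (R x y z <-> R (J x) (J y) (J z)).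
Proof.
  intros H Hx Hy Hz. apply (transfer _ (scons x (scons y (fun _ => z))) H).
  intros [|[|k]]; simpl; auto.
Qed.

Lemma transfer4 {B : bool} (R : V -> V -> V -> V -> Prop) x y z u :
  definable B (two_domains Y Z) (fixed_by X j) (fun e => R (e 0) (e 1) (e 2) (e 3)) ->
  x ∈ X -> y ∈ X -> z ∈ X -> u ∈ X -> (R x y z u <-> R (J x) (J y) (J z) (J u)).
Proof.
  intros H Hx Hy Hz Hu. apply (transfer _ (scons x (scons y (scons z (fun _ => u)))) H).
  intros [|[|[|k]]]; simpl; auto.
Qed.

(** The unique solution of a condition with fixed constants is in [X] by elementarity, and its image
    solves the same condition in [Z]. This is the usual source of fixed points of [j]. *)
Lemma fix_def {B : bool} (P : V -> Prop) y : (exists x, x ∈ X) ->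
  definable B (two_domains Y Z) (fixed_by X j) (fun e => P (e 0)) ->
  y ∈ Y -> P y -> (forall y', y' ∈ Y \/ y' ∈ Z -> P y' -> y' = y) -> y ∈ X /\ J y = y.
Proof.
  intros [x0 Hx0] HP Hy Py U.
  destruct (hull_witness (fun e => P (e 0)) (fun _ => x0) HP) as (y' & Hy' & Py'); auto.
  - now left.
  - now intros c [Hc _].
  - exists y. auto.
  - simpl in Py'. assert (Ey : y' = y) by (apply U; auto; left; now apply Hsub). subst y'.
    split; auto. apply U; [right; now apply Hel|]. now apply (transfer1 P y HP).
Qed.

Lemma fixed_dom c : fixed_by X j c -> forall D, two_domains Y Z D -> D c.
Proof.
  intros [Hc Ec] D [->| ->]; [now apply Hsub|]. rewrite <- Ec. now apply Hel.
Qed.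

Lemma rel_J x y : rel j x y <-> x ∈ X /\ y = J x.
Proof. apply (rel_ap j X Z), Hj. Qed.

Lemma J_mem x y : x ∈ X -> y ∈ X -> (x ∈ y <-> J x ∈ J y).
Proof. apply (transfer2 (B := false) (fun x y => x ∈ y)). dfn_tac. Qed.

Lemma J_sub x y : x ∈ X -> y ∈ X -> (x ⊆ y <-> J x ⊆ J y).
Proof. apply (transfer2 (B := false) (fun x y => x ⊆ y)). dfn_tac. Qed.

Lemma J_ord x : x ∈ X -> (is_ordinal x <-> is_ordinal (J x)).
Proof. apply (transfer1 (B := false) is_ordinal). dfn_tac. Qed.

Lemma J_limit x : x ∈ X -> (is_limit x <-> is_limit (J x)).
Proof. apply (transfer1 (B := false) is_limit). dfn_tac. Qed.

Lemma J_emp : emp ∈ X -> J emp = emp.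
Proof.
  intros H. apply is_empty_emp. apply (proj1 (transfer1 (B := false) is_empty emp ltac:(dfn_tac) H)).
  now apply is_empty_emp.
Qed.

Lemma J_succ x : x ∈ X -> succ x ∈ X -> J (succ x) = succ (J x).
Proof.
  intros H1 H2. apply is_succ_succ. apply (proj1 (transfer2 (B := false) is_succ x (succ x) ltac:(dfn_tac) H1 H2)).
  now apply is_succ_succ.
Qed.

Lemma J_opair x y : x ∈ X -> y ∈ X -> opair x y ∈ X -> J (opair x y) = opair (J x) (J y).
Proof.
  intros H1 H2 H3. apply is_opair_opair. apply (proj1 (transfer3 (B := false) is_opair (opair x y) x y ltac:(dfn_tac) H3 H1 H2)).
  now apply is_opair_opair.
Qed.

Lemma J_rel f x y : f ∈ X -> x ∈ X -> y ∈ X -> (rel f x y <-> rel (J f) (J x) (J y)).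
Proof. apply (transfer3 (B := false) rel). dfn_tac. Qed.

Lemma J_fun f x y : f ∈ X -> x ∈ X -> y ∈ X -> (is_fun f x y <-> is_fun (J f) (J x) (J y)).
Proof. apply (transfer3 (B := false) is_fun). dfn_tac. Qed.

Lemma J_ap f a b x : is_fun f a b -> f ∈ X -> a ∈ X -> b ∈ X -> x ∈ X -> x ∈ a -> ap f x ∈ X ->
  J (ap f x) = ap (J f) (J x).
Proof.
  intros Hf H1 H2 H3 H4 Hx H5. symmetry. apply (ap_eq _ (J a) (J b)).
  - now apply (proj1 (J_fun f a b H1 H2 H3)).
  - apply (proj1 (J_rel f x (ap f x) H1 H4 H5)). eapply ap_rel; eauto.
Qed.

Lemma J_VV a : is_ordinal a -> a ∈ X -> VV a ∈ X -> J (VV a) = VV (J a).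
Proof.
  intros Ha H1 H2. apply level_of_VV; [now apply (proj1 (J_ord a H1))|].
  apply (proj1 (transfer2 (B := false) level_of a (VV a) ltac:(dfn_tac) H1 H2)). now apply level_of_VV.
Qed.

Lemma J_fix_below a : is_ordinal a -> VV a ⊆ X -> (forall b, b ∈ a -> J b = b) ->
  forall x, x ∈ VV a -> J x = x.
Proof.
  intros Ha HaX Hfix.
  (* Induction on rank, with [rel j x x] in place of the equation so that the predicate is
     definable. *)
  assert (K : forall c, is_ordinal c -> c ⊆ a -> forall v x, v = VV c -> x ∈ v -> rel j x x).
  { apply (ord_ind (fun c => c ⊆ a -> forall v x, v = VV c -> x ∈ v -> rel j x x)); [dfn_tac|].
    intros c Hc IH Hca v x -> Hx.
    assert (HxX : x ∈ X) by (apply HaX, (VV_mono c a); auto).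
    apply rel_J. split; auto.
    apply in_VV in Hx as (d & Hd & Hx); auto.
    assert (Od : is_ordinal d) by (apply (ord_in c); auto).
    assert (HdX : d ∈ X) by (apply HaX, ord_sub_VV; auto).
    assert (HVX : VV d ∈ X) by (apply HaX, VV_in; auto).
    assert (EV : J (VV d) = VV d) by (rewrite J_VV by auto; f_equal; auto).
    assert (Kd : forall z, z ∈ VV d -> z ∈ X /\ J z = z).
    { intros z Hz. assert (R : rel j z z).
      { apply (IH d Hd) with (v := VV d); auto. intros w Hw. apply Hca. now apply (ord_trans w d). }
      apply rel_J in R. split; [tauto|]. symmetry; tauto. }
    apply ext. intros z. split.
    - intros Hz. destruct (Kd z (Hx z Hz)) as [HzX Ez]. rewrite <- Ez. now apply (proj1 (J_mem z x HzX HxX)).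
    - intros Hz. assert (Hzd : z ∈ VV d).
      { rewrite <- EV. revert z Hz. now apply (proj1 (J_sub x (VV d) HxX HVX)). }
      destruct (Kd z Hzd) as [HzX Ez]. rewrite <- Ez in Hz. now apply (proj2 (J_mem z x HzX HxX)). }
  intros x Hx. assert (R : rel j x x) by (apply (K a Ha (sub_refl a) (VV a)); auto).
  apply rel_J in R. symmetry; tauto.
Qed.

Lemma J_nat : omega ⊆ X -> forall n, is_nat n -> J n = n.
Proof.
  intros HX.
  assert (HnX : forall n, is_nat n -> n ∈ X) by (intros n Hn; now apply HX, in_omega).
  assert (K : forall n, is_nat n -> rel j n n).
  { apply nat_ind'; [dfn_tac| |].
    - apply rel_J. split; [apply HnX, nat_emp|]. symmetry. apply J_emp, HnX, nat_emp.
    - intros n Hn IH. apply rel_J in IH as [_ IH]. apply rel_J.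
      split; [now apply HnX, nat_succ|]. rewrite J_succ; auto using nat_succ. now rewrite <- IH. }
  intros n Hn. specialize (K n Hn). apply rel_J in K. symmetry; tauto.
Qed.

End Elementary.

Ltac dfn_const ::=
  solve [ exact I | assumption | apply univ_I | apply fixed_dom; assumption
        | match goal with H : forall c, _ -> forall D, _ -> D c |- _ => apply H; assumption end
        | auto ].

Lemma def_is_level_univ {V : structure} {Q : V -> Prop} :
  definable false univ Q (fun e => is_level (e 0)).
Proof. unfold is_level. dfn_tac. Qed.
#[export] Hint Resolve def_is_level_univ : dfn.

Definition all_trans {V : structure} : (V -> Prop) -> Prop :=
  fun D => forall x y, D y -> x ∈ y -> D x.

#[export] Instance trans_all_trans {V : structure} : trans_domains (@all_trans V).
Proof. intros D HD. exact HD. Qed.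

(** A formula without constants can be built into larger formulas of the metatheory, whose place in
    the Levy hierarchy can then be read off. *)
Lemma delta0_formula {V : structure} (P : (nat -> V) -> Prop) :
  definable true all_trans (fun _ => False) P ->
  exists p, Delta0 p /\ forall D, all_trans D -> forall e, (forall k, D (e k)) -> (sat D p e <-> P e).
Proof.
  intros (p & s & H1 & H2 & H3).
  exists (rename (fun i => match s i with inl k => k | inr _ => 0 end) p).
  split; [now apply Delta0_rename; auto|].
  intros D HD e He. rewrite <- (H3 D HD e He), sat_rename. apply sat_ext.
  intros k. unfold valuation. destruct (s k) eqn:Es; auto. destruct (H2 k d Es) as [[] _].
Qed.

(** * Cardinals *)

Section Cardinals.
Context {V : structure} {HZF : ZF V}.
Implicit Types x y z a b c f g k l n m : V.

Lemma infinite_cardinal_limit k : is_cardinal k -> omega ⊆ k -> is_limit k.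
Proof.
  intros [Ok Hk] Hw. destruct (ord_cases k Ok) as [->|[(b & Ob & ->)|]]; auto.
  - exfalso. apply (proj1 (in_emp emp)), Hw, in_omega, nat_emp.
  - exfalso. apply (Hk b (in_succ_self b)).
    assert (Hwb : omega ⊆ b).
    { intros n Hn. specialize (Hw n Hn) as Hnb. apply in_succ in Hnb as [|E]; auto. subst b.
      apply in_omega in Hn. exfalso.
      assert (K : succ n ∈ succ n) by (apply Hw, in_omega; now apply nat_succ).
      now apply not_in_self in K. }
    (* Shift [omega] by one to make room for the extra point [b]. *)
    destruct (fun_ex (fun x y => (is_empty x /\ y = b) \/ (is_nat x /\ is_succ y x) \/ (~ is_nat x /\ y = x))
      b (succ b)) as (f & Hf & Hr & _).
    + dfn_tac.
    + intros x Hx. destruct (classic (is_nat x)) as [Nx|Nx].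
      * destruct (nat_cases x Nx) as [->|(m & Hm & ->)].
        -- exists b. split; [apply in_succ_self|]. left. split; auto. now apply is_empty_emp.
        -- exists m. split.
           ++ apply in_succ. left. apply Hwb. now apply in_omega.
           ++ right; left. split; auto. now apply is_succ_succ.
      * exists x. split; [apply in_succ; auto|]. auto.
    + intros x y y' _ _ _ [[H1 H2]|[[H1 H2]|[H1 H2]]] [[H3 H4]|[[H3 H4]|[H3 H4]]]; try congruence.
      * exfalso. apply (H1 y'). apply H4. auto.
      * destruct H3. apply is_empty_emp in H1. subst. apply nat_emp.
      * exfalso. apply (H3 y). apply H2. auto.
      * apply is_succ_succ in H2, H4. rewrite H2 in H4, H1.
        apply succ_inj in H4; auto; apply nat_ord.
        -- apply (nat_in (succ y)); auto. apply in_succ_self.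
        -- rewrite H4 in H1. apply (nat_in (succ y')); auto. apply in_succ_self.
      * destruct H1. apply is_empty_emp in H3. subst. apply nat_emp.
    + exists f. split; auto. intros y Hy.
      assert (U : forall x, rel f x y <-> x ∈ b /\ ((is_empty x /\ y = b) \/ (is_nat x /\ is_succ y x) \/ (~ is_nat x /\ y = x))).
      { intros x. rewrite Hr. tauto. }
      unfold unique. setoid_rewrite U.
      apply in_succ in Hy as [Hy| ->].
      * destruct (classic (is_nat y)) as [Ny|Ny].
        -- exists (succ y). assert (Hs : succ y ∈ b) by (apply Hwb, in_omega, nat_succ; auto). split.
           ++ split; auto. split; auto. right; left. split; [now apply nat_succ|now apply is_succ_succ].
           ++ intros x (_ & _ & [[H1 ->]|[[H1 H2]|[H1 ->]]]).
              ** now apply not_in_self in Hy.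
              ** apply is_succ_succ in H2. auto.
              ** tauto.
        -- exists y. split; [tauto|]. intros x (_ & _ & [[H1 ->]|[[H1 H2]|[H1 H2]]]); auto.
           ++ now apply not_in_self in Hy.
           ++ destruct Ny. apply (nat_in x); auto. apply H2; auto.
      * exists emp. assert (He : emp ∈ b) by (apply Hwb, in_omega, nat_emp). split.
        -- split; auto. split; auto. left. split; auto. now apply is_empty_emp.
        -- intros x (Hx & _ & [[H1 _]|[[H1 H2]|[H1 ->]]]).
           ++ symmetry. now apply is_empty_emp.
           ++ exfalso. apply (no_2cycle x b); auto. apply H2. auto.
           ++ now apply not_in_self in Hx.
Qed.

End Cardinals.

Lemma def_is_bijection {V : structure} {b DD} {Q : V -> Prop} {HT : trans_domains DD} :
  definable b DD Q (fun e => is_bijection (e 0) (e 1) (e 2)).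
Proof.
  apply (def_equiv' (fun e : nat -> V => is_fun (e 0) (e 1) (e 2) /\
    forall y, y ∈ e 2 -> exists x, x ∈ e 1 /\ (rel (e 0) x y /\
      forall x', x' ∈ e 1 -> rel (e 0) x' y -> x = x'))); [|dfn_tac].
  intros e. unfold is_bijection, unique. split; intros [H1 H2]; split; auto; intros y Hy;
    destruct (H2 y Hy) as (x & H); exists x.
  - destruct H as (Hx & Hr & U). split; auto. intros x' []. auto.
  - destruct H as ((Hx & Hr) & U). auto.
Qed.
#[export] Hint Resolve def_is_bijection : dfn.

Lemma def_is_cardinal_univ {V : structure} {Q : V -> Prop} :
  definable false univ Q (fun e => is_cardinal (e 0)).
Proof. unfold is_cardinal. dfn_tac. Qed.
#[export] Hint Resolve def_is_cardinal_univ : dfn.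

(** The supremum of the cardinals below [l] is a limit ordinal included in [l], which shows that [l]
    is infinite. *)
Lemma limit_cardinal_limit {V : structure} {HZF : ZF V} (l : V) : is_limit_cardinal l -> is_limit l.
Proof.
  intros (Hl & Hne & H). apply infinite_cardinal_limit; auto.
  assert (Ol : is_ordinal l) by apply Hl.
  assert (He : emp ∈ l).
  { destruct (ord_tri emp l) as [K|[K|K]]; auto using ord_emp.
    - subst l. destruct Hne. now apply is_empty_emp.
    - now apply in_emp in K. }
  assert (Ce : is_cardinal emp).
  { split; [apply ord_emp|]. intros a Ha. now apply in_emp in Ha. }
  pose (C := sep l is_cardinal).
  assert (HC : forall m, m ∈ C <-> m ∈ l /\ is_cardinal m) by (intros m; apply in_sep; dfn_tac).
  assert (OC : forall m, m ∈ C -> is_ordinal m) by (intros m Hm; apply HC in Hm as [_ [Om _]]; auto).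
  assert (L : is_limit (bigcup C)).
  { apply limit_intro.
    - now apply ord_bigcup.
    - destruct (H emp He Ce) as (m & Cm & Hm & Hml). apply nonempty. exists emp.
      apply in_bigcup. exists m. split; auto. now apply HC.
    - intros x Hx. apply in_bigcup in Hx as (m & Hm & Hx).
      apply HC in Hm as Hm'. destruct (H m) as (m' & Cm' & Hm1 & Hm2); try tauto.
      assert (Hm3 : m' ∈ C) by now apply HC.
      apply in_bigcup. exists m'. split; auto.
      assert (Ox : is_ordinal x) by (apply (ord_in m); auto).
      apply (ord_le_lt (succ x) m); auto using ord_succ. apply succ_le; auto. }
  apply (sub_trans _ (bigcup C)); [now apply omega_le_limit|].
  intros x Hx. apply in_bigcup in Hx as (m & Hm & Hx). apply HC in Hm as [Hm _].
  now apply (ord_trans x m).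
Qed.

(** * From an ultraexacting cardinal to embeddings of [V_{lambda+1}] *)

(* [q = <c, s>] and [q' = <c, k o s>] for some [c] in [O] and [s : w -> W]. *)
Definition composed {V : structure} (k q q' O w W : V) : Prop :=
  exists c, c ∈ O /\ exists u, u ∈ q /\ exists s, s ∈ u /\ exists u', u' ∈ q' /\ exists s', s' ∈ u' /\
    (is_opair q c s /\ is_opair q' c s' /\ is_fun s w W /\ is_fun s' w W /\
     forall n, n ∈ w -> exists x, x ∈ W /\ exists y, y ∈ W /\
       (rel s n x /\ rel k x y /\ rel s' n y)).

(** For [B] a satisfaction relation, [q] and [q'] witness that [k] is not elementary. Bounding all
    quantifiers keeps the matrix of the reflected statement bounded. *)
Definition not_preserved {V : structure} (k q q' B O w W : V) : Prop :=
  composed k q q' O w W /\ ~ (q ∈ B <-> q' ∈ B).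

Definition nontrivial_on {V : structure} (k W : V) : Prop :=
  is_fun k W W /\ exists x, x ∈ W /\ ~ rel k x x.

(** * Quantifying away ordinal parameters *)

Section Quantified_ordinals.
Context {V : structure} {HZF : ZF V}.

(** The ordinal parameters in a definition of the given set may be moved by [j]. They are therefore
    quantified away, and fixed ones are found afterwards. *)
Fixpoint ex_ords (o : fm) (n : nat) (p : fm) : fm :=
  match n with 0 => p | S n => Ex (And o (ex_ords o n p)) end.

Lemma prepend_snoc {T : Type} (l : list T) x e : prepend (l ++ x :: nil) e = prepend l (scons x e).
Proof. unfold prepend. now rewrite fold_right_app. Qed.

Lemma sat_ex_ords (D : V -> Prop) o (Ho : forall e, (forall k, D (e k)) -> (sat D o e <-> is_ordinal (e 0)))
  p n : forall e, (forall k, D (e k)) ->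
  (sat D (ex_ords o n p) e <->
   exists l, length l = n /\ (forall x, In x l -> D x /\ is_ordinal x) /\ sat D p (prepend l e)).
Proof.
  induction n; simpl; intros e He.
  - split.
    + intros H. exists nil. simpl. tauto.
    + intros ([|] & H1 & _ & H3); [auto|discriminate].
  - assert (Hse : forall x, D x -> forall k, D (scons x e k)) by (intros x Hx [|k]; simpl; auto).
    split.
    + intros (x & Hx & Hox & Hs). rewrite IHn in Hs by auto. destruct Hs as (l & H1 & H2 & H3).
      exists (l ++ x :: nil). rewrite length_app. simpl. split; [lia|]. split.
      * intros y Hy. apply in_app_or in Hy as [Hy|[<-|[]]]; auto. split; auto.
        now rewrite Ho in Hox by auto.
      * now rewrite prepend_snoc.
    + intros (l & H1 & H2 & H3). destruct (exists_last (l := l)) as (l1 & x & ->); [intros ->; discriminate|].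
      destruct (H2 x) as [Dx Ox]; [apply in_or_app; simpl; auto|].
      exists x. split; auto. split; [now rewrite Ho by auto|].
      rewrite IHn by auto. exists l1. rewrite prepend_snoc in H3. split; [|split]; auto.
      * rewrite length_app in H1. simpl in H1. lia.
      * intros y Hy. apply H2, in_or_app; auto.
Qed.

End Quantified_ordinals.

Section Fixed_ordinals.
Context {V : structure} {HZF : ZF V} {X Y Z j eta zeta : V}
  {E : elementary_map X Y Z j eta zeta}.
Notation J := (ap j).
Notation fixed := (fixed_by X j).

Lemma least_in (P : V -> Prop) a x : dfn (fun e => P (e 0)) -> transitive_set a -> x ∈ a -> P x ->
  exists y, y ∈ a /\ P y /\ forall z, z ∈ y -> ~ P z.
Proof.
  intros HP Ta Hx Px. destruct (foundation P a x HP Hx Px) as (y & Hy & Py & K).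
  exists y. split; auto. split; auto. intros z Hz. apply K; auto. now apply (Ta y).
Qed.

(** For each quantifier in turn, the least ordinal that works is definable from what is already
    fixed, hence fixed. *)
Lemma fixed_ex_ords v o (Hv : fixed v) (Tv : transitive_set v)
  (Ho : forall e, (forall k, e k ∈ v) -> (sat (fun x => x ∈ v) o e <-> is_ordinal (e 0))) p n :
  forall e, (forall k, fixed (e k) /\ e k ∈ v) -> sat (fun x => x ∈ v) (ex_ords o n p) e ->
  exists l, length l = n /\ (forall x, In x l -> fixed x /\ x ∈ v) /\
    sat (fun x => x ∈ v) p (prepend l e).
Proof.
  assert (TY : transitive_set Y).
  { assert (HY := em_Y (V := V)). apply is_V_VV in HY as [OY ->]. now apply VV_trans. }
  induction n; intros e He Hs; cbn [ex_ords] in Hs.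
  - exists nil. simpl. split; auto. split; auto. tauto.
  - destruct Hs as (y0 & Hy0 & Ho0 & Hs0).
    rewrite Ho in Ho0 by (intros [|k]; simpl; auto; apply He). simpl in Ho0.
    pose (R := fun y => sat (fun x => x ∈ v) (ex_ords o n p) (scons y e)).
    (* Needed twice: in the universe to obtain a least [y], and in both structures to see that it is
       fixed. *)
    assert (HR : forall (DD : (V -> Prop) -> Prop) (Q : V -> Prop), trans_domains DD ->
      (forall c, fixed c -> Q c /\ forall D, DD D -> D c) -> definable false DD Q (fun e => R (e 0))).
    { intros DD Q HT HQ.
      apply (def_equiv' (fun e' => sat (fun x => x ∈ v) (ex_ords o n p)
        (fun k => match k with 0 => e' 0 | S k => e k end))).
      - intros e'. apply sat_ext. intros [|k]; reflexivity.
      - apply (def_sat (ex_ords o n p) (fun _ => v) (fun k e' => match k with 0 => e' 0 | S k => e k end)).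
        + destruct (HQ v Hv). now apply is_term_const.
        + intros [|k]; [apply is_term_var|]. destruct (HQ (e k) (proj1 (He k))).
          now apply is_term_const. }
    assert (HR1 : dfn (fun e => R (e 0))).
    { apply HR; [typeclasses eauto|]. intros c _. split; [exact I|apply univ_I]. }
    assert (HR2 : definable false (two_domains Y Z) fixed (fun e => R (e 0))).
    { apply HR; [typeclasses eauto|]. intros c Hc. split; auto. now apply fixed_dom. }
    destruct (least_in (fun y => is_ordinal y /\ y ∈ v /\ R y) v y0) as (y & Hy & (Oy & _ & Ry) & Ky); auto.
    { dfn_tac. }
    destruct (fix_def (B := false) (fun y => (is_ordinal y /\ y ∈ v /\ R y) /\
      forall z, z ∈ y -> ~ R z) y) as [HyX Ey].
    { exists v. apply Hv. }
    { dfn_tac. }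
    { apply (TY v); auto. apply (em_sub (V := V)), Hv. }
    { split; auto. intros z Hz Rz. apply (Ky z Hz). split; [apply (ord_in y); auto|]. split; auto. now apply (Tv y). }
    { intros y' _ [(Oy' & Hy' & Ry') K']. destruct (ord_tri y' y) as [L|[L|L]]; auto.
      - destruct (Ky y' L). auto.
      - destruct (K' y L). auto. }
    destruct (IHn (scons y e)) as (l & H1 & H2 & H3).
    { intros [|k]; simpl; auto. split; auto. split; auto. }
    { exact Ry. }
    exists (l ++ y :: nil). rewrite length_app. simpl. split; [lia|]. split.
    + intros x Hx. apply in_app_or in Hx as [Hx|[<-|[]]]; auto. split; auto. split; auto.
    + now rewrite prepend_snoc.
Qed.

End Fixed_ordinals.

(** ** The canonical extension of an embedding of [V_lambda] *)

Section Extension.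
Context {V : structure} {HZF : ZF V} {X Y Z j eta zeta : V}
  {E : elementary_map X Y Z j eta zeta}.
Context {l : V} (Hl : is_limit l) (HVl : VV l ⊆ X) (HlX : l ∈ X) (Jl : ap j l = l)
  (HWX : VV (succ l) ∈ X) (HVlX : VV l ∈ X).
Notation J := (ap j).
Notation fixed := (fixed_by X j).
Notation W := (VV (succ l)).
Implicit Types x y z a b c k q u v r : V.

Lemma lt_limit_X a : a ∈ l -> a ∈ X.
Proof. intros H. apply HVl, ord_sub_VV; auto. Qed.

Lemma J_lt a : a ∈ l -> J a ∈ l.
Proof. intros H. rewrite <- Jl. now apply (proj1 (J_mem a l (lt_limit_X a H) HlX)). Qed.

Lemma J_ge a : a ∈ l -> a ⊆ J a.
Proof.
  intros Ha. apply NNPP. intros N.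
  destruct (foundation (fun a => forall b, rel j a b -> ~ a ⊆ b) l a) as (m & Hm & Nm & K); auto.
  - dfn_tac.
  - intros b Hb. apply rel_J in Hb as [_ ->]. auto.
  - assert (Om : is_ordinal m) by (apply (ord_in l); auto).
    assert (HmX := lt_limit_X m Hm).
    assert (Nm' : ~ m ⊆ J m) by (apply Nm, rel_J; auto).
    assert (OJ : is_ordinal (J m)) by (apply (ord_in l); auto using J_lt).
    destruct (ord_lt_or_le (J m) m OJ Om) as [L|]; [|tauto].
    apply (K (J m)); auto using J_lt.
    intros b Hb. apply rel_J in Hb as [HJX ->].
    assert (L' : J (J m) ∈ J m) by now apply (proj1 (J_mem (J m) m HJX HmX)).
    intros S. apply S in L'. now apply not_in_self in L'.
Qed.

Lemma J_Vl : J (VV l) = VV l.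
Proof. rewrite J_VV; auto. now rewrite Jl. Qed.

(** An element of [J b] lies in some [VV a] with [a] below [l], and [VV a] is included in [J (VV a)]
    because [j] does not decrease ordinals. Hence it lies in the image of the part of [b] inside
    [VV a]. *)
Lemma J_union b z : b ∈ X -> b ∈ W ->
  (z ∈ J b <-> exists y, y ∈ VV l /\ y ⊆ b /\ z ∈ J y).
Proof.
  intros HbX Hb. assert (Hbl : b ⊆ VV l) by (apply VV_succ in Hb; auto). split.
  - intros Hz. assert (Hzl : z ∈ VV l).
    { rewrite <- J_Vl. revert z Hz. now apply (proj1 (J_sub b (VV l) HbX HVlX)). }
    apply VV_limit in Hzl as (a & Ha & Hza); auto.
    assert (Oa : is_ordinal a) by (apply (ord_in l); auto).
    assert (HVa : VV a ∈ VV l) by (apply VV_in; auto).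
    pose (y := sep b (fun z => z ∈ VV a)).
    assert (Hy : forall z, z ∈ y <-> z ∈ b /\ z ∈ VV a) by (intros u; apply (in_sep (fun z => z ∈ VV a)); dfn_tac).
    assert (Hyl : y ∈ VV l).
    { apply (VV_sub l y (VV a)); auto. intros u Hu. now apply Hy. }
    exists y. split; auto. split; [intros u Hu; now apply Hy|].
    assert (T : (forall z, z ∈ J y -> z ∈ J b /\ z ∈ J (VV a)) /\
      forall z, z ∈ J b -> z ∈ J (VV a) -> z ∈ J y).
    { apply (proj1 (transfer3 (B := false) (fun y b v => (forall z, z ∈ y -> z ∈ b /\ z ∈ v) /\
        forall z, z ∈ b -> z ∈ v -> z ∈ y) y b (VV a) ltac:(dfn_tac) (HVl y Hyl) HbX (HVl _ HVa))).
      split; [intros u; apply Hy|]. intros u H1 H2. now apply Hy. }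
    apply T; auto. rewrite J_VV; auto using lt_limit_X.
    apply (VV_mono a (J a)); auto using J_ge. apply (ord_in l); auto using J_lt.
  - intros (y & Hy & Hyb & Hz). revert z Hz. now apply (proj1 (J_sub y b (HVl y Hy) HbX)).
Qed.

(* The canonical extension [b |-> U {r(y) : y in V_l, y sub b}] of a map [r] of [V_l]. *)
Definition extends_to r k Vl W' : Prop :=
  is_fun k W' W' /\ forall b, b ∈ W' -> forall b', b' ∈ W' -> rel k b b' ->
    (forall z, z ∈ b' -> exists y, y ∈ Vl /\ exists u, u ∈ Vl /\ (y ⊆ b /\ rel r y u /\ z ∈ u)) /\
    (forall y, y ∈ Vl -> forall u, u ∈ Vl -> y ⊆ b -> rel r y u -> u ⊆ b').

(** [k] is determined by [r] alone, so it will be in [X] together with [r]; by [J_union] it agrees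
    with [j] on the elements of [X] in its domain. *)
Lemma extension_ex r : is_restriction r j (VV l) ->
  exists k, extends_to r k (VV l) W /\
    (forall k', extends_to r k' (VV l) W -> k' = k) /\
    (forall b, b ∈ X -> b ∈ W -> ap k b = J b).
Proof.
  intros Hr.
  assert (Rr : forall y u, rel r y u <-> y ∈ VV l /\ u = J y).
  { intros y u. rewrite rel_opair, (Hr (opair y u)), <- rel_opair, rel_J. split.
    - intros [[_ ->] (y' & u' & Hy & Eo)]. apply is_opair_opair, opair_inj in Eo as [-> _]. auto.
    - intros [Hy ->]. split; auto. exists y, (J y). split; auto. now apply is_opair_opair. }
  assert (Jl' : forall y, y ∈ VV l -> J y ∈ VV l).
  { intros y Hy. rewrite <- J_Vl. now apply (proj1 (J_mem y (VV l) (HVl y Hy) HVlX)). }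
  assert (OS : is_ordinal (succ l)) by auto using ord_succ.
  destruct (fun_ex (fun b b' => forall z, z ∈ b' <-> exists y u, y ∈ VV l /\ y ⊆ b /\ rel r y u /\ z ∈ u) W W)
    as (k & Hk & Hrel & Hap).
  - dfn_tac.
  - intros b Hb. exists (sep (VV l) (fun z => exists y u, y ∈ VV l /\ y ⊆ b /\ rel r y u /\ z ∈ u)).
    assert (Hd : dfn (fun e : nat -> V => exists y u, y ∈ VV l /\ y ⊆ b /\ rel r y u /\ e 0 ∈ u)) by dfn_tac.
    split.
    + apply VV_succ; auto. intros z Hz. now apply in_sep in Hz.
    + intros z. rewrite in_sep by auto. split; [tauto|]. intros H. split; auto.
      destruct H as (y & u & Hy & _ & Hu & Hz). apply Rr in Hu as [_ ->].
      apply (VV_trans l (limit_ord l Hl) (J y)); auto.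
  - intros b y y' _ _ _ H H'. apply ext. intros z. now rewrite H, H'.
  - assert (Hsp : forall b z, b ∈ W -> (z ∈ ap k b <-> exists y, y ∈ VV l /\ y ⊆ b /\ z ∈ J y)).
    { intros b z Hb. rewrite (Hap b Hb z). split.
      - intros (y & u & Hy & Hyb & Hu & Hz). apply Rr in Hu as [_ ->]. eauto.
      - intros (y & Hy & Hyb & Hz). exists y, (J y). rewrite Rr. auto. }
    assert (Hext : forall k', extends_to r k' (VV l) W -> forall b z, b ∈ W ->
      (z ∈ ap k' b <-> exists y, y ∈ VV l /\ y ⊆ b /\ z ∈ J y)).
    { intros k' [Hk' Hc] b z Hb.
      destruct (Hc b Hb (ap k' b)) as [H1 H2]; [eapply ap_in; eauto|eapply ap_rel; eauto|]. split.
      - intros Hz. destruct (H1 z Hz) as (y & Hy & u & _ & Hyb & Hu & Hzu).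
        apply Rr in Hu as [_ ->]. eauto.
      - intros (y & Hy & Hyb & Hz). apply (H2 y Hy (J y)); auto. now apply Rr. }
    exists k. split; [|split].
    + split; auto. intros b Hb b' Hb' Hbb'. apply (rel_ap k W W) in Hbb' as [_ ->]; auto. split.
      * intros z Hz. apply Hsp in Hz as (y & Hy & Hyb & Hz); auto. exists y. split; auto.
        exists (J y). rewrite Rr. auto.
      * intros y Hy u Hu Hyb Hr' z Hz. apply Rr in Hr' as [_ ->]. apply Hsp; eauto.
    + intros k' Hk'. apply (fun_ext k' k W W W); auto; [apply Hk'|].
      intros b Hb. apply ext. intros z. now rewrite Hsp, (Hext k') by auto.
    + intros b HbX Hb. apply ext. intros z. rewrite Hsp by auto. symmetry. now apply J_union.
Qed.

End Extension.

Lemma def_extends_to {V : structure} {b DD} {Q : V -> Prop} {HT : trans_domains DD} :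
  definable b DD Q (fun e => extends_to (e 0) (e 1) (e 2) (e 3)).
Proof. unfold extends_to. dfn_tac. Qed.
#[export] Hint Resolve def_extends_to : dfn.

Lemma def_nontrivial_on {V : structure} {b DD} {Q : V -> Prop} {HT : trans_domains DD} :
  definable b DD Q (fun e => nontrivial_on (e 0) (e 1)).
Proof. unfold nontrivial_on. dfn_tac. Qed.
#[export] Hint Resolve def_nontrivial_on : dfn.

(** The order of the variables is that of the formula it enters: q', q and k, quantified from the
    inside out, then the set b, then the constants W, V_omega and omega. *)
Lemma def_not_preserved {V : structure} {b DD} {Q : V -> Prop} {HT : trans_domains DD} :
  definable b DD Q (fun e => not_preserved (e 2) (e 1) (e 0) (e 3) (e 5) (e 6) (e 4)).
Proof. unfold not_preserved, composed. dfn_tac. Qed.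

Lemma Delta0_Sigma_Pi p : Delta0 p -> forall n, Sigma n p /\ Pi n p.
Proof.
  intros H. induction n as [|n [IH1 IH2]].
  - split; constructor; auto.
  - split; [now apply Sigma_of_Pi|now apply Pi_of_Sigma].
Qed.

Lemma OD_definable {V : structure} (A : V) :
  OD A -> definable false univ is_ordinal (fun e => e 0 = A).
Proof.
  intros (p & e & He & H).
  exists p, (fun i => match i with 0 => inl 0 | S k => inr (e k) end).
  split; [discriminate|]. split.
  - intros [|i] c; [discriminate|]. intros [= <-]. split; auto. apply univ_I.
  - intros D -> e' _. rewrite <- H. apply sat_ext. intros [|k]; reflexivity.
Qed.

Lemma definable_OD {V : structure} {HZF : ZF V} (A : V) :
  definable false univ is_ordinal (fun e => e 0 = A) -> OD A.
Proof.
  intros (p & s & _ & H2 & H3).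
  exists (rename (fun i => match s i with inl _ => 0 | inr _ => S i end) p),
    (fun i => match s i with inl _ => emp | inr c => c end).
  split.
  - intros k. destruct (s k) as [|c] eqn:Es; [apply ord_emp|]. apply (proj1 (H2 k c Es)).
  - intros x. unfold holds. rewrite sat_rename.
    rewrite <- (H3 (fun _ => True) eq_refl (fun _ => x) (fun _ => I)).
    apply sat_ext. intros k. unfold valuation. destruct (s k) eqn:Es; simpl; rewrite ?Es; auto.
Qed.

(** * Preservation of an ordinal definable set *)

Section Forward.
Context {V : structure} {HZF : ZF V} {X Y Z j eta zeta : V}
  {E : elementary_map X Y Z j eta zeta}.
Notation J := (ap j).
Notation fixed := (fixed_by X j).
Notation O := (VV omega).
Implicit Types x y z a b c q u v r l : V.

Lemma fixed_VV a : is_ordinal a -> a ∈ eta -> fixed a -> fixed (VV a).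
Proof.
  intros Oa Ha Fa. assert (HY := em_Y (V := V)). apply is_V_VV in HY as [OY EY].
  apply (fix_def (B := false) (fun v => level_of a v)).
  - exists a. apply Fa.
  - dfn_tac.
  - rewrite EY. now apply VV_in.
  - now apply level_of_VV.
  - intros y _ Hy. now apply level_of_VV in Hy.
Qed.

Lemma fixed_omega : omega ∈ eta -> (exists x, x ∈ X) -> fixed omega.
Proof.
  intros Ha Hne. assert (HY := em_Y (V := V)). apply is_V_VV in HY as [OY EY].
  apply (fix_def (B := false) (fun y => is_limit y /\ forall z, z ∈ y -> ~ is_limit z)); auto.
  - dfn_tac.
  - rewrite EY. now apply ord_sub_VV.
  - split; [apply limit_omega|]. intros z Hz Lz. apply omega_le_limit in Lz.
    apply Lz in Hz. now apply not_in_self in Hz.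
  - intros y _ [Ly Ky]. apply omega_le_limit in Ly as H.
    apply ord_sub in H as [H| ->]; auto using ord_omega.
    destruct (Ky omega H limit_omega).
Qed.

(** [B] itself need not be fixed by [j]. What leads to a contradiction is the existence of some set,
    [b0] in the reflected statement, that has a definition by the same formula and the same failure
    of preservation. *)
Lemma OD_preserved l n r B :
  is_limit l -> l ∈ eta -> l ∈ zeta -> is_limit eta -> is_limit zeta ->
  VV l ⊆ X -> l ∈ X -> J l = l -> (exists a, a ∈ l /\ ~ rel j a a) ->
  is_restriction r j (VV l) -> r ∈ X -> n > 0 -> C (S n) zeta -> OD B ->
  exists k, nontrivial_on k (VV (succ l)) /\
    forall q q', ~ not_preserved k q q' B O omega (VV (succ l)).
Proof.
  intros Hl Hle Hlz Leta Lzeta HVl HlX Jl (a0 & Ha0 & Na0) Hr HrX Hn HC (p & eB & HeB & HpB).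
  assert (HY := em_Y (V := V)). apply is_V_VV in HY as [OY EY].
  assert (HZ := em_Z (V := V)). apply is_V_VV in HZ as [OZ EZ].
  assert (Ol : is_ordinal l) by auto.
  assert (OSl : is_ordinal (succ l)) by auto using ord_succ.
  assert (Hwl : omega ⊆ l) by now apply omega_le_limit.
  assert (Hwe : omega ∈ eta) by (apply (ord_le_lt omega l); auto using ord_omega).
  assert (Fl : fixed l) by (split; auto).
  assert (FSl : fixed (succ l)).
  { apply (fix_def (B := false) (fun y => is_succ l y)); eauto.
    - dfn_tac.
    - rewrite EY. apply ord_sub_VV; auto. now apply limit_succ.
    - now apply is_succ_succ.
    - intros y _ Hy. now apply is_succ_succ in Hy. }
  assert (Fw : fixed omega) by (apply fixed_omega; eauto).
  set (W := VV (succ l)) in *.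
  assert (FW : fixed W) by (apply fixed_VV; auto; now apply limit_succ).
  assert (FO : fixed O) by (apply fixed_VV; auto using ord_omega).
  assert (FVl : fixed (VV l)) by (apply fixed_VV; auto).
  apply NNPP. intros Nk.
  assert (N : forall k, nontrivial_on k W -> exists q q', not_preserved k q q' B O omega W).
  { intros k Hk. apply NNPP. intros Nq. apply Nk. exists k. split; auto. intros q q' H. eauto. }
  destruct (delta0_formula (V := V) (fun e => nontrivial_on (e 0) (e 2))) as (pf & Df & Hpf); [dfn_tac|].
  destruct (delta0_formula (V := V) (fun e => not_preserved (e 2) (e 1) (e 0) (e 3) (e 5) (e 6) (e 4)))
    as (pb & Db & Hpb); [apply def_not_preserved|].
  destruct (delta0_formula (V := V) (fun e => is_ordinal (e 0))) as (po & Do & Hpo); [dfn_tac|].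
  destruct (fv_lt_ex p) as [N0 HN0']. assert (HN0 : fv_lt (S N0) p) by (apply (fv_lt_mono p N0); auto).
  clear HN0'.
  (* [nu] speaks of b and the three constants. In [phi] the [N0] ordinals stand between b and these
     constants and are skipped by [nu'], whereas [p'] skips b. *)
  pose (nu := All (imp pf (Ex (Ex pb)))).
  pose (p' := rename (fun k => match k with 0 => 0 | S k => S (S k) end) p).
  pose (nu' := rename (fun k => match k with 0 => 0 | S k => S (N0 + k) end) nu).
  pose (phi := Ex (And (All (And (imp p' (Eq 0 1)) (imp (Eq 0 1) p'))) nu')).
  (* The first conjunct makes the height of a level a limit, so that the level contains the
     functions on W together with W. *)
  pose (chi := And (All (Ex (Mem 1 0))) (ex_ords po N0 phi)).
  pose (E0 := fun k : nat => match k with 0 => W | 1 => O | _ => omega end).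
  assert (FE0 : forall k, fixed (E0 k)) by (intros [|[|k]]; simpl; auto).
  assert (pre_in : forall (P : V -> Prop) ls, (forall x, In x ls -> P x) -> (forall k, P (E0 k)) ->
    forall k, P (prepend ls E0 k)).
  { intros P ls. induction ls as [|x ls IH]; simpl; intros H1 H2 k; auto.
    destruct k; simpl; auto. }
  assert (sat_phi : forall D ls, all_trans D -> (forall k, D (E0 k)) -> length ls = N0 ->
    (forall x, In x ls -> D x) -> (sat D phi (prepend ls E0) <-> exists b, D b /\
      (forall x, D x -> (sat D p (scons x (prepend ls E0)) <-> x = b)) /\
      (forall k, D k -> nontrivial_on k W -> exists q, D q /\ exists q', D q' /\
        not_preserved k q q' b O omega W))).
  { intros D ls TD HE Hls Hin. assert (HP : forall k, D (prepend ls E0 k)) by (apply pre_in; auto).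
    assert (K1 : forall b, D b -> (sat D (All (And (imp p' (Eq 0 1)) (imp (Eq 0 1) p'))) (scons b (prepend ls E0)) <->
      forall x, D x -> (sat D p (scons x (prepend ls E0)) <-> x = b))).
    { intros b Hb. rewrite sat_All.
      assert (K : forall x, sat D (And (imp p' (Eq 0 1)) (imp (Eq 0 1) p')) (scons x (scons b (prepend ls E0))) <->
        (sat D p (scons x (prepend ls E0)) <-> x = b)).
      { intros x. change (sat D (imp p' (Eq 0 1)) (scons x (scons b (prepend ls E0))) /\
          sat D (imp (Eq 0 1) p') (scons x (scons b (prepend ls E0))) <->
          (sat D p (scons x (prepend ls E0)) <-> x = b)).
        rewrite !sat_imp. unfold p'. rewrite sat_rename.
        rewrite (sat_ext D p _ (scons x (prepend ls E0))) by (intros [|k]; reflexivity).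
        simpl. tauto. }
      split; intros H x Hx; apply K; auto. }
    assert (K2 : forall b, D b -> (sat D nu' (scons b (prepend ls E0)) <->
      forall k, D k -> nontrivial_on k W -> exists q, D q /\ exists q', D q' /\
        not_preserved k q q' b O omega W)).
    { intros b Hb. unfold nu'. rewrite sat_rename.
      rewrite (sat_ext D nu _ (scons b E0)).
      2:{ intros [|k]; simpl; auto. rewrite <- Hls. apply prepend_ge. }
      unfold nu. rewrite sat_All.
      assert (HbE : forall k, D (scons b E0 k)) by (intros [|k]; simpl; auto).
      split.
      - intros H k Hk Hnk. specialize (H k Hk). rewrite sat_imp in H.
        destruct H as (q & Hq & q' & Hq' & Hs).
        + apply Hpf; auto. intros [|i]; simpl; auto.
        + exists q. split; auto. exists q'. split; auto.
          apply Hpb in Hs; auto. intros [|[|[|i]]]; simpl; auto.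
      - intros H k Hk. rewrite sat_imp. intros Hs. apply Hpf in Hs; auto; [|intros [|i]; simpl; auto].
        destruct (H k Hk Hs) as (q & Hq & q' & Hq' & Hs').
        exists q. split; auto. exists q'. split; auto. apply Hpb; auto.
        intros [|[|[|i]]]; simpl; auto. }
    split.
    - intros (b & Hb & H1 & H2). exists b. split; auto. split; [now apply K1|now apply K2].
    - intros (b & Hb & H1 & H2). exists b. split; auto. split; [now apply K1|now apply K2]. }
  assert (sat_chi : forall D, all_trans D -> (forall k, D (E0 k)) -> (sat D chi E0 <->
    (forall x, D x -> exists y, D y /\ x ∈ y) /\ sat D (ex_ords po N0 phi) E0)).
  { intros D TD HE. unfold chi. change (sat D (All (Ex (Mem 1 0))) E0 /\ sat D (ex_ords po N0 phi) E0 <->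
     (forall x, D x -> exists y, D y /\ x ∈ y) /\ sat D (ex_ords po N0 phi) E0).
    rewrite sat_All. simpl. tauto. }
  assert (TT : all_trans (fun _ : V => True)) by (intros x y; auto).
  assert (Hchi : holds chi E0).
  { apply sat_chi; auto. split.
    - intros x _. exists (sing x). split; auto. now apply in_sing.
    - apply sat_ex_ords; auto. exists (map eB (seq 0 N0)).
      rewrite length_map, length_seq. split; auto. split.
      + intros x Hx. split; auto. apply in_map_iff in Hx as (k & <- & _). auto.
      + apply sat_phi; auto.
        * now rewrite length_map, length_seq.
        * exists B. split; auto. split.
          -- intros x _. rewrite <- HpB. apply (sat_agree _ p (S N0)); auto.
             intros [|k] Hk; simpl; auto. rewrite prepend_map by lia. reflexivity.
          -- intros k _ Hk. destruct (N k Hk) as (q & q' & H). eauto. }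
  destruct (reflection chi (succ l) OSl) as (g & Lg & Hlg & Rg).
  assert (Og : is_ordinal g) by auto.
  assert (HE0g : forall k, E0 k ∈ VV g).
  { assert (Hwg : omega ∈ g).
    { apply (ord_le_lt omega l); auto using ord_omega. apply (ord_trans l (succ l)); auto. apply in_succ_self. }
    intros [|[|k]]; simpl.
    - now apply VV_in.
    - now apply VV_in.
    - now apply ord_sub_VV. }
  pose (Good := fun v => is_level v /\ (W ∈ v /\ O ∈ v /\ omega ∈ v) /\ sat (fun x => x ∈ v) chi E0).
  assert (Gg : Good (VV g)).
  { split; [apply is_level_VV; eauto|]. split; [exact (conj (HE0g 0) (conj (HE0g 1) (HE0g 2)))|].
    now apply Rg. }
  assert (GoodE : forall v, Good v -> forall k, E0 k ∈ v).
  { intros v (_ & (H1 & H2 & H3) & _) [|[|k]]; simpl; auto. }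
  destruct (delta0_formula (V := V) (fun e => level_matrix (e 1) (e 2) (e 0) /\
    (e 3 ∈ e 2 /\ e 4 ∈ e 2 /\ e 5 ∈ e 2) /\
    sat (fun x => x ∈ e 2) chi (fun k => match k with 0 => e 3 | 1 => e 4 | _ => e 5 end)))
    as (pm & Dm & Hpm).
  { apply def_and; [dfn_tac|]. apply def_and; [dfn_tac|].
    apply (def_sat chi (fun e => e 2) (fun k e => match k with 0 => e 3 | 1 => e 4 | _ => e 5 end)); [dfn_tac|].
    intros [|[|k]]; dfn_tac. }
  (* The quantifiers are for the level, its history and the test element of [level_matrix]. This
     makes [Phi] a Sigma_2 formula, and [n] is positive. *)
  pose (Phi := Ex (Ex (All pm))).
  assert (SPhi : Sigma (S n) Phi).
  { destruct n as [|n]; [lia|]. apply Sigma_Ex, Sigma_Ex, Sigma_of_Pi, Pi_All.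
    now apply Delta0_Sigma_Pi. }
  assert (Epm : forall D v h x, all_trans D -> (forall k, D (E0 k)) -> D v -> D h -> D x ->
    (sat D pm (scons x (scons h (scons v E0))) <-> level_matrix h v x /\ (W ∈ v /\ O ∈ v /\ omega ∈ v) /\
      sat (fun x => x ∈ v) chi E0)).
  { intros D v h x TD HE Hv Hh Hx. rewrite Hpm; auto; [|intros [|[|[|k]]]; simpl; auto].
    cbn [scons]. rewrite (sat_ext _ chi _ E0) by (intros [|[|k]]; reflexivity). reflexivity. }
  assert (HPhi : holds Phi E0).
  { destruct Gg as ((h & Hh) & H2 & H3). exists (VV g). split; auto. exists h. split; auto.
    apply sat_All. intros x _. apply Epm; auto. }
  assert (FE0Z : forall k, E0 k ∈ Z) by (intros k; apply (fixed_dom (E0 k) (FE0 k)); now right).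
  assert (FE0X : forall k, E0 k ∈ X) by (intros k; apply (FE0 k)).
  assert (FE0Y : forall k, E0 k ∈ Y) by (intros k; apply (fixed_dom (E0 k) (FE0 k)); now left).
  assert (SZ : sat (fun x => x ∈ Z) Phi E0).
  { destruct HC as (v & Hv & HC). assert (v = Z) by (eapply is_V_unique; [exact Hv|apply E]). subst v.
    now apply HC. }
  (* From [Z], where it holds by correctness, [Phi] is pulled back along [j] to [X], its constants
     being fixed, and passed on to [Y]. *)
  assert (SY : sat (fun x => x ∈ Y) Phi E0).
  { apply (proj2 (em_sub (V := V)) Phi E0 FE0X). apply (proj2 (em_elem (V := V)) Phi E0 FE0X).
    revert SZ. apply sat_ext. intros k. apply (proj2 (FE0 k)). }
  assert (TY : all_trans (fun x => x ∈ Y)).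
  { intros x y Hy Hx. rewrite EY in *. now apply (VV_trans eta OY y). }
  assert (GY : exists v, v ∈ Y /\ Good v).
  { destruct SY as (v & Hv & h & Hh & SY). rewrite sat_All in SY.
    assert (K : forall x, x ∈ Y -> level_matrix h v x /\ (W ∈ v /\ O ∈ v /\ omega ∈ v) /\
      sat (fun x => x ∈ v) chi E0) by (intros x Hx; apply (Epm (fun x => x ∈ Y)); auto).
    exists v. split; auto. destruct (K _ (FE0Y 0)) as (_ & H2 & H3). split; [|split; auto].
    apply (is_level_abs eta); auto; [now rewrite <- EY|]. exists h. rewrite <- EY. split; auto.
    intros x Hx. apply (K x Hx). }
  assert (HSat : forall (DD : (V -> Prop) -> Prop) (Q : V -> Prop), trans_domains DD ->
      (forall c, fixed c -> Q c /\ forall D, DD D -> D c) ->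
      definable false DD Q (fun e => sat (fun x => x ∈ e 0) chi E0)).
  { intros DD Q HT HQ. apply (def_sat chi (fun e => e 0) (fun k e => E0 k)); [apply is_term_var|].
    intros k. destruct (HQ _ (FE0 k)). now apply is_term_const. }
  assert (HS1 : dfn (fun e => sat (fun x => x ∈ e 0) chi E0)).
  { apply HSat; [typeclasses eauto|]. intros c _. split; [exact I|apply univ_I]. }
  assert (HS2 : definable false (two_domains Y Z) fixed (fun e => sat (fun x => x ∈ e 0) chi E0)).
  { apply HSat; [typeclasses eauto|]. intros c Hc. split; auto. now apply fixed_dom. }
  assert (HG1 : dfn (fun e => Good (e 0))) by (unfold Good; apply def_and; [dfn_tac|apply def_and; [dfn_tac|auto]]).
  assert (HG2 : definable false (two_domains Y Z) fixed (fun e => Good (e 0)))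
    by (unfold Good; apply def_and; [dfn_tac|apply def_and; [dfn_tac|auto]]).
  destruct GY as (v1 & Hv1 & Gv1).
  (* Levels are linearly ordered by membership, so the least good one is unique and therefore
     fixed. *)
  destruct (least_in Good Y v1) as (v0 & Hv0 & Gv0 & Kv0); auto.
  { intros y Hy x Hx. now apply (TY x y). }
  assert (Fv0 : fixed v0).
  { apply (fix_def (B := false) (fun v => Good v /\ forall v', v' ∈ v -> ~ Good v')); eauto.
    - dfn_tac.
    - intros y _ [Gy Ky]. destruct (level_linear y v0) as [L|[L|L]]; auto.
      + apply Gy.
      + apply Gv0.
      + destruct (Kv0 y L Gy).
      + destruct (Ky v0 L Gv0). }
  assert (HE0v := GoodE v0 Gv0).
  destruct Gv0 as (Lv0 & HWv & Sv0).
  apply is_level_VV in Lv0 as (g0 & Og0 & Ev0).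
  assert (Tv0 : transitive_set v0) by (rewrite Ev0; now apply VV_trans).
  assert (TDv : all_trans (fun x => x ∈ v0)) by (intros x y Hy Hx; now apply (Tv0 y)).
  apply sat_chi in Sv0 as [Hlim Sv0]; auto.
  assert (Lg0 : is_limit g0).
  { destruct (ord_cases g0 Og0) as [->|[(b & Ob & ->)|]]; auto; exfalso.
    - destruct HWv as [HWv _]. rewrite Ev0 in HWv. apply in_VV in HWv as (b & Hb & _); auto.
      now apply in_emp in Hb.
    - destruct (Hlim (VV b)) as (y & Hy & Hby).
      + rewrite Ev0. apply VV_in; auto. apply in_succ_self.
      + rewrite Ev0 in Hy. apply VV_succ in Hy; auto. apply Hy in Hby. now apply not_in_self in Hby. }
  destruct (fixed_ex_ords v0 po Fv0 Tv0) with (p := phi) (n := N0) (e := E0) as (ls & Hls & Hin & Sphi); auto.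
  apply sat_phi in Sphi; auto; [|intros x Hx; now apply Hin].
  destruct Sphi as (b0 & Hb0 & Ub0 & Nb0).
  assert (Fb0 : fixed b0).
  { assert (FP : forall k, fixed (prepend ls E0 k)).
    { apply pre_in; auto. intros x Hx. now apply Hin. }
    apply (fix_def (B := false) (fun b => b ∈ v0 /\ sat (fun x => x ∈ v0) p (scons b (prepend ls E0)))); eauto.
    - apply def_and; [dfn_tac|].
      apply (def_equiv' (fun e => sat (fun x => x ∈ v0) p (fun k => match k with 0 => e 0 | S k => prepend ls E0 k end))).
      + intros e. apply sat_ext. intros [|k]; reflexivity.
      + apply (def_sat p (fun e => v0) (fun k e => match k with 0 => e 0 | S k => prepend ls E0 k end)); [dfn_tac|].
        intros [|k]; [dfn_tac|]. specialize (FP k). dfn_tac.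
    - split; auto. now apply Ub0.
    - intros y _ [Hy Sy]. now apply Ub0. }
  destruct (extension_ex Hl HVl HlX Jl (proj1 FVl) r Hr) as (k & Hk & Uk & Ek). fold W in Hk, Uk, Ek.
  assert (Hkv : k ∈ v0).
  { rewrite Ev0. apply (VV_fun_limit g0 k W W); auto; try (rewrite <- Ev0; apply HWv). apply Hk. }
  assert (Ha0X : a0 ∈ X) by (apply HVl, ord_sub_VV; auto).
  assert (Ha0W : a0 ∈ W).
  { apply ord_sub_VV; auto. apply in_succ; auto. }
  assert (NTk : nontrivial_on k W).
  { split; [apply Hk|]. exists a0. split; auto. intros Ra. apply Na0. apply rel_J. split; auto.
    rewrite <- Ek by auto. symmetry. eapply ap_eq; [apply Hk|exact Ra]. }
  pose (DD1 := fun D : V -> Prop => D = (fun x => x ∈ Y)).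
  assert (HT1 : trans_domains DD1) by (intros D ->; exact TY).
  pose (inX := fun c => c ∈ X).
  assert (Hc1 : forall c, inX c -> forall D, DD1 D -> D c).
  { intros c Hc D ->. now apply (em_sub (V := V)). }
  assert (FX : forall c, fixed c -> inX c) by (intros c; apply proj1).
  assert (FVl' := FX _ FVl). assert (FW' := FX _ FW). assert (FO' := FX _ FO).
  assert (Fw' := FX _ Fw). assert (Fb0' := FX _ Fb0). assert (Fv0' := FX _ Fv0).
  change (inX r) in HrX.
  assert (HkX : inX k).
  { destruct (hull_witness (B := false) (DD := DD1) (Q := inX)
      (fun e => extends_to r (e 0) (VV l) W) (fun _ => l)) as (k' & Hk'X & Hk'); auto.
    - dfn_tac.
    - reflexivity.
    - exists k. split; auto. now apply (TY k v0).
    - simpl in Hk'. now rewrite <- (Uk k' Hk'). }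
  destruct (Nb0 k Hkv NTk) as (q1 & Hq1 & q1' & Hq1' & Hqq1).
  (* Only q is required to be in [X]; its companion [q2'] will turn out to be [J q]. *)
  destruct (hull_witness (B := false) (DD := DD1) (Q := inX)
      (fun e => exists q', q' ∈ v0 /\ not_preserved k (e 0) q' b0 O omega W) (fun _ => l)) as (q & HqX & q2' & Hq2' & Hqq2); auto.
  { unfold not_preserved, composed. dfn_tac. }
  { reflexivity. }
  { exists q1. split; [now apply (TY q1 v0)|]. exists q1'. auto. }
  simpl in Hqq2. change (inX q) in HqX.
  destruct Hqq2 as [(c & Hc & u & _ & s & _ & u' & _ & s' & _ & Hqc & Hqc' & Hs & Hs' & Hcomp) Nq].
  apply is_opair_opair in Hqc, Hqc'.
  assert (HcX : c ∈ X).
  { apply HVl. apply (VV_mono omega l); auto using ord_omega. }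
  assert (Jc : J c = c).
  { apply (J_fix_below omega); auto using ord_omega.
    - apply (sub_trans _ (VV l)); auto. apply VV_mono; auto using ord_omega.
    - intros m Hm. apply in_omega in Hm. apply J_nat; auto.
      intros z Hz. apply HVl, ord_sub_VV; auto. }
  assert (HsX : s ∈ X).
  { change (inX c) in HcX.
    destruct (hull_witness (B := false) (DD := DD1) (Q := inX) (fun e => is_opair q c (e 0)) (fun _ => l))
      as (s1 & Hs1 & Hq1s); auto.
    - dfn_tac.
    - reflexivity.
    - exists s. split; [|now apply is_opair_opair].
      apply (TY s (upair c s)); [|apply in_upair; auto].
      apply (TY _ q); [now apply (em_sub (V := V))|]. rewrite Hqc. apply in_upair; auto.
    - simpl in Hq1s. apply is_opair_opair in Hq1s. rewrite Hqc in Hq1s. apply opair_inj in Hq1s as [_ ->]. auto. }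
  assert (Jw : J omega = omega) by apply Fw. assert (JW : J W = W) by apply FW.
  assert (HJs : is_fun (J s) omega W).
  { rewrite <- Jw, <- JW. apply (proj1 (J_fun s omega W HsX Fw' FW')); auto. }
  (* At a natural number m, which is fixed, both have the value [J (ap s m)]: [s'] because [k]
     agrees with [j] on [X], and [J s] by elementarity. *)
  assert (Es' : s' = J s).
  { apply (fun_ext s' (J s) omega W W); auto. intros m Hm.
    assert (HmX : inX m) by (apply HVl, ord_sub_VV; auto).
    assert (Jm : J m = m).
    { apply J_nat; [|now apply in_omega]. intros z Hz. apply HVl, ord_sub_VV; auto. }
    destruct (Hcomp m Hm) as (x & Hx & y & Hy & R1 & R2 & R3).
    assert (HxX : x ∈ X).
    { change (inX s) in HsX.
      destruct (hull_witness (B := false) (DD := DD1) (Q := inX) (fun e => rel s m (e 0)) (fun _ => l))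
        as (x1 & Hx1 & Rx1); auto.
      - dfn_tac.
      - reflexivity.
      - exists x. split; auto. apply (TY x W); auto. now apply (em_sub (V := V)).
      - simpl in Rx1. now rewrite (fun_func s omega W m x x1). }
    rewrite (ap_eq s' omega W m y) by auto.
    symmetry. apply (ap_eq (J s) omega W); auto.
    rewrite <- Jm. apply (rel_ap k W W) in R2 as [_ ->]; [|apply Hk]. rewrite Ek by auto.
    now apply (proj1 (J_rel s m x HsX HmX HxX)). }
  assert (Jq : J q = q2').
  { rewrite Hqc, J_opair; auto; [|now rewrite <- Hqc]. now rewrite Jc, <- Es', Hqc'. }
  apply Nq. rewrite <- Jq. rewrite (J_mem q b0 HqX Fb0') at 1.
  assert (Jb0 : J b0 = b0) by apply Fb0. now rewrite Jb0.
Qed.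

End Forward.

Section Forward_theorem.
Context {V : structure} {HZF : ZF V}.

Theorem ultraexacting_embedding (l A : V) : ultraexacting l -> A ⊆ VV (succ l) -> OD A ->
  exists j : V, elementary_embedding (VV (succ l)) (Some A) (VV (succ l)) (Some A) j /\
    exists x : V, x ∈ VV (succ l) /\ ~ rel j x x.
Proof.
  intros (Hlc & Vl & HVl & n & eta & X & zeta & j & Hw & r & Hr & HrX) HA HOD.
  destruct Hw as (Hn & (Ceta & _ & Hle) & (Y & HY & HXY) & (HVX & HlX) & (Czeta & HCz & Hlz) &
    (Z & HZ & Hj) & Rl & Hmove).
  apply is_V_VV in HVl as [Ol ->].
  assert (Hl : is_limit l) by now apply limit_cardinal_limit.
  assert (OW : is_ordinal (succ l)) by auto using ord_succ.
  assert (E : elementary_map X Y Z j eta zeta).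
  { constructor; auto.
    - now apply substructure_elem.
    - apply Hj.
    - eapply embedding_elem; eauto. }
  assert (Jl : ap j l = l) by (apply rel_J in Rl; symmetry; tauto).
  assert (inf : forall k, is_cardinal k -> l ∈ k -> is_limit k).
  { intros k Hk Hlk. apply infinite_cardinal_limit; auto.
    apply (sub_trans _ l); [now apply omega_le_limit|]. apply ord_sub; auto. apply Hk. }
  apply NNPP. intros N.
  set (W := VV (succ l)) in *.
  (* The satisfaction relation as one set of pairs: preserving membership in it along [k] is
     elementarity for all formulas of the model at once. *)
  pose (isB := fun a W' q : V => exists c s : V, is_opair q c s /\ is_formula true c /\ is_assignment W' s /\
    satisfies W' (Some a) c s).
  assert (HisB : forall Q, definable false univ Q (fun e => isB (e 0) (e 1) (e 2))).
  { intros Q. unfold isB. dfn_tac.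
    apply (def_subst4 (fun W A c s => satisfies W (Some A) c s)); [apply def_satisfies_Some|dfn_tac..]. }
  destruct (sep_ex (isB A W) (prod (VV omega) (pow (prod omega W)))) as [B HB].
  { apply (def_subst3 isB); [apply HisB|dfn_tac..]. }
  assert (HB' : forall q, q ∈ B <-> isB A W q).
  { intros q. rewrite HB. split; [tauto|]. intros H. split; auto.
    destruct H as (c & s & Ho & Hc & Hs & _). apply is_opair_opair in Ho. subst q.
    apply opair_in_prod. split; [now apply (formula_Vomega true)|].
    apply in_pow, fun_sub_prod. now apply assignment_fun. }
  assert (ODB : OD B).
  { apply definable_OD.
    (* Only ordinals may serve as constants here, so [A] enters through its own definition and W
       through [l]. *)
    apply (def_equiv' (fun e => exists a, a = A /\ exists m, is_succ l m /\ exists W', is_V m W' /\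
      forall q, q ∈ e 0 <-> isB a W' q)).
    - intros e. split.
      + intros (a & -> & m & Hm & W' & HW' & H). apply is_succ_succ in Hm. subst m.
        apply is_V_VV in HW' as [_ ->]. apply ext. intros q. now rewrite H, HB'.
      + intros ->. exists A. split; auto. exists (succ l). split; [now apply is_succ_succ|].
        exists W. split; [now apply is_V_VV|]. exact HB'.
    - apply (def_ex (fun a e => a = A /\ exists m, is_succ l m /\ exists W', is_V m W' /\
        forall q, q ∈ e 0 <-> isB a W' q)); [reflexivity|dfn_side|].
      apply def_and; [now apply OD_definable|]. dfn_tac. }
  destruct (OD_preserved l n r B) as (k & [Hk [x [Hx Nx]]] & Kk); auto.
  apply N. exists k. split; [|eauto].
  split; [reflexivity|]. split; auto. intros c s s' Hc Hs Hs' Hcomp.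
  assert (Fs := proj1 (assignment_fun W s) Hs). assert (Fs' := proj1 (assignment_fun W s') Hs').
  assert (K : opair c s ∈ B <-> opair c s' ∈ B).
  { apply NNPP. intros NN. apply (Kk (opair c s) (opair c s')). split; auto.
    assert (U : forall t, upair c t ∈ opair c t /\ t ∈ upair c t).
    { intros t. split; apply in_upair; auto. }
    exists c. split; [now apply (formula_Vomega true)|].
    exists (upair c s). split; [apply U|]. exists s. split; [apply U|].
    exists (upair c s'). split; [apply U|]. exists s'. split; [apply U|].
    rewrite !is_opair_opair. repeat (split; auto).
    intros m Hm. exists (ap s m). split; [eapply ap_in; eauto|].
    exists (ap s' m). split; [eapply ap_in; eauto|].
    assert (R1 : rel s m (ap s m)) by (eapply ap_rel; eauto).
    assert (R2 : rel k (ap s m) (ap k (ap s m))) by (eapply ap_rel; eauto; eapply ap_in; eauto).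
    specialize (Hcomp m _ _ R1 R2). rewrite <- (ap_eq s' omega W m _ Fs' Hcomp) in R2.
    split; auto. split; auto. eapply ap_rel; eauto. }
  rewrite !HB' in K.
  assert (KB : forall t, is_assignment W t -> (isB A W (opair c t) <-> satisfies W (Some A) c t)).
  { intros t Ht. split.
    - intros (c' & t' & Ho & _ & _ & H). apply is_opair_opair, opair_inj in Ho as [-> ->]. auto.
    - intros H. exists c, t. rewrite is_opair_opair. auto. }
  now rewrite !KB in K by auto.
Qed.

End Forward_theorem.

(** * Injections, Cantor-Bernstein and Hartogs *)

Definition is_injection {V : structure} (f a b : V) : Prop :=
  is_fun f a b /\ forall x, x ∈ a -> forall x', x' ∈ a -> forall y, y ∈ b ->
    rel f x y -> rel f x' y -> x = x'.

Lemma def_is_injection {V : structure} {b DD} {Q : V -> Prop} {HT : trans_domains DD} :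
  definable b DD Q (fun e => is_injection (e 0) (e 1) (e 2)).
Proof. unfold is_injection. dfn_tac. Qed.
#[export] Hint Resolve def_is_injection : dfn.

Section Injections.
Context {V : structure} {HZF : ZF V}.
Implicit Types x y z a b c f g h u v : V.

Lemma injection_ap f a b : is_injection f a b <->
  is_fun f a b /\ forall x x', x ∈ a -> x' ∈ a -> ap f x = ap f x' -> x = x'.
Proof.
  split; intros [Hf H]; split; auto.
  - intros x x' Hx Hx' E. apply (H x Hx x' Hx' (ap f x)).
    + eapply ap_in; eauto.
    + eapply ap_rel; eauto.
    + rewrite E. eapply ap_rel; eauto.
  - intros x Hx x' Hx' y _ H1 H2. apply H; auto.
    rewrite (ap_eq f a b x y), (ap_eq f a b x' y); auto.
Qed.

Lemma injection_comp f g a b c : is_injection f a b -> is_injection g b c ->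
  exists h, is_injection h a c /\ forall x, x ∈ a -> ap h x = ap g (ap f x).
Proof.
  intros Hf Hg. apply injection_ap in Hf as [Ff If], Hg as [Fg Ig].
  destruct (comp_fun f g a b c Ff Fg) as (h & Fh & Eh). exists h. split; auto.
  apply injection_ap. split; auto. intros x x' Hx Hx' E. rewrite !Eh in E by auto.
  apply If; auto. apply Ig; auto; eapply ap_in; eauto.
Qed.

Lemma injection_sub a b : a ⊆ b -> exists f, is_injection f a b /\ forall x, x ∈ a -> ap f x = x.
Proof.
  intros H. destruct (fun_ex (fun x y => y = x) a b) as (f & Hf & _ & E).
  - dfn_tac.
  - intros x Hx. eauto.
  - congruence.
  - exists f. split; auto. apply injection_ap. split; auto. intros x x' Hx Hx' K.
    now rewrite !E in K by auto.
Qed.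

Lemma injection_restrict f a b a' : is_injection f a b -> a' ⊆ a ->
  exists g, is_injection g a' b /\ forall x, x ∈ a' -> ap g x = ap f x.
Proof.
  intros Hf Ha. destruct (injection_sub a' a Ha) as (i & Hi & Ei).
  destruct (injection_comp i f a' a b Hi Hf) as (h & Hh & Eh). exists h. split; auto.
  intros x Hx. now rewrite Eh, Ei.
Qed.

Lemma bijection_injections f a b : is_bijection f a b ->
  is_injection f a b /\ exists g, is_injection g b a.
Proof.
  intros [Hf H]. split.
  - split; auto. intros x Hx x' Hx' y Hy H1 H2. destruct (H y Hy) as (z & _ & U).
    rewrite <- (U x), <- (U x'); auto.
  - destruct (fun_ex (fun y x => rel f x y) b a) as (g & Hg & _ & E).
    + dfn_tac.
    + intros y Hy. destruct (H y Hy) as (x & [Hx Hr] & _). eauto.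
    + intros y x x' Hy Hx Hx' H1 H2. destruct (H y Hy) as (z & _ & U).
      rewrite <- (U x), <- (U x'); auto.
    + exists g. apply injection_ap. split; auto. intros y y' Hy Hy' K.
      assert (H1 := E y Hy). assert (H2 := E y' Hy'). rewrite K in H1. now apply (fun_func f a b (ap g y')).
Qed.

(** [S] is the least subset of [a] that contains the points outside the range of [g] and is closed
    under [f] followed by [g]. The bijection is [f] on [S] and the inverse of [g] elsewhere.
    Defining [S] as an intersection avoids a recursion. *)
Lemma cantor_bernstein f g a b : is_injection f a b -> is_injection g b a ->
  exists h, is_bijection h a b.
Proof.
  intros Hf Hg. apply injection_ap in Hf as [Ff If], Hg as [Fg Ig].
  pose (cl := fun T => (forall y, y ∈ a -> (forall z, ~ rel g z y) -> y ∈ T) /\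
    forall y z u, y ∈ T -> rel f y z -> rel g z u -> u ∈ T).
  assert (Hcl : dfn (fun e => cl (e 0))) by (unfold cl; dfn_tac).
  pose (S := sep a (fun x => forall T, cl T -> x ∈ T)).
  assert (HS : forall x, x ∈ S <-> x ∈ a /\ forall T, cl T -> x ∈ T).
  { intros x. apply (in_sep (fun x => forall T, cl T -> x ∈ T)). dfn_tac. }
  assert (clS : cl S).
  { split.
    - intros y Hy N. apply HS. split; auto. intros T HT. now apply HT.
    - intros y z u Hy H1 H2. apply HS in Hy as [Hy K]. apply HS. split.
      + eapply fun_cod; [exact Fg|eauto].
      + intros T HT. apply (proj2 HT y z u); auto. }
  assert (Sinv : forall x z, x ∈ S -> rel g z x -> exists y, y ∈ S /\ rel f y z).
  { intros x z Hx Hz.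
    pose (T := sep S (fun x => (forall z, ~ rel g z x) \/ exists y z, y ∈ S /\ rel f y z /\ rel g z x)).
    assert (HT : forall x, x ∈ T <-> x ∈ S /\ ((forall z, ~ rel g z x) \/ exists y z, y ∈ S /\ rel f y z /\ rel g z x)).
    { intros u. apply (in_sep (fun x => (forall z, ~ rel g z x) \/ exists y z, y ∈ S /\ rel f y z /\ rel g z x)). dfn_tac. }
    assert (K : x ∈ T).
    { apply HS in Hx as [_ Hx]. apply Hx. split.
      - intros y Hy N. apply HT. split; auto. now apply clS.
      - intros y w u Hy H1 H2. apply HT in Hy as [Hy _]. apply HT. split; [|right; eauto].
        apply (proj2 clS y w u); auto. }
    apply HT in K as [_ [N|(y & z' & Hy & H1 & H2)]]; [destruct (N z Hz)|].
    exists y. split; auto. replace z with z'; auto.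
    apply Ig; try (eapply fun_dom; eauto).
    rewrite (ap_eq g b a z x), (ap_eq g b a z' x); auto. }
  assert (Snot : forall x, x ∈ a -> x ∉ S -> exists z, rel g z x).
  { intros x Hx N. apply NNPP. intros N'. apply N, clS; auto. intros z Hz. eauto. }
  destruct (fun_ex (fun x y => (x ∈ S /\ rel f x y) \/ (x ∉ S /\ rel g y x)) a b) as (h & Fh & Rh & _).
  - dfn_tac.
  - intros x Hx. destruct (classic (x ∈ S)) as [K|K].
    + exists (ap f x). split; [eapply ap_in; eauto|]. left. split; auto. eapply ap_rel; eauto.
    + destruct (Snot x Hx K) as [z Hz]. exists z. split; [eapply fun_dom; eauto|]. auto.
  - intros x y y' _ _ _ [[K H]|[K H]] [[K' H']|[K' H']]; try tauto.
    + now apply (fun_func f a b x).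
    + apply Ig; try (eapply fun_dom; eauto). rewrite (ap_eq g b a y x), (ap_eq g b a y' x); auto.
  - exists h. split; auto. intros y Hy.
    assert (Hr : rel g y (ap g y)) by (eapply ap_rel; eauto).
    assert (Hga : ap g y ∈ a) by (eapply ap_in; eauto).
    destruct (classic (ap g y ∈ S)) as [K|K].
    + destruct (Sinv _ y K Hr) as (x & Hx & Hxy). assert (Hxa : x ∈ a) by (apply HS in Hx; tauto).
      exists x. split.
      * split; auto. apply Rh. auto.
      * intros x' [Hx' Hr']. apply Rh in Hr' as (_ & _ & [[K1 H1]|[K1 H1]]).
        -- apply If; auto. rewrite (ap_eq f a b x y), (ap_eq f a b x' y); auto.
        -- destruct K1. rewrite <- (ap_eq g b a y x'); auto.
    + exists (ap g y). split.
      * split; auto. apply Rh. auto.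
      * intros x' [Hx' Hr']. apply Rh in Hr' as (_ & _ & [[K1 H1]|[K1 H1]]).
        -- destruct K. apply (proj2 clS x' y); auto.
        -- eapply ap_eq; eauto.
Qed.

(* The order that an injection of an ordinal induces on its range determines the ordinal. *)
Definition induced_order f a r : Prop :=
  forall p, p ∈ r <-> exists x y, x ∈ a /\ y ∈ a /\ x ⊆ y /\ exists u v, rel f x u /\ rel f y v /\ is_opair p u v.

(** Both maps enumerate the same set in the same order, so by induction they agree: at each place
    the least element not yet taken has to come next. *)
Lemma induced_order_unique f f' a a' b r : is_ordinal a -> is_ordinal a' ->
  is_injection f a b -> is_injection f' a' b -> induced_order f a r -> induced_order f' a' r -> a = a'.
Proof.
  assert (main : forall f f' a a', is_ordinal a -> is_ordinal a' ->
    is_injection f a b -> is_injection f' a' b -> induced_order f a r -> induced_order f' a' r -> a ⊆ a').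
  { clear - HZF. intros f f' a a' Oa Oa' Hf Hf' Hr Hr'.
    apply injection_ap in Hf as [Ff If], Hf' as [Ff' If'].
    assert (R : forall x y, x ∈ a -> y ∈ a -> (x ⊆ y <-> opair (ap f x) (ap f y) ∈ r)).
    { intros x y Hx Hy. rewrite (Hr (opair (ap f x) (ap f y))). split.
      - intros H. exists x, y. repeat (split; auto). exists (ap f x), (ap f y).
        split; [eapply ap_rel; eauto|]. split; [eapply ap_rel; eauto|]. now apply is_opair_opair.
      - intros (x1 & y1 & Hx1 & Hy1 & L & u & v & H1 & H2 & Ho).
        apply is_opair_opair, opair_inj in Ho as [E1 E2].
        apply (rel_ap f a b) in H1 as [_ ->]; auto. apply (rel_ap f a b) in H2 as [_ ->]; auto.
        apply If in E1, E2; auto. now subst. }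
    assert (R' : forall x y, x ∈ a' -> y ∈ a' -> (x ⊆ y <-> opair (ap f' x) (ap f' y) ∈ r)).
    { intros x y Hx Hy. rewrite (Hr' (opair (ap f' x) (ap f' y))). split.
      - intros H. exists x, y. repeat (split; auto). exists (ap f' x), (ap f' y).
        split; [eapply ap_rel; eauto|]. split; [eapply ap_rel; eauto|]. now apply is_opair_opair.
      - intros (x1 & y1 & Hx1 & Hy1 & L & u & v & H1 & H2 & Ho).
        apply is_opair_opair, opair_inj in Ho as [E1 E2].
        apply (rel_ap f' a' b) in H1 as [_ ->]; auto. apply (rel_ap f' a' b) in H2 as [_ ->]; auto.
        apply If' in E1, E2; auto. now subst. }
    assert (cor : forall x, x ∈ a -> exists x', x' ∈ a' /\ ap f x = ap f' x').
    { intros x Hx. assert (K : opair (ap f x) (ap f x) ∈ r) by (apply R; auto using sub_refl).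
      apply Hr' in K as (x1 & y1 & Hx1 & _ & _ & u & v & H1 & _ & Ho).
      apply is_opair_opair, opair_inj in Ho as [E1 _]. apply (rel_ap f' a' b) in H1 as [_ ->]; auto.
      eauto. }
    assert (cor' : forall x', x' ∈ a' -> exists x, x ∈ a /\ ap f x = ap f' x').
    { intros x Hx. assert (K : opair (ap f' x) (ap f' x) ∈ r) by (apply R'; auto using sub_refl).
      apply Hr in K as (x1 & y1 & Hx1 & _ & _ & u & v & H1 & _ & Ho).
      apply is_opair_opair, opair_inj in Ho as [E1 _]. apply (rel_ap f a b) in H1 as [_ ->]; auto.
      eauto. }
    assert (fixp : forall x, is_ordinal x -> x ∈ a -> forall u, rel f x u -> rel f' x u).
    { apply (ord_ind (fun x => x ∈ a -> forall u, rel f x u -> rel f' x u)); [dfn_tac|].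
      intros x Ox IH Hx u Hu. apply (rel_ap f a b) in Hu as [_ ->]; auto.
      assert (IH' : forall y, y ∈ x -> y ∈ a' /\ ap f y = ap f' y).
      { intros y Hy. assert (Hya : y ∈ a) by now apply (ord_trans y x).
        assert (K : rel f' y (ap f y)) by (apply IH; auto; eapply ap_rel; eauto).
        apply (rel_ap f' a' b) in K; auto. }
      destruct (cor x Hx) as (x' & Hx' & E).
      assert (Ox' : is_ordinal x') by (apply (ord_in a'); auto).
      assert (x' = x); [|subst x'; apply (rel_ap f' a' b); auto].
      destruct (ord_tri x' x) as [L|[L|L]]; auto.
      - destruct (IH' x' L) as [_ E']. rewrite <- E' in E.
        assert (Hxa : x' ∈ a) by now apply (ord_trans x' x).
        apply If in E; auto.
      - assert (Hxa' : x ∈ a') by now apply (ord_trans x x').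
        destruct (cor' x Hxa') as (z & Hz & Ez).
        assert (Oz : is_ordinal z) by (apply (ord_in a); auto).
        assert (Lz : z ⊆ x).
        { apply R; auto. rewrite Ez, E. apply R'; auto. apply ord_sub; auto. }
        apply ord_sub in Lz as [Lz| ->]; auto.
        + destruct (IH' z Lz) as [Hza' Ez']. rewrite Ez' in Ez. apply If' in Ez; auto. subst z.
          now apply not_in_self in Lz.
        + rewrite E in Ez. apply If' in Ez; auto. }
    intros x Hx. assert (K : rel f' x (ap f x)).
    { apply fixp; auto; [apply (ord_in a); auto|]. eapply ap_rel; eauto. }
    eapply fun_dom; eauto. }
  intros. apply sub_antisym; eauto.
Qed.

(** Choice-free: an ordinal injecting into [a] is determined by the order induced on the range, so
    replacement on the relations on [a] yields all these ordinals. *)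
Lemma hartogs a : exists h, is_ordinal h /\
  (forall b, b ∈ h <-> is_ordinal b /\ exists f, is_injection f b a).
Proof.
  destruct (repl_ex (fun r b => is_ordinal b /\ exists f, is_injection f b a /\ induced_order f b r)
    (pow (prod a a))) as [h Hh].
  - unfold induced_order. dfn_tac.
  - intros r b b' _ (Ob & f & Hf & Hr) (Ob' & f' & Hf' & Hr').
    apply (induced_order_unique f f' b b' a r); auto.
  - assert (Hh' : forall b, b ∈ h <-> is_ordinal b /\ exists f, is_injection f b a).
    { intros b. rewrite Hh. split.
      - intros (r & _ & Ob & f & Hf & _). eauto.
      - intros (Ob & f & Hf).
        assert (Hd : dfn (fun e : nat -> V => exists x y, x ∈ b /\ y ∈ b /\ x ⊆ y /\
          exists u v, rel f x u /\ rel f y v /\ is_opair (e 0) u v)) by dfn_tac.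
        exists (sep (prod a a) (fun p => exists x y, x ∈ b /\ y ∈ b /\ x ⊆ y /\
          exists u v, rel f x u /\ rel f y v /\ is_opair p u v)).
        split; [apply in_pow; intros p Hp; now apply in_sep in Hp|]. split; auto. exists f. split; auto.
        intros p. rewrite in_sep by auto. split; [tauto|]. intros H. split; auto.
        destruct H as (x & y & _ & _ & _ & u & v & H1 & H2 & Ho). apply is_opair_opair in Ho. subst p.
        apply opair_in_prod. split; (eapply fun_cod; [apply Hf|eauto]). }
    exists h. split; auto. split.
    + intros b Hb c Hc. apply Hh' in Hb as (Ob & f & Hf). apply Hh'. split; [apply (ord_in b); auto|].
      destruct (injection_restrict f b a c Hf) as (g & Hg & _); eauto. apply (proj1 Ob c Hc).
    + intros b Hb. apply Hh' in Hb as [[Tb _] _]. exact Tb.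
Qed.

Lemma cardinal_above a : is_ordinal a -> exists k, is_cardinal k /\ a ∈ k.
Proof.
  intros Oa. destruct (hartogs a) as (h & Oh & Hh). exists h.
  assert (Ha : a ∈ h).
  { apply Hh. split; auto. destruct (injection_sub a a (sub_refl a)) as (f & Hf & _). eauto. }
  split; auto. split; auto. intros b Hb (f & Hf).
  apply bijection_injections in Hf as (_ & g & Hg).
  apply Hh in Hb as (_ & f' & Hf'). destruct (injection_comp g f' h b a Hg Hf') as (i & Hi & _).
  apply (not_in_self h). apply Hh. eauto.
Qed.

Lemma limit_of_cardinals a : is_ordinal a ->
  (forall b, b ∈ a -> exists k, is_cardinal k /\ b ∈ k /\ k ∈ a) -> is_cardinal a.
Proof.
  intros Oa H. split; auto. intros b Hb (f & Hf).
  destruct (H b Hb) as (k & [Ok Hk] & Hbk & Hka).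
  apply bijection_injections in Hf as (_ & g & Hg).
  destruct (injection_restrict g a b k Hg) as (g' & Hg' & _); [now apply (proj1 Oa k)|].
  destruct (injection_sub b k) as (i & Hi & _); [now apply (proj1 Ok b)|].
  apply (Hk b Hbk). eapply cantor_bernstein; eauto.
Qed.

End Injections.

(** * Closed unbounded classes of ordinals inside [C(n)] *)

Section Correct.
Context {V : structure} {HZF : ZF V}.
Implicit Types x y z a b c f g h s v : V.

Definition truth a c s : Prop :=
  exists v, is_V a v /\ is_assignment v s /\ satisfies v None c s.

(* [K (S m)] consists of the points of [K m] that already see every formula which
   persists upwards along [K m] and is true at some larger point of [K m]. *)
Fixpoint K (m : nat) a : Prop :=
  match m with
  | 0 => is_ordinal a /\ (exists b, b ∈ a) /\
      forall b, b ∈ a -> exists k, is_cardinal k /\ b ∈ k /\ k ∈ a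
  | S m => K m a /\ forall c, is_formula false c ->
      (forall x y s, K m x -> K m y -> x ⊆ y -> truth x c s -> truth y c s) ->
      forall v s, is_V a v -> is_assignment v s ->
      forall b, K m b -> a ⊆ b -> truth b c s -> truth a c s
  end.

Lemma def_truth {Q : V -> Prop} : definable false univ Q (fun e => truth (e 0) (e 1) (e 2)).
Proof.
  unfold truth. dfn_tac.
  apply (def_subst3 (fun X c s => satisfies X None c s)); [apply def_satisfies_None|dfn_tac..].
Qed.
#[local] Hint Resolve def_truth : dfn.

Lemma def_K {Q : V -> Prop} m : definable false univ Q (fun e => K m (e 0)).
Proof. induction m; simpl; dfn_tac. Qed.
#[local] Hint Resolve def_K : dfn.

Lemma truth_VV a c s : is_ordinal a -> (truth a c s <-> is_fun s omega (VV a) /\ satisfies (VV a) None c s).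
Proof.
  intros Oa. unfold truth. split.
  - intros (v & Hv & Hs & H). apply is_V_VV in Hv as [_ ->]. split; auto. now apply assignment_fun.
  - intros [H1 H2]. exists (VV a). rewrite is_V_VV. split; auto. split; auto. now apply assignment_fun.
Qed.

Lemma K_K0 m a : K m a -> K 0 a.
Proof. induction m; [auto|]. intros [H _]. exact (IHm H). Qed.

Lemma K_limit m a : K m a -> is_limit a.
Proof.
  intros H. apply K_K0 in H as (Oa & [b Hb] & H). apply limit_intro; auto.
  - apply nonempty. eauto.
  - intros c Hc. destruct (H c Hc) as (k & [Ok _] & Hck & Hka).
    assert (Oc : is_ordinal c) by (apply (ord_in k); auto).
    apply (ord_le_lt (succ c) k); auto using ord_succ. now apply succ_le.
Qed.

Lemma K_cardinal m a : K m a -> is_cardinal a.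
Proof. intros H. apply K_K0 in H as (Oa & _ & H). now apply limit_of_cardinals. Qed.

Lemma K_ord m a : K m a -> is_ordinal a.
Proof. intros H. apply limit_ord. eapply K_limit; eauto. Qed.

Lemma fun_cod_mono s a X Y : is_fun s a X -> X ⊆ Y -> is_fun s a Y.
Proof.
  intros [H1 H2] H. split; auto. intros p Hp. destruct (H1 p Hp) as (x & y & Hx & Hy & Ho).
  exists x, y. auto.
Qed.

(** The values below [n] are prescribed one after the other, starting from the assignment that is
    constantly [emp]; being finitely many in the sense of the model, they lie in a common stage
    below [a]. *)
Lemma truncate a s n : is_limit a -> is_fun s omega (VV a) -> is_nat n ->
  exists b s', b ∈ a /\ is_fun s' omega (VV b) /\ forall k, k ∈ n -> ap s' k = ap s k.
Proof.
  intros La Hs Hn. assert (Oa := limit_ord a La).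
  assert (H : exists b s' v, b ∈ a /\ is_V b v /\ is_fun s' omega v /\
    forall k y, k ∈ n -> rel s k y -> rel s' k y).
  { revert n Hn. apply (nat_ind' (fun n => exists b s' v, b ∈ a /\ is_V b v /\ is_fun s' omega v /\
      forall k y, k ∈ n -> rel s k y -> rel s' k y)).
    - dfn_tac.
    - assert (H1 : succ emp ∈ a) by (apply limit_succ; auto using limit_emp).
      assert (O1 : is_ordinal (succ emp)) by auto using ord_succ, ord_emp.
      destruct (const_fun (VV (succ emp)) emp omega) as (s' & Hs' & _).
      { apply ord_sub_VV; auto. apply in_succ_self. }
      exists (succ emp), s', (VV (succ emp)). rewrite is_V_VV. repeat (split; auto).
      intros k y Hk. now apply in_emp in Hk.
    - intros n Hn (b & s' & v & Hb & Hv & Hs' & H). apply is_V_VV in Hv as [Ob ->].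
      assert (Hx : ap s n ∈ VV a) by (eapply ap_in; eauto; now apply in_omega).
      apply VV_limit in Hx as (b1 & Hb1 & Hx); auto.
      assert (Ob1 : is_ordinal b1) by (apply (ord_in a); auto).
      assert (M : exists d, d ∈ a /\ is_ordinal d /\ b ⊆ d /\ b1 ⊆ d).
      { destruct (ord_le_total b b1); auto; [exists b1|exists b]; auto using sub_refl. }
      destruct M as (d & Hd & Od & L1 & L2).
      assert (Hxd : ap s n ∈ VV d) by (apply (VV_mono b1 d); auto).
      assert (Hs'd : is_fun s' omega (VV d)) by (apply (fun_cod_mono s' omega (VV b)); auto using VV_mono).
      exists d, (upd s' n (ap s n)), (VV d). rewrite is_V_VV. split; auto. split; auto.
      split; [now apply upd_fun|]. intros k y Hk Hr. apply rel_upd.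
      destruct (classic (k = n)) as [->|N].
      + left. split; auto. symmetry. eapply ap_eq; eauto.
      + right. split; auto. apply H; auto. apply in_succ in Hk as [|]; tauto. }
  destruct H as (b & s' & v & Hb & Hv & Hs' & H). apply is_V_VV in Hv as [_ ->].
  exists b, s'. split; auto. split; auto. intros k Hk. eapply ap_eq; eauto. apply H; auto.
  eapply ap_rel; eauto. apply in_omega. eapply nat_in; eauto.
Qed.

(* A formula looks only at finitely many values, so an assignment may be moved to a
   smaller stage without changing the truth value at two given stages. *)
Lemma truncate_truth a b c s : is_limit a -> is_ordinal b -> a ⊆ b -> is_formula false c ->
  is_fun s omega (VV a) -> exists d s', d ∈ a /\ is_fun s' omega (VV d) /\
    (truth a c s <-> truth a c s') /\ (truth b c s <-> truth b c s').
Proof.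
  intros La Ob Hab Hc Hs. assert (Oa := limit_ord a La).
  destruct (finite_support (VV a) None c Hc) as (n & Hn & Sa).
  destruct (finite_support (VV b) None c Hc) as (n' & Hn' & Sb).
  assert (M : exists k, is_nat k /\ n ⊆ k /\ n' ⊆ k).
  { destruct (ord_le_total n n'); auto using nat_ord; [exists n'|exists n]; auto using sub_refl. }
  destruct M as (k & Hk & L1 & L2).
  destruct (truncate a s k La Hs Hk) as (d & s' & Hd & Hs' & E).
  assert (Od : is_ordinal d) by (apply (ord_in a); auto).
  assert (Hs'a : is_fun s' omega (VV a)).
  { apply (fun_cod_mono s' omega (VV d)); auto. apply VV_mono; auto. apply ord_sub; auto. }
  assert (Hsb : is_fun s omega (VV b)) by (apply (fun_cod_mono s omega (VV a)); auto using VV_mono).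
  assert (Hs'b : is_fun s' omega (VV b)) by (apply (fun_cod_mono s' omega (VV a)); auto using VV_mono).
  exists d, s'. split; auto. split; auto. rewrite !truth_VV by auto.
  assert (E1 : satisfies (VV a) None c s <-> satisfies (VV a) None c s').
  { apply Sa; auto. intros i Hi. symmetry. auto. }
  assert (E2 : satisfies (VV b) None c s <-> satisfies (VV b) None c s').
  { apply Sb; auto. intros i Hi. symmetry. auto. }
  tauto.
Qed.

(** After truncation, a formula true at a later point of [K m] concerns an assignment that already
    lives at some smaller point x of [K (S m)]. There it is true as well, and it persists from x up
    to [a]. *)
Lemma K_closed m : forall a, is_limit a ->
  (forall b, b ∈ a -> exists x, x ∈ a /\ b ∈ x /\ K m x) -> K m a.
Proof.
  induction m; intros a La H; assert (Oa := limit_ord a La); simpl.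
  - split; auto. split; [exists emp; now apply limit_emp|].
    intros b Hb. destruct (H b Hb) as (x & Hx & Hbx & (Ox & _ & Kx)).
    destruct (Kx b Hbx) as (k & Ck & Hbk & Hk). exists k. split; auto. split; auto.
    now apply (ord_trans k x).
  - assert (Ka : K m a).
    { apply IHm; auto. intros b Hb. destruct (H b Hb) as (x & Hx & Hbx & [Kx _]). eauto. }
    split; auto. intros c Hc Pers v s Hv Hs b Kb Hab Ht.
    apply is_V_VV in Hv as [_ ->]. apply assignment_fun in Hs.
    destruct (truncate_truth a b c s La (K_ord m b Kb) Hab Hc Hs) as (d & s' & Hd & Hs' & Ea & Eb).
    rewrite Ea. rewrite Eb in Ht.
    destruct (H d Hd) as (x & Hx & Hdx & [Kx Hxx]).
    assert (Ox := K_ord m x Kx).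
    assert (Hxa : x ⊆ a) by (apply ord_sub; auto).
    apply (Pers x a); auto.
    apply (Hxx c Hc Pers (VV x) s') with (b := b); auto.
    + now apply is_V_VV.
    + apply assignment_fun. apply (fun_cod_mono s' omega (VV d)); auto.
      assert (Od : is_ordinal d) by (apply (ord_in a); auto).
      apply VV_mono; auto. apply ord_sub; auto.
    + eapply sub_trans; eauto.
Qed.

(** The closure condition: for each formula and each assignment from the present stage, if the
    formula is true at some later point of [K m], then it is so at one not beyond the next stage.
    From there truth persists up to the closure point. *)
Lemma K_unbounded m : forall a, is_ordinal a -> exists b, a ∈ b /\ K m b.
Proof.
  induction m; intros a Oa.
  - destruct (closing (fun a b => exists k, is_cardinal k /\ a ∈ k /\ k ∈ b)) with (a := a)
      as (g & Lg & Hag & H); auto.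
    + dfn_tac.
    + intros x Ox. destruct (cardinal_above x Ox) as (k & Ck & Hk).
      exists (succ k). split; [apply ord_succ, Ck|]. exists k. auto using in_succ_self.
    + intros x x' b Ox Ox' Ob L (k & Ck & Hk & Hkb). exists k. split; auto. split; auto.
      apply (ord_le_lt x' x); auto. apply Ck.
    + intros x b b' Ox Ob Ob' L (k & Ck & Hk & Hkb). exists k. auto.
    + exists g. split; auto. simpl. split; auto. split; [eauto|].
      intros b Hb. destruct (H b Hb) as (y & Hy & k & Ck & Hbk & Hky). exists k.
      split; auto. split; auto. apply (ord_trans k y); auto.
  - pose (P := fun a b c s => (exists g, K m g /\ a ⊆ g /\ truth g c s) ->
      exists g, K m g /\ g ⊆ b /\ truth g c s).
    destruct (closing (fun a b => (exists x, K m x /\ a ∈ x /\ x ∈ b) /\ a ⊆ b /\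
      forall c, is_formula false c -> forall s v, is_V a v -> is_assignment v s -> P a b c s)) with (a := a)
      as (g & Lg & Hag & H); auto.
    + unfold P. dfn_tac.
    + intros x Ox. destruct (IHm x Ox) as (y & Hxy & Ky). assert (Oy := K_ord m y Ky).
      destruct (collect_ord (fun p b => forall c s, is_opair p c s -> P x b c s)
        (prod (VV omega) (pow (prod omega (VV x))))) as (b & Ob & Hb).
      * unfold P. dfn_tac.
      * intros p b b' Ob Ob' L H c s Ho Hg. destruct (H c s Ho Hg) as (g & Kg & Lg & Tg).
        exists g. split; auto. split; auto. eapply sub_trans; eauto.
      * intros p _. destruct (classic (exists c s g, is_opair p c s /\ K m g /\ x ⊆ g /\ truth g c s))
          as [(c & s & g & Ho & Kg & Lg & Tg)|N].
        -- exists g. split; [now apply (K_ord m)|]. intros c' s' Ho' _.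
           destruct (is_opair_inj Ho Ho') as [<- <-]. exists g. auto using sub_refl.
        -- exists emp. split; [apply ord_emp|]. intros c s Ho (g & Hg). destruct N. eauto 6.
      * assert (M : exists d, is_ordinal d /\ succ y ⊆ d /\ b ⊆ d).
        { destruct (ord_le_total (succ y) b); auto using ord_succ; [exists b|exists (succ y)];
          auto using sub_refl, ord_succ. }
        destruct M as (d & Od & L1 & L2). exists d. split; auto.
        assert (Hyd : y ∈ d) by (apply L1, in_succ_self). split; [eauto|]. split.
        { apply ord_sub; auto. left. now apply (ord_trans x y). }
        intros c Hc s v Hv Hs Hg. apply is_V_VV in Hv as [_ ->].
        destruct (Hb (opair c s)) with (c := c) (s := s) as (g & Kg & Lg & Tg); auto.
        -- apply opair_in_prod. split; [now apply (formula_Vomega false)|].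
           apply in_pow, fun_sub_prod. now apply assignment_fun.
        -- now apply is_opair_opair.
        -- exists g. split; auto. split; auto. eapply sub_trans; eauto.
    + intros x x' b Ox Ox' Ob L ((y & Ky & Hxy & Hyb) & Hxb & HP).
      split; [exists y; split; auto; split; auto; apply (ord_le_lt x' x); auto; now apply (K_ord m)|].
      split; [eapply sub_trans; eauto|].
      intros c Hc s v Hv Hs (g & Kg & Lg & Tg). apply is_V_VV in Hv as [_ ->].
      assert (Og := K_ord m g Kg).
      destruct (ord_lt_or_le g x Og Ox) as [Lt|Le].
      * exists g. split; auto. split; auto. apply (sub_trans g x); auto. apply ord_sub; auto.
      * apply (HP c Hc s (VV x)); eauto; [now apply is_V_VV|].
        apply assignment_fun. apply assignment_fun in Hs.
        apply (fun_cod_mono s omega (VV x')); auto using VV_mono.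
    + intros x b b' Ox Ob Ob' L ((y & Ky & Hxy & Hyb) & Hxb & HP).
      split; [exists y; auto|]. split; [eapply sub_trans; eauto|].
      intros c Hc s v Hv Hs Hg. destruct (HP c Hc s v Hv Hs Hg) as (g & Kg & Lg & Tg).
      exists g. split; auto. split; auto. eapply sub_trans; eauto.
    + assert (Og : is_ordinal g) by auto.
      assert (Kg : K m g).
      { apply K_closed; auto. intros b Hb. destruct (H b Hb) as (y & Hy & (x & Kx & Hbx & Hxy) & _).
        exists x. split; auto. now apply (ord_trans x y). }
      exists g. split; auto. split; auto.
      intros c Hc Pers v s Hv Hs b Kb Hgb Ht.
      apply is_V_VV in Hv as [_ ->]. apply assignment_fun in Hs.
      destruct (truncate_truth g b c s Lg (K_ord m b Kb) Hgb Hc Hs) as (d & s' & Hd & Hs' & Ea & Eb).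
      rewrite Ea. rewrite Eb in Ht.
      assert (Od : is_ordinal d) by (apply (ord_in g); auto).
      destruct (H d Hd) as (y & Hy & _ & _ & HP).
      destruct (HP c Hc s' (VV d)) as (z & Kz & Lz & Tz).
      * now apply is_V_VV.
      * now apply assignment_fun.
      * exists b. split; auto. split; auto. apply (sub_trans d g); auto. apply ord_sub; auto.
      * apply (Pers z g); auto. apply (sub_trans z y); auto. apply ord_sub; auto. apply (ord_in g); auto.
Qed.

Lemma Delta0_abs (D : V -> Prop) p : Delta0 p -> all_trans D -> forall e, (forall k, D (e k)) ->
  (sat D p e <-> holds p e).
Proof.
  intros Hp TD. unfold holds. induction Hp; simpl; intros e He; try tauto.
  - now rewrite IHHp.
  - now rewrite IHHp1, IHHp2.
  - assert (Hse : forall x, D x -> forall k, D (scons x e k)) by (intros x Hx [|k]; simpl; auto).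
    split.
    + intros (x & Hx & Hm & Hs). exists x. split; auto. split; auto. apply IHHp; auto.
    + intros (x & _ & Hm & Hs). assert (Hx : D x) by (apply (TD x (e i)); auto).
      exists x. split; auto. split; auto. apply IHHp; auto.
Qed.

(** Soundness from the points of [K m] to the universe, persistence between points, and
    reachability: what is true holds at some later point. This weakening of absoluteness is
    preserved by existential quantifiers. *)
Definition upward m p : Prop :=
  (forall a e, K m a -> (forall k : nat, e k ∈ VV a) -> sat (fun x => x ∈ VV a) p e -> holds p e) /\
  (forall a b e, K m a -> K m b -> a ⊆ b -> (forall k : nat, e k ∈ VV a) ->
     sat (fun x => x ∈ VV a) p e -> sat (fun x => x ∈ VV b) p e) /\
  (forall a e, K m a -> (forall k : nat, e k ∈ VV a) -> holds p e ->
     exists b, K m b /\ a ⊆ b /\ sat (fun x => x ∈ VV b) p e).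

(** By persistence the code of [p] is among the formulas considered in [K (S m)], and reachability
    provides the later point at which it is true. *)
Lemma upward_correct m p : upward m p -> forall a, K (S m) a -> forall e, (forall k, e k ∈ VV a) ->
  (sat (fun x => x ∈ VV a) p e <-> holds p e).
Proof.
  intros (H1 & H2 & H3) a Ka e He. assert (Ka' : K m a) by apply Ka.
  split; [now apply H1|]. intros H. destruct (H3 a e Ka' He H) as (b & Kb & Hab & Sb).
  assert (Oa := K_ord m a Ka'). assert (Ob := K_ord m b Kb).
  destruct (fv_lt_ex p) as [n Hn].
  destruct (assignment_env (VV a) e n He) as (s & Hs & Es).
  assert (T : truth a (tr n p) s).
  { apply (proj2 Ka (tr n p)) with (v := VV a) (b := b); auto.
    - apply tr_formula.
    - intros x y t Kx Ky Hxy Tx. assert (Ox := K_ord m x Kx). assert (Oy := K_ord m y Ky).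
      apply truth_VV in Tx as [Ft Tx]; auto. apply truth_VV; auto.
      assert (Ft' : is_fun t omega (VV y)) by (apply (fun_cod_mono t omega (VV x)); auto using VV_mono).
      split; auto.
      pose (e' := fun i => ap t (num (n - 1 - i))).
      assert (He' : forall k, e' k ∈ VV x) by (intros k; eapply ap_in; eauto; apply in_omega, num_nat).
      rewrite (tr_sat (VV x) None p n e') in Tx by auto.
      rewrite (tr_sat (VV y) None p n e') by auto. now apply (H2 x y).
    - now apply is_V_VV.
    - now apply assignment_fun.
    - apply truth_VV; auto.
      assert (Hsb : is_fun s omega (VV b)) by (apply (fun_cod_mono s omega (VV a)); auto using VV_mono).
      split; auto. now rewrite (tr_sat _ None p n e). }
  apply truth_VV in T as [_ T]; auto. now rewrite (tr_sat _ None p n e) in T.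
Qed.

Lemma upward_equiv m p q : (forall (D : V -> Prop) e, sat D p e <-> sat D q e) -> upward m p -> upward m q.
Proof.
  intros E (H1 & H2 & H3). split; [|split].
  - intros a e Ka He Hs. apply E, H1 with (a := a); auto. now apply E.
  - intros a b e Ka Kb Hab He Hs. apply E, (H2 a b); auto. now apply E.
  - intros a e Ka He Hs. destruct (H3 a e Ka He) as (b & Kb & Hab & Sb); [now apply E|].
    exists b. split; auto. split; auto. now apply E.
Qed.

Lemma upward_absolute m p : (forall a, K m a -> forall e, (forall k, e k ∈ VV a) ->
  (sat (fun x => x ∈ VV a) p e <-> holds p e)) -> upward m p.
Proof.
  intros H. split; [|split].
  - intros a e Ka He. now apply H.
  - intros a b e Ka Kb Hab He Hs. apply H; auto.
    + intros k. apply (VV_mono a b); auto; now apply (K_ord m).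
    + apply (H a); auto.
  - intros a e Ka He Hs. exists a. split; auto. split; [apply sub_refl|]. now apply H.
Qed.

Lemma upward_Ex m p : upward m p -> upward m (Ex p).
Proof.
  intros (H1 & H2 & H3).
  assert (Hse : forall (D : V -> Prop) x e, D x -> (forall k : nat, D (e k)) -> forall k, D (scons x e k))
    by (intros D x e Hx He [|k]; simpl; auto).
  split; [|split].
  - intros a e Ka He (x & Hx & Hs). exists x. split; auto. apply (H1 a); auto.
    apply (Hse (fun x => x ∈ VV a)); auto.
  - intros a b e Ka Kb Hab He (x & Hx & Hs). exists x. split.
    + apply (VV_mono a b); auto; now apply (K_ord m).
    + apply (H2 a b); auto. apply (Hse (fun x => x ∈ VV a)); auto.
  - intros a e Ka He (x & _ & Hs). destruct (rank_ex x) as (r & Or & Hr).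
    assert (Oa := K_ord m a Ka).
    assert (M : exists d, is_ordinal d /\ a ⊆ d /\ r ⊆ d).
    { destruct (ord_le_total a r); auto; [exists r|exists a]; auto using sub_refl. }
    destruct M as (d & Od & L1 & L2). destruct (K_unbounded m d Od) as (d' & Hd' & Kd').
    assert (Od' := K_ord m d' Kd').
    assert (Ld : d ⊆ d') by (apply ord_sub; auto).
    assert (Hx : x ∈ VV d') by (apply (VV_mono r d'); auto; eapply sub_trans; eauto).
    assert (He' : forall k, e k ∈ VV d') by (intros k; apply (VV_mono a d'); auto; eapply sub_trans; eauto).
    destruct (H3 d' (scons x e) Kd') as (b & Kb & Hb & Sb); auto.
    { apply (Hse (fun x => x ∈ VV d')); auto. }
    exists b. split; auto. split; [eauto using sub_trans|]. exists x. split; auto.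
    apply (VV_mono d' b); auto. now apply (K_ord m).
Qed.

Lemma K_correct m : forall p, Sigma m p \/ Pi m p -> forall a, K m a ->
  forall e, (forall k, e k ∈ VV a) -> (sat (fun x => x ∈ VV a) p e <-> holds p e).
Proof.
  induction m; intros p Hp a Ka e He.
  - apply Delta0_abs; auto.
    + destruct Hp as [Hp|Hp]; inversion Hp; auto.
    + intros x y Hy Hx. apply (VV_trans a (K_ord 0 a Ka) y); auto.
  - destruct Hp as [Hp|Hp].
    + apply (upward_correct m); auto. clear a Ka e He.
      enough (G : forall n p, Sigma n p -> n = S m -> upward m p) by eauto.
      clear p Hp. apply (Sigma_ind (fun n p => n = S m -> upward m p)).
      * discriminate.
      * intros n p Hp [= ->]. apply upward_absolute. intros. apply IHm; auto.
      * intros n p _ IH E. now apply upward_Ex, IH.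
    + assert (G : forall n p, Pi n p -> n = S m -> upward m (Neg p)).
      { clear p Hp. apply (Pi_ind (fun n p => n = S m -> upward m (Neg p))).
        - discriminate.
        - intros n p Hp [= ->]. apply upward_absolute. intros b Kb e' He'.
          unfold holds. simpl. specialize (IHm p (or_introl Hp) b Kb e' He'). unfold holds in IHm. tauto.
        - intros n p _ IH E1. apply (upward_equiv m (Ex (Neg p))); [|now apply upward_Ex, IH].
          intros D e'. unfold All. simpl. tauto. }
      specialize (G (S m) p Hp eq_refl). assert (H := upward_correct m (Neg p) G a Ka e He).
      unfold holds in *. simpl in H. tauto.
Qed.

Lemma K_C m a : K m a -> C m a.
Proof.
  intros Ka. exists (VV a). split; [apply is_V_VV; split; auto; now apply (K_ord m)|].
  intros p Hp e He. apply (K_correct m); auto.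
Qed.

End Correct.
#[export] Hint Resolve def_truth def_K : dfn.

(** * Dependent choice *)

Lemma def_is_restriction {V : structure} {Q : V -> Prop} :
  definable false univ Q (fun e => is_restriction (e 0) (e 1) (e 2)).
Proof. unfold is_restriction. dfn_tac. Qed.
#[export] Hint Resolve def_is_restriction : dfn.

Section Choice.
Context {V : structure} {HZF : ZF V}.
Implicit Types x y z a b c d f g h s t u : V.

Definition restr f a : V := sep f (fun p => exists x y, x ∈ a /\ is_opair p x y).

Lemma is_restriction_restr g f a : is_restriction g f a <-> g = restr f a.
Proof.
  assert (H : forall p, p ∈ restr f a <-> p ∈ f /\ exists x y, x ∈ a /\ is_opair p x y).
  { intros p. apply (in_sep (fun p => exists x y, x ∈ a /\ is_opair p x y)). dfn_tac. }
  split.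
  - intros K. apply ext. intros p. now rewrite H, (K p).
  - intros -> p. apply H.
Qed.

Lemma rel_restr f a x y : rel (restr f a) x y <-> x ∈ a /\ rel f x y.
Proof.
  rewrite !rel_opair. rewrite (proj2 (is_restriction_restr (restr f a) f a) eq_refl (opair x y)). split.
  - intros [H (x' & y' & Hx & Ho)]. apply is_opair_opair, opair_inj in Ho as [-> _]. auto.
  - intros [H1 H2]. split; auto. exists x, y. split; auto. now apply is_opair_opair.
Qed.

Lemma restr_fun f a b c : is_fun f a b -> c ⊆ a -> is_fun (restr f c) c b.
Proof.
  intros Hf Hc. split.
  - intros p Hp. assert (Hp' := Hp).
    apply (proj2 (is_restriction_restr (restr f c) f c) eq_refl p) in Hp as [Hp (x & y & Hx & Ho)].
    exists x, y. split; auto. split; auto. apply is_opair_opair in Ho. subst p.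
    apply rel_opair in Hp. eapply fun_cod; eauto.
  - intros x Hx. exists (ap f x). split.
    + apply rel_restr. split; auto. eapply ap_rel; eauto.
    + intros y Hy. apply rel_restr in Hy as [_ Hy]. eapply ap_eq; eauto.
Qed.

Lemma ap_restr f a b c x : is_fun f a b -> c ⊆ a -> x ∈ c -> ap (restr f c) x = ap f x.
Proof.
  intros Hf Hc Hx. apply (ap_eq _ c b); [eapply restr_fun; eauto|].
  apply rel_restr. split; auto. eapply ap_rel; eauto.
Qed.

Lemma rel_ext a b c d f g : is_fun f a b -> is_fun g c d -> (forall x y, rel f x y <-> rel g x y) -> f = g.
Proof.
  intros Hf Hg H. apply ext. intros p. split; intros Hp.
  - destruct (proj1 Hf p Hp) as (x & y & _ & _ & Ho). apply is_opair_opair in Ho. subst p.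
    now apply rel_opair, H, rel_opair.
  - destruct (proj1 Hg p Hp) as (x & y & _ & _ & Ho). apply is_opair_opair in Ho. subst p.
    now apply rel_opair, H, rel_opair.
Qed.

Lemma fun_dom_unique f a a' b b' : is_fun f a b -> is_fun f a' b' -> a = a'.
Proof.
  intros H H'. apply ext. intros x. split; intros Hx.
  - apply (fun_dom f a' b' x (ap f x)); auto. now apply (ap_rel f a b).
  - apply (fun_dom f a b x (ap f x)); auto. now apply (ap_rel f a' b').
Qed.

Lemma restr_ext f g a b a' b' c : is_fun f a b -> is_fun g a' b' -> c ⊆ a -> c ⊆ a' ->
  (forall x y, x ∈ c -> (rel f x y <-> rel g x y)) -> restr f c = restr g c.
Proof.
  intros Hf Hg Hc Hc' H. apply (rel_ext c b c b'); try (eapply restr_fun; eauto).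
  intros x y. rewrite !rel_restr. split; intros [H1 H2]; split; auto; now apply H.
Qed.

Context {l : V} (Hl : is_limit l) (HDC : DC l).

Section Recursion.
Context (Y : V) (R : V -> V -> Prop) (HR : dfn (fun e => R (e 0) (e 1))).

Definition good_seq s b : Prop :=
  is_fun s b Y /\ forall x, x ∈ b -> forall s' y, is_restriction s' s x -> rel s x y -> R s' y.

Lemma def_good_seq : dfn (fun e => good_seq (e 0) (e 1)).
Proof. unfold good_seq. dfn_tac. Qed.
#[local] Hint Resolve def_good_seq : dfn.

Lemma good_seq_R s b x : good_seq s b -> x ∈ b -> R (restr s x) (ap s x).
Proof.
  intros [Hs H] Hx. apply (H x Hx); [now apply is_restriction_restr|]. eapply ap_rel; eauto.
Qed.

Lemma good_seq_intro s b : is_fun s b Y -> (forall x, x ∈ b -> R (restr s x) (ap s x)) -> good_seq s b.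
Proof.
  intros Hs H. split; auto. intros x Hx s' y Hs' Hy. apply is_restriction_restr in Hs'. subst s'.
  apply (rel_ap s b Y) in Hy as [_ ->]; auto.
Qed.

Lemma good_seq_sub s t b c : good_seq s b -> good_seq t c -> s ⊆ t ->
  b ⊆ c /\ forall x y, x ∈ b -> (rel s x y <-> rel t x y).
Proof.
  intros [Hs _] [Ht _] H.
  assert (K : forall x y, rel s x y -> rel t x y) by (intros x y; rewrite !rel_opair; apply H).
  assert (K' : forall x, x ∈ b -> rel s x (ap s x)) by (intros x Hx; eapply ap_rel; eauto).
  split.
  - intros x Hx. eapply fun_dom; eauto.
  - intros x y Hx. split; auto. intros Hy. rewrite (fun_func t c Y x y (ap s x)); auto.
Qed.

Lemma good_seq_proper s t b c : is_ordinal b -> is_ordinal c -> good_seq s b -> good_seq t c ->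
  s ⊆ t -> s <> t -> b ∈ c.
Proof.
  intros Ob Oc Hs Ht H N. destruct (good_seq_sub s t b c Hs Ht H) as [L K].
  apply ord_sub in L as [L| ->]; auto. destruct N.
  apply (rel_ext c Y c Y); try apply Hs; try apply Ht.
  intros x y. split; intros Hr.
  - apply K; auto. eapply fun_dom; [apply Hs|eauto].
  - apply K; auto. eapply fun_dom; [apply Ht|eauto].
Qed.

(** The length [c] of the union may be all of [l] even when [d] is smaller, since nothing makes [l]
    regular. *)
Lemma good_seq_union f d A : is_ordinal d -> is_fun f d A ->
  (forall a, a ∈ d -> exists b, b ∈ l /\ good_seq (ap f a) b) ->
  (forall a b, a ∈ b -> b ∈ d -> ap f a ⊆ ap f b) ->
  exists u c, is_ordinal c /\ c ⊆ l /\ good_seq u c /\ (forall a, a ∈ d -> ap f a ⊆ u) /\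
    (forall x, x ∈ c -> exists a b, a ∈ d /\ x ∈ b /\ good_seq (ap f a) b).
Proof.
  intros Od Hf Hg Hinc. assert (Ol := limit_ord l Hl).
  pose (u := sep (bigcup A) (fun p => exists a s, rel f a s /\ p ∈ s)).
  assert (Hu : forall p, p ∈ u <-> exists a, a ∈ d /\ p ∈ ap f a).
  { intros p. unfold u. rewrite in_sep by dfn_tac. split.
    - intros (_ & a & s & Hr & Hp). apply (rel_ap f d A) in Hr as [Ha ->]; eauto.
    - intros (a & Ha & Hp). split.
      + apply in_bigcup. exists (ap f a). split; auto. eapply ap_in; eauto.
      + exists a, (ap f a). split; auto. eapply ap_rel; eauto. }
  assert (Hur : forall x y, rel u x y <-> exists a, a ∈ d /\ rel (ap f a) x y).
  { intros x y. rewrite rel_opair, Hu. split; intros (a & Ha & H); exists a; split; auto; now apply rel_opair. }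
  pose (c := sep l (fun x => exists y, rel u x y)).
  assert (Hc' : forall x, x ∈ c <-> x ∈ l /\ exists y, rel u x y)
    by (intros x; apply (in_sep (fun x => exists y, rel u x y)); dfn_tac).
  assert (Hc : forall x, x ∈ c <-> exists a b, a ∈ d /\ x ∈ b /\ b ∈ l /\ good_seq (ap f a) b).
  { intros x. rewrite Hc'. split.
    - intros (Hx & y & Hy). apply Hur in Hy as (a & Ha & Hy). destruct (Hg a Ha) as (b & Hb & Gb).
      exists a, b. split; auto. split; auto. eapply fun_dom; [apply Gb|eauto].
    - intros (a & b & Ha & Hx & Hb & Gb). split; [now apply (ord_trans x b)|].
      exists (ap (ap f a) x). apply Hur. exists a. split; auto. eapply ap_rel; [apply Gb|auto]. }
  assert (Oc : is_ordinal c).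
  { split.
    - intros x Hx y Hy. apply Hc in Hx as (a & b & Ha & Hx & Hb & Gb). apply Hc. exists a, b.
      split; auto. split; auto. apply (ord_trans y x); auto. apply (ord_in l); auto.
    - intros x Hx. apply Hc' in Hx as [Hx _]. apply (proj1 (ord_in l x Ol Hx)). }
  assert (agree : forall a b x y y', a ∈ d -> b ∈ d -> rel (ap f a) x y -> rel (ap f b) x y' -> y = y').
  { assert (W : forall a b x y y', a ∈ d -> b ∈ d -> ap f a ⊆ ap f b -> rel (ap f a) x y -> rel (ap f b) x y' -> y = y').
    { intros a b x y y' Ha Hb L H1 H2. destruct (Hg b Hb) as (c0 & _ & [F _]).
      apply (fun_func (ap f b) c0 Y x); auto. revert H1. rewrite !rel_opair. apply L. }
    intros a b x y y' Ha Hb H1 H2.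
    destruct (ord_tri a b) as [L|[->|L]]; try (apply (ord_in d); auto).
    - eapply (W a b); eauto.
    - eapply (W b b); eauto using sub_refl.
    - symmetry. eapply (W b a); eauto. }
  assert (Fu : is_fun u c Y).
  { split.
    - intros p Hp. apply Hu in Hp as (a & Ha & Hp). destruct (Hg a Ha) as (b & Hb & Gb).
      destruct (proj1 (proj1 Gb) p Hp) as (x & y & Hx & Hy & Ho). exists x, y. split; auto.
      apply Hc. exists a, b. auto.
    - intros x Hx. apply Hc' in Hx as (_ & y & Hy). exists y. split; auto. intros y' Hy'.
      apply Hur in Hy as (a & Ha & Hy), Hy' as (b & Hb & Hy'). eauto. }
  exists u, c. split; auto. split; [intros x Hx; now apply Hc'|]. split; [|split].
  - apply good_seq_intro; auto. intros x Hx. apply Hc in Hx as (a & b & Ha & Hxb & Hb & Gb).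
    assert (Ob : is_ordinal b) by (apply (ord_in l); auto).
    assert (E : forall x y, x ∈ b -> (rel u x y <-> rel (ap f a) x y)).
    { intros x0 y Hx0. split.
      - intros H. apply Hur in H as (a' & Ha' & H).
        assert (K : rel (ap f a) x0 (ap (ap f a) x0)) by (eapply ap_rel; [apply Gb|auto]).
        now rewrite (agree a' a x0 y (ap (ap f a) x0)).
      - intros H. apply Hur. eauto. }
    assert (Hbc : b ⊆ c).
    { intros z Hz. apply Hc. exists a, b. auto. }
    assert (Hxs : x ⊆ b) by (apply (proj1 Ob x Hxb)).
    replace (restr u x) with (restr (ap f a) x).
    + replace (ap u x) with (ap (ap f a) x); [now apply (good_seq_R _ b)|].
      symmetry. apply (ap_eq u c Y); auto. apply E; auto. eapply ap_rel; [apply Gb|auto].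
    + apply (restr_ext _ _ b Y c Y); auto.
      * apply Gb.
      * eapply sub_trans; eauto.
      * intros z y Hz. symmetry. apply E. auto.
  - intros a Ha p Hp. apply Hu. eauto.
  - intros x Hx. apply Hc in Hx as (a & b & Ha & Hx & _ & Gb). eauto.
Qed.

(** The tree consists of the good sequences shorter than [l] under proper extension. As [l] may be
    singular, a short chain can have a union of length [l] and then no bound in the tree. But such a
    union is the sequence sought, and arguing by contradiction excludes this case. *)
Lemma dependent_choice :
  (forall s b, b ∈ l -> good_seq s b -> exists y, y ∈ Y /\ R s y) ->
  exists g, is_fun g l Y /\ forall b, b ∈ l -> R (restr g b) (ap g b).
Proof.
  intros Htot. apply NNPP. intros N.
  assert (N' : forall g, ~ good_seq g l).
  { intros g Hg. apply N. exists g. split; [apply Hg|]. intros b Hb. now apply (good_seq_R g l). }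
  assert (Ol := limit_ord l Hl).
  pose (T := sep (pow (prod l Y)) (fun s => exists b, b ∈ l /\ good_seq s b)).
  assert (HT : forall s, s ∈ T <-> exists b, b ∈ l /\ good_seq s b).
  { intros s. unfold T. rewrite in_sep by dfn_tac. split; [tauto|]. intros H. split; auto.
    destruct H as (b & Hb & [Hs _]). apply in_pow. apply fun_sub_prod in Hs.
    intros p Hp. apply Hs in Hp. apply in_prod in Hp as (x & y & Hx & Hy & ->).
    apply opair_in_prod. split; auto. now apply (ord_trans x b). }
  pose (r := sep (prod T T) (fun p => exists s t, is_opair p s t /\ s ⊆ t /\ s <> t)).
  assert (Hr : forall s t, rel r s t <-> s ∈ T /\ t ∈ T /\ s ⊆ t /\ s <> t).
  { intros s t. unfold r. rewrite rel_opair, in_sep, opair_in_prod by dfn_tac. split.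
    - intros ([H1 H2] & s' & t' & Ho & H3). apply is_opair_opair, opair_inj in Ho as [-> ->]. tauto.
    - intros (H1 & H2 & H3 & H4). split; auto. exists s, t. rewrite is_opair_opair. auto. }
  assert (chain : forall d f, is_ordinal d -> is_chain T r d f ->
    exists u c, is_ordinal c /\ c ⊆ l /\ good_seq u c /\ (forall a, a ∈ d -> ap f a ⊆ u) /\
    (forall x, x ∈ c -> exists a b, a ∈ d /\ x ∈ b /\ good_seq (ap f a) b)).
  { intros d f Od [Hf Hinc]. apply (good_seq_union f d T); auto.
    - intros a Ha. apply HT. eapply ap_in; eauto.
    - intros a b Ha Hb. assert (Had : a ∈ d) by now apply (ord_trans a b).
      assert (K : rel r (ap f a) (ap f b)) by (apply (Hinc a b); auto; eapply ap_rel; eauto).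
      apply Hr in K. tauto. }
  destruct (HDC T r) as (f & [Hf Hinc] & _).
  - split; [|split].
    + intros x Hx H. apply Hr in H. tauto.
    + intros x y z _ _ _ H1 H2. apply Hr in H1 as (A1 & A2 & A3 & A4), H2 as (B1 & B2 & B3 & B4).
      apply Hr. split; auto. split; auto. split; [eapply sub_trans; eauto|].
      intros ->. apply A4. apply sub_antisym; auto.
    + intros t a Ht [s0 Hs0] Ha. apply HT in Ht as (bt & Hbt & Gt).
      destruct (Ha s0 Hs0) as [Hs0T _]. apply HT in Hs0T as (b0 & Hb0 & G0).
      destruct (foundation (fun b => exists s, s ∈ a /\ good_seq s b) l b0) as (b & Hb & (s & Hs & Gs) & Kb); eauto.
      { dfn_tac. }
      exists s. split; auto. intros s' Hs'. destruct (Ha s' Hs') as [HsT Hrs'].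
      assert (HsT' := HsT). apply HT in HsT' as (b' & Hb' & Gs').
      destruct (Ha s Hs) as [HsT2 Hrs]. apply Hr in Hrs as (_ & _ & Ls & _), Hrs' as (_ & _ & Ls' & _).
      assert (Ob : is_ordinal b) by (apply (ord_in l); auto).
      assert (Ob' : is_ordinal b') by (apply (ord_in l); auto).
      assert (L : b ⊆ b').
      { destruct (ord_lt_or_le b' b Ob' Ob) as [L|]; auto. destruct (Kb b' L Hb'). eauto. }
      destruct (good_seq_sub s t b bt Gs Gt Ls) as [_ E].
      destruct (good_seq_sub s' t b' bt Gs' Gt Ls') as [_ E'].
      destruct (classic (s' = s)); auto. right. apply Hr. split; auto. split; auto. split; [|congruence].
      intros p Hp. destruct (proj1 (proj1 Gs) p Hp) as (x & y & Hx & Hy & Ho).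
      apply is_opair_opair in Ho. subst p. apply rel_opair, E'; auto. apply E; auto. now apply rel_opair.
  - intros s Hs. assert (Hs' := Hs). apply HT in Hs' as (b & Hb & Gs).
    destruct (Htot s b Hb Gs) as (y & Hy & HRy).
    assert (Ob : is_ordinal b) by (apply (ord_in l); auto).
    assert (rel_t : forall x z, rel (cup s (sing (opair b y))) x z <-> rel s x z \/ (x = b /\ z = y)).
    { intros x z. rewrite !rel_opair, in_cup, in_sing. split; intros [H|H]; auto.
      - right. now apply opair_inj.
      - destruct H as [-> ->]; auto. }
    assert (nb : forall z, ~ rel s b z).
    { intros z Hz. apply (not_in_self b). eapply fun_dom; [apply Gs|eauto]. }
    assert (Ft : is_fun (cup s (sing (opair b y))) (succ b) Y).
    { split.
      - intros p Hp. apply in_cup in Hp as [Hp|Hp].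
        + destruct (proj1 (proj1 Gs) p Hp) as (x & z & Hx & Hz & Ho). exists x, z.
          split; auto. apply in_succ; auto.
        + apply in_sing in Hp. exists b, y. rewrite is_opair_opair. auto using in_succ_self.
      - intros x Hx. apply in_succ in Hx as [Hx| ->].
        + exists (ap s x). split.
          * apply rel_t. left. eapply ap_rel; [apply Gs|auto].
          * intros z Hz. apply rel_t in Hz as [Hz|[-> _]]; [eapply ap_eq; [apply Gs|auto]|].
            now apply not_in_self in Hx.
        + exists y. split; [apply rel_t; auto|]. intros z Hz. apply rel_t in Hz as [Hz|[_ ->]]; auto.
          destruct (nb z Hz). }
    assert (Er : forall x, x ⊆ b -> restr (cup s (sing (opair b y))) x = restr s x).
    { intros x Hx. apply (restr_ext _ _ (succ b) Y b Y); auto; [apply Gs| |].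
      - intros z Hz. apply in_succ; auto.
      - intros z w Hz. rewrite rel_t. split; auto. intros [H|[-> _]]; auto.
        apply Hx in Hz. now apply not_in_self in Hz. }
    assert (Rs : restr s b = s).
    { apply (rel_ext b Y b Y); [apply (restr_fun s b Y); [apply Gs|apply sub_refl]|apply Gs|].
      intros x z. rewrite rel_restr. split; [tauto|]. intros H. split; auto. eapply fun_dom; [apply Gs|eauto]. }
    assert (Gt : good_seq (cup s (sing (opair b y))) (succ b)).
    { apply good_seq_intro; auto. intros x Hx. apply in_succ in Hx as [Hx| ->].
      - rewrite Er by (apply (proj1 Ob x Hx)).
        replace (ap (cup s (sing (opair b y))) x) with (ap s x); [now apply (good_seq_R s b)|].
        symmetry. apply (ap_eq _ (succ b) Y); auto. apply rel_t. left. eapply ap_rel; [apply Gs|auto].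
      - rewrite Er by apply sub_refl. rewrite Rs.
        replace (ap (cup s (sing (opair b y))) b) with y; auto.
        symmetry. apply (ap_eq _ (succ b) Y); auto. apply rel_t. auto. }
    exists (cup s (sing (opair b y))).
    assert (HtT : cup s (sing (opair b y)) ∈ T).
    { apply HT. exists (succ b). split; auto. now apply limit_succ. }
    split; auto. apply Hr. split; auto. split; auto. split.
    + intros p Hp. apply in_cup. auto.
    + intros E. apply (nb y). rewrite E. apply rel_t. auto.
  - intros d f Hd Hch. assert (Od : is_ordinal d) by (apply (ord_in l); auto).
    destruct (chain d f Od Hch) as (u & c & Oc & Hcl & Gu & Hsub & _).
    apply ord_sub in Hcl as [Hcl| ->]; auto; [|destruct (N' u Gu)].
    assert (HuT : u ∈ T) by (apply HT; eauto).
    exists u. split; auto. intros a x Ha Hx. destruct Hch as [Hf Hinc].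
    apply (rel_ap f d T) in Hx as [_ ->]; auto.
    destruct (classic (ap f a = u)); auto. right. apply Hr. split; [eapply ap_in; eauto|]. auto.
  - destruct (chain l f Ol (conj Hf Hinc)) as (u & c & Oc & Hcl & Gu & Hsub & _).
    apply (N' u). replace l with c; auto. apply sub_antisym; auto.
    (* Lengths strictly increase along the branch, so the node at place a has length at least a, and
       the union has length [l]. *)
    assert (grow : forall a, is_ordinal a -> a ∈ l -> forall s, rel f a s -> forall b, good_seq s b -> b ∈ l -> a ⊆ b).
    { apply (ord_ind (fun a => a ∈ l -> forall s, rel f a s -> forall b, good_seq s b -> b ∈ l -> a ⊆ b)); [dfn_tac|].
      intros a Oa IH Ha s Hs b Gb Hb a' Ha'.
      assert (Ha'l : a' ∈ l) by now apply (ord_trans a' a).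
      assert (Hr' : rel f a' (ap f a')) by (eapply ap_rel; eauto).
      assert (HT' : ap f a' ∈ T) by (eapply ap_in; eauto).
      apply HT in HT' as (b' & Hb' & Gb').
      assert (L := IH a' Ha' Ha'l _ Hr' b' Gb' Hb').
      assert (K : rel r (ap f a') s) by (apply (Hinc a' a); auto).
      apply Hr in K as (_ & _ & K1 & K2).
      assert (Ob : is_ordinal b) by (apply (ord_in l); auto).
      assert (Ob' : is_ordinal b') by (apply (ord_in l); auto).
      apply (ord_le_lt a' b'); auto; [apply (ord_in a); auto|].
      apply (good_seq_proper (ap f a') s); auto. }
    intros a Ha. assert (Hsa : succ a ∈ l) by now apply limit_succ.
    assert (HT' : ap f (succ a) ∈ T) by (eapply ap_in; eauto).
    apply HT in HT' as (b & Hb & Gb).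
    assert (L : succ a ⊆ b).
    { apply (grow (succ a)) with (s := ap f (succ a)); auto; [apply (ord_in l); auto|eapply ap_rel; eauto]. }
    destruct (good_seq_sub (ap f (succ a)) u b c Gb Gu (Hsub _ Hsa)) as [L' _].
    apply L', L, in_succ_self.
Qed.

End Recursion.

(** The term at place [b] depends on the past only through its length, which is read off from the
    domain of [s]; outside [a] the default [y0] is good enough. *)
Lemma choice (P : V -> V -> Prop) a Y : dfn (fun e => P (e 0) (e 1)) -> a ⊆ l ->
  (forall x, x ∈ a -> exists y, y ∈ Y /\ P x y) ->
  exists f, is_fun f a Y /\ forall x, x ∈ a -> P x (ap f x).
Proof.
  intros HP Ha H. destruct (classic (exists x, x ∈ a)) as [[x0 Hx0]|N].
  - destruct (H x0 Hx0) as (y0 & Hy0 & _).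
    destruct (dependent_choice Y (fun s y => forall b, is_fun s b Y -> b ∈ a -> P b y)) as (g & Hg & K).
    + dfn_tac.
    + intros s b Hb [Hs _]. destruct (classic (b ∈ a)) as [Hba|Hba].
      * destruct (H b Hba) as (y & Hy & Py). exists y. split; auto. intros b' Hs' _.
        now rewrite <- (fun_dom_unique s b b' Y Y Hs Hs').
      * exists y0. split; auto. intros b' Hs' Hb'. destruct Hba.
        now rewrite (fun_dom_unique s b b' Y Y Hs Hs').
    + exists (restr g a). split; [eapply restr_fun; eauto|]. intros x Hx.
      rewrite (ap_restr g l Y a x) by auto. apply (K x); auto.
      apply (restr_fun g l Y); auto. apply (proj1 (limit_ord l Hl) x). auto.
  - destruct (fun_ex (fun _ _ => True) a Y) as (f & Hf & _).
    + dfn_tac.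
    + intros x Hx. destruct N; eauto.
    + intros x y y' Hx. destruct N; eauto.
    + exists f. split; auto. intros x Hx. destruct N; eauto.
Qed.

(** At each stage a value not taken before is chosen as long as there is one. Either this goes on
    through all stages below [n], or the values exhaust [Y]. *)
Lemma injection_or_surjection Y y0 n : y0 ∈ Y -> is_ordinal n -> n ⊆ l ->
  (exists f, is_injection f n Y) \/
  exists f, is_fun f n Y /\ forall y, y ∈ Y -> exists x, x ∈ n /\ rel f x y.
Proof.
  intros Hy0 On Hn.
  destruct (dependent_choice Y (fun s y => (exists z, z ∈ Y /\ forall x, ~ rel s x z) -> forall x, ~ rel s x y))
    as (g & Hg & K).
  - dfn_tac.
  - intros s b Hb _. destruct (classic (exists z, z ∈ Y /\ forall x, ~ rel s x z)) as [(z & Hz & Nz)|N].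
    + exists z. auto.
    + exists y0. split; auto.
  - assert (Fn := restr_fun g l Y n Hg Hn).
    destruct (classic (forall y, y ∈ Y -> exists x, x ∈ n /\ rel g x y)) as [S|S].
    + right. exists (restr g n). split; auto. intros y Hy. destruct (S y Hy) as (x & Hx & Hr).
      exists x. split; auto. apply rel_restr. auto.
    + left. exists (restr g n). apply injection_ap. split; auto.
      assert (W : forall x x', x ∈ n -> x' ∈ n -> x ∈ x' -> ap g x <> ap g x').
      { intros x x' Hx Hx' L E. apply (K x' (Hn x' Hx')) with (x := x).
        - apply not_all_ex_not in S as (z & Hz). apply imply_to_and in Hz as [Hz Nz].
          exists z. split; auto. intros w Hw. apply rel_restr in Hw as [Hw1 Hw2]. apply Nz.
          exists w. split; auto. now apply (ord_trans w x').
        - apply rel_restr. split; auto. rewrite <- E. eapply ap_rel; eauto. }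
      intros x x' Hx Hx' E. rewrite !(ap_restr g l Y n) in E by auto.
      destruct (ord_tri x x') as [L|[L|L]]; auto; try (apply (ord_in n); auto).
      * destruct (W x x'); auto.
      * destruct (W x' x); auto.
Qed.

Lemma surjection_section f n Y : is_ordinal n -> is_fun f n Y ->
  (forall y, y ∈ Y -> exists x, x ∈ n /\ rel f x y) -> exists h, is_injection h Y n.
Proof.
  intros On Hf Hs.
  destruct (fun_ex (fun y x => rel f x y /\ forall x', rel f x' y -> x ⊆ x') Y n) as (h & Hh & _ & E).
  - dfn_tac.
  - intros y Hy. destruct (Hs y Hy) as (x & Hx & Hr).
    destruct (least_ord (fun x => rel f x y) x) as (m & Om & Rm & _ & Km); auto.
    + dfn_tac.
    + apply (ord_in n); auto.
    + exists m. split; [eapply fun_dom; eauto|]. split; auto. intros x' Hx'. apply Km; auto.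
      apply (ord_in n); auto. eapply fun_dom; eauto.
  - intros y x x' _ _ _ [H1 H2] [H3 H4]. apply sub_antisym; auto.
  - exists h. apply injection_ap. split; auto. intros y y' Hy Hy' K.
    destruct (E y Hy) as [H1 _], (E y' Hy') as [H2 _]. rewrite K in H1.
    now apply (fun_func f n Y (ap h y')).
Qed.

End Choice.

(** * The critical sequence of an embedding of [V_{lambda+1}] *)

(* Membership in the domain; unlike [x ∈ W] it is definable inside [W]. *)
Definition in_dom {V : structure} (W x : V) : Prop := x ∈ W.

Lemma def_in_dom {V : structure} {b} {W : V} {Q : V -> Prop} :
  definable b (two_domains W W) Q (fun e => in_dom W (e 0)).
Proof.
  apply (def_equiv (fun _ => True)); [|apply def_True].
  intros D [->| ->] e He; unfold in_dom; split; auto.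
Qed.
#[export] Hint Resolve def_in_dom : dfn.

Lemma two_domains_ex {V : structure} (W : V) (R : V -> Prop) D : two_domains W W D ->
  (forall x, R x -> in_dom W x) -> (exists x, R x) -> exists x, D x /\ R x.
Proof. intros [->| ->] H [x Hx]; exists x; split; auto; now apply H. Qed.

Ltac dfn_side ::=
  let D := fresh in let HD := fresh in
  intros D HD;
  first [ rewrite HD; intros ? _ [? ?]; eexists; split; [exact I|eassumption]
        | intros ? ? [? ?]; eexists; split; [|eassumption]; tauto
        | intros ? _; apply (two_domains_ex _ _ D HD); intros ?; unfold in_dom;
          first [tauto | intros ?; apply NNPP; tauto]
        | idtac ].

Section Crit.
Context {V : structure} {HZF : ZF V} {l j : V}.
Notation W := (VV (succ l)).
Context {E : elementary_map W W W j (succ l) (succ l)} (Hcard : is_cardinal l).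
Notation J := (ap j).
Notation fixed := (fixed_by W j).
Notation DW := (two_domains W W).
Implicit Types x y z a b c d f g h k n u v : V.

Let Ol : is_ordinal l := proj1 Hcard.
Let OSl : is_ordinal (succ l) := ord_succ l (proj1 Hcard).

Lemma W_iff x : x ∈ W <-> x ⊆ VV l.
Proof. now apply VV_succ. Qed.

Lemma Vl_sub_W x : x ∈ VV l -> x ∈ W.
Proof. intros H. apply W_iff. now apply VV_trans. Qed.

Lemma Vl_W : VV l ∈ W.
Proof. apply W_iff, sub_refl. Qed.

Lemma ord_W a : a ⊆ l -> a ∈ W.
Proof. intros H. apply W_iff. apply (sub_trans a l); auto. now apply ord_sub_VV. Qed.

Lemma lt_W a : a ∈ l -> a ∈ W.
Proof. intros H. apply ord_W. now apply (proj1 Ol). Qed.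

Lemma W_ord a : is_ordinal a -> a ∈ W -> a ⊆ l.
Proof. intros Oa H. apply (ord_in_VV (succ l) a) in H; auto. now apply in_succ_le in H. Qed.

(** [l] is the largest ordinal of [W], hence definable there. *)
Lemma J_l : J l = l.
Proof.
  apply (fix_def (E := E) (B := false) (fun y => is_ordinal y /\ forall z, in_dom W z -> is_ordinal z -> y ∉ z)).
  - exists l. apply ord_W, sub_refl.
  - dfn_tac.
  - apply ord_W, sub_refl.
  - split; auto. intros z Hz Oz Hl. apply (W_ord z Oz Hz) in Hl. now apply not_in_self in Hl.
  - intros y Hy [Oy K]. assert (HyW : y ∈ W) by tauto.
    assert (L := W_ord y Oy HyW). apply ord_sub in L as [L|]; auto.
    destruct (K l); auto. apply ord_W, sub_refl.
Qed.

Lemma fixed_l : fixed l.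
Proof. split; [apply ord_W, sub_refl|apply J_l]. Qed.

(** At this point [l] might still be finite, so only the numbers that belong to [W] are
    considered. *)
Lemma J_nat_W n : is_nat n -> n ∈ W -> J n = n.
Proof.
  assert (K : forall n, is_nat n -> n ∈ W -> rel j n n).
  { apply (nat_ind' (fun n => n ∈ W -> rel j n n)); [dfn_tac| |].
    - intros H. apply (rel_J (E := E)). split; auto. symmetry. now apply (J_emp (E := E)).
    - intros m Hm IH H.
      assert (HmW : m ∈ W) by (apply (VV_trans _ OSl (succ m)); auto using in_succ_self).
      specialize (IH HmW). apply (rel_J (E := E)) in IH as [_ IH]. apply (rel_J (E := E)). split; auto.
      rewrite (J_succ (E := E)); auto. now rewrite <- IH. }
  intros Hn HW. specialize (K n Hn HW). apply (rel_J (E := E)) in K. symmetry; tauto.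
Qed.

Context (Hmove : exists x, x ∈ W /\ ~ rel j x x).

(** If the ordinals below [l] are fixed, then so is each element of [VV l], and therefore each
    subset of [VV l]. *)
Lemma moved_ordinal : exists a, a ∈ l /\ J a <> a.
Proof.
  apply NNPP. intros N. destruct Hmove as (x & Hx & Nx). apply Nx, (rel_J (E := E)). split; auto.
  assert (fixV : forall z, z ∈ VV l -> J z = z).
  { apply (J_fix_below (E := E)); auto.
    - intros z. apply Vl_sub_W.
    - intros b Hb. apply NNPP. eauto. }
  assert (JV : J (VV l) = VV l) by (rewrite (J_VV (E := E)); auto using Vl_W; [now rewrite J_l|apply fixed_l]).
  assert (Hxl := proj1 (W_iff x) Hx).
  assert (HJx : J x ⊆ VV l) by (rewrite <- JV; apply (proj1 (J_sub (E := E) x (VV l) Hx Vl_W)); auto).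
  apply ext. intros z. split; intros Hz.
  - assert (Ez := fixV z (Hxl z Hz)). rewrite <- Ez.
    apply (proj1 (J_mem (E := E) z x (Vl_sub_W z (Hxl z Hz)) Hx)); auto.
  - assert (Ez := fixV z (HJx z Hz)). rewrite <- Ez in Hz.
    now apply (proj2 (J_mem (E := E) z x (Vl_sub_W z (HJx _ (eq_ind _ (fun t => t ∈ J x) Hz _ Ez))) Hx)).
Qed.

Lemma crit_ex : exists k, k ∈ l /\ J k <> k /\ forall a, a ∈ k -> J a = a.
Proof.
  destruct moved_ordinal as (a & Ha & Na).
  destruct (foundation (fun a => ~ rel j a a) l a) as (k & Hk & Nk & K); auto.
  - dfn_tac.
  - intros R. apply (rel_J (E := E)) in R. destruct Na. symmetry; tauto.
  - exists k. split; auto. split.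
    + intros Ek. apply Nk, (rel_J (E := E)). split; [now apply lt_W|auto].
    + intros b Hb. assert (Hbl : b ∈ l) by now apply (ord_trans b k).
      specialize (K b Hb Hbl). apply NNPP in K. apply (rel_J (E := E)) in K. symmetry; tauto.
Qed.

Lemma crit_infinite k : k ∈ l -> J k <> k -> omega ⊆ l.
Proof.
  intros Hk Nk. destruct (ord_lt_or_le l omega Ol ord_omega) as [L|]; auto.
  destruct Nk. apply in_omega in L. apply J_nat_W; [|now apply lt_W]. eapply nat_in; eauto.
Qed.

Lemma lambda_limit : is_limit l.
Proof.
  destruct crit_ex as (k & Hk & Nk & _). apply infinite_cardinal_limit; auto.
  now apply (crit_infinite k).
Qed.

Let Ll : is_limit l := lambda_limit.
Let VlW : VV l ⊆ W := Vl_sub_W.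
Let lW : l ∈ W := proj1 fixed_l.

Lemma J_lt_l a : a ∈ l -> J a ∈ l.
Proof. apply (J_lt (E := E) Ll VlW lW J_l). Qed.

Lemma J_ge_l a : a ∈ l -> a ⊆ J a.
Proof. apply (J_ge (E := E) Ll VlW lW J_l). Qed.

Lemma omega_lt : omega ⊆ l.
Proof. now apply omega_le_limit. Qed.

Lemma fixed_w : fixed omega.
Proof.
  apply (fixed_omega (E := E)); [|exists l; apply lW].
  apply in_succ_le; auto using ord_omega, omega_lt.
Qed.

Lemma J_n n : is_nat n -> J n = n.
Proof. intros H. apply J_nat_W; auto. apply lt_W, omega_lt, in_omega. auto. Qed.

Lemma opair_W x y : x ∈ VV l -> y ∈ VV l -> opair x y ∈ VV l.
Proof. now apply VV_opair_limit. Qed.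

Lemma lt_Vl a : a ∈ l -> a ∈ VV l.
Proof. now apply ord_sub_VV. Qed.

Lemma fun_W f a b : a ⊆ VV l -> b ⊆ VV l -> is_fun f a b -> f ∈ W.
Proof.
  intros Ha Hb Hf. apply W_iff. intros p Hp. destruct (proj1 Hf p Hp) as (x & y & Hx & Hy & Ho).
  apply is_opair_opair in Ho. subst p. apply opair_W; auto.
Qed.

Lemma ord_sub_Vl a : a ⊆ l -> a ⊆ VV l.
Proof. intros H. apply (sub_trans a l); auto. now apply ord_sub_VV. Qed.

Lemma VV_lt a : a ∈ l -> VV a ∈ VV l.
Proof. now apply VV_in. Qed.

Lemma VV_le a : a ⊆ l -> is_ordinal a -> VV a ⊆ VV l.
Proof. intros H Oa. now apply VV_mono. Qed.

Lemma J_VV_lt a : a ∈ l -> J (VV a) = VV (J a).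
Proof.
  intros Ha. apply (J_VV (E := E)); auto using lt_W; [apply (ord_in l); auto|].
  apply Vl_sub_W, VV_lt; auto.
Qed.

(** ** Iterating the embedding *)

Lemma iterate_J a : a ∈ l -> exists f, is_fun f omega l /\ ap f emp = a /\
  forall n, is_nat n -> ap f (succ n) = J (ap f n).
Proof.
  intros Ha.
  destruct (fun_ex (fun x y => rel j x y) l l) as (S & HS & _ & ES).
  - dfn_tac.
  - intros x Hx. exists (J x). split; [now apply J_lt_l|]. apply (rel_J (E := E)). split; auto using lt_W.
  - intros x y y' _ _ _. apply (fun_func j W W), E.
  - destruct (iterate_fun S l a HS Ha) as (f & Hf & H0 & Hs). exists f. split; auto. split; auto.
    intros n Hn. rewrite Hs by auto. assert (Hfn : ap f n ∈ l) by (eapply ap_in; eauto; now apply in_omega).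
    specialize (ES _ Hfn). apply (rel_J (E := E)) in ES. tauto.
Qed.

(** [w] stands for [omega]. Quantifiers are bounded by it and by the codomain [C], so that [j]
    respects the notion. *)
Definition is_sup g f C w : Prop :=
  (forall z, z ∈ g -> exists m, m ∈ w /\ exists y, y ∈ C /\ (rel f m y /\ z ∈ y)) /\
  (forall m, m ∈ w -> forall y, y ∈ C -> rel f m y -> y ⊆ g).

Lemma def_is_sup {B : bool} {DD} {Q : V -> Prop} {HT : trans_domains DD} :
  definable B DD Q (fun e => is_sup (e 0) (e 1) (e 2) (e 3)).
Proof. unfold is_sup. dfn_tac. Qed.
#[local] Hint Resolve def_is_sup : dfn.

Lemma is_sup_iff g f C : is_fun f omega C ->
  (is_sup g f C omega <-> forall z, z ∈ g <-> exists m, is_nat m /\ z ∈ ap f m).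
Proof.
  intros Hf. split.
  - intros [H1 H2] z. split.
    + intros Hz. destruct (H1 z Hz) as (m & Hm & y & Hy & Hr & Hzy).
      exists m. split; [now apply in_omega|]. now rewrite (ap_eq f omega C m y).
    + intros (m & Hm & Hz). apply in_omega in Hm. apply (H2 m Hm (ap f m)); auto.
      * eapply ap_in; eauto.
      * eapply ap_rel; eauto.
  - intros H. split.
    + intros z Hz. apply H in Hz as (m & Hm & Hz). apply in_omega in Hm. exists m. split; auto.
      exists (ap f m). split; [eapply ap_in; eauto|]. split; auto. eapply ap_rel; eauto.
    + intros m Hm y Hy Hr z Hz. apply H. exists m. split; [now apply in_omega|].
      now rewrite (ap_eq f omega C m y).
Qed.

Lemma seq_W f : is_fun f omega l -> f ∈ W.
Proof. apply fun_W; auto using ord_sub_Vl, omega_lt, sub_refl. Qed.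

Lemma J_seq f : is_fun f omega l -> is_fun (J f) omega l /\
  forall n, is_nat n -> ap (J f) n = J (ap f n).
Proof.
  intros Hf. assert (HfW := seq_W f Hf). assert (Fw := fixed_w). destruct Fw as [wW Jw].
  split.
  - rewrite <- Jw at 1. rewrite <- J_l. apply (proj1 (J_fun (E := E) f omega l HfW wW lW)). auto.
  - intros n Hn. apply in_omega in Hn as Hn'. rewrite (J_ap (E := E) f omega l n); auto.
    + now rewrite (J_n n Hn).
    + apply lt_W, omega_lt, Hn'.
    + apply lt_W. eapply ap_in; eauto.
Qed.

Lemma J_sup f g : is_fun f omega l -> g ∈ W -> is_sup g f l omega -> is_sup (J g) (J f) l omega.
Proof.
  intros Hf Hg H. assert (Fw := fixed_w). assert (Fl := fixed_l).
  apply (proj1 (transfer2 (E := E) (B := false) (fun g f => is_sup g f l omega) g f ltac:(dfn_tac) Hg (seq_W f Hf))).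
  exact H.
Qed.

(** Applying [j] to the orbit shifts it by one place, which does not change the supremum. *)
Lemma orbit_sup a f : a ∈ l -> is_fun f omega l -> ap f emp = a ->
  (forall n, is_nat n -> ap f (succ n) = J (ap f n)) ->
  exists g, is_ordinal g /\ g ⊆ l /\ is_sup g f l omega /\ J g = g.
Proof.
  intros Ha Hf H0 HS.
  assert (Hin : forall n, is_nat n -> ap f n ∈ l) by (intros n Hn; eapply ap_in; eauto; now apply in_omega).
  destruct (sup_omega f l Hf) as (g & Og & Hg).
  { intros n Hn. apply (ord_in l); auto. }
  assert (Hgl : g ⊆ l).
  { intros z Hz. apply Hg in Hz as (n & Hn & Hz). apply (ord_trans z (ap f n)); auto. }
  assert (Sg : is_sup g f l omega) by now apply is_sup_iff.
  exists g. split; auto. split; auto. split; auto.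
  assert (SJ := J_sup f g Hf (ord_W g Hgl) Sg).
  destruct (J_seq f Hf) as [FJ EJ]. rewrite is_sup_iff in SJ by auto.
  apply ext. intros z. rewrite SJ, Hg. split; intros (n & Hn & Hz).
  - exists (succ n). split; auto using nat_succ. rewrite HS by auto. now rewrite <- EJ.
  - exists n. split; auto. rewrite EJ by auto. apply (J_ge_l (ap f n)); auto.
Qed.

(** ** Below the critical point *)

Context {k : V} (Hk : k ∈ l) (Nk : J k <> k) (Fk : forall a, a ∈ k -> J a = a).
Let Ok : is_ordinal k := ord_in l k Ol Hk.
Let kW : k ∈ W := lt_W k Hk.

Lemma crit_lt : k ∈ J k.
Proof.
  assert (L := J_ge_l k Hk). assert (OJ : is_ordinal (J k)) by (apply (ord_in l); auto using J_lt_l).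
  apply ord_sub in L as [L|L]; auto. congruence.
Qed.

Lemma crit_limit : is_limit k.
Proof.
  destruct (ord_cases k Ok) as [->|[(b & Ob & Eb)|]]; auto; exfalso; apply Nk.
  - apply (J_emp (E := E)); auto.
  - assert (Hb : b ∈ k) by (rewrite Eb; apply in_succ_self).
    assert (HbW : b ∈ W) by (apply (VV_trans _ OSl k); auto).
    rewrite Eb at 1. rewrite (J_succ (E := E)); auto; [|now rewrite <- Eb].
    rewrite Fk by auto. now symmetry.
Qed.

Lemma crit_omega : omega ∈ k.
Proof.
  assert (L := omega_le_limit k crit_limit). apply ord_sub in L as [L| <-]; auto using ord_omega.
  destruct Nk. apply fixed_w.
Qed.

Lemma crit_fix_V x : x ∈ VV k -> J x = x.
Proof.
  apply (J_fix_below (E := E)); auto. apply (sub_trans _ (VV l)); auto.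
  apply VV_le; auto. now apply (proj1 Ol).
Qed.

(** The value x of [J f] at [k] is in [VV a], hence fixed. As [k] is in [J k], elementarity finds b
    in [k] that [f] sends to x; then [J f] takes the value x both at b and at [k]. *)
Lemma no_injection_crit a : a ∈ k -> ~ exists f, is_injection f k (VV a).
Proof.
  intros Ha (f & Hf). assert (Hal : a ∈ l) by now apply (ord_trans a k).
  assert (VaW : VV a ∈ W) by now apply Vl_sub_W, VV_lt.
  assert (JVa : J (VV a) = VV a) by (rewrite J_VV_lt, Fk; auto).
  assert (HfW : f ∈ W).
  { apply (fun_W f k (VV a)); [apply ord_sub_Vl, (proj1 Ol); auto| |apply Hf].
    apply VV_trans; auto. now apply VV_lt. }
  assert (HJf : is_injection (J f) (J k) (VV a)).
  { rewrite <- JVa. apply (proj1 (transfer3 (E := E) (B := false) is_injection f k (VV a) ltac:(dfn_tac) HfW kW VaW)). auto. }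
  assert (Hx : ap (J f) k ∈ VV a) by (eapply ap_in; [apply HJf|apply crit_lt]).
  assert (HxW : ap (J f) k ∈ W) by (apply (VV_trans _ OSl (VV a)); auto).
  assert (Jx : J (ap (J f) k) = ap (J f) k).
  { apply crit_fix_V. apply (VV_mono a k); auto; [apply (ord_in k); auto|]. apply (proj1 Ok a Ha). }
  assert (T := transfer3 (E := E) (B := false) (fun k f x => exists b, b ∈ k /\ rel f b x) k f (ap (J f) k)
    ltac:(dfn_tac) kW HfW HxW). rewrite Jx in T.
  destruct (proj2 T) as (b & Hb & Rb).
  { exists k. split; [apply crit_lt|]. eapply ap_rel; [apply HJf|apply crit_lt]. }
  assert (HbW : b ∈ W) by (apply (VV_trans _ OSl k); auto).
  apply (J_rel (E := E)) in Rb; auto. rewrite Jx, (Fk b Hb) in Rb.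
  assert (b = k).
  { apply (proj2 HJf b) with (y := ap (J f) k); auto.
    - apply (ord_trans b k); auto; [|apply crit_lt]. apply (ord_in l); auto using J_lt_l.
    - apply crit_lt.
    - eapply ap_rel; [apply HJf|apply crit_lt]. }
  subst b. now apply not_in_self in Hb.
Qed.

Context (HDC : DC l).

Definition inj_below c : Prop := forall a, a ∈ c ->
  exists v, in_dom W v /\ (level_of a v /\ exists h, in_dom W h /\ is_injection h v c).

Lemma def_inj_below {Q : V -> Prop} : definable false DW Q (fun e => inj_below (e 0)).
Proof. unfold inj_below. dfn_tac. Qed.
#[local] Hint Resolve def_inj_below : dfn.

Lemma inj_below_VV c : c ∈ l -> (inj_below c <-> forall a, a ∈ c -> exists h, is_injection h (VV a) c).
Proof.
  intros Hc. assert (Oc : is_ordinal c) by (apply (ord_in l); auto). split.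
  - intros H a Ha. destruct (H a Ha) as (v & _ & Hv & h & _ & Hh).
    apply level_of_VV in Hv; [|apply (ord_in c); auto]. subst v. eauto.
  - intros H a Ha. assert (Hal : a ∈ l) by now apply (ord_trans a c).
    destruct (H a Ha) as (h & Hh). exists (VV a). split; [apply Vl_sub_W; now apply VV_lt|].
    split; [apply level_of_VV; auto; apply (ord_in c); auto|]. exists h. split; auto.
    apply (fun_W h (VV a) c); [|apply ord_sub_Vl; now apply (proj1 Ol)|apply Hh].
    apply VV_trans; auto. now apply VV_lt.
Qed.

(** The choiceless form of being a strong limit. Dependent choice yields an injection of [k] into
    [VV a], which is excluded, or a map of [k] onto [VV a], for which least preimages give the
    injection. *)
Lemma inj_below_crit : inj_below k.
Proof.
  apply inj_below_VV; auto. intros a Ha. assert (Oa : is_ordinal a) by (apply (ord_in k); auto).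
  destruct (classic (exists y, y ∈ VV a)) as [[y0 Hy0]|N].
  - destruct (injection_or_surjection Ll HDC (VV a) y0 k) as [H|(f & Hf & Hs)]; auto.
    + now apply (proj1 Ol).
    + destruct (no_injection_crit a Ha H).
    + now apply (surjection_section f k).
  - assert (Ev : VV a = emp) by (apply is_empty_emp; intros y Hy; eauto). rewrite Ev.
    destruct (injection_sub emp k) as (f & Hf & _); eauto. intros z Hz. now apply in_emp in Hz.
Qed.

Lemma cantor (a f : V) : ~ is_injection f (pow a) a.
Proof.
  intros Hf. assert (Ff := proj1 Hf). apply injection_ap in Hf as [_ If].
  pose (D := sep a (fun z => exists y, rel f y z /\ z ∉ y)).
  assert (HD : forall z, z ∈ D <-> z ∈ a /\ exists y, rel f y z /\ z ∉ y)
    by (intros z; apply (in_sep (fun z => exists y, rel f y z /\ z ∉ y)); dfn_tac).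
  assert (HDp : D ∈ pow a) by (apply in_pow; intros z Hz; now apply HD in Hz).
  assert (Hd : ap f D ∈ a) by (eapply ap_in; eauto).
  assert (Rd : rel f D (ap f D)) by (eapply ap_rel; eauto).
  assert (N : ap f D ∉ D).
  { intros K. assert (K' := K). apply HD in K' as (_ & y & Hy & Ny).
    assert (y ∈ pow a) by (eapply fun_dom; eauto).
    assert (y = D); [|subst y; auto]. apply If; auto. eapply ap_eq; eauto. }
  apply N, HD. split; auto. exists D. auto.
Qed.

(** The injection avoids [c], so that those for successive terms of the critical sequence have
    disjoint ranges and can be glued. *)
Definition inj_interval c d : Prop := exists v, in_dom W v /\ (level_of c v /\
  exists q, in_dom W q /\ (is_injection q v d /\
    forall x, x ∈ v -> forall y, y ∈ d -> rel q x y -> y ∉ c)).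

Lemma def_inj_interval {Q : V -> Prop} : definable false DW Q (fun e => inj_interval (e 0) (e 1)).
Proof. unfold inj_interval. dfn_tac. Qed.
#[local] Hint Resolve def_inj_interval : dfn.

(** For x in [VV k], the pairs of x with elements of [VV (succ k)] cannot all be sent below [k]: the
    subsets of [k] are among these elements, and Cantor's theorem applies. So x goes to the least
    value outside [k] that such a pair receives. *)
Lemma inj_interval_crit : inj_interval k (J k).
Proof.
  assert (HJl := J_lt_l k Hk). assert (OJ : is_ordinal (J k)) by (apply (ord_in l); auto).
  assert (LJ : is_limit (J k)) by (apply (proj1 (J_limit (E := E) k kW)); apply crit_limit).
  assert (IJ : inj_below (J k)).
  { apply (proj1 (transfer1 (E := E) (B := false) inj_below k ltac:(dfn_tac) kW)). apply inj_below_crit. }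
  rewrite inj_below_VV in IJ by auto.
  assert (Osk : is_ordinal (succ k)) by auto using ord_succ.
  assert (Osk2 : is_ordinal (succ (succ k))) by auto using ord_succ.
  assert (Osk3 : is_ordinal (succ (succ (succ k)))) by auto using ord_succ.
  (* An ordered pair of elements of [VV (succ k)] appears two stages later. *)
  destruct (IJ (succ (succ (succ k)))) as (e & He).
  { apply limit_succ, limit_succ, limit_succ; auto using crit_lt. }
  assert (pairs : forall x y, x ∈ VV k -> y ∈ VV (succ k) -> opair x y ∈ VV (succ (succ (succ k)))).
  { intros x y Hx Hy. assert (Hx' : x ∈ VV (succ k)).
    { apply (VV_mono k (succ k)); auto. intros z Hz. apply in_succ; auto. }
    apply VV_succ; auto. intros u Hu. apply VV_succ; auto. intros z Hz.
    apply in_upair in Hu as [->| ->]; apply in_upair in Hz as [->| ->]; auto. }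
  assert (Ee := proj1 He). assert (Ie := proj2 (proj1 (injection_ap _ _ _) He)).
  assert (big : forall x, x ∈ VV k -> exists z, z ∈ J k /\ z ∉ k /\ exists y, y ∈ VV (succ k) /\ rel e (opair x y) z).
  { intros x Hx. apply NNPP. intros N.
    destruct (fun_ex (fun y z => rel e (opair x y) z) (pow k) k) as (f & Hf & _ & Ef).
    - apply (def_equiv' (fun e' => exists p, is_opair p x (e' 0) /\ rel e p (e' 1))); [|dfn_tac].
      intros e'. split.
      + intros (p & Hp & H). apply is_opair_opair in Hp. now subst.
      + intros H. exists (opair x (e' 0)). rewrite is_opair_opair. auto.
    - intros y Hy. apply in_pow in Hy.
      assert (Hy' : y ∈ VV (succ k)) by (apply VV_succ; auto; apply (sub_trans y k); auto using ord_sub_VV).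
      exists (ap e (opair x y)). assert (R : rel e (opair x y) (ap e (opair x y))) by (eapply ap_rel; eauto).
      split; auto. apply NNPP. intros Nz. apply N. exists (ap e (opair x y)).
      split; [eapply ap_in; eauto|]. eauto.
    - intros y z z' _ _ _ H1 H2. eapply fun_func; [exact Ee|eauto|eauto].
    - apply (cantor k f). apply injection_ap. split; auto. intros y y' Hy Hy' Eq.
      assert (H1 := Ef y Hy). assert (H2 := Ef y' Hy'). rewrite Eq in H1.
      assert (Eo : opair x y = opair x y').
      { apply (proj2 He _ (fun_dom _ _ _ _ _ Ee H1) _ (fun_dom _ _ _ _ _ Ee H2) _ (fun_cod _ _ _ _ _ Ee H1)); auto. }
      now apply opair_inj in Eo. }
  pose (P := fun x z => z ∉ k /\ exists y p, y ∈ VV (succ k) /\ is_opair p x y /\ rel e p z).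
  assert (HP : forall x z, P x z <-> z ∉ k /\ exists y, y ∈ VV (succ k) /\ rel e (opair x y) z).
  { intros x z. unfold P. split; intros [H1 H2]; split; auto.
    - destruct H2 as (y & p & Hy & Ho & Hr). apply is_opair_opair in Ho. subst p. eauto.
    - destruct H2 as (y & Hy & Hr). exists y, (opair x y). rewrite is_opair_opair. auto. }
  assert (dP : dfn (fun e => P (e 0) (e 1))) by (unfold P; dfn_tac).
  destruct (fun_ex (fun x z => P x z /\ forall z', z' ∈ J k -> P x z' -> z ⊆ z') (VV k) (J k)) as (q & Fq & Rq & Eq).
  - dfn_tac.
  - intros x Hx. destruct (big x Hx) as (z & Hz & Nz & Hy).
    destruct (least_ord (fun z => z ∈ J k /\ P x z) z) as (m & Om & [Hm Pm] & _ & Km); auto.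
    + dfn_tac.
    + apply (ord_in (J k)); auto.
    + split; auto. now apply HP.
    + exists m. split; auto. split; auto. intros z' Hz' Pz'. apply Km; auto. apply (ord_in (J k)); auto.
  - intros x z z' _ Hz Hz' [P1 K1] [P2 K2]. apply sub_antisym; auto.
  - exists (VV k). split; [apply Vl_sub_W; now apply VV_lt|]. split; [now apply level_of_VV|].
    exists q. split.
    { apply (fun_W q (VV k) (J k)); auto; [|apply ord_sub_Vl; now apply (proj1 Ol)].
      apply VV_trans; auto. now apply VV_lt. }
    split.
    + apply injection_ap. split; auto. intros x x' Hx Hx' Eqq.
      destruct (Eq x Hx) as [P1 _], (Eq x' Hx') as [P2 _]. rewrite Eqq in P1.
      apply HP in P1 as (_ & y & Hy & H1), P2 as (_ & y' & Hy' & H2).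
      assert (Eo : opair x y = opair x' y').
      { apply (proj2 He _ (fun_dom _ _ _ _ _ Ee H1) _ (fun_dom _ _ _ _ _ Ee H2) _ (fun_cod _ _ _ _ _ Ee H1)); auto. }
      now apply opair_inj in Eo.
    + intros x Hx z Hz Hr. apply Rq in Hr as (_ & _ & [Nz _] & _). exact Nz.
Qed.

(** A bijection from b below [k] onto [k] would be sent to one from b onto [J k] with the same
    values, which never takes the value [k]. *)
Lemma crit_cardinal : is_cardinal k.
Proof.
  split; auto. intros b Hb (f & Hf). assert (Hbl : b ∈ l) by now apply (ord_trans b k).
  assert (HbW := lt_W b Hbl).
  assert (HfW : f ∈ W).
  { apply (fun_W f b k); [apply ord_sub_Vl, (proj1 Ol); auto|apply ord_sub_Vl, (proj1 Ol); auto|apply Hf]. }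
  assert (HJf : is_bijection (J f) b (J k)).
  { rewrite <- (Fk b Hb). apply (proj1 (transfer3 (E := E) (B := false) is_bijection f b k ltac:(dfn_tac) HfW HbW kW)). auto. }
  destruct (proj2 HJf k crit_lt) as (x & [Hx Rx] & _).
  assert (Hxk : x ∈ k) by now apply (ord_trans x b).
  assert (Hy : ap f x ∈ k) by (eapply ap_in; [apply Hf|auto]).
  assert (R : rel (J f) (J x) (J (ap f x))).
  { apply (proj1 (J_rel (E := E) f x (ap f x) HfW (lt_W x (ord_trans x k l Ol Hxk Hk)) (lt_W _ (ord_trans _ k l Ol Hy Hk)))).
    eapply ap_rel; [apply Hf|auto]. }
  rewrite (Fk x Hxk), (Fk _ Hy) in R.
  assert (Ek : k = ap f x) by (eapply fun_func; [apply HJf|eauto|eauto]).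
  rewrite <- Ek in Hy. now apply not_in_self in Hy.
Qed.

Definition cardinal_W c : Prop :=
  is_ordinal c /\ forall a, a ∈ c -> ~ exists f, in_dom W f /\ is_bijection f a c.

Lemma def_cardinal_W {Q : V -> Prop} : definable false DW Q (fun e => cardinal_W (e 0)).
Proof. unfold cardinal_W. dfn_tac. Qed.
#[local] Hint Resolve def_cardinal_W : dfn.

Lemma cardinal_W_iff c : c ∈ l -> (cardinal_W c <-> is_cardinal c).
Proof.
  intros Hc. split; intros [Oc H]; split; auto; intros a Ha.
  - intros (f & Hf). apply (H a Ha). exists f. split; auto.
    apply (fun_W f a c); [|apply ord_sub_Vl, (proj1 Ol); auto|apply Hf].
    apply ord_sub_Vl, (proj1 Ol). now apply (ord_trans a c).
  - intros (f & _ & Hf). apply (H a Ha). eauto.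
Qed.

(** ** The supremum of the critical sequence *)

(** What is known of [k] and [J k] is definable in [W], and applying [j] passes it from one pair of
    successive terms to the next. *)
Lemma crit_sequence : exists f d, is_fun f omega l /\ ap f emp = k /\
  (forall n, is_nat n -> ap f n ∈ ap f (succ n)) /\ is_limit d /\ d ⊆ l /\ J d = d /\ k ∈ d /\
  (forall z, z ∈ d <-> exists n, is_nat n /\ z ∈ ap f n) /\
  (forall n, is_nat n -> is_cardinal (ap f n)) /\
  (forall n, is_nat n -> inj_interval (ap f n) (ap f (succ n))).
Proof.
  destruct (iterate_J k Hk) as (f & Hf & H0 & HS).
  assert (Hin : forall n, is_nat n -> ap f n ∈ l) by (intros n Hn; eapply ap_in; eauto; now apply in_omega).
  assert (Hr : forall n, is_nat n -> rel f n (ap f n)) by (intros n Hn; eapply ap_rel; eauto; now apply in_omega).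
  destruct (orbit_sup k f Hk Hf H0 HS) as (d & Od & Hdl & Sd & Jd).
  rewrite is_sup_iff in Sd by auto.
  pose (P := fun x y => x ∈ y /\ inj_interval x y /\ cardinal_W x).
  assert (dP : definable false DW fixed (fun e => P (e 0) (e 1))) by (unfold P; dfn_tac).
  assert (dI : dfn (fun e => inj_interval (e 0) (e 1))).
  { unfold inj_interval, in_dom, level_of. dfn_tac. }
  assert (main : forall n, is_nat n -> P (ap f n) (ap f (succ n))).
  { intros n Hn. assert (G : forall x y m, rel f n x -> is_succ n m -> rel f m y ->
      x ∈ y /\ inj_interval x y /\ is_cardinal x).
    { revert n Hn. apply (nat_ind' (fun n => forall x y m, rel f n x -> is_succ n m -> rel f m y ->
        x ∈ y /\ inj_interval x y /\ is_cardinal x)).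
      - dfn_tac.
      - intros x y m Hx Hm Hy. apply is_succ_succ in Hm. subst m.
        apply (rel_ap f omega l) in Hx as [_ ->]; auto. apply (rel_ap f omega l) in Hy as [_ ->]; auto.
        rewrite HS, H0 by apply nat_emp. split; [apply crit_lt|]. split; [apply inj_interval_crit|apply crit_cardinal].
      - intros n Hn IH x y m Hx Hm Hy. apply is_succ_succ in Hm. subst m.
        apply (rel_ap f omega l) in Hx as [_ ->]; auto. apply (rel_ap f omega l) in Hy as [_ ->]; auto.
        assert (Hsn := nat_succ n Hn).
        destruct (IH (ap f n) (ap f (succ n)) (succ n)) as (A1 & A2 & A3); auto; [now apply is_succ_succ|].
        assert (P0 : P (ap f n) (ap f (succ n))) by (split; auto; split; auto; apply cardinal_W_iff; auto).
        apply (proj1 (transfer2 (E := E) P _ _ dP (lt_W _ (Hin n Hn)) (lt_W _ (Hin _ Hsn)))) in P0.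
        rewrite <- !HS in P0 by auto. destruct P0 as (B1 & B2 & B3). split; auto. split; auto.
        apply cardinal_W_iff; auto. }
    destruct (G (ap f n) (ap f (succ n)) (succ n)) as (A1 & A2 & A3); auto using nat_succ; [now apply is_succ_succ|].
    split; auto. split; auto. apply cardinal_W_iff; auto. }
  exists f, d. split; auto. split; auto. split; [intros n Hn; apply (main n Hn)|].
  assert (Hkd : forall n, is_nat n -> ap f n ∈ d).
  { intros n Hn. apply Sd. exists (succ n). split; auto using nat_succ. apply (main n Hn). }
  split.
  { apply limit_intro; auto.
    - apply nonempty. exists (ap f emp). apply Hkd, nat_emp.
    - intros z Hz. apply Sd in Hz as (n & Hn & Hz). apply Sd. exists (succ n). split; auto using nat_succ.
      assert (On : is_ordinal (ap f n)) by (apply (ord_in l); auto).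
      assert (Oz : is_ordinal z) by (apply (ord_in (ap f n)); auto).
      apply (ord_le_lt (succ z) (ap f n)); auto using ord_succ; [| |apply (main n Hn)].
      + apply (ord_in l); auto using nat_succ.
      + now apply succ_le. }
  split; auto. split; auto. split; [rewrite <- H0; apply Hkd, nat_emp|]. split; auto.
  split; intros n Hn; [apply cardinal_W_iff; auto|]; apply (main n Hn).
Qed.

(** One injection is chosen for each interval of the sequence, and x is sent by the first one whose
    domain contains it. Injectivity across different domains holds because the ranges lie in
    disjoint intervals. *)
Lemma Vd_injection f d : is_fun f omega l ->
  (forall n, is_nat n -> ap f n ∈ ap f (succ n)) -> is_limit d -> d ⊆ l ->
  (forall z, z ∈ d <-> exists n, is_nat n /\ z ∈ ap f n) ->
  (forall n, is_nat n -> inj_interval (ap f n) (ap f (succ n))) ->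
  exists h, is_injection h (VV d) d.
Proof.
  intros Hf Hinc Ld Hdl Hd HI.
  assert (Hin : forall n, is_nat n -> ap f n ∈ l) by (intros n Hn; eapply ap_in; eauto; now apply in_omega).
  assert (On : forall n, is_nat n -> is_ordinal (ap f n)) by (intros n Hn; apply (ord_in l); auto).
  assert (Hmono : forall m, is_nat m -> forall n, n ∈ m -> ap f (succ n) ⊆ ap f m).
  { intros m Hm. assert (G : forall n x y n', n ∈ m -> is_succ n n' -> rel f n' x -> rel f m y -> x ⊆ y).
    { revert m Hm. apply (nat_ind' (fun m => forall n x y n', n ∈ m -> is_succ n n' -> rel f n' x -> rel f m y -> x ⊆ y)).
      - dfn_tac.
      - intros n x y n' Hn. now apply in_emp in Hn.
      - intros m Hm IH n x y n' Hn Hn' Hx Hy. apply is_succ_succ in Hn'. subst n'.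
        apply in_succ in Hn as [Hn| ->].
        + apply (sub_trans x (ap f m)).
          * apply (IH n x (ap f m) (succ n)); auto; [now apply is_succ_succ|].
            eapply ap_rel; eauto. now apply in_omega.
          * apply (rel_ap f omega l) in Hy as [_ ->]; auto.
            apply (proj1 (On (succ m) (nat_succ m Hm))). now apply Hinc.
        + rewrite (fun_func f omega l (succ m) x y); auto using sub_refl. }
    intros n Hn. assert (Nn : is_nat n) by (eapply nat_in; eauto).
    apply (G n _ _ (succ n)); auto; [now apply is_succ_succ| |]; eapply ap_rel; eauto; apply in_omega; auto using nat_succ. }
  destruct (choice Ll HDC (fun n q => forall c c' n', rel f n c -> is_succ n n' -> rel f n' c' ->
     is_V c (VV c) -> forall v, is_V c v -> is_injection q v c' /\ forall x y, rel q x y -> y ∉ c) omega W)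
    as (Q & FQ & HQ).
  { apply (def_equiv' (fun e => forall c c' n', rel f (e 0) c -> is_succ (e 0) n' -> rel f n' c' ->
     forall v, is_V c v -> is_injection (e 1) v c' /\ forall x y, rel (e 1) x y -> y ∉ c)); [|dfn_tac].
    intros e. split.
    - intros H c c' n' H1 H2 H3 _. now apply (H c c' n').
    - intros H c c' n' H1 H2 H3 v Hv. apply (H c c' n'); auto. apply is_V_VV. split; auto. apply Hv. }
  { apply omega_lt. }
  { intros n Hn. apply in_omega in Hn. destruct (HI n Hn) as (v & _ & Hv & q & Hq & Iq & Kq).
    apply level_of_VV in Hv; auto. subst v. exists q. split; auto.
    intros c c' n' Hc Hn' Hc' _ v Hv. apply is_succ_succ in Hn'. subst n'.
    apply (rel_ap f omega l) in Hc as [_ ->]; auto. apply (rel_ap f omega l) in Hc' as [_ ->]; auto.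
    apply is_V_VV in Hv as [_ ->]. split; auto. intros x y Hr. apply (Kq x); auto.
    - eapply fun_dom; [apply Iq|eauto].
    - eapply fun_cod; [apply Iq|eauto]. }
  assert (HQ' : forall n, is_nat n -> is_injection (ap Q n) (VV (ap f n)) (ap f (succ n)) /\
    forall x y, rel (ap Q n) x y -> y ∉ ap f n).
  { intros n Hn. apply in_omega in Hn as Hn'. apply (HQ n Hn' (ap f n) (ap f (succ n)) (succ n)).
    - eapply ap_rel; eauto.
    - now apply is_succ_succ.
    - eapply ap_rel; eauto. apply in_omega. now apply nat_succ.
    - apply is_V_VV. auto.
    - apply is_V_VV. auto. }
  pose (lev := fun x n => is_nat n /\ (exists c v, rel f n c /\ is_V c v /\ x ∈ v) /\
    forall m c v, m ∈ n -> rel f m c -> is_V c v -> x ∉ v).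
  assert (Hlev : forall x n, lev x n <-> is_nat n /\ x ∈ VV (ap f n) /\ forall m, m ∈ n -> x ∉ VV (ap f m)).
  { intros x n. unfold lev. split.
    - intros (Nn & (c & v & Hc & Hv & Hx) & H). split; auto.
      apply (rel_ap f omega l) in Hc as [_ ->]; auto. apply is_V_VV in Hv as [_ ->]. split; auto.
      intros m Hm. assert (Nm : is_nat m) by (eapply nat_in; eauto).
      apply (H m (ap f m)); auto; [|apply is_V_VV; auto]. eapply ap_rel; eauto. now apply in_omega.
    - intros (Nn & Hx & H). split; auto. split.
      + exists (ap f n), (VV (ap f n)). rewrite is_V_VV. split; auto. eapply ap_rel; eauto. now apply in_omega.
      + intros m c v Hm Hc Hv. apply (rel_ap f omega l) in Hc as [_ ->]; auto.
        apply is_V_VV in Hv as [_ ->]. auto. }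
  assert (dlev : dfn (fun e => lev (e 0) (e 1))) by (unfold lev; dfn_tac).
  assert (lev_ex : forall x, x ∈ VV d -> exists n, lev x n).
  { intros x Hx. apply VV_limit in Hx as (b & Hb & Hx); auto. apply Hd in Hb as (n & Hn & Hb).
    assert (Hxn : x ∈ VV (ap f n)).
    { apply (VV_mono b (ap f n)); auto; [apply (ord_in (ap f n)); auto|]. apply (proj1 (On n Hn) b Hb). }
    destruct (least_ord (fun n => is_nat n /\ exists c v, rel f n c /\ is_V c v /\ x ∈ v) n) as (m & Om & (Nm & Hm) & _ & Km).
    - dfn_tac.
    - now apply nat_ord.
    - split; auto. exists (ap f n), (VV (ap f n)). rewrite is_V_VV. split; auto.
      eapply ap_rel; eauto. now apply in_omega.
    - exists m. split; auto. split; auto. intros i c v Hi Hc Hv Hxv.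
      assert (Ni : is_nat i) by (eapply nat_in; eauto).
      assert (L : m ⊆ i) by (apply Km; [now apply nat_ord|split; eauto]). apply L in Hi. now apply not_in_self in Hi. }
  assert (lev_u : forall x n n', lev x n -> lev x n' -> n = n').
  { intros x n n' H H'. apply Hlev in H as (Nn & Hx & H), H' as (Nn' & Hx' & H').
    destruct (ord_tri n n') as [L|[L|L]]; auto using nat_ord.
    - destruct (H' n L Hx).
    - destruct (H n' L Hx'). }
  assert (Hv : forall x n, lev x n -> ap (ap Q n) x ∈ ap f (succ n) /\ ap (ap Q n) x ∉ ap f n /\ rel (ap Q n) x (ap (ap Q n) x)).
  { intros x n H. apply Hlev in H as (Nn & Hx & _). destruct (HQ' n Nn) as [[Fq Iq] Kq].
    assert (R : rel (ap Q n) x (ap (ap Q n) x)) by (eapply ap_rel; eauto).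
    split; [eapply ap_in; eauto|]. split; eauto. }
  destruct (fun_ex (fun x y => exists n q, lev x n /\ rel Q n q /\ rel q x y) (VV d) d) as (h & Fh & Rh & Eh).
  - dfn_tac.
  - intros x Hx. destruct (lev_ex x Hx) as (n & Hn). destruct (Hv x n Hn) as (A1 & A2 & A3).
    assert (Nn : is_nat n) by apply Hn.
    exists (ap (ap Q n) x). split; [apply Hd; exists (succ n); auto using nat_succ|].
    exists n, (ap Q n). split; auto. split; auto. eapply ap_rel; eauto. now apply in_omega.
  - intros x y y' _ _ _ (n & q & Hn & Hq & Hy) (n' & q' & Hn' & Hq' & Hy').
    rewrite (lev_u x n' n Hn' Hn) in Hq'. rewrite (fun_func Q omega W n q' q FQ Hq' Hq) in Hy'.
    assert (Nn : is_nat n) by apply Hn. rewrite <- (ap_eq Q omega W n q FQ Hq) in Hy, Hy'.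
    apply (fun_func (ap Q n) (VV (ap f n)) (ap f (succ n)) x); auto. apply (HQ' n Nn).
  - exists h. apply injection_ap. split; auto. intros x x' Hx Hx' Eq.
    destruct (Eh x Hx) as (n & q & Hn & Hq & Hy), (Eh x' Hx') as (n' & q' & Hn' & Hq' & Hy').
    assert (Nn : is_nat n) by apply Hn. assert (Nn' : is_nat n') by apply Hn'.
    rewrite <- (ap_eq Q omega W n q FQ Hq) in Hy. rewrite <- (ap_eq Q omega W n' q' FQ Hq') in Hy'.
    rewrite <- Eq in Hy'.
    destruct (HQ' n Nn) as [I1 K1], (HQ' n' Nn') as [I2 K2].
    assert (n = n').
    { destruct (ord_tri n n') as [L|[L|L]]; auto using nat_ord; exfalso.
      - apply (K2 _ _ Hy'). apply (Hmono n' Nn' n L). eapply fun_cod; [apply I1|eauto].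
      - apply (K1 _ _ Hy). apply (Hmono n Nn n' L). eapply fun_cod; [apply I2|eauto]. }
    subst n'. apply (proj2 I1 x) with (y := ap h x); auto.
    + eapply fun_dom; [apply I1|eauto].
    + eapply fun_dom; [apply I1|eauto].
    + eapply fun_cod; [apply I1|eauto].
Qed.

End Crit.

#[local] Hint Resolve def_is_sup : dfn.

(** * Omega-clubs and Kunen's inconsistency argument *)

(** No monotonicity is asked of [f]: a supremum that is attained is in [C] anyway. The restriction
    to [W] makes the notion transferable. *)
Definition wclub {V : structure} (W C t w : V) : Prop :=
  C ⊆ t /\ (forall b, b ∈ t -> exists c, c ∈ C /\ b ∈ c) /\
  forall f, in_dom W f -> is_fun f w C -> forall g, g ∈ t -> is_sup g f C w -> g ∈ C.

(* For [e] enumerating injections [e_g] of the ordinals [g < t], the set of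
   [g] with [e_g(b) = x] meets every omega-club. *)
Definition positive {V : structure} (W e b x t w : V) : Prop :=
  forall C, in_dom W C -> wclub W C t w -> exists g, g ∈ C /\ (b ∈ g /\
    exists q, in_dom W q /\ (rel e g q /\ rel q b x)).

Section Clubs.
Context {V : structure} {HZF : ZF V}.
Implicit Types x y z a b c d f g h k n u v : V.

Lemma def_wclub {W : V} {Q : V -> Prop} {T : trans_domains (two_domains W W)} :
  definable false (two_domains W W) Q (fun e => wclub W (e 0) (e 1) (e 2)).
Proof. unfold wclub. dfn_tac. Qed.
#[local] Hint Resolve def_wclub : dfn.

Lemma def_positive {W : V} {Q : V -> Prop} {T : trans_domains (two_domains W W)} :
  definable false (two_domains W W) Q (fun e => positive W (e 0) (e 1) (e 2) (e 3) (e 4)).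
Proof. unfold positive. dfn_tac. Qed.

Lemma def_wclub_univ {W : V} : dfn (fun e => wclub W (e 0) (e 1) (e 2)).
Proof. unfold wclub, in_dom. dfn_tac. Qed.
#[local] Hint Resolve def_wclub_univ : dfn.

Lemma def_positive_univ {W : V} : dfn (fun e => positive W (e 0) (e 1) (e 2) (e 3) (e 4)).
Proof. unfold positive, in_dom. dfn_tac. Qed.

Context {W d th h e U : V} (Ld : is_limit d) (Hh : is_injection h (VV d) d)
  (Oth : is_ordinal th)
  (Hth : forall b, b ∈ th <-> is_ordinal b /\ exists f, is_injection f b d)
  (Fe : is_fun e th U) (He : forall g, g ∈ th -> is_injection (ap e g) g d)
  (HW : forall f, is_fun f omega th -> f ∈ W).
Let Od : is_ordinal d := limit_ord d Ld.

Lemma omega_sub_d : omega ⊆ d.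
Proof. now apply omega_le_limit. Qed.

Lemma no_injection_Vd : ~ exists f, is_injection f th (VV d).
Proof.
  intros (f & Hf). destruct (injection_comp f h th (VV d) d Hf Hh) as (g & Hg & _).
  apply (not_in_self th). apply Hth. eauto.
Qed.

(** Regularity of the Hartogs number. For an unbounded [F], each b below [th] could be coded by the
    least x with b below [ap F x] together with the value at b of the injection with index [ap F x].
    This would inject [th] into [VV d], hence into [d]. *)
Lemma bounded F a : is_fun F a th -> a ⊆ d ->
  exists b, b ∈ th /\ forall x, x ∈ a -> ap F x ⊆ b.
Proof.
  intros HF Ha. apply NNPP. intros N.
  assert (Hcof : forall b, b ∈ th -> exists x, x ∈ a /\ b ∈ ap F x).
  { intros b Hb. apply NNPP. intros Nb. apply N. exists b. split; auto. intros x Hx.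
    assert (HFx : ap F x ∈ th) by (eapply ap_in; eauto).
    destruct (ord_lt_or_le b (ap F x)) as [L|L]; auto; try (apply (ord_in th); auto).
    destruct Nb. eauto. }
  apply no_injection_Vd.
  pose (P := fun b x => exists g, rel F x g /\ b ∈ g).
  assert (HP : forall b x, P b x <-> x ∈ a /\ b ∈ ap F x).
  { intros b x. unfold P. split.
    - intros (g & Hg & Hb). apply (rel_ap F a th) in Hg as [Hx ->]; auto.
    - intros [Hx Hb]. exists (ap F x). split; auto. eapply ap_rel; eauto. }
  assert (dP : dfn (fun e => P (e 0) (e 1))) by (unfold P; dfn_tac).
  destruct (fun_ex (fun b p => exists x g q y, P b x /\ (forall x', P b x' -> x ⊆ x') /\
    rel F x g /\ rel e g q /\ rel q b y /\ is_opair p x y) th (VV d)) as (i & Fi & _ & Ei).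
  - dfn_tac.
  - intros b Hb. destruct (Hcof b Hb) as (x & Hx & Hbx).
    destruct (least_ord (P b) x) as (m & Om & Pm & _ & Km).
    + unfold P. dfn_tac.
    + apply (ord_in d); auto.
    + now apply HP.
    + assert (Pm' := Pm). apply HP in Pm' as [Hm Hbm].
      assert (HFm : ap F m ∈ th) by (eapply ap_in; eauto).
      destruct (He _ HFm) as [Fq Iq].
      exists (opair m (ap (ap e (ap F m)) b)). split.
      * apply VV_opair_limit; auto; apply ord_sub_VV; auto. eapply ap_in; eauto.
      * exists m, (ap F m), (ap e (ap F m)), (ap (ap e (ap F m)) b).
        split; auto. split.
        { intros x' Hx'. apply Km; auto. apply HP in Hx' as [Hx' _]. apply (ord_in d); auto. }
        split; [eapply ap_rel; eauto|]. split; [eapply ap_rel; eauto|].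
        split; [eapply ap_rel; eauto|]. now apply is_opair_opair.
  - intros b p p' _ _ _ (x & g & q & y & P1 & K1 & A1 & A2 & A3 & A4) (x' & g' & q' & y' & P2 & K2 & B1 & B2 & B3 & B4).
    assert (x = x') by (apply sub_antisym; auto). subst x'.
    assert (g = g') by (eapply fun_func; [exact HF|eauto|eauto]). subst g'.
    assert (q = q') by (eapply fun_func; [exact Fe|eauto|eauto]). subst q'.
    assert (Hg : g ∈ th) by (eapply fun_cod; eauto). destruct (He g Hg) as [Fq _].
    rewrite (ap_eq e th U g q Fe A2) in Fq.
    assert (y = y') by (eapply fun_func; [exact Fq|eauto|eauto]). subst y'.
    apply is_opair_opair in A4, B4. congruence.
  - exists i. apply injection_ap. split; auto. intros b b' Hb Hb' Eq.
    destruct (Ei b Hb) as (x & g & q & y & P1 & K1 & A1 & A2 & A3 & A4).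
    destruct (Ei b' Hb') as (x' & g' & q' & y' & P2 & K2 & B1 & B2 & B3 & B4).
    rewrite <- Eq in B4. destruct (is_opair_inj A4 B4) as [<- <-].
    assert (g = g') by (eapply fun_func; [exact HF|eauto|eauto]). subst g'.
    assert (q = q') by (eapply fun_func; [exact Fe|eauto|eauto]). subst q'.
    assert (Hg : g ∈ th) by (eapply fun_cod; eauto). destruct (He g Hg) as [Fq Iq].
    rewrite (ap_eq e th U g q Fe A2) in Fq, Iq.
    apply (Iq b) with (y := y); auto.
    + eapply fun_dom; eauto.
    + eapply fun_dom; eauto.
    + eapply fun_cod; eauto.
Qed.

Lemma sup_lt f g : is_fun f omega th -> is_ordinal g ->
  (forall z, z ∈ g <-> exists n, is_nat n /\ z ∈ ap f n) -> g ∈ th.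
Proof.
  intros Hf Og Hg. destruct (bounded f omega Hf omega_sub_d) as (b & Hb & K).
  apply (ord_le_lt g b); auto; [apply (ord_in th); auto|].
  intros z Hz. apply Hg in Hz as (n & Hn & Hz). apply (K n); auto. now apply in_omega.
Qed.

Lemma th_limit : is_limit th.
Proof.
  assert (Hd : d ∈ th) by (apply Hth; split; auto; destruct (injection_sub d d (sub_refl d)) as (f & Hf & _); eauto).
  apply infinite_cardinal_limit.
  - split; auto. intros a Ha (f & Hf). apply bijection_injections in Hf as (_ & g & Hg).
    apply (not_in_self th), Hth. split; auto. apply Hth in Ha as (_ & f' & Hf').
    destruct (injection_comp g f' th a d) as (i & Hi & _); eauto.
  - apply (sub_trans omega d); auto using omega_sub_d. apply (proj1 Oth d Hd).
Qed.

(** By regularity, the next elements above c in all these clubs have a common bound. Iterating this,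
    the supremum of the bounds is for each x also the supremum of a sequence from the club with
    index x. *)
Lemma wclub_inter C Y b : is_fun C d Y -> (forall x, x ∈ d -> wclub W (ap C x) th omega) -> b ∈ th ->
  exists g, b ∈ g /\ g ∈ th /\ forall x, x ∈ d -> g ∈ ap C x.
Proof.
  intros HC HCl Hb.
  pose (N := fun x c c' => exists D, rel C x D /\ c' ∈ D /\ c ∈ c' /\ forall c'', c'' ∈ D -> c ∈ c'' -> c' ⊆ c'').
  assert (dN : dfn (fun e => N (e 0) (e 1) (e 2))) by (unfold N; dfn_tac).
  assert (HN : forall x c, x ∈ d -> c ∈ th -> exists c', c' ∈ ap C x /\ c' ∈ th /\ c ∈ c' /\ N x c c').
  { intros x c Hx Hc. destruct (HCl x Hx) as (H1 & H2 & _). destruct (H2 c Hc) as (c0 & Hc0 & L0).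
    destruct (least_ord (fun c' => c' ∈ ap C x /\ c ∈ c') c0) as (m & Om & [Hm Lm] & _ & Km); auto.
    - dfn_tac.
    - apply (ord_in th); auto.
    - exists m. split; auto. split; auto. split; auto. exists (ap C x). split; [eapply ap_rel; eauto|].
      split; auto. split; auto. intros c'' H3 H4. apply Km; auto. apply (ord_in th); auto. }
  assert (UN : forall x c c' c'', N x c c' -> N x c c'' -> c' = c'').
  { intros x c c' c'' (D & A1 & A2 & A3 & A4) (D' & B1 & B2 & B3 & B4).
    assert (D = D') by (eapply fun_func; [exact HC|eauto|eauto]). subst D'. apply sub_antisym; auto. }
  pose (St := fun c y => c ∈ y /\ forall x c', x ∈ d -> N x c c' -> c' ⊆ y).
  assert (dSt : dfn (fun e => St (e 0) (e 1))) by (unfold St; dfn_tac).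
  destruct (fun_ex (fun c y => St c y /\ forall y', y' ∈ th -> St c y' -> y ⊆ y') th th) as (S & FS & _ & ES).
  { dfn_tac. }
  { intros c Hc. destruct (fun_ex (fun x c' => N x c c') d th) as (F & HF & _ & EF).
    - apply (def_substs _ ((fun e => e 0) :: (fun _ => c) :: (fun e => e 1) :: nil) dN).
      repeat constructor; dfn_tac.
    - intros x Hx. destruct (HN x c Hx Hc) as (c' & _ & H1 & _ & H2). eauto.
    - intros x c1 c2 _ _ _. apply UN.
    - destruct (bounded F d HF (sub_refl d)) as (y & Hy & Ky).
      assert (Hx0 : emp ∈ d) by now apply limit_emp.
      destruct (HN emp c Hx0 Hc) as (c' & _ & Hc' & Lc & Nc).
      assert (Oy : is_ordinal y) by (apply (ord_in th); auto).
      destruct (least_ord (fun y => y ∈ th /\ St c y) y) as (m & Om & [Hm Sm] & _ & Km); auto.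
      + dfn_tac.
      + split; auto. split.
        * apply (Ky emp Hx0). now rewrite (UN emp c (ap F emp) c' (EF emp Hx0) Nc).
        * intros x c1 Hx Nx. rewrite (UN x c c1 (ap F x) Nx (EF x Hx)). auto.
      + exists m. split; auto. split; auto. intros y' Hy' Sy'. apply Km; auto. apply (ord_in th); auto. }
  { intros c y y' _ Hy Hy' [A1 A2] [B1 B2]. apply sub_antisym; auto. }
  destruct (iterate_fun S th b FS Hb) as (f & Hf & H0 & Hs).
  assert (Hin : forall n, is_nat n -> ap f n ∈ th) by (intros n Hn; eapply ap_in; eauto; now apply in_omega).
  assert (HSt : forall n, is_nat n -> St (ap f n) (ap f (succ n))).
  { intros n Hn. rewrite Hs by auto. now apply ES, Hin. }
  destruct (sup_omega f th Hf) as (g & Og & Hg); [intros n Hn; apply (ord_in th); auto|].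
  assert (Hgt : g ∈ th) by now apply (sup_lt f).
  exists g. split; [|split; auto].
  { apply Hg. exists (succ emp). split; [apply nat_succ, nat_emp|]. rewrite <- H0 at 1. apply (HSt emp), nat_emp. }
  intros x Hx. destruct (HCl x Hx) as (C1 & C2 & C3).
  destruct (fun_ex (fun n c' => exists c, rel f n c /\ N x c c') omega (ap C x)) as (s & Fs & _ & Es).
  { dfn_tac. }
  { intros n Hn. apply in_omega in Hn as Nn. destruct (HN x (ap f n) Hx (Hin n Nn)) as (c' & A1 & _ & _ & A2).
    exists c'. split; auto. exists (ap f n). split; auto. eapply ap_rel; eauto. }
  { intros n c1 c2 _ _ _ (c & A1 & A2) (c' & B1 & B2).
    rewrite (fun_func f omega th n c' c Hf B1 A1) in B2. eapply UN; eauto. }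
  apply (C3 s); auto.
  - apply HW. eapply fun_cod_mono; eauto.
  - apply is_sup_iff; auto. intros z. rewrite Hg.
    assert (Ns : forall n, is_nat n -> N x (ap f n) (ap s n)).
    { intros n Hn. apply in_omega in Hn as Hn'. destruct (Es n Hn') as (c & A1 & A2).
      now rewrite (ap_eq f omega th n c Hf A1). }
    split; intros (n & Hn & Hz).
    + exists n. split; auto. destruct (Ns n Hn) as (D & A1 & A2 & A3 & _).
      apply (ord_trans z (ap f n)); auto. apply (ord_in th); auto. apply C1. eapply ap_in; eauto. now apply in_omega.
    + exists (succ n). split; auto using nat_succ. now apply (proj2 (HSt n Hn) x (ap s n) Hx (Ns n Hn)).
Qed.

Context {l : V} (Ll : is_limit l) (HDC : DC l) (Hdl : d ⊆ l)
  (HeW : forall g, g ∈ th -> ap e g ∈ W).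

(** The Ulam matrix argument: for g above b the injection with index g sends b to some x below [d].
    If no x were positive, an omega-club avoiding x could be chosen for each x, and a common element
    g above b would leave no value for b. *)
Lemma positive_ex b : b ∈ th -> exists x, x ∈ d /\ positive W e b x th omega.
Proof.
  intros Hb. apply NNPP. intros N.
  assert (dp := def_positive_univ (W := W)).
  destruct (choice Ll HDC (fun x C => wclub W C th omega /\
    forall g q, g ∈ C -> b ∈ g -> rel e g q -> ~ rel q b x) d W) as (C & FC & KC); auto.
  - dfn_tac.
  - intros x Hx. apply NNPP. intros NC. apply N. exists x. split; auto. intros C HC HwC.
    apply NNPP. intros Ng. apply NC. exists C. split; auto. split; auto.
    intros g q Hg Hbg Hq Hr. apply Ng. exists g. split; auto. split; auto. exists q. split; auto.
    rewrite <- (ap_eq e th U g q Fe Hq). apply HeW. now apply (proj1 HwC).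
  - destruct (wclub_inter C W b) as (g & Hbg & Hg & K); auto; [intros x Hx; now apply KC|].
    destruct (He g Hg) as [Fq _].
    assert (Hx : ap (ap e g) b ∈ d) by (eapply ap_in; eauto).
    apply (proj2 (KC _ Hx) g (ap e g)); auto; [eapply ap_rel; eauto|]. eapply ap_rel; eauto.
Qed.

(** Pigeonhole by regularity: if for each x the suitable b were bounded, they would all be bounded
    together, against [positive_ex]. *)
Lemma positive_unbounded : exists x, x ∈ d /\
  forall c, c ∈ th -> exists b, b ∈ th /\ c ∈ b /\ positive W e b x th omega.
Proof.
  apply NNPP. intros N. assert (dp := def_positive_univ (W := W)).
  pose (P := fun x c => forall b, b ∈ th -> positive W e b x th omega -> b ⊆ c).
  assert (dP : dfn (fun e => P (e 0) (e 1))).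
  { unfold P. dfn_tac. }
  destruct (fun_ex (fun x c => P x c /\ forall c', c' ∈ th -> P x c' -> c ⊆ c') d th) as (F & HF & _ & EF).
  - dfn_tac.
  - intros x Hx. assert (Hc : exists c, c ∈ th /\ P x c).
    { apply NNPP. intros Nc. apply N. exists x. split; auto. intros c Hc. apply NNPP. intros Nb. apply Nc.
      exists c. split; auto. intros b Hb Pb.
      destruct (ord_lt_or_le c b) as [L|L]; auto; try (apply (ord_in th); auto).
      destruct Nb. eauto. }
    destruct Hc as (c & Hc & Pc).
    destruct (least_ord (fun c => c ∈ th /\ P x c) c) as (m & Om & [Hm Pm] & _ & Km); auto.
    + dfn_tac.
    + apply (ord_in th); auto.
    + exists m. split; auto. split; auto. intros c' H1 H2. apply Km; auto. apply (ord_in th); auto.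
  - intros x c c' _ H1 H2 [A1 A2] [B1 B2]. apply sub_antisym; auto.
  - destruct (bounded F d HF (sub_refl d)) as (b & Hb & Kb).
    assert (Hsb : succ b ∈ th) by (apply limit_succ; auto using th_limit).
    destruct (positive_ex (succ b) Hsb) as (x & Hx & Px).
    assert (L := proj1 (EF x Hx) (succ b) Hsb Px). apply (not_in_self b), (Kb x Hx), L, in_succ_self.
Qed.

End Clubs.
#[export] Hint Resolve def_positive : dfn.

Section Kunen.
Context {V : structure} {HZF : ZF V} {l j : V}.
Notation W := (VV (succ l)).
Context {E : elementary_map W W W j (succ l) (succ l)} (Hcard : is_cardinal l)
  (Hmove : exists x, x ∈ W /\ ~ rel j x x) (HDC : DC l).
Notation J := (ap j).
Notation fixed := (fixed_by W j).
Notation DW := (two_domains W W).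
Implicit Types x y z a b c d f g h k n u v : V.

Let Ol : is_ordinal l := proj1 Hcard.
Let Ll : is_limit l := lambda_limit (E := E) Hcard Hmove.
Let OSl : is_ordinal (succ l) := ord_succ l (proj1 Hcard).

Lemma sub_W x y : y ∈ W -> x ⊆ y -> x ∈ W.
Proof. now apply VV_sub. Qed.

(** As [th] is at most [l], the injections concerned belong to [W], and [th] is definable there from
    the fixed [d]. *)
Lemma fixed_hartogs d th : d ∈ l -> J d = d -> is_ordinal th -> th ⊆ l ->
  (forall b, b ∈ th <-> is_ordinal b /\ exists f, is_injection f b d) -> J th = th.
Proof.
  intros Hd Jd Oth Htl Hth.
  assert (Fd : fixed d) by (split; auto; now apply lt_W).
  assert (inW : forall b f, b ⊆ l -> is_injection f b d -> f ∈ W).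
  { intros b f Hb Hf. apply (fun_W (E := E) Hcard Hmove f b d); [now apply ord_sub_Vl|apply ord_sub_Vl; auto; now apply (proj1 Ol)|apply Hf]. }
  apply (fix_def (E := E) (B := false) (fun y => is_ordinal y /\
    (forall b, b ∈ y -> exists f, in_dom W f /\ is_injection f b d) /\
    ~ exists f, in_dom W f /\ is_injection f y d)).
  - exists l. now apply fixed_l.
  - dfn_tac.
  - now apply ord_W.
  - split; auto. split.
    + intros b Hb. assert (Hb' := Hb). apply Hth in Hb as (_ & f & Hf). exists f. split; auto.
      apply (inW b); auto. apply (sub_trans b th); auto. now apply (proj1 Oth).
    + intros (f & _ & Hf). apply (not_in_self th), Hth. eauto.
  - intros y _ (Oy & K1 & K2). apply ext. intros z. rewrite Hth. split.
    + intros Hz. split; [apply (ord_in y); auto|]. destruct (K1 z Hz) as (f & _ & Hf). eauto.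
    + intros (Oz & f & Hf). destruct (ord_lt_or_le z y) as [L|L]; auto.
      exfalso. apply K2. destruct (injection_restrict f z d y Hf L) as (g & Hg & _). exists g. split; auto.
      apply (inW y); auto. apply (sub_trans y z); auto. apply (sub_trans z th); auto.
      apply (proj1 Oth z). apply Hth. eauto.
Qed.

(** [C] consists of the fixed points below [th]. They are unbounded because suprema of orbits are
    fixed, and closed because [j] does not change an omega-sequence of fixed points. *)
Lemma fixed_wclub d th h e U : is_limit d -> is_injection h (VV d) d -> is_ordinal th -> th ⊆ l ->
  (forall b, b ∈ th <-> is_ordinal b /\ exists f, is_injection f b d) ->
  is_fun e th U -> (forall g, g ∈ th -> is_injection (ap e g) g d) -> J th = th ->
  exists C, C ∈ W /\ wclub W C th omega /\ forall x, x ∈ C -> J x = x.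
Proof.
  intros Ld Hh Oth Htl Hth Fe He Jth.
  assert (thW : th ∈ W) by now apply ord_W.
  assert (Lth : is_limit th) by now apply (th_limit Ld Oth Hth).
  destruct (sep_ex (fun x => rel j x x) th) as (C & HC); [dfn_tac|].
  assert (HC' : forall x, x ∈ C <-> x ∈ th /\ J x = x).
  { intros x. rewrite HC, (rel_J (E := E)). split.
    - intros (H1 & _ & H2). auto.
    - intros (H1 & H2). split; auto. split; auto. apply lt_W; auto. }
  assert (CW : C ∈ W) by (apply (sub_W C th); auto; intros x Hx; now apply HC' in Hx).
  exists C. split; auto. split; [|intros x Hx; now apply HC'].
  split; [intros x Hx; now apply HC'|]. split.
  - intros b Hb. assert (Hsb : succ b ∈ th) by now apply limit_succ.
    destruct (iterate_J (E := E) Hcard Hmove (succ b)) as (f & Hf & H0 & Hs); auto.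
    destruct (orbit_sup (E := E) Hcard Hmove (succ b) f) as (g & Og & Hgl & Sg & Jg); auto.
    rewrite is_sup_iff in Sg by auto.
    assert (Hin : forall n, is_nat n -> forall y, rel f n y -> y ∈ th).
    { apply (nat_ind' (fun n => forall y, rel f n y -> y ∈ th)); [dfn_tac| |].
      - intros y Hy. apply (rel_ap f omega l) in Hy as [_ ->]; auto. now rewrite H0.
      - intros n Hn IH y Hy. apply (rel_ap f omega l) in Hy as [_ ->]; auto. rewrite Hs by auto.
        assert (Hfn : ap f n ∈ th) by (apply IH; eapply ap_rel; eauto; now apply in_omega).
        rewrite <- Jth. apply (proj1 (J_mem (E := E) (ap f n) th (lt_W Hcard _ (Htl _ Hfn)) thW)). auto. }
    assert (Hf' : is_fun f omega th).
    { split; [|apply Hf]. intros p Hp. destruct (proj1 Hf p Hp) as (x & y & Hx & Hy & Ho).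
      exists x, y. split; auto. split; auto. apply (Hin x); [now apply in_omega|].
      apply is_opair_opair in Ho. subst p. now apply rel_opair. }
    exists g. split.
    + apply HC'. split; auto. now apply (sup_lt Ld Hh Oth Hth Fe He f).
    + apply Sg. exists emp. split; [apply nat_emp|]. rewrite H0. apply in_succ_self.
  - intros f HfW Hf g Hg Sg.
    assert (Hfl : is_fun f omega l).
    { eapply fun_cod_mono; eauto. intros x Hx. apply Htl. now apply HC' in Hx. }
    rewrite is_sup_iff in Sg by auto.
    assert (Sg' : is_sup g f l omega) by now apply is_sup_iff.
    apply (J_sup (E := E) Hcard Hmove) in Sg'; auto; [|apply lt_W; auto].
    destruct (J_seq (E := E) Hcard Hmove f Hfl) as [FJ EJ]. rewrite is_sup_iff in Sg' by auto.
    apply HC'. split; auto. apply ext. intros z. rewrite Sg, Sg'.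
    assert (K : forall n, is_nat n -> ap (J f) n = ap f n).
    { intros n Hn. rewrite EJ by auto. apply HC'. eapply ap_in; eauto. now apply in_omega. }
    split; intros (n & Hn & Hz); exists n; split; auto; [rewrite <- K|rewrite K]; auto.
Qed.

Context {k : V} (Hk : k ∈ l) (Nk : J k <> k) (Fk : forall a, a ∈ k -> J a = a).

(* The sets of [g] with [e_g(b) = x] are disjoint for distinct [b] and positive for
   the elements [b] of a set with an injection [i] of [k] into it.  Applying [j], the
   set for [J i k] contains a fixed point [g], hence [J i k] is in the range of [j],
   which would put [k] in the range of [j]. *)
Lemma no_fixed_limit_above d h : is_limit d -> d ∈ l -> J d = d -> k ∈ d ->
  ~ is_injection h (VV d) d.
Proof.
  intros Ld Hd Jd Hkd Hh. assert (Od := limit_ord d Ld).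
  assert (Hdl : d ⊆ l) by now apply (proj1 Ol).
  destruct (hartogs d) as (th & Oth & Hth).
  assert (Htl : th ⊆ l).
  (* Otherwise [l] would inject into the smaller ordinal d, although it is a cardinal. *)
  { destruct (ord_lt_or_le l th Ol Oth) as [L|]; auto. exfalso. apply Hth in L as (_ & f & Hf).
    destruct (injection_sub d l Hdl) as (g & Hg & _).
    destruct (cantor_bernstein g f d l Hg Hf) as (i & Hi). apply (proj2 Hcard d Hd). eauto. }
  assert (Jth := fixed_hartogs d th Hd Jd Oth Htl Hth).
  assert (thW : th ∈ W) by now apply ord_W.
  assert (Fth : fixed th) by now split.
  assert (Fw := fixed_w (E := E) Hcard Hmove).
  assert (Fd : fixed d) by (split; auto; now apply lt_W).
  assert (dinj : dfn (fun e => is_injection (e 1) (e 0) d)) by dfn_tac.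
  destruct (choice Ll HDC (fun g q => is_injection q g d) th (VV l)) as (e & Fe & He); auto.
  { intros g Hg. assert (Hg' := Hg). apply Hth in Hg as (_ & q & Hq). exists q. split; auto.
    apply (VV_fun_limit l q g d); auto; [| |apply Hq]; apply lt_Vl; auto. }
  assert (eW : e ∈ W).
  { apply (fun_W (E := E) Hcard Hmove e th (VV l)); auto using sub_refl. now apply ord_sub_Vl. }
  assert (HeW : forall g, g ∈ th -> ap e g ∈ W).
  { intros g Hg. apply Vl_sub_W; auto. eapply ap_in; eauto. }
  assert (HW : forall f, is_fun f omega th -> f ∈ W).
  { intros f Hf. apply (fun_W (E := E) Hcard Hmove f omega th); auto; apply ord_sub_Vl; auto.
    now apply omega_le_limit. }
  destruct (positive_unbounded Ld Hh Oth Hth Fe He HW Ll HDC Hdl HeW) as (x & Hx & Hunb).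
  assert (dp := def_positive_univ (W := W)).
  destruct (sep_ex (fun b => positive W e b x th omega) th) as (B & HB); [dfn_tac|].
  assert (HBth : B ⊆ th) by (intros b Hb; now apply HB in Hb).
  assert (BW : B ∈ W) by now apply (sub_W B th).
  assert (Hkl : k ⊆ l) by now apply (proj1 Ol).
  assert (Ok : is_ordinal k) by (apply (ord_in l); auto).
  assert (Hd_th : d ∈ th) by (apply Hth; split; auto; destruct (injection_sub d d (sub_refl d)) as (f & Hf & _); eauto).
  destruct (Hunb d Hd_th) as (b0 & Hb0 & _ & Pb0).
  assert (Hi : exists i, is_injection i k B).
  { destruct (injection_or_surjection Ll HDC B b0 k) as [H|(g & Hg & Sg)]; auto; [now apply HB|].
    (* By regularity the range of g is bounded in th, as [k] is below d, whereas B is unbounded. *)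
    exfalso. assert (Hg' : is_fun g k th) by (eapply fun_cod_mono; eauto).
    destruct (bounded Ld Hh Oth Hth Fe He g k Hg') as (c & Hc & Kc); [now apply (proj1 Od)|].
    destruct (Hunb c Hc) as (b & Hb & Hcb & Pb). destruct (Sg b) as (y & Hy & Ry); [now apply HB|].
    apply (not_in_self c). apply (Kc y Hy). now rewrite (ap_eq g k B y b Hg Ry). }
  destruct Hi as (i & Hi). assert (Fi := proj1 Hi).
  assert (kW : k ∈ W) by now apply lt_W.
  assert (xW : x ∈ W) by (apply lt_W; auto).
  assert (iW : i ∈ W).
  { apply (fun_W (E := E) Hcard Hmove i k B); auto; [now apply ord_sub_Vl|].
    apply (sub_trans B th); auto. now apply ord_sub_Vl. }
  assert (HJi : is_injection (J i) (J k) (J B)).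
  { apply (proj1 (transfer3 (E := E) (B := false) is_injection i k B ltac:(dfn_tac) iW kW BW)). auto. }
  assert (HJe : (forall b, b ∈ J B -> positive W (J e) b (J x) th omega) /\ is_fun (J e) th (J (VV l)) /\
    (forall g q, g ∈ th -> q ∈ J (VV l) -> rel (J e) g q -> is_injection q g d) /\ J B ⊆ th).
  { assert (T := transfer4 (E := E) (B := false) (fun B e x v => (forall b, b ∈ B -> positive W e b x th omega) /\
      is_fun e th v /\ (forall g, g ∈ th -> forall q, q ∈ v -> rel e g q -> is_injection q g d) /\ B ⊆ th)
      B e x (VV l) ltac:(dfn_tac) BW eW xW (Vl_W Hcard)).
    destruct (proj1 T) as (T1 & T2 & T3 & T4).
    - split; [intros b Hb; now apply HB|]. split; auto. split; auto.
      intros g Hg q Hq Hr. rewrite <- (ap_eq e th (VV l) g q Fe Hr). auto.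
    - split; auto. }
  destruct HJe as (HJB & FJe & IJe & HJBth).
  assert (Hkj : k ∈ J k) by now apply (crit_lt (E := E) Hcard Hmove Hk Nk).
  assert (Hb : ap (J i) k ∈ J B) by (eapply ap_in; [apply HJi|auto]).
  set (b' := ap (J i) k) in *.
  assert (Rb : rel (J i) k b') by (eapply ap_rel; [apply HJi|auto]).
  destruct (fixed_wclub d th h e (VV l)) as (C & CW & HC & FC); auto.
  destruct (HJB b' Hb C CW HC) as (g & HgC & Hbg & q & HqW & Hq & Hr).
  assert (Hg : g ∈ th) by now apply (proj1 HC).
  assert (Jg := FC g HgC). assert (gW : g ∈ W) by (apply lt_W; auto).
  (* g is fixed, so the injection with index g in [J e] is the image of the one in [e]. That it
     takes the value [J x] then pulls back to a statement about [e] and x. *)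
  assert (Eq : q = J (ap e g)).
  { eapply fun_func; [exact FJe|exact Hq|]. rewrite <- Jg at 1.
    apply (proj1 (J_rel (E := E) e g (ap e g) eW gW (HeW g Hg))). eapply ap_rel; eauto. }
  subst q.
  assert (T := transfer3 (E := E) (B := false) (fun g q x => exists b, b ∈ g /\ rel q b x) g (ap e g) x
    ltac:(dfn_tac) gW (HeW g Hg) xW). rewrite Jg in T.
  destruct (proj2 T) as (b & Hbg' & Hrb); [eauto|].
  assert (bW : b ∈ W) by (apply (VV_trans _ OSl g); auto).
  apply (proj1 (J_rel (E := E) (ap e g) b x (HeW g Hg) bW xW)) in Hrb.
  assert (Jbg : J b ∈ g) by (rewrite <- Jg; apply (proj1 (J_mem (E := E) b g bW gW)); auto).
  assert (Eb : b' = J b).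
  { assert (Iq := IJe g (J (ap e g)) Hg (fun_cod _ _ _ _ _ FJe Hq) Hq).
    apply (proj2 Iq b' Hbg (J b) Jbg (J x)); auto. eapply fun_cod; [apply Iq|eauto]. }
  assert (T' := transfer3 (E := E) (B := false) (fun k i b => exists a, a ∈ k /\ rel i a b) k i b
    ltac:(dfn_tac) kW iW bW). rewrite <- Eb in T'.
  destruct (proj2 T') as (a & Ha & Ra); [eauto|].
  assert (aW : a ∈ W) by (apply (VV_trans _ OSl k); auto).
  apply (proj1 (J_rel (E := E) i a b iW aW bW)) in Ra. rewrite <- Eb, (Fk a Ha) in Ra.
  (* [J i] is injective and takes the value b' at [k] as well as at a, which is fixed as an element
     of [k]. *)
  assert (Eak : a = k).
  { apply (proj2 HJi a) with (y := b'); auto. apply (ord_trans a k); auto.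
    apply (ord_in l); auto. now apply (J_lt_l (E := E)). }
  subst a. now apply not_in_self in Ha.
Qed.

End Kunen.

Lemma critical_facts {V : structure} {HZF : ZF V} {l j : V}
    {E : elementary_map (VV (succ l)) (VV (succ l)) (VV (succ l)) j (succ l) (succ l)} :
  is_cardinal l -> (exists x, x ∈ VV (succ l) /\ ~ rel j x x) -> DC l ->
  is_limit l /\ omega ∈ l /\ is_limit_cardinal l /\ (exists h, is_injection h (VV l) l) /\
  ap j l = l /\ exists a, a ∈ l /\ ap j a <> a.
Proof.
  intros Hcard Hmove HDC. assert (Ll := lambda_limit (E := E) Hcard Hmove).
  destruct (crit_ex (E := E) Hcard Hmove) as (k & Hk & Nk & Fk).
  destruct (crit_sequence (E := E) Hcard Hmove Hk Nk Fk HDC) as (f & d & Hf & H0 & Hinc & Ld & Hdl & Jd & Hkd & Hd & Hc & Hi).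
  destruct (Vd_injection (E := E) Hcard Hmove HDC f d) as (h & Hh); auto.
  (* d is a fixed limit above the critical point with an injection of [VV d] into d; below [l] this
     is impossible. *)
  assert (Edl : d = l).
  { apply (ord_sub d l (limit_ord d Ld) (proj1 Hcard)) in Hdl as [L|]; auto.
    destruct (no_fixed_limit_above (E := E) Hcard Hmove HDC Hk Nk Fk d h); auto. }
  subst d. split; auto. split.
  { apply (ord_trans omega k l (proj1 Hcard)); auto. now apply (crit_omega (E := E) Hcard Hmove Hk Nk Fk). }
  split; [|split; [eauto|split; [now apply (J_l (E := E))|eauto]]].
  split; auto. split; [intros N; apply (N k Hk)|].
  intros m Hm _. apply Hd in Hm as (n & Hn & Hm). exists (ap f n). split; auto. split; auto.
  apply Hd. exists (succ n). split; auto using nat_succ.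
Qed.

(** * Elementary substructures of size lambda *)

Section Hull.
Context {V : structure} {HZF : ZF V} {l q Z w1 w2 : V}
  (Hcard : is_cardinal l) (Ll : is_limit l) (Hw : omega ∈ l) (HDC : DC l) (Hq : is_injection q (VV l) l)
  (HZ : VV l ⊆ Z) (Hw1 : w1 ∈ Z) (Hw2 : w2 ∈ Z).
Implicit Types x y z a b c d f g h k n u v s t : V.
Notation satZ := (satisfies Z None).
Let Ol : is_ordinal l := proj1 Hcard.
Let Fq : is_fun q (VV l) l := proj1 Hq.

(* What the value [y] of the enumeration must do at the stage [b = q u], where [s] is the
   enumeration below [b].  Each task is repeated for all [d < l], hence comes up at
   arbitrarily late stages. *)
Definition stage s y : Prop := forall b u, is_fun s b Z -> rel q u b ->
  (forall x, is_code 0 x x u -> y = x) /\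
  (forall x, is_code 1 x x u -> y = w1) /\
  (forall x, is_code 2 x x u -> y = w2) /\
  (forall a i t d p r, is_code 3 p r u -> is_opair p a i -> is_opair r t d ->
     is_formula false a -> is_nat i -> is_fun t omega b ->
     forall s', is_fun s' omega Z -> (forall k x z, rel t k x -> rel s x z -> rel s' k z) ->
     (exists x s'', x ∈ Z /\ is_fun s'' omega Z /\ is_update s' i x s'' /\ satZ a s'') ->
     exists s'', is_fun s'' omega Z /\ is_update s' i y s'' /\ satZ a s'').

Lemma def_stage : dfn (fun e => stage (e 0) (e 1)).
Proof. unfold stage. assert (H := def_satisfies_const Z None). dfn_tac. Qed.

Lemma code_parts (m : nat) x y : code m x y ∈ VV l -> x ∈ VV l /\ y ∈ VV l.
Proof.
  unfold code. rewrite !opair_in_VV_limit; auto. tauto.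
Qed.

Lemma stage_ex s b : is_fun s b Z -> exists y, y ∈ Z /\ stage s y.
Proof.
  intros Hs.
  (* Stages outside the range of [q] carry no task. *)
  destruct (classic (exists u, rel q u b)) as [[u Hu]|N].
  2:{ exists w1. split; auto. intros b' u Hb' Hr. rewrite (fun_dom_unique s b' b Z Z) in Hr; auto. destruct N. eauto. }
  assert (Huv : u ∈ VV l) by (eapply fun_dom; eauto).
  assert (uniq : forall b' u', is_fun s b' Z -> rel q u' b' -> b' = b /\ u' = u).
  { intros b' u' Hb' Hu'. assert (b' = b) by (eapply fun_dom_unique; eauto). subst b'. split; auto.
    apply (proj2 Hq u') with (y := b); auto; [eapply fun_dom; eauto|eapply fun_cod; eauto]. }
  assert (clash : forall (m n : nat) x y x' y', m <> n -> u = code m x y -> is_code n x' y' u -> False).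
  { intros m n x y x' y' Hmn -> H. apply is_code_code, code_inj in H. tauto. }
  destruct (classic (exists x, u = code 0 x x)) as [[x Hx]|N0].
  { exists x. split; [apply HZ; subst u; now apply code_parts in Huv|].
    intros b' u' H1 H2. destruct (uniq b' u' H1 H2) as [-> ->]. split; [|split; [|split]].
    - intros x' Hc. rewrite Hx in Hc. apply is_code_code, code_inj in Hc. tauto.
    - intros x' Hc. exfalso. apply (clash 0 1 x x x' x'); auto.
    - intros x' Hc. exfalso. apply (clash 0 2 x x x' x'); auto.
    - intros a i t d p r Hc. exfalso. apply (clash 0 3 x x p r); auto. }
  destruct (classic (exists x, u = code 1 x x)) as [[x Hx]|N1].
  { exists w1. split; auto.
    intros b' u' H1 H2. destruct (uniq b' u' H1 H2) as [-> ->]. split; [|split; [|split]]; auto.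
    - intros x' Hc. exfalso. apply (clash 1 0 x x x' x'); auto.
    - intros x' Hc. exfalso. apply (clash 1 2 x x x' x'); auto.
    - intros a i t d p r Hc. exfalso. apply (clash 1 3 x x p r); auto. }
  destruct (classic (exists x, u = code 2 x x)) as [[x Hx]|N2].
  { exists w2. split; auto.
    intros b' u' H1 H2. destruct (uniq b' u' H1 H2) as [-> ->]. split; [|split; [|split]]; auto.
    - intros x' Hc. exfalso. apply (clash 2 0 x x x' x'); auto.
    - intros x' Hc. exfalso. apply (clash 2 1 x x x' x'); auto.
    - intros a i t d p r Hc. exfalso. apply (clash 2 3 x x p r); auto. }
  assert (fin : forall y, (forall a i t d, u = code 3 (opair a i) (opair t d) ->
     is_formula false a -> is_nat i -> is_fun t omega b ->
     forall s', is_fun s' omega Z -> (forall k x z, rel t k x -> rel s x z -> rel s' k z) ->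
     (exists x s'', x ∈ Z /\ is_fun s'' omega Z /\ is_update s' i x s'' /\ satZ a s'') ->
     exists s'', is_fun s'' omega Z /\ is_update s' i y s'' /\ satZ a s'') -> stage s y).
  { intros y H b' u' H1 H2. destruct (uniq b' u' H1 H2) as [-> ->]. split; [|split; [|split]].
    - intros x Hc. apply is_code_code in Hc. destruct N0. eauto.
    - intros x Hc. apply is_code_code in Hc. destruct N1. eauto.
    - intros x Hc. apply is_code_code in Hc. destruct N2. eauto.
    - intros a i t d p r Hc Hp Hr. apply is_code_code in Hc. apply is_opair_opair in Hp, Hr. subst p r.
      now apply (H a i t d). }
  (* A task and the enumeration so far determine the assignment [s'], so a witness for one such
     assignment is a witness for all. *)
  destruct (classic (exists a i t d s' x s'', u = code 3 (opair a i) (opair t d) /\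
     is_fun t omega b /\ is_fun s' omega Z /\ (forall k x z, rel t k x -> rel s x z -> rel s' k z) /\
     x ∈ Z /\ is_fun s'' omega Z /\ is_update s' i x s'' /\ satZ a s''))
    as [(a & i & t & d & s' & x & s'' & Hu' & Ht & Hs' & Hc & Hx & Hs'' & Hup & Hsat)|N3].
  - exists x. split; auto. apply fin. intros a' i' t' d' Eu Ha Hi Ht' s1 Hs1 Hc1 _.
    rewrite Hu' in Eu. apply code_inj in Eu as (_ & E1 & E2).
    apply opair_inj in E1 as [<- <-]. apply opair_inj in E2 as [<- <-].
    assert (s1 = s').
    { apply (fun_ext s1 s' omega Z Z); auto. intros k Hk.
      assert (R1 : rel t k (ap t k)) by (eapply ap_rel; eauto).
      assert (R2 : rel s (ap t k) (ap s (ap t k))) by (eapply ap_rel; eauto; eapply ap_in; eauto).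
      rewrite (ap_eq s1 omega Z k _ Hs1 (Hc1 _ _ _ R1 R2)). now rewrite (ap_eq s' omega Z k _ Hs' (Hc _ _ _ R1 R2)). }
    subst s1. eauto.
  - exists w1. split; auto. apply fin. intros a i t d Eu Ha Hi Ht s' Hs' Hc (x & s'' & H1 & H2 & H3 & H4).
    exfalso. apply N3. exists a, i, t, d, s', x, s''. auto 10.
Qed.

(** The codes of the repetitions of one task are distinct, one for each d below [l], and [q] cannot
    send all of them below [b] because [l] is a cardinal. *)
Lemma late_stage p t b : p ∈ VV l -> t ∈ VV l -> b ∈ l ->
  exists d, d ∈ l /\ b ⊆ ap q (code 3 p (opair t d)).
Proof.
  intros Hp Ht Hb. apply NNPP. intros N.
  assert (Hc : forall d, d ∈ l -> code 3 p (opair t d) ∈ VV l).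
  { intros d Hd. unfold code. rewrite !opair_in_VV_limit by auto. split; [|split; [auto|split; auto]].
    - apply (VV_mono omega l); auto using ord_omega, omega_le_limit. apply nat_Vomega, num_nat.
    - apply ord_sub_VV; auto. }
  destruct (fun_ex (fun d y => exists r u, is_opair r t d /\ is_code 3 p r u /\ rel q u y) l b) as (f & Ff & _ & Ef).
  - dfn_tac.
  - intros d Hd. exists (ap q (code 3 p (opair t d))).
    assert (Hv : ap q (code 3 p (opair t d)) ∈ l) by (eapply ap_in; eauto). split.
    + destruct (ord_lt_or_le (ap q (code 3 p (opair t d))) b) as [L|L]; auto; try (apply (ord_in l); auto).
      destruct N. eauto.
    + exists (opair t d), (code 3 p (opair t d)). rewrite is_opair_opair, is_code_code.
      split; auto. split; auto. eapply ap_rel; eauto.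
  - intros d y y' _ _ _ (r & u & A1 & A2 & A3) (r' & u' & B1 & B2 & B3).
    apply is_opair_opair in A1, B1. subst r r'. apply is_code_code in A2, B2. subst u u'.
    eapply fun_func; [exact Fq|eauto|eauto].
  - assert (If : is_injection f l b).
    { apply injection_ap. split; auto. intros d d' Hd Hd' Eq.
      destruct (Ef d Hd) as (r & u & A1 & A2 & A3), (Ef d' Hd') as (r' & u' & B1 & B2 & B3).
      apply is_opair_opair in A1, B1. subst r r'. apply is_code_code in A2, B2. rewrite <- Eq in B3.
      assert (Eu : u = u').
      { apply (proj2 Hq u) with (y := ap f d); auto; [eapply fun_dom; eauto|eapply fun_dom; eauto|eapply fun_cod; eauto]. }
      subst u u'. apply code_inj in Eu as (_ & _ & Eu). now apply opair_inj in Eu. }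
    destruct (injection_sub b l (proj1 Ol b Hb)) as (g & Hg & _).
    destruct (cantor_bernstein g f b l Hg If) as (i & Hi). apply (proj2 Hcard b Hb). eauto.
Qed.

Lemma enumeration : exists g, is_fun g l Z /\ (forall x, x ∈ VV l -> exists b, b ∈ l /\ ap g b = x) /\
  (exists b, b ∈ l /\ ap g b = w1) /\ (exists b, b ∈ l /\ ap g b = w2) /\
  forall a i t b, is_formula false a -> is_nat i -> b ∈ l -> is_fun t omega b ->
    forall s, is_fun s omega Z -> (forall k, is_nat k -> ap s k = ap g (ap t k)) ->
    (exists x, x ∈ Z /\ satZ a (upd s i x)) -> exists c, c ∈ l /\ satZ a (upd s i (ap g c)).
Proof.
  destruct (dependent_choice Ll HDC Z stage def_stage) as (g & Fg & Hg).
  { intros s b _ [Hs _]. eapply stage_ex; eauto. }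
  assert (Hst : forall u, u ∈ VV l -> exists b, b ∈ l /\ b = ap q u /\ is_fun (restr g b) b Z /\ stage (restr g b) (ap g b) /\ rel q u b).
  { intros u Hu. assert (Hb : ap q u ∈ l) by (eapply ap_in; eauto). exists (ap q u). split; auto.
    split; auto. split; [eapply restr_fun; eauto; now apply (proj1 Ol)|]. split; auto. eapply ap_rel; eauto. }
  assert (Hn : forall n : nat, num n ∈ VV l).
  { intros n. apply (VV_mono omega l); auto using ord_omega, omega_le_limit. apply nat_Vomega, num_nat. }
  assert (Hc : forall (n : nat) x, x ∈ VV l -> code n x x ∈ VV l).
  { intros n x Hx. unfold code. rewrite !opair_in_VV_limit by auto. auto. }
  assert (He : emp ∈ VV l) by (apply ord_sub_VV; auto; now apply limit_emp).
  exists g. split; auto. split; [|split; [|split]].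
  - intros x Hx. destruct (Hst (code 0 x x) (Hc 0 x Hx)) as (b & Hb & _ & Fb & Sb & Rb).
    exists b. split; auto. apply (proj1 (Sb b _ Fb Rb)). now apply is_code_code.
  - destruct (Hst (code 1 emp emp) (Hc 1 emp He)) as (b & Hb & _ & Fb & Sb & Rb).
    exists b. split; auto. apply (proj1 (proj2 (Sb b _ Fb Rb)) emp). now apply is_code_code.
  - destruct (Hst (code 2 emp emp) (Hc 2 emp He)) as (b & Hb & _ & Fb & Sb & Rb).
    exists b. split; auto. apply (proj1 (proj2 (proj2 (Sb b _ Fb Rb))) emp). now apply is_code_code.
  - intros a i t b Ha Hi Hb Ht s Hs Hcomp (x & Hx & Hsat).
    assert (HaV : a ∈ VV l) by (apply (VV_mono omega l); auto using ord_omega, omega_le_limit; eapply formula_Vomega; eauto).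
    assert (HiV : i ∈ VV l) by (apply (VV_mono omega l); auto using ord_omega, omega_le_limit; now apply nat_Vomega).
    assert (HtV : t ∈ VV l).
    { apply (VV_fun_limit l t omega b); auto; apply ord_sub_VV; auto. }
    assert (Hp : opair a i ∈ VV l) by (apply VV_opair_limit; auto).
    destruct (late_stage (opair a i) t b Hp HtV Hb) as (d & Hd & Hbd).
    assert (HdV : d ∈ VV l) by (apply ord_sub_VV; auto).
    destruct (Hst (code 3 (opair a i) (opair t d))) as (c & Hcl & Ec & Fc & Sc & Rc).
    { unfold code. rewrite !opair_in_VV_limit by auto. auto. }
    rewrite <- Ec in Hbd. exists c. split; auto.
    destruct (proj2 (proj2 (proj2 (Sc c _ Fc Rc))) a i t d (opair a i) (opair t d)) with (s' := s) as (s'' & H1 & H2 & H3); auto.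
    + now apply is_code_code.
    + now apply is_opair_opair.
    + now apply is_opair_opair.
    + eapply fun_cod_mono; eauto.
    + intros k y z Hk Hz. apply rel_restr in Hz as [Hy Hz].
      assert (Hkw : k ∈ omega) by (exact (fun_dom _ _ _ _ _ Ht Hk)).
      apply (rel_ap s omega Z); auto. split; auto. rewrite Hcomp by now apply in_omega.
      rewrite (ap_eq t omega b k y Ht Hk). symmetry. eapply ap_eq; eauto.
    + exists x, (upd s i x). split; auto. split; [now apply upd_fun|]. split; auto.
      apply (is_update_upd Z); auto. now apply upd_fun.
    + apply (is_update_upd Z) in H2; auto; [now subst s''|]. eapply ap_in; eauto.
Qed.

(** [truncate] gives values in [VV b]; those not in b are replaced by [emp], which does not affect
    the places below [n]. *)
Lemma bounded_index n f : is_nat n -> is_fun f omega l ->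
  exists b t, b ∈ l /\ is_fun t omega b /\ forall k, k ∈ n -> ap t k = ap f k.
Proof.
  intros Hn Hf.
  destruct (truncate l f n Ll) as (b & t & Hb & Ht & K); auto.
  { eapply fun_cod_mono; eauto. now apply ord_sub_VV. }
  assert (Ob : is_ordinal b) by (apply (ord_in l); auto).
  assert (H0 : emp ∈ b).
  { destruct (ord_lt_or_le emp b) as [L|L]; auto using ord_emp.
    assert (b = emp) by (apply sub_antisym; auto; intros z Hz; now apply in_emp in Hz). subst b.
    assert (H : ap t emp ∈ VV emp) by (eapply ap_in; eauto; apply in_omega, nat_emp).
    apply in_VV in H as (c & Hc & _); auto. now apply in_emp in Hc. }
  destruct (fun_ex (fun k y => (y ∈ b /\ rel t k y) \/ (exists x, rel t k x /\ x ∉ b /\ is_empty y)) omega b)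
    as (t' & Ft & _ & Et).
  - dfn_tac.
  - intros k Hk. assert (R : rel t k (ap t k)) by (eapply ap_rel; eauto).
    destruct (classic (ap t k ∈ b)) as [H|H]; [eauto|]. exists emp. split; auto. right.
    exists (ap t k). split; auto. split; auto. now apply is_empty_emp.
  - intros k y y' _ Hy Hy' [[A1 A2]|(x & A1 & A2 & A3)] [[B1 B2]|(x' & B1 & B2 & B3)].
    + eapply fun_func; [exact Ht|eauto|eauto].
    + destruct B2. now rewrite (fun_func t omega (VV b) k x' y Ht B1 A2).
    + destruct A2. now rewrite (fun_func t omega (VV b) k x y' Ht A1 B2).
    + apply is_empty_emp in A3, B3. congruence.
  - exists b, t'. split; auto. split; auto. intros k Hk. rewrite <- K by auto.
    assert (Hkw : k ∈ omega) by (apply in_omega; eapply nat_in; eauto).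
    destruct (Et k Hkw) as [[_ A]|(x & A1 & A2 & _)].
    + symmetry. eapply ap_eq; eauto.
    + exfalso. apply A2. rewrite <- (ap_eq t omega (VV b) k x Ht A1), K by auto.
      apply (ord_in_VV b); auto; [apply (ord_in l); auto; eapply ap_in; eauto|].
      rewrite <- K by auto. eapply ap_in; eauto.
Qed.

(** The Tarski-Vaught test. Parameters are given by their least indices, but an unbounded sequence
    of indices is not in [VV l] and cannot be part of a task, so only the finitely many indices on
    which the formula depends are kept. *)
Lemma hull : exists g X, is_fun g l X /\ (forall x, x ∈ X -> exists b, b ∈ l /\ ap g b = x) /\
  VV l ⊆ X /\ w1 ∈ X /\ w2 ∈ X /\ elementary_substructure X Z.
Proof.
  destruct enumeration as (g & Fg & H0 & (b1 & Hb1 & E1) & (b2 & Hb2 & E2) & Hwit).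
  destruct (sep_ex (fun x => exists b, rel g b x) Z) as (X & HX); [dfn_tac|].
  assert (HX' : forall x, x ∈ X <-> exists b, b ∈ l /\ ap g b = x).
  { intros x. rewrite HX. split.
    - intros (_ & b & Hb). exists b. split; [eapply fun_dom; eauto|eapply ap_eq; eauto].
    - intros (b & Hb & <-). split; [eapply ap_in; eauto|]. exists b. eapply ap_rel; eauto. }
  assert (XZ : X ⊆ Z) by (intros x Hx; now apply HX in Hx).
  exists g, X. split; [|split; [intros x Hx; now apply HX'|]].
  { split; [|apply Fg]. intros p Hp. destruct (proj1 Fg p Hp) as (x & y & Hx & Hy & Ho).
    exists x, y. split; auto. split; auto. apply HX. split; auto. exists x.
    apply is_opair_opair in Ho. subst p. now apply rel_opair. }
  split; [intros x Hx; now apply HX', H0|]. split; [apply HX'; eauto|]. split; [apply HX'; eauto|].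
  split; auto.
  assert (main : forall c, is_formula false c -> forall s, is_fun s omega X -> (satisfies X None c s <-> satZ c s)).
  { assert (D1 := def_satisfies_const X None). assert (D2 := def_satisfies_const Z None).
    assert (up : forall s, is_fun s omega X -> is_fun s omega Z) by (intros s Hs; eapply fun_cod_mono; eauto).
    apply (formula_ind false (fun c => forall s, is_fun s omega X -> (satisfies X None c s <-> satZ c s))).
    - dfn_tac.
    - intros i k Hi Hk s Hs. rewrite !satisfies_mem; auto. reflexivity.
    - intros i k Hi Hk s Hs. rewrite !satisfies_eq; auto. reflexivity.
    - discriminate.
    - intros a Ha IH s Hs. rewrite !satisfies_neg; auto. now rewrite IH.
    - intros a b Ha IHa Hb IHb s Hs. rewrite !satisfies_and; auto. now rewrite IHa, IHb.
    - intros i a Hi Ha IH s Hs. rewrite !satisfies_ex; auto. split.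
      + intros (x & Hx & Hsat). exists x. split; auto. apply IH; auto. now apply upd_fun.
      + intros (x & Hx & Hsat).
        assert (Hres : exists x, x ∈ X /\ satZ a (upd s i x)).
        2:{ destruct Hres as (y & Hy & Hy'). exists y. split; auto. apply IH; auto. now apply upd_fun. }
        destruct (finite_support Z None a Ha) as (n & Hn & Hsup).
        destruct (fun_ex (fun k b => exists x, rel s k x /\ rel g b x /\ forall b', rel g b' x -> b ⊆ b') omega l)
          as (f & Ff & _ & Ef).
        * dfn_tac.
        * intros k Hk. assert (Hsk : ap s k ∈ X) by (eapply ap_in; eauto).
          apply HX' in Hsk as (b & Hb & Eb).
          destruct (least_ord (fun b => rel g b (ap s k)) b) as (m & Om & Pm & _ & Km).
          -- dfn_tac.
          -- apply (ord_in l); auto.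
          -- rewrite <- Eb. eapply ap_rel; eauto.
          -- exists m. split; [eapply fun_dom; eauto|]. exists (ap s k). split; [eapply ap_rel; eauto|].
             split; auto. intros b' Hb'. apply Km; auto. apply (ord_in l); auto. eapply fun_dom; eauto.
        * intros k b b' _ _ _ (y & A1 & A2 & A3) (y' & B1 & B2 & B3).
          rewrite (fun_func s omega X k y' y Hs B1 A1) in *. apply sub_antisym; auto.
        * destruct (bounded_index n f Hn Ff) as (b & t & Hb & Ht & Kt).
          assert (Htl : is_fun t omega l) by (eapply fun_cod_mono; eauto; now apply (proj1 Ol)).
          destruct (comp_fun t g omega l Z Htl Fg) as (s1 & Hs1 & Es1).
          assert (agree : forall k, k ∈ n -> ap s1 k = ap s k).
          { intros k Hk. assert (Hkw : k ∈ omega) by (apply in_omega; eapply nat_in; eauto).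
            rewrite Es1, Kt by auto. destruct (Ef k Hkw) as (y & A1 & A2 & _).
            rewrite (ap_eq s omega X k y Hs A1). eapply ap_eq; eauto. }
          assert (sw : forall y, y ∈ Z -> (satZ a (upd s1 i y) <-> satZ a (upd s i y))).
          { intros y Hy. apply Hsup; auto using upd_fun. intros k Hk.
            assert (Nk : is_nat k) by (eapply nat_in; eauto).
            destruct (classic (k = i)) as [->|Nki].
            - rewrite !(ap_upd_same Z); auto.
            - rewrite !(ap_upd_other Z); auto. }
          destruct (Hwit a i t b Ha Hi Hb Ht s1 Hs1) as (c & Hc & Hsc).
          -- intros k Hk. apply Es1. now apply in_omega.
          -- exists x. split; auto. now apply sw.
          -- exists (ap g c). split; [apply HX'; eauto|]. apply sw; auto. eapply ap_in; eauto. }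
  intros c s Hc Hs. apply main; auto. now apply assignment_fun.
Qed.

End Hull.

(** * From embeddings of [V_{lambda+1}] to ultraexacting cardinals *)

(* [g] names elements of [z] by elements of [v]: <0, b> names [b], and 0 names [l]. *)
Definition naming {V : structure} (v z l g : V) : Prop :=
  is_fun g v z /\ (forall b p o, b ∈ v -> is_empty o -> is_opair p o b -> rel g p b) /\
  forall o, is_empty o -> rel g o l.

Definition theory_of {V : structure} (v z g T : V) : Prop :=
  forall p, p ∈ T <-> exists c t s, is_opair p c t /\ is_formula false c /\ t ∈ v /\
    is_assignment v t /\ is_assignment z s /\
    (forall k x y, rel t k x -> rel g x y -> rel s k y) /\ satisfies z None c s.

(** The naming [g] is quantified because none is singled out; what remains is definable from the
    ordinals [l] and [zeta]. *)
Definition theories {V : structure} (l zeta T : V) : Prop :=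
  exists v z g, is_V l v /\ is_V zeta z /\ T ⊆ v /\ naming v z l g /\ theory_of v z g T.

Lemma def_theories {V : structure} {Q : V -> Prop} :
  definable false univ Q (fun e => theories (e 0) (e 1) (e 2)).
Proof.
  assert (H : definable false univ Q (fun e : nat -> V => satisfies (e 0) None (e 1) (e 2)))
    by apply def_satisfies_None.
  unfold theories, naming, theory_of. dfn_tac.
  all: apply (def_substs _ ((fun e => e 5) :: (fun e => e 2) :: (fun e => e 0) :: nil) H);
    repeat constructor; dfn_tac.
Qed.
#[export] Hint Resolve def_theories : dfn.

Section Backward.
Context {V : structure} {HZF : ZF V}.
Implicit Types x y z a b c d f g h k n u v s t : V.

Lemma theories_OD l zeta : is_ordinal l -> is_ordinal zeta ->
  exists A, A ⊆ VV (succ l) /\ OD A /\ forall T, T ∈ A <-> theories l zeta T.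
Proof.
  intros Ol Oz. destruct (sep_ex (theories l zeta) (VV (succ l))) as (A & HA); [dfn_tac|].
  assert (HA' : forall T, T ∈ A <-> theories l zeta T).
  { intros T. rewrite HA. split; [tauto|]. intros H. split; auto.
    destruct H as (v & z & g & Hv & _ & HT & _). apply is_V_VV in Hv as [_ ->]. now apply VV_succ. }
  exists A. split; [intros T HT; now apply HA in HT|]. split; auto.
  apply definable_OD. apply (def_equiv' (fun e => forall T, T ∈ e 0 <-> theories l zeta T)); [|dfn_tac].
  intros e. split.
  - intros H. apply ext. intros T. now rewrite H, HA'.
  - now intros ->.
Qed.

Context {l zeta j A : V} (Hcard : is_cardinal l) (HDC : DC l) (Kz : K 2 zeta) (Hlz : l ∈ zeta)
  (HA : forall T, T ∈ A <-> theories l zeta T).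
Notation W := (VV (succ l)).
Notation Z := (VV zeta).
Notation J := (ap j).
Notation satZ := (satisfies Z None).
Context (Hj : elementary_embedding W (Some A) W (Some A) j)
  (Hmove : exists x, x ∈ W /\ ~ rel j x x).
Let Ol : is_ordinal l := proj1 Hcard.
Let Oz : is_ordinal zeta := K_ord 2 zeta Kz.
Let Lz : is_limit zeta := K_limit 2 zeta Kz.

Lemma embedding_map : elementary_map W W W j (succ l) (succ l).
Proof.
  constructor.
  - apply is_V_VV. auto using ord_succ.
  - apply is_V_VV. auto using ord_succ.
  - split; auto. reflexivity.
  - apply Hj.
  - eapply embedding_elem; eauto.
Qed.
Let E : elementary_map W W W j (succ l) (succ l) := embedding_map.

Let facts := critical_facts (E := E) Hcard Hmove HDC.
Let Ll : is_limit l := proj1 facts.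
Let Hw : omega ∈ l := proj1 (proj2 facts).
Let VlW : VV l ⊆ W := Vl_sub_W Hcard.

Lemma Vl_Z : VV l ⊆ Z.
Proof. apply VV_mono; auto. now apply (proj1 Oz). Qed.

Lemma omega_Vl x : x ∈ VV omega -> x ∈ VV l.
Proof. apply VV_mono; auto using ord_omega. now apply omega_le_limit. Qed.

Lemma J_Vl_self : J (VV l) = VV l.
Proof.
  rewrite (J_VV (E := E)); auto using Vl_W; [now rewrite (J_l (E := E) Hcard)|].
  apply (fixed_l (E := E) Hcard).
Qed.

Lemma J_in_Vl x : x ∈ VV l -> J x ∈ VV l.
Proof.
  intros Hx. rewrite <- J_Vl_self.
  now apply (proj1 (J_mem (E := E) x (VV l) (VlW x Hx) (Vl_W Hcard))).
Qed.

Lemma J_omega x : x ∈ VV omega -> J x = x.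
Proof.
  apply (J_fix_below (E := E)); auto using ord_omega.
  - intros y Hy. now apply VlW, omega_Vl.
  - intros n Hn. apply (J_n (E := E) Hcard Hmove). now apply in_omega.
Qed.

Lemma J_assignment t : t ∈ VV l -> is_fun t omega (VV l) ->
  is_fun (J t) omega (VV l) /\ forall k, is_nat k -> ap (J t) k = J (ap t k).
Proof.
  intros Ht Ft. destruct (fixed_w (E := E) Hcard Hmove) as [wW Jw].
  split.
  - rewrite <- Jw, <- J_Vl_self. apply (proj1 (J_fun (E := E) t omega (VV l) (VlW t Ht) wW (Vl_W Hcard))). auto.
  - intros k Hk. apply in_omega in Hk as Hk'.
    rewrite (J_ap (E := E) t omega (VV l) k); auto using Vl_W.
    + now rewrite (J_n (E := E) Hcard Hmove k Hk).
    + apply VlW, omega_Vl. now apply nat_Vomega.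
    + apply VlW. eapply ap_in; eauto.
Qed.

Lemma theory_iff g T c t s : is_fun g (VV l) Z -> theory_of (VV l) Z g T -> is_formula false c ->
  t ∈ VV l -> is_fun t omega (VV l) -> is_fun s omega Z -> (forall k, is_nat k -> ap s k = ap g (ap t k)) ->
  (opair c t ∈ T <-> satZ c s).
Proof.
  intros Fg HT Hc Ht Ft Fs Es. rewrite (HT (opair c t)). split.
  - intros (c' & t' & s' & Ho & _ & _ & _ & Hs' & Hcomp & Hsat).
    apply is_opair_opair, opair_inj in Ho as [<- <-]. apply assignment_fun in Hs'.
    assert (s' = s); [|now subst s'].
    apply (fun_ext s' s omega Z Z); auto. intros k Hk. rewrite Es by now apply in_omega.
    eapply ap_eq; eauto. apply (Hcomp k (ap t k)); [eapply ap_rel; eauto|].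
    eapply ap_rel; eauto. eapply ap_in; eauto.
  - intros Hsat. exists c, t, s. rewrite is_opair_opair, !assignment_fun. repeat (split; auto).
    intros k x y Hk Hx. assert (Hkw := fun_dom _ _ _ _ _ Ft Hk).
    apply (rel_ap s omega Z); auto. split; auto. rewrite Es by now apply in_omega.
    rewrite (ap_eq t omega (VV l) k x Ft Hk). symmetry. eapply ap_eq; eauto.
Qed.

(* The truth of [c] only depends on finitely many values of the assignment, which can be
   prescribed by an assignment that belongs to [V_lambda]. *)
Lemma theory_transfer g h T : is_fun g (VV l) Z -> theory_of (VV l) Z g T -> T ∈ W ->
  is_fun h (VV l) Z -> theory_of (VV l) Z h (J T) ->
  forall c t s s', is_formula false c -> is_fun t omega (VV l) -> is_fun s omega Z -> is_fun s' omega Z ->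
  (forall k, is_nat k -> ap s k = ap g (ap t k)) ->
  (forall k, is_nat k -> ap s' k = ap h (J (ap t k))) -> (satZ c s <-> satZ c s').
Proof.
  intros Fg HT HTW Fh HJT c t s s' Hc Ft Fs Fs' Es Es'.
  destruct (finite_support Z None c Hc) as (n & Hn & Hsup).
  destruct (truncate l t n Ll Ft Hn) as (b & t1 & Hb & Ft1 & K1).
  assert (Ob : is_ordinal b) by (apply (ord_in l); auto).
  assert (Ht1 : t1 ∈ VV l).
  { apply (VV_fun_limit l t1 omega (VV b)); auto; [apply ord_sub_VV; auto|now apply VV_in]. }
  assert (Ft1' : is_fun t1 omega (VV l)).
  { eapply fun_cod_mono; eauto. apply VV_mono; auto. now apply (proj1 Ol). }
  destruct (J_assignment t1 Ht1 Ft1') as [FJ EJ].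
  destruct (comp_fun t1 g omega (VV l) Z Ft1' Fg) as (s1 & Fs1 & Es1).
  destruct (comp_fun (J t1) h omega (VV l) Z FJ Fh) as (s2 & Fs2 & Es2).
  rewrite (Hsup s s1), (Hsup s' s2); auto.
  - rewrite <- (theory_iff g T c t1 s1); auto; [|intros k Hk; apply Es1; now apply in_omega].
    rewrite <- (theory_iff h (J T) c (J t1) s2); auto using J_in_Vl; [|intros k Hk; apply Es2; now apply in_omega].
    assert (HcV : c ∈ VV l) by (apply omega_Vl; eapply formula_Vomega; eauto).
    assert (Hp : opair c t1 ∈ VV l) by now apply VV_opair_limit.
    rewrite (J_mem (E := E) (opair c t1) T); auto.
    rewrite (J_opair (E := E)); auto. rewrite (J_omega c); [reflexivity|]. eapply formula_Vomega; eauto.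
  - intros k Hk. assert (Nk : is_nat k) by (eapply nat_in; eauto).
    rewrite Es', Es2 by (auto; now apply in_omega). now rewrite EJ, K1.
  - intros k Hk. assert (Nk : is_nat k) by (eapply nat_in; eauto).
    rewrite Es, Es1 by (auto; now apply in_omega). now rewrite K1.
Qed.

Lemma restriction_Z : restr j (VV l) ∈ Z.
Proof.
  apply (VV_mono (succ l) zeta); auto using ord_succ.
  { intros x Hx. apply in_succ in Hx as [Hx| ->]; auto. now apply (ord_trans x l). }
  apply VV_succ; auto. intros p Hp.
  assert (Fr : is_fun (restr j (VV l)) (VV l) W) by (apply (restr_fun j W W); auto; apply Hj).
  destruct (proj1 Fr p Hp) as (x & y & Hx & _ & Ho). apply is_opair_opair in Ho. subst p.
  apply rel_opair, rel_restr in Hp as [_ Hr]. apply (rel_J (E := E)) in Hr as [_ ->].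
  apply VV_opair_limit; auto using J_in_Vl.
Qed.

Lemma named_hull : exists X g T, elementary_substructure X Z /\ VV l ⊆ X /\ l ∈ X /\ restr j (VV l) ∈ X /\
  is_fun g (VV l) X /\ (forall x, x ∈ X -> exists a, a ∈ VV l /\ ap g a = x) /\
  naming (VV l) Z l g /\ T ⊆ VV l /\ theory_of (VV l) Z g T.
Proof.
  assert (F := facts). destruct F as (_ & _ & _ & (q & Hq) & _).
  destruct (hull (Z := Z) (w1 := l) (w2 := restr j (VV l)) Hcard Ll Hw HDC Hq Vl_Z) as (e & X & Fe & Se & VX & lX & iX & HX).
  { now apply ord_sub_VV. }
  { apply restriction_Z. }
  (* A pair with 0 names its second component, a pair with 1 an entry of the enumeration [e], and
     anything else names [l]; so does 0, which is no pair. *)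
  pose (P1 := fun p y => exists o, is_empty o /\ is_opair p o y).
  pose (P2 := fun p y => exists o b, is_num 1 o /\ is_opair p o b /\ rel e b y).
  assert (d1 : dfn (fun e => P1 (e 0) (e 1))) by (unfold P1; dfn_tac).
  assert (d2 : dfn (fun e => P2 (e 0) (e 1))) by (unfold P2; dfn_tac).
  assert (u1 : forall p y y', P1 p y -> P1 p y' -> y = y').
  { intros p y y' (o & _ & H) (o' & _ & H'). now destruct (is_opair_inj H H'). }
  assert (u2 : forall p y y', P2 p y -> P2 p y' -> y = y').
  { intros p y y' (o & b & _ & H & R) (o' & b' & _ & H' & R'). destruct (is_opair_inj H H') as [_ <-].
    eapply fun_func; [exact Fe|eauto|eauto]. }
  assert (u12 : forall p y y', P1 p y -> P2 p y' -> False).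
  { intros p y y' (o & H1 & H2) (o' & b & H3 & H4 & _). destruct (is_opair_inj H2 H4) as [-> _].
    apply is_num_num in H3. subst o'. apply (H1 emp), in_succ_self. }
  destruct (fun_ex (fun p y => P1 p y \/ P2 p y \/ ((forall z, ~ P1 p z /\ ~ P2 p z) /\ y = l)) (VV l) X)
    as (g & Fg & Rg & _).
  - dfn_tac.
  - intros p Hp. destruct (classic (exists y, P1 p y)) as [[y Hy]|N1].
    + exists y. split; auto. apply VX. destruct Hy as (o & _ & Ho). apply is_opair_opair in Ho. subst p.
      apply opair_in_VV_limit in Hp; tauto.
    + destruct (classic (exists y, P2 p y)) as [[y Hy]|N2].
      * exists y. split; auto. destruct Hy as (o & b & _ & _ & R). eapply fun_cod; eauto.
      * exists l. split; auto. right. right. split; auto. intros z. split; eauto.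
  - intros p y y' _ _ _ [H|[H|[H1 H2]]] [H'|[H'|[H1' H2']]]; try congruence; eauto;
      try (exfalso; eauto; fail); try (destruct (H1' y); tauto); destruct (H1 y'); tauto.
  - assert (XZ : X ⊆ Z) by apply HX.
    assert (FgZ : is_fun g (VV l) Z) by (eapply fun_cod_mono; eauto).
    assert (emp_V : emp ∈ VV l) by (apply ord_sub_VV; auto; now apply limit_emp).
    destruct (sep_ex (fun p => exists c t s, is_opair p c t /\ is_formula false c /\ t ∈ VV l /\
      is_assignment (VV l) t /\ is_assignment Z s /\
      (forall k x y, rel t k x -> rel g x y -> rel s k y) /\ satZ c s) (VV l)) as (T & HT).
    { assert (D := def_satisfies_const Z None). dfn_tac. }
    exists X, g, T. repeat (split; [assumption|]). split; [|split; [|split]].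
    + intros x Hx. destruct (Se x Hx) as (b & Hb & Eb).
      assert (Ho : opair (num 1) b ∈ VV l).
      { apply VV_opair_limit; auto; [apply omega_Vl, nat_Vomega, num_nat|apply ord_sub_VV; auto]. }
      exists (opair (num 1) b). split; auto. eapply ap_eq; [exact Fg|].
      apply Rg. split; auto. split; auto. right. left. exists (num 1), b.
      split; [now apply is_num_num|]. split; [now apply is_opair_opair|]. rewrite <- Eb. eapply ap_rel; eauto.
    + split; auto. split.
      * intros b p o Hb Ho Hp. apply Rg. assert (Hp' := Hp). apply is_opair_opair in Hp'. apply is_empty_emp in Ho as Ho'. subst p o.
        split; [apply VV_opair_limit; auto|]. split; auto. left. exists emp. split; auto.
      * intros o Ho. apply is_empty_emp in Ho. subst o. apply Rg. split; auto. split; auto. right. right.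
        assert (N : forall x y, ~ is_opair emp x y).
        { intros x y H. apply is_opair_opair in H. apply (in_emp (upair x x)). rewrite H. apply in_upair; auto. }
        split; auto. intros z. split; [intros (o & _ & H)|intros (o & b & _ & H & _)]; eapply N; eauto.
    + intros p Hp. now apply HT in Hp.
    + intros p. rewrite HT. split; [tauto|]. intros H. split; auto.
      destruct H as (c & t & s & Ho & Hc & Ht & _). apply is_opair_opair in Ho. subst p.
      apply VV_opair_limit; auto. apply omega_Vl. eapply formula_Vomega; eauto.
Qed.

Lemma embedding_ultraexacting : ultraexacting l.
Proof.
  destruct named_hull as (X & g & T & HX & VX & lX & iX & Fg & Sg & Ng & HTV & HT).
  assert (XZ : X ⊆ Z) by apply HX.
  assert (TW : T ∈ W) by now apply VV_succ.
  assert (VZ : is_V zeta Z) by now apply is_V_VV.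
  assert (Vl : is_V l (VV l)) by now apply is_V_VV.
  assert (TA : T ∈ A) by (apply HA; exists (VV l), Z, g; auto).
  apply (embedding_pred W A W A j T Hj TW), HA in TA as (v & z & h & Hv & Hz & _ & Nh & HJT).
  apply is_V_VV in Hv as [_ ->]. apply is_V_VV in Hz as [_ ->].
  assert (FgZ : is_fun g (VV l) Z) by apply Ng. assert (Fh : is_fun h (VV l) Z) by apply Nh.
  assert (key := theory_transfer g h T FgZ HT TW Fh HJT).
  assert (emp_V : emp ∈ VV l) by (apply ord_sub_VV; auto; now apply limit_emp).
  assert (Hg0 : forall b, b ∈ VV l -> ap g (opair emp b) = b).
  { intros b Hb. eapply ap_eq; eauto. apply (proj1 (proj2 Ng) b _ emp); auto; [now apply is_empty_emp|now apply is_opair_opair]. }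
  assert (Hh0 : forall b, b ∈ VV l -> ap h (opair emp b) = b).
  { intros b Hb. eapply ap_eq; eauto. apply (proj1 (proj2 Nh) b _ emp); auto; [now apply is_empty_emp|now apply is_opair_opair]. }
  assert (gl : ap g emp = l) by (eapply ap_eq; eauto; apply (proj2 (proj2 Ng)); now apply is_empty_emp).
  assert (hl : ap h emp = l) by (eapply ap_eq; eauto; apply (proj2 (proj2 Nh)); now apply is_empty_emp).
  (* If two names denote the same element, the equation of the variables 0 and 1 holds at these
     names, and [theory_transfer] makes it hold at their images. *)
  assert (well : forall a b, a ∈ VV l -> b ∈ VV l -> ap g a = ap g b -> ap h (J a) = ap h (J b)).
  { intros a b Ha Hb Eq.
    destruct (assignment_ex (VV l) (fun n : nat => match n with 0 => a | _ => b end) 2) as (t & Ft & Et).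
    { now intros [|n]. }
    assert (t0 := Et 0 ltac:(lia)). assert (t1 := Et 1 ltac:(lia)). cbv iota in t0, t1.
    destruct (comp_fun t g omega (VV l) Z Ft FgZ) as (s & Fs & Es).
    destruct (fun_ex (fun k y => exists x x', rel t k x /\ rel j x x' /\ rel h x' y) omega Z) as (s' & Fs' & _ & Es').
    - dfn_tac.
    - intros k Hk. assert (Htk : ap t k ∈ VV l) by (eapply ap_in; eauto).
      exists (ap h (J (ap t k))). split; [eapply ap_in; eauto using J_in_Vl|].
      exists (ap t k), (J (ap t k)). split; [eapply ap_rel; eauto|].
      split; [apply (rel_J (E := E)); auto|]. eapply ap_rel; eauto using J_in_Vl.
    - intros k y y' _ _ _ (x & x' & A1 & A2 & A3) (u & u' & B1 & B2 & B3).
      rewrite (fun_func t omega (VV l) k u x Ft B1 A1) in B2.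
      rewrite (fun_func j W W x u' x' (proj1 (proj2 Hj)) B2 A2) in B3.
      eapply fun_func; [exact Fh|eauto|eauto].
    - assert (Es'' : forall k, is_nat k -> ap s' k = ap h (J (ap t k))).
      { intros k Hk. apply in_omega in Hk. destruct (Es' k Hk) as (x & x' & A1 & A2 & A3).
        apply (rel_J (E := E)) in A2 as [_ ->]. rewrite (ap_eq t omega (VV l) k x Ft A1).
        symmetry. eapply ap_eq; eauto. }
      assert (K : satZ (code 1 (num 0) (num 1)) s <-> satZ (code 1 (num 0) (num 1)) s').
      { apply (key _ t); auto using form_eq, num_nat. intros k Hk. apply Es. now apply in_omega. }
      assert (N : forall m : nat, num m ∈ omega) by (intros m; apply in_omega, num_nat).
      rewrite !satisfies_eq in K; auto using num_nat.
      rewrite (Es (num 0)), (Es (num 1)), (Es'' (num 0)), (Es'' (num 1)), t0, t1 in K; auto using num_nat.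
      now apply K. }
  destruct (fun_ex (fun x y => exists a a', rel g a x /\ rel j a a' /\ rel h a' y) X Z) as (i & Fi & _ & Ei).
  { dfn_tac. }
  { intros x Hx. destruct (Sg x Hx) as (a & Ha & Ea). exists (ap h (J a)).
    split; [eapply ap_in; eauto using J_in_Vl|]. exists a, (J a).
    split; [rewrite <- Ea; eapply ap_rel; eauto|]. split; [apply (rel_J (E := E)); auto|].
    eapply ap_rel; eauto using J_in_Vl. }
  { intros x y y' _ _ _ (a & a' & A1 & A2 & A3) (b & b' & B1 & B2 & B3).
    apply (rel_J (E := E)) in A2 as [_ ->], B2 as [_ ->].
    rewrite <- (ap_eq h (VV l) Z _ y Fh A3), <- (ap_eq h (VV l) Z _ y' Fh B3). apply well.
    - apply (fun_dom _ _ _ _ _ Fg A1).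
    - apply (fun_dom _ _ _ _ _ Fg B1).
    - rewrite (ap_eq g (VV l) X a x Fg A1). symmetry. now apply (ap_eq g (VV l) X). }
  assert (Hi : forall a, a ∈ VV l -> ap i (ap g a) = ap h (J a)).
  { intros a Ha. assert (Hx : ap g a ∈ X) by (eapply ap_in; eauto).
    destruct (Ei _ Hx) as (b & b' & B1 & B2 & B3). apply (rel_J (E := E)) in B2 as [_ ->].
    rewrite <- (ap_eq h (VV l) Z _ _ Fh B3). apply well; auto; [apply (fun_dom _ _ _ _ _ Fg B1)|]. eapply ap_eq; eauto. }
  (* [j] maps the name of b to the name of [J b], so [i] extends the restriction of [j]. *)
  assert (Hi_V : forall b, b ∈ VV l -> ap i b = J b).
  { intros b Hb. assert (Hp : opair emp b ∈ VV l) by now apply VV_opair_limit.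
    rewrite <- (Hg0 b Hb) at 1. rewrite Hi by auto. rewrite (J_opair (E := E)); auto.
    rewrite (J_emp (E := E)) by auto. auto using J_in_Vl. }
  assert (Hi_l : ap i l = l).
  { rewrite <- gl at 1. rewrite Hi by auto. now rewrite (J_emp (E := E)) by auto. }
  assert (emb : elementary_embedding X None Z None i).
  { split; [reflexivity|]. split; auto. intros c s s' Hc Hs Hs' Hcomp.
    rewrite (proj2 HX c s Hc Hs). apply assignment_fun in Hs, Hs'.
    (* Names for the values of the assignment must be chosen. The sequence of names may be outside
       [VV l], which [theory_transfer] permits. *)
    destruct (choice Ll HDC (fun k a => exists x, rel s k x /\ rel g a x) omega (VV l)) as (t & Ft & Et).
    - dfn_tac.
    - now apply omega_le_limit.
    - intros k Hk. assert (Hx : ap s k ∈ X) by (eapply ap_in; eauto).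
      destruct (Sg _ Hx) as (a & Ha & Ea). exists a. split; auto. exists (ap s k).
      split; [eapply ap_rel; eauto|]. rewrite <- Ea. eapply ap_rel; eauto.
    - assert (Es : forall k, is_nat k -> ap s k = ap g (ap t k)).
      { intros k Hk. apply in_omega in Hk. destruct (Et k Hk) as (x & A1 & A2).
        rewrite (ap_eq s omega X k x Hs A1). symmetry. eapply ap_eq; eauto. }
      apply (key c t s s'); auto; [eapply fun_cod_mono; eauto|].
      intros k Hk. assert (Hk' : k ∈ omega) by now apply in_omega.
      assert (Hx : ap s k ∈ X) by (eapply ap_in; eauto).
      eapply ap_eq; eauto. apply (Hcomp k (ap s k)); [eapply ap_rel; eauto|].
      rewrite <- Hi, <- Es; auto; [eapply ap_rel; eauto|]. eapply ap_in; eauto. }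
  assert (F := facts). destruct F as (_ & _ & Hlim & _ & _ & a & Ha & Na).
  (* The same ordinal serves on both sides: being in [K 2], it is in [K 1] as well. *)
  split; auto. exists (VV l). split; auto. exists 1, zeta, X, zeta, i. split.
  - split; [lia|]. split; [split; [now apply (K_cardinal 2)|split; auto; apply K_C, Kz]|].
    split; [eauto|]. split; [auto|].
    split; [split; [now apply (K_cardinal 2)|split; auto; apply K_C, Kz]|].
    split; [eauto|]. split; [rewrite <- Hi_l at 2; eapply ap_rel; eauto|].
    exists a. split; auto. intros R. apply Na. rewrite <- Hi_V by (apply ord_sub_VV; auto). eapply ap_eq; eauto.
  - exists (restr j (VV l)). split; auto. apply is_restriction_restr.
    apply (rel_ext (VV l) W (VV l) Z).
    + apply (restr_fun j W W); auto. apply Hj.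
    + eapply restr_fun; eauto.
    + intros x y. rewrite !rel_restr. split; intros [Hx R]; split; auto.
      * apply (rel_J (E := E)) in R as [_ ->]. rewrite <- Hi_V by auto. eapply ap_rel; eauto.
      * apply (rel_J (E := E)). split; auto. rewrite <- Hi_V by auto. symmetry. eapply ap_eq; eauto.
Qed.

End Backward.

Theorem theorem3p1 (V : structure) (HZF : ZF V)
    (lambda : V) (Hcard : is_cardinal lambda) (HDC : DC lambda)
    (lambda1 W : V) (Hsucc : is_succ lambda lambda1) (HW : is_V lambda1 W) :
  ultraexacting lambda <->
  (forall A : V, A ⊆ W -> OD A ->
     exists j : V, elementary_embedding W (Some A) W (Some A) j /\
       exists x : V, x ∈ W /\ ~ rel j x x).
Proof.
  apply is_succ_succ in Hsucc. subst lambda1. apply is_V_VV in HW as [_ ->]. split.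
  - intros H A HA OA. now apply ultraexacting_embedding.
  (* The witness will be built with n = 1, which requires zeta in C^(2). *)
  - intros H. destruct (K_unbounded 2 lambda (proj1 Hcard)) as (zeta & Hlz & Kz).
    destruct (theories_OD lambda zeta (proj1 Hcard) (K_ord 2 zeta Kz)) as (A & HAW & OA & HA).
    destruct (H A HAW OA) as (j & Hj & Hmove).
    now apply (embedding_ultraexacting (zeta := zeta) (j := j) (A := A)).
Qed.
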